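(* Let $\mathcal X$ be a locally compact Polish space, $\bar\mu\in\mathcal P(\mathcal X)$ and $\tau\colon\mathcal X\to[0,+\infty]$ measurable, such that $\bar\mu(\{\tau=0\})=\bar\mu(\{\tau=+\infty\})=0$ and $\bar\mu(\{\xi<+\infty\})=0$. For $t>0$ let $\mathbf P_t$ be the law of the empirical measure $\pi_t$ when $(x_i)_{i\ge1}$ is i.i.d. with marginal law $\bar\mu$, regarded as a probability measure on $\mathcal M_1(\mathcal X)\supset\mathcal P(\mathcal X)$. Then $(\mathbf P_t)_{t>0}$ satisfies a good large deviations principle on $\mathcal M_1(\mathcal X)$ with rate $I'$, where $$I'(\nu)=\begin{cases}\nu_a(1/\tau)\,\mathbf H(\bar\nu_a|\bar\mu)+\nu_s(\xi)+(1-\nu(\mathcal X))\,\xi^\infty & \text{if }\nu_a(1/\tau)<+\infty,\\ +\infty&\text{otherwise.}\end{cases}$$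
   Context: Fix a complete metric on $\mathcal X$ inducing its topology; $B_\delta(x)$ is the ball of radius $\delta$ centered at $x$. $\mathcal P(\mathcal X)$ is the set of Borel probability measures on $\mathcal X$. $\mathcal M_1(\mathcal X)$ is the set of positive Radon measures on $\mathcal X$ with total mass at most $1$, with the vague topology, i.e. the weakest topology making $\mu\mapsto\mu(f)$ continuous for all compactly supported continuous $f$; $\mu(f):=\int f\,d\mu$. With this topology $\mathcal M_1(\mathcal X)$ is a compact Polish space. Define $\xi\colon\mathcal X\to[0,+\infty]$ and $\xi^\infty\in[0,+\infty]$ by $$\xi(x)=\sup_{\delta>0}\sup\{c\ge0:\ \bar\mu(e^{c\tau}\mathbf 1_{B_\delta(x)})<+\infty\},\qquad \xi^\infty=\sup_{K\subset\mathcal X,\ K\text{ compact}}\sup\{c\ge0:\ \bar\mu(e^{c\tau}\mathbf 1_{K^c})<+\infty\}.$$ Process: let $\mathbf x=(x_1,x_2,\dots)\in\mathcal X^{\mathbb N^+}$ have law $\bar\mu^{\otimes\mathbb N^+}$. Set $S_0=0$, $S_n=\sum_{i=1}^n\tau(x_i)$, $\mathcal N_t=\inf\{n\in\mathbb N: S_{n+1}\ge t\}$ (with $\mathbb N=\{0,1,\dots\}$), $X_t=x_{\mathcal N_t+1}$, and $\pi_t=\frac1t\int_{[0,t[}\delta_{X_s}\,ds\in\mathcal P(\mathcal X)$; these are well defined almost surely. $\mathbf P_t=\bar\mu^{\otimes\mathbb N^+}\circ\pi_t^{-1}$. For $\nu\in\mathcal M_1(\mathcal X)$, $\nu_a$ and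 $\nu_s$ are the absolutely continuous and singular parts of $\nu$ with respect to $\bar\mu$. If $\nu_a(1/\tau)\in\,]0,+\infty[$, $\bar\nu_a(dx)=\frac{\frac1{\tau(x)}\nu_a(dx)}{\nu_a(1/\tau)}$, a probability measure. Conventions: $\nu_a(1/\tau)\,\mathbf H(\bar\nu_a|\bar\mu):=0$ whenever $\nu_a(1/\tau)=0$, and $0\cdot(+\infty)=0$. $\mathbf H(\nu|\mu)$ is the relative entropy: $\int h(\frac{d\nu}{d\mu})\,d\mu$ with $h(\varrho)=\varrho(\log\varrho-1)+1$ if $\nu\ll\mu$, and $+\infty$ otherwise. A family $(\mathbf Q_t)_{t>0}$ of Borel probability measures on a Polish space $\mathcal Y$ satisfies a good large deviations principle with rate $I\colon\mathcal Y\to[0,+\infty]$ if: $I$ is good, i.e. $\{I\le M\}$ is compact for all $M>0$ and $I\not\equiv+\infty$; $\limsup_{t\to+\infty}\frac1t\log\mathbf Q_t(\mathcal C)\le-\inf_{\mathcal C}I$ for all closed $\mathcal C\subset\mathcal Y$; and $\liminf_{t\to+\infty}\frac1t\log\mathbf Q_t(\mathcal O)\ge-\inf_{\mathcal O}I$ for all open $\mathcal O\subset\mathcal Y$. *)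

(* Defs.v *)
From HB Require Import structures.
From mathcomp Require Import all_boot all_order all_algebra finmap.
From mathcomp Require Import all_classical all_reals all_analysis.
From mathcomp Require Import measurable_realfun.

Set Implicit Arguments.
Unset Strict Implicit.
Unset Printing Implicit Defensive.

Import Order.TTheory GRing.Theory Num.Theory.
Import numFieldTopology.Exports numFieldNormedType.Exports.

Local Open Scope classical_set_scope.
Local Open Scope ring_scope.
Local Open Scope ereal_scope.

(* Pointedness is part of the library structure [completeType]; here it only
   says that the space is nonempty. *)
#[short(type="completeMetricType")]
HB.structure Definition CompleteMetric (R : realType) :=
  { T of Metric R T & CompletePseudoMetric R T }.

Notation borel Y := (g_sigma_algebraType (@open Y)).

Definition mdensity d (T : measurableType d) (R : realType)
  (m : set T -> \bar R) (f : T -> \bar R)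
  of measurable_fun [set: T] f & (forall x, 0 <= f x) :=
  fun A => \int[m]_(x in A) f x.

Section mdensity_measure.
Context d (T : measurableType d) (R : realType).
Variables (m : {measure set T -> \bar R}) (f : T -> \bar R).
Hypotheses (mf : measurable_fun [set: T] f) (f0 : forall x, 0 <= f x).

Let mdensity0 : mdensity m mf f0 set0 = 0.
Proof. by rewrite /mdensity integral_set0. Qed.

Let mdensity_ge0 A : 0 <= mdensity m mf f0 A.
Proof. exact: integral_ge0. Qed.

Let mdensity_sigma_additive : semi_sigma_additive (mdensity m mf f0).
Proof. exact: semi_sigma_additive_nng_induced. Qed.

HB.instance Definition _ := isMeasure.Build _ _ _ (mdensity m mf f0)
  mdensity0 mdensity_ge0 mdensity_sigma_additive.

End mdensity_measure.

Lemma measurable_inve (R : realType) :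
  measurable_fun [set: \bar R] (@inve R).
Proof.
have mi : measurable_fun [set: R] (@GRing.inv R).
  have -> : [set: R] = [set 0%R] `|` ~` [set 0%R] by rewrite setUv.
  have c1 : measurable (~` [set 0%R : R]) by exact: measurableC.
  apply/measurable_funU => //; split; first exact: measurable_fun_set1.
  apply: open_continuous_measurable_fun.
    by apply: closed_openC; exact: closed_eq.
  by move=> x /set_mem/= x0; apply: inv_continuous; apply/eqP.
rewrite (_ : @inve R = fun y => if y == 0 then +oo else
    if y == -oo then -oo else ((fine y)^-1)%:E); last first.
  by apply/funext => -[r| |] //=; rewrite ?invr0 // /inve eqe; case: ifP.
have mE (a : \bar R) : measurable_fun [set: \bar R] (fun y => y == a).
  apply: (measurable_fun_bool true) => /=.
  rewrite setTI (_ : _ @^-1` _ = [set a]); first exact: emeasurable_set1.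
  by apply/seteqP; split=> y /=; [move/eqP|move=> ->; rewrite eqxx].
apply: measurable_fun_ifT => //; apply: measurable_fun_ifT => //.
by apply/measurable_EFinP; apply: measurableT_comp => //; exact: measurable_fine.
Qed.

Section lebesgue_decomposition.
Context d (T : measurableType d) (R : realType).

Definition mutually_singular (m1 m2 : set T -> \bar R) :=
  exists N, [/\ measurable N, m1 (~` N) = 0 & m2 N = 0].

Variables (mu : {measure set T -> \bar R}) (nu : {finite_measure set T -> \bar R}).

Definition is_lebesgue_decomposition
    (p : {finite_measure set T -> \bar R} * {finite_measure set T -> \bar R}) :=
  [/\ p.1 `<< mu, mutually_singular p.2 mu &
      forall A, measurable A -> nu A = p.1 A + p.2 A].

Lemma lebesgue_decomposition_exists : exists p, is_lebesgue_decomposition p.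
Proof.
pose Nul := [set N : set T | measurable N /\ mu N = 0].
pose s := ereal_sup [set nu N | N in Nul].
have sfin : s \is a fin_num.
  rewrite ge0_fin_numE; last first.
    by apply: ereal_sup_ubound; exists set0; rewrite /Nul /= ?measure0.
  apply: (@le_lt_trans _ _ (nu setT)); last first.
    by rewrite ltey_eq fin_num_measure.
  apply: ge_ereal_sup => _ [N [mN _] <-].
  by apply: le_measure; rewrite ?inE.
have adh n : exists N, Nul N /\ s - (n.+1%:R^-1)%:E < nu N.
  have e0 : (0 < n.+1%:R^-1 :> R)%R by rewrite invr_gt0.
  have [_ [N NulN <-] lt] := ub_ereal_sup_adherent e0 sfin.
  by exists N.
pose F n := sval (cid (adh n)).
have FN n : Nul (F n) by rewrite /F; case: cid => N [].
have Fs n : s - (n.+1%:R^-1)%:E < nu (F n) by rewrite /F; case: cid => N [].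
pose N := \bigcup_n F n.
have mN : measurable N by apply: bigcup_measurable => n _; case: (FN n).
have muN : mu N = 0.
  apply/eqP; rewrite eq_le measure_ge0 andbT.
  have -> : 0 = \sum_(n <oo) mu (F n) :> \bar R.
    by rewrite eseries0// => n _ _; case: (FN n).
  apply: measure_sigma_subadditive => //.
  by move=> n; case: (FN n).
have nuN : s <= nu N.
  apply/lee_addgt0Pr => e e0; near \oo => n.
  apply: (@le_trans _ _ (nu (F n) + (n.+1%:R^-1)%:E)).
    by rewrite -leeBlDr// ltW.
  apply: leeD; last first.
    by rewrite lee_fin ltW//; near: n; exact: (near_infty_natSinv_lt (PosNum e0)).
  apply: le_measure; rewrite ?inE//; first by case: (FN n).
  exact: bigcup_sup.
have mNC : measurable (~` N) by exact: measurableC.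
exists (mrestr nu mNC : {finite_measure set T -> \bar R},
        mrestr nu mN : {finite_measure set T -> \bar R}); split => /=.
- apply/null_content_dominatesP => A mA muA0; rewrite /mrestr.
  have mANC : measurable (A `&` ~` N) by exact: measurableI.
  have muAN : mu (N `|` (A `&` ~` N)) = 0.
    apply/eqP; rewrite eq_le measure_ge0 andbT.
    apply: le_trans (measureU2 _ _ _) _ => //.
    rewrite [X in X + _](_ : _ = 0)// add0e -muA0.
    by apply: le_measure; rewrite ?inE.
  have : nu (N `|` (A `&` ~` N)) <= nu N.
    apply: le_trans nuN; apply: ereal_sup_ubound.
    by exists (N `|` (A `&` ~` N)) => //; split => //; exact: measurableU.
  rewrite measureU//; last by rewrite setIA setIAC setICr set0I.
  rewrite -leeBrDl ?fin_num_measure// subee ?fin_num_measure// => le0.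
  by apply/eqP; rewrite eq_le le0 measure_ge0.
- by exists N; split => //; rewrite /mrestr setICl measure0.
- move=> A mA; rewrite /mrestr -measureU ?setIUr//; try exact: measurableI.
  + by rewrite -setIUr setUC setUv setIT.
  + by rewrite setIACA setICl setI0.
Unshelve. all: by end_near. Qed.

Definition ac_part := (sval (cid lebesgue_decomposition_exists)).1.
Definition sing_part := (sval (cid lebesgue_decomposition_exists)).2.

End lebesgue_decomposition.

Section relative_entropy.
Context d (T : measurableType d) (R : realType).
Local Open Scope charge_scope.

(* [ln 0 = 0] in the library, hence [entropy_fun 0 = 1]. *)
Definition entropy_fun (r : R) : R := (r * (ln r - 1) + 1)%R.

Definition rel_entropy (nu mu : {finite_measure set T -> \bar R}) : \bar R :=
  if `[< nu `<< mu >] then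
    \int[mu]_x (entropy_fun (fine (('d (charge_of_finite_measure nu) '/d mu) x)))%:E
  else +oo.

End relative_entropy.

Section M1.
Context (R : realType) (X : completeMetricType R).

Definition radon (nu : set (borel X) -> \bar R) :=
  forall A, measurable A ->
    nu A = ereal_sup [set nu K | K in [set K : set X | compact K /\ K `<=` A]].

(* A library measure is a function on all sets, whose values on non-measurable
   sets are irrelevant. Fixing them to 0 makes equality in [M1] the equality of
   measures, so that the vague topology is Hausdorff. *)
Record M1 := MkM1 {
  M1_val :> subprobability (borel X) R ;
  M1_radon : radon M1_val ;
  M1_out : forall A : set (borel X), ~ measurable A -> M1_val A = 0 }.

HB.instance Definition _ := gen_eqMixin M1.
HB.instance Definition _ := gen_choiceMixin M1.

Definition Cc := {f : X -> R |
  continuous f /\ compact (closure [set x | f x != 0%R])}.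

Definition vague (f : Cc) : Topological M1 :=
  Topological.on (initial_topology
    (fun nu : M1 => (\int[nu]_(x in [set: borel X]) sval f x)%R)).

HB.instance Definition _ := Topological.copy M1 (sup_topology vague).

Lemma M1_ext (m1 m2 : M1) :
  (forall A : set (borel X), measurable A -> m1 A = m2 A) -> m1 = m2.
Proof.
move=> m12; have : M1_val m1 = M1_val m2 :> (set (borel X) -> \bar R).
  apply/funext => A; have [mA|mA] := pselect (measurable A); first exact: m12.
  by rewrite !M1_out.
case: m1 m2 {m12} => [[f1 c1] r1 o1] [[f2 c2] r2 o2] /= f12.
move: c1 r1 o1 c2 r2 o2; rewrite f12 => c1 r1 o1 c2 r2 o2.
have c12 : c1 = c2.
  case: c1 c2 {r1 o1 r2 o2 f12} => [[a b] [e] [g] [i] [j] [k]] [[+ +] [+] [+] [+] [+] [+]].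
  move=> a' b' e' g' i' j' k'.
  by rewrite (Prop_irrelevance a' a) (Prop_irrelevance b' b)
    (Prop_irrelevance e' e) (Prop_irrelevance g' g)
    (Prop_irrelevance i' i) (Prop_irrelevance j' j)
    (Prop_irrelevance k' k).
subst c2; congr MkM1; exact: Prop_irrelevance.
Qed.

Section M1_of_subprobability.
Variables (m : subprobability (borel X) R) (rm : radon m).

Definition on_measurable (A : set (borel X)) : \bar R :=
  if `[< measurable A >] then m A else 0.

Let on_measurableE A : measurable A -> on_measurable A = m A.
Proof. by move=> mA; rewrite /on_measurable asboolT. Qed.

Let on_measurable0 : on_measurable set0 = 0.
Proof. by rewrite on_measurableE// measure0. Qed.

Let on_measurable_ge0 A : 0 <= on_measurable A.
Proof. by rewrite /on_measurable; case: ifP. Qed.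

Let on_measurable_sigma_additive : semi_sigma_additive on_measurable.
Proof.
move=> F mF tF mUF; rewrite on_measurableE//.
under eq_fun do under eq_bigr do rewrite on_measurableE//.
exact: measure_semi_sigma_additive.
Qed.

HB.instance Definition _ := isMeasure.Build _ _ _ on_measurable
  on_measurable0 on_measurable_ge0 on_measurable_sigma_additive.

Let on_measurable_setT : on_measurable [set: borel X] <= 1.
Proof. by rewrite on_measurableE//; exact: sprobability_setT. Qed.

HB.instance Definition _ := Measure_isSubProbability.Build _ _ _ on_measurable
  on_measurable_setT.

Lemma compact_borel_measurable (K : set X) :
  compact K -> measurable (K : set (borel X)).
Proof.
move=> cK; rewrite -(setCK K); apply: measurableC.
apply: sub_sigma_algebra; apply: closed_openC.
exact: (compact_closed (@metric_hausdorff _ _)).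
Qed.

Let on_measurable_radon : radon on_measurable.
Proof.
move=> A mA; rewrite on_measurableE// rm//; congr ereal_sup.
by apply/seteqP; split=> _ [K [cK KA] <-]; exists K => //;
  rewrite on_measurableE//; exact: compact_borel_measurable.
Qed.

Let on_measurable_out A : ~ measurable A -> on_measurable A = 0.
Proof. by move=> mA; rewrite /on_measurable asboolF. Qed.

Definition M1_of : M1 := MkM1 on_measurable_radon on_measurable_out.

Lemma M1_ofE A : measurable A -> M1_of A = m A.
Proof. exact: on_measurableE. Qed.

End M1_of_subprobability.

Lemma radon_mzero : radon (@mzero _ (borel X) R).
Proof.
move=> A mA; apply/eqP; rewrite eq_le; apply/andP; split.
  by apply: ereal_sup_ubound; exists set0 => //; split => //; exact: compact0.
by apply: ge_ereal_sup => _ [K _ <-].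
Qed.

HB.instance Definition _ := isPointed.Build M1 (M1_of radon_mzero).

End M1.

Section empirical_measure.
Context (R : realType) (X : completeMetricType R).
(* The sequence is indexed from 0: [x i] is the sample of index i + 1. *)
Variables (tau : X -> \bar R) (x : nat -> X).

Definition renewal (n : nat) : \bar R := \sum_(i < n) tau (x i).

(* The value 0 is used only when no such n exists, which has probability 0. *)
Definition counting_process (t : R) : nat :=
  if pselect (exists n, t%:E <= renewal n.+1) is left h then ex_minn h else 0%N.

Definition renewal_reward (t : R) : borel X := x (counting_process t).

(* For [t <= 0] this is the zero measure; only [t > 0] matters. *)
Definition occupation (t : R) : set (borel X) -> \bar R := fun A =>
  (t^-1)%:E * \int[lebesgue_measure]_(s in `[0%R, t[) \d_(renewal_reward s) A.

Lemma measurable_counting_process : measurable_fun [set: R] counting_process.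
Proof.
have mr n : measurable [set s : R | s%:E <= renewal n].
  rewrite (_ : [set s | _] = [set: R] `&` EFin @^-1` [set` `]-oo, renewal n]]).
    by apply: EFin_measurable => //; exact: emeasurable_itv.
  by apply/seteqP; split => s /=; rewrite in_itv/=; tauto.
have mrC n : measurable [set s : R | ~ s%:E <= renewal n].
  exact: measurableC (mr n).
move=> _ B _; rewrite setTI.
rewrite (_ : _ @^-1` B = \bigcup_(n in B) counting_process @^-1` [set n]); last first.
  by apply/seteqP; split => [s Bs|s [n Bn /= ->]//]; exists (counting_process s).
apply: bigcup_measurable => n _.
have -> : counting_process @^-1` [set n] =
    ([set s : R | s%:E <= renewal n.+1] `&`
      \bigcap_(m in [set m | (m < n)%N]) [set s : R | ~ s%:E <= renewal m.+1])
    `|` (\bigcap_m [set s : R | ~ s%:E <= renewal m.+1] `&` [set s | n = 0%N]).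
  apply/seteqP; split => s /=; rewrite /counting_process.
    case: pselect => [h|h]; last first.
      by move=> <-; right; split => // m _ /= sm; apply: h; exists m.
    case: ex_minnP => k sk kmin <-; left; split => // m /= mk sm.
    by move: (kmin _ sm); rewrite leqNgt mk.
  case: pselect => [h|h].
    case: ex_minnP => k sk kmin [[sn nmin]|[sN _]]; last first.
      by have := sN k Logic.I.
    apply/eqP; rewrite eqn_leq kmin//= leqNgt; apply/negP => kn.
    exact: (nmin _ kn).
  by move=> [[sn _]|[_ ->]] //; exfalso; apply: h; exists n.
apply: measurableU; apply: measurableI => //.
- by apply: bigcap_measurableType => m _.
- by apply: bigcap_measurableType => m _.
- have [n0|n0] := pselect (n = 0%N).
    by rewrite (_ : [set s | _] = setT)//; apply/seteqP; split.
  by rewrite (_ : [set s | _] = set0)//; apply/seteqP; split.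
Qed.

Lemma measurable_dirac_renewal_reward (D : set R) (A : set (borel X)) :
  measurable_fun D (fun s => \d_(renewal_reward s) A : \bar R).
Proof.
apply: measurable_funTS.
rewrite (_ : (fun s => _) = (fun n => \d_(x n : borel X) A) \o counting_process)//.
by apply: measurableT_comp => //; exact: measurable_counting_process.
Qed.

Section occupation_measure.
Variable t : R.

Let occupation0 : occupation t set0 = 0.
Proof.
by rewrite /occupation; under eq_integral do rewrite measure0; rewrite integral0 mule0.
Qed.

Let occupation_le0 A : (t <= 0)%R -> occupation t A = 0.
Proof.
by move=> t0; rewrite /occupation set_itv_ge ?integral_set0 ?mule0// bnd_simp -leNgt.
Qed.

Let occupation_ge0 A : 0 <= occupation t A.
Proof.
have [t0|t0] := leP t 0%R; first by rewrite occupation_le0.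
by rewrite /occupation mule_ge0 ?lee_fin ?invr_ge0 ?(ltW t0)// integral_ge0.
Qed.

Let occupation_sigma_additive : semi_sigma_additive (occupation t).
Proof.
move=> F mF tF mUF; rewrite /occupation.
have -> : \int[lebesgue_measure]_(s in `[0%R, t[)
      \d_(renewal_reward s) (\bigcup_n F n) =
    \sum_(n <oo) \int[lebesgue_measure]_(s in `[0%R, t[) \d_(renewal_reward s) (F n).
  rewrite -integral_nneseries//; last first.
    by move=> n; exact: measurable_dirac_renewal_reward.
  apply: eq_integral => s _; apply/esym/cvg_lim => //.
  exact: measure_semi_sigma_additive.
rewrite (_ : (fun n => _) = (fun n => (t^-1)%:E * \sum_(0 <= i < n)
   \int[lebesgue_measure]_(s in `[0%R, t[) \d_(renewal_reward s) (F i))); last first.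
  by apply/funext => n; rewrite ge0_sume_distrr// => i _; exact: integral_ge0.
apply: cvgeZl => //; apply: is_cvg_nneseries => n _ _; exact: integral_ge0.
Qed.

HB.instance Definition _ := isMeasure.Build _ _ _ (occupation t)
  occupation0 occupation_ge0 occupation_sigma_additive.

Lemma occupation_setT : (0 < t)%R -> occupation t [set: borel X] = 1.
Proof.
move=> t0; rewrite /occupation.
under eq_integral do rewrite diracT.
rewrite integral_cst//= mul1e lebesgue_measure_itv/= lte_fin t0 oppr0 addr0.
by rewrite -EFinM mulVf// gt_eqF.
Qed.

Let occupation_setT1 : occupation t [set: borel X] <= 1.
Proof.
have [t0|t0] := leP t 0%R; first by rewrite occupation_le0.
by rewrite occupation_setT.
Qed.

HB.instance Definition _ := Measure_isSubProbability.Build _ _ _ (occupation t)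
  occupation_setT1.

Lemma occupation_radon : radon (occupation t).
Proof.
move=> A mA.
pose K n := [set x i | i in [set i | (i < n)%N /\ A (x i)]].
have cK n : compact (K n).
  apply: finite_compact; apply: finite_image.
  by apply: (@sub_finite_set _ _ `I_n) => // i [].
have mK n : measurable (K n : set (borel X)) by exact: compact_borel_measurable.
have KA n : K n `<=` A by move=> _ [i [_ Ai] <-].
have mUK : measurable (\bigcup_n K n : set (borel X)) by exact: bigcup_measurable.
have ndK : nondecreasing_seq K.
  move=> m n mn; apply/subsetPset => _ [i [im Ai] <-]; exists i => //.
  by split => //; exact: leq_trans mn.
have AUK : occupation t A = occupation t (\bigcup_n K n).
  rewrite /occupation; congr (_ * _); apply: eq_integral => s _.
  rewrite !diracE; congr (_%:R%:E); congr nat_of_bool; apply/idP/idP => /set_mem sA; apply/mem_set.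
    exists (counting_process s).+1 => //.
    by exists (counting_process s) => //; split.
  by case: sA => n _ /KA.
apply/eqP; rewrite eq_le; apply/andP; split; last first.
  apply: ge_ereal_sup => _ [C [cC CA] <-].
  by apply: le_measure; rewrite ?inE//; exact: compact_borel_measurable.
have cvK := nondecreasing_cvg_mu mK mUK ndK : occupation t \o K @ \oo --> _.
rewrite AUK -(cvg_lim _ cvK)//; apply: lime_le; first by apply/cvg_ex; eexists; exact: cvK.
apply: nearW => n /=; apply: ereal_sup_ubound; exists (K n) => //; split => //.
Qed.

End occupation_measure.

Definition empirical (t : R) : M1 X := M1_of (occupation_radon t).

End empirical_measure.

Section iid.
Context d d' (Omega : measurableType d) (T : measurableType d') (R : realType).
Variables (P : probability Omega R) (x : nat -> {RV P >-> T}).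

Definition mutually_independent :=
  forall (J : {fset nat}) (A : nat -> set T), (forall i, measurable (A i)) ->
    P (\bigcap_(i in [set` J]) (x i @^-1` A i)) =
    \prod_(i <- J) P (x i @^-1` A i).

(* Equivalently, the law of the whole sequence is the infinite product of
   copies of [mu]. *)
Definition iid (mu : probability T R) :=
  (forall i A, measurable A -> distribution P (x i) A = mu A) /\
  mutually_independent.

End iid.

Section large_deviations.
Context (R : realType) (Y : ptopologicalType).

(* [Q] is a mere function on sets, so that push-forwards can be written before
   the measurability of the map is known; that [Q t] is a Borel probability
   measure is part of [good_ldp]. *)
Definition borel_probability (Q : set (borel Y) -> \bar R) :=
  exists P : probability (borel Y) R, forall A, measurable A -> Q A = P A.

Definition good_rate (I : Y -> \bar R) :=
  [/\ forall y, 0 <= I y,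
      forall M : R, (0 < M)%R -> compact [set y | I y <= M%:E] &
      exists y, I y != +oo].

Definition good_ldp (Q : R -> set (borel Y) -> \bar R) (I : Y -> \bar R) :=
  [/\ forall t, (0 < t)%R -> borel_probability (Q t),
      good_rate I,
      forall C : set Y, closed C ->
        limf_esup (fun t : R => (t^-1)%:E * lne (Q t C)) +oo%R
          <= - ereal_inf (I @` C) &
      forall O : set Y, open O ->
        - ereal_inf (I @` O)
          <= limf_einf (fun t : R => (t^-1)%:E * lne (Q t O)) +oo%R].

End large_deviations.

Section rate_function.
Context (R : realType) (X : completeMetricType R).
Variables (mu : probability (borel X) R) (tau : borel X -> \bar R).

Definition exp_moments (A : set (borel X)) : set (\bar R) :=
  [set c%:E | c in [set c : R | (0 <= c)%R /\
                     \int[mu]_(y in A) expeR (c%:E * tau y) < +oo]].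

Definition xi (x : X) : \bar R :=
  ereal_sup [set ereal_sup (exp_moments (ball x delta)) |
              delta in [set delta : R | (0 < delta)%R]].

Definition xi_infty : \bar R :=
  ereal_sup [set ereal_sup (exp_moments (~` K)) | K in [set K : set X | compact K]].

Hypotheses (mtau : measurable_fun [set: borel X] tau)
  (tau_ge0 : forall x, 0 <= tau x).

Lemma measurable_inv_tau : measurable_fun [set: borel X] (fun x => (tau x)^-1).
Proof. exact: measurableT_comp (@measurable_inve R) mtau. Qed.

Lemma inv_tau_ge0 x : 0 <= (tau x)^-1.
Proof. by rewrite inve_ge0. Qed.

(* In [\bar R], [0^-1 = +oo] and [+oo^-1 = 0]. *)
Definition inv_tau_mass (nu : M1 X) : \bar R :=
  \int[ac_part mu nu]_x (tau x)^-1.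

(* [mnormalize] returns its second argument [mu] when the mass is 0 or +oo. *)
Definition ac_bar (nu : M1 X) : probability (borel X) R :=
  mnormalize (mdensity (ac_part mu nu) measurable_inv_tau inv_tau_ge0) mu.

(* In [\bar R], [0 * +oo = 0]. *)
Definition ldp_rate (nu : M1 X) : \bar R :=
  if inv_tau_mass nu < +oo then
    inv_tau_mass nu * rel_entropy (ac_bar nu) mu
    + \int[sing_part mu nu]_x xi x
    + (1 - nu [set: borel X]) * xi_infty
  else +oo.

End rate_function.

(* Main.v *)
(* The rate is identified with the dual functional
     J(nu) = sup { c + nu(g) : c real, g in Cc, mu(e^(tau (c + g))) < 1 }.
   Upper bound: if mu(e^(tau f)) < 1, then E e^(t pi_t(f)) is bounded uniformly in t, by summing
   over the number of renewals before t; hence P(pi_t(f) >= b) = O(e^(-t b)), and the upper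
   bound with rate J follows on closed sets by compactness of M1.
   I <= J: J may be tested against bounded measurable functions below weights w = c + g with
   mu(e^(tau w)) < +oo, whose supremum is xi, and xi_infty at infinity. On a mu-null set the
   test function is chosen close to w, which yields nu_s(xi) and (1 - nu(X)) xi_infty; elsewhere
   it is chosen close to (log rho) / tau, with rho the density of the normalised
   nu_a / tau, which yields the entropy.
   Lower bound: a bounded density r, supported where tau is bounded away from 0 and from
   infinity, is a change of law under which pi_t is close to the normalised measure r tau mu,
   at an entropy cost per unit of time. Every nu with I(nu) < +oo is approximated at cost I(nu)
   by adding three such measures: a truncation of nu_a; on cells where the test functions
   oscillate little, densities proportional to e^(c tau) with c just above xi, where e^(c tau)
   is not integrable, for nu_s; and the same outside a large compact set for the missing mass.
   The two exponential bounds force I = J, so that I is lower semicontinuous. *)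
Require Import Defs.
From HB Require Import structures.
From mathcomp Require Import all_boot all_order all_algebra finmap.
From mathcomp Require Import all_classical all_reals all_analysis.
From mathcomp Require Import measurable_realfun.
From mathcomp Require Import ring lra.

Set Implicit Arguments.
Unset Strict Implicit.
Unset Printing Implicit Defensive.

Import Order.TTheory GRing.Theory Num.Theory.
Import numFieldTopology.Exports numFieldNormedType.Exports.

Local Open Scope classical_set_scope.
Local Open Scope ring_scope.
Local Open Scope ereal_scope.

(** * Locally compact metric spaces *)

(** Three obstacles shape the proof. First, the number of renewals before [t] is random: the strict
    inequality in the constraint [mu(e^(tau f)) < 1] is what makes the series over all possible
    numbers of renewals geometric. Since [M1] is compact, no exponential tightness is required; mass
    may escape to infinity, at the price [xi_infty]. Secondly, the formula of the rate treats [nu_a]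
    and [nu_s] differently. Where [xi] is infinite, hence [nu_a]-almost everywhere, the weights [w]
    tend to infinity and leave the test function unconstrained, so that only the entropy matters; on
    a [mu]-null set the exponential integral sees nothing, and the weight itself is the only
    constraint. Thirdly, the entropy of a normalised density is not additive, whereas the three
    approximating densities must be superposed. Costs are therefore written [a * h(r / a)], with [h]
    the entropy integrand and [a] a free renewal rate: this expression is convex and homogeneous of
    degree 1 in [(a, r)], hence subadditive, and its minimum over [a] is the true cost. *)

Section bumps.
Context (R : realType) (X : completeMetricType R).
Hypotheses (X_second_countable : @second_countable X)
  (X_locally_compact : locally_compact [set: X]).

Lemma closed_separator (A B : set X) : closed A -> closed B -> A `&` B = set0 ->
  uniform_separator A B.
Proof. by move=> cA; apply: normal_uniform_separator => //; exact: (@pseudometric_normal R). Qed.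

(** Members of a countable base whose closure is not compact are replaced by the empty set, which
    keeps the index set [nat]. Regularity gives, inside [G] intersected with a compact neighborhood,
    a neighborhood whose closure stays there; any base member contained in it qualifies. *)
Lemma relatively_compact_basis : exists e : nat -> set X,
  (forall i, open (e i) /\ compact (closure (e i))) /\
  forall x G, nbhs x G -> exists i, e i x /\ closure (e i) `<=` G.
Proof.
have [B cB [Bo Bn]] := X_second_countable.
have [e eB] : exists e : nat -> set X, B `<=` range e.
  move/pfcard_geP: cB => [->|[f]]; first by exists (fun=> set0).
  by exists f => U BU; have [n _ <-] := 'surj_f BU; exists n.
pose ok (U : set X) := open U /\ compact (closure U).
exists (fun i => if `[< ok (e i) >] then e i else set0); split.
  move=> i; case: asboolP => // _; split; first exact: open0.
  by rewrite closure0; exact: compact0.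
move=> x G xG; have [K] := X_locally_compact (Logic.I : [set: X] x).
rewrite withinET => xK [cK clK].
have /(@uniform_regular X x) [V xV VGK] : nbhs x (G `&` K) by exact: filterI.
have [U [BU Ux] UV] := Bn x V xV.
have [i _ eiU] := eB U BU.
exists i; case: asboolP => [_|[]]; rewrite eiU.
  by split=> //; apply: subset_trans (subset_trans VGK (@subIsetl _ _ _)); exact: closureS.
split; first exact: Bo.
apply: (subclosed_compact _ cK); first exact: closed_closure.
by apply: subset_trans (subset_trans VGK (@subIsetr _ _ _)); exact: closureS.
Qed.


Lemma compact_closed_metric (K : set X) : compact K -> closed K.
Proof. exact: (compact_closed (@metric_hausdorff _ _)). Qed.

(** Urysohn functions are taken only between finite unions of base members, hence countably many of
    them, indexed by pickled pairs of sequences. Two successive covers insert such unions between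
    [K] and [G]: [K] lies in [U s], the closure of [U s] in [U t], and the closure of [U t] in
    [G]. *)
Lemma countable_bumps : exists D : nat -> Cc X,
  (forall n x, (0 <= sval (D n) x <= 1)%R) /\
  forall K G, compact K -> open G -> K `<=` G -> exists n,
    (forall x, K x -> sval (D n) x = 1%R) /\
    (forall x, sval (D n) x != 0%R -> G x).
Proof.
have [e [eo en]] := relatively_compact_basis.
pose U (s : seq nat) := \bigcup_(i in [set` s]) e i.
have Uo s : open (U s) by apply: bigcup_open => i _; have [] := eo i.
have Uc s (G : set X) : (forall i, i \in s -> closure (e i) `<=` G) ->
    compact (closure (U s)) /\ closure (U s) `<=` G.
  move=> sG; pose C := \big[setU/set0]_(i <- s) closure (e i).
  have cC : compact C by apply: bigsetU_compact => i _; have [] := eo i.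
  have UC : closure (U s) `<=` C.
    rewrite closureE => x; apply; split; first exact: compact_closed_metric.
    rewrite /C -bigcup_seq => y [i si ey].
    by exists i => //; exact: subset_closure.
  split; first by apply: (subclosed_compact _ cC) => //; exact: closed_closure.
  apply: subset_trans UC _; rewrite /C -bigcup_seq => y [i /= si].
  exact: sG.
have cover K G : compact K -> open G -> K `<=` G ->
    exists s, K `<=` U s /\ forall i, i \in s -> closure (e i) `<=` G.
  rewrite compact_cover => cK oG KG.
  have [|x Kx|s sI Ks] := cK nat [set i | closure (e i) `<=` G] e.
  - by move=> i _; have [] := eo i.
  - have [i [ei ?]] := en x G (open_nbhs_nbhs (conj oG (KG _ Kx))).
    by exists i.
  exists (enum_fset s); split => // i si.
  by have := sI i si; rewrite inE.
pose good (p : seq nat * seq nat) := closure (U p.1) `<=` U p.2 /\ compact (closure (U p.2)).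
pose f p := Urysohn (R := R) (~` U p.2) (closure (U p.1)).
have f0 p : good p -> forall x, f p x != 0%R -> U p.2 x.
  move=> [p12 _] x fx; apply: contrapT => Ux.
  have /(_ (f p x)) : f p @` (~` U p.2) `<=` [set 0%R].
    apply: Urysohn_sub0; apply: closed_separator; [|exact: closed_closure|].
      exact: open_closedC.
    by rewrite setIC; apply/disjoints_subset; rewrite setCK.
  by move=> /(_ (ex_intro2 _ _ x Ux erefl))/= fx0; rewrite fx0 eqxx in fx.
have f1 p : good p -> forall x, U p.1 x -> f p x = 1%R.
  move=> [p12 _] x Ux; have /(_ (f p x)) : f p @` (closure (U p.1)) `<=` [set 1%R].
    apply: Urysohn_sub1; apply: closed_separator; [|exact: closed_closure|].
      exact: open_closedC.
    by rewrite setIC; apply/disjoints_subset; rewrite setCK.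
  by apply; exists x => //; exact: subset_closure.
have fCc p : good p -> continuous (f p) /\ compact (closure [set x | f p x != 0%R]).
  move=> gp; split; first exact: Urysohn_continuous.
  apply: (subclosed_compact _ gp.2); first exact: closed_closure.
  by apply: closureS => x; exact: f0.
have z_Cc : continuous (fun _ : X => 0%R : R) /\
    compact (closure [set x : X | (0%R : R) != 0%R]).
  split; first exact: cst_continuous.
  rewrite (_ : [set _ | _] = set0) ?closure0; first exact: compact0.
  by apply/seteqP; split => x //=; rewrite eqxx.
(* Pairs that are not nested get the zero function, so that every index names an element of [Cc]. *)
pose g p : Cc X := if pselect (good p) is left h then exist _ _ (fCc p h) else exist _ _ z_Cc.
exists (fun n => if choice.unpickle n is Some p then g p else exist _ _ z_Cc); split.
  move=> n x; case: choice.unpickle => [p|]/=; last by rewrite lexx ler01.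
  rewrite /g; case: pselect => h /=; last by rewrite lexx ler01.
  by have := @Urysohn_range X R (~` U p.2) (closure (U p.1)) (f p x);
    rewrite /= in_itv/=; apply; exists x.
move=> K G cK oG KG.
have [t [Kt tG]] := cover _ _ cK oG KG.
have [s [Ks st]] := cover _ _ cK (Uo t) Kt.
have gst : good (s, t).
  by split => /=; [have [] := Uc s _ st|have [] := Uc t _ tG].
exists (choice.pickle (s, t)); rewrite choice.pickleK /g; case: pselect => // h /=; split.
  by move=> x Kx; apply: f1 => //=; exact: Ks.
move=> x /(f0 _ gst)/= tx; apply: (proj2 (Uc t _ tG)).
exact: subset_closure.
Qed.

Lemma sigma_compact : exists K : nat -> set X,
  [/\ forall n, compact (K n), nondecreasing_seq K & \bigcup_n K n = setT].
Proof.
have [e [eo en]] := relatively_compact_basis.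
exists (fun n => \big[setU/set0]_(i < n) closure (e i)); split.
- by move=> n; apply: bigsetU_compact => i _; have [] := eo i.
- by move=> m n mn; apply/subsetPset; exact: (@subset_bigsetU _ (fun i => closure (e i))).
- apply/seteqP; split => // x _.
  have [i [ei _]] := en x setT filterT; exists i.+1 => //.
  by rewrite big_ord_recr/=; right; exact: subset_closure.
Qed.

End bumps.

(** * Measures generated by set functions on compact sets *)

Section measure_of_content.
Context (R : realType) (X : completeMetricType R).
Variable lam : set X -> \bar R.
Hypotheses (lam_ge0 : forall K, 0 <= lam K) (lam0 : lam set0 = 0)
  (lam_le1 : forall K, lam K <= 1)
  (lamU : forall K L, compact K -> compact L -> lam (K `|` L) <= lam K + lam L)
  (lamUd : forall K L, compact K -> compact L -> K `&` L = set0 ->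
     lam K + lam L <= lam (K `|` L)).

Let inner (G : set X) : \bar R :=
  ereal_sup [set lam K | K in [set K | compact K /\ K `<=` G]].

Let outer (A : set X) : \bar R :=
  ereal_inf [set inner G | G in [set G | open G /\ A `<=` G]].

Let inner_ge0 G : 0 <= inner G.
Proof.
by apply: ereal_sup_ubound; exists set0 => //; split => //; exact: compact0.
Qed.

Let inner_le1 G : inner G <= 1.
Proof. by apply: ge_ereal_sup => _ [K _ <-]. Qed.

Let le_inner G H : G `<=` H -> inner G <= inner H.
Proof.
move=> GH; apply: ge_ereal_sup => _ [K [cK KG] <-].
by apply: ereal_sup_ubound; exists K => //; split => //; exact: subset_trans GH.
Qed.

Let lam_inner K G : compact K -> K `<=` G -> lam K <= inner G.
Proof. by move=> cK KG; apply: ereal_sup_ubound; exists K. Qed.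

Let outer_ge0 A : 0 <= outer A.
Proof. by apply: le_ereal_inf_tmp => _ [G _ <-]. Qed.

Let le_outer A B : A `<=` B -> outer A <= outer B.
Proof.
move=> AB; apply: le_ereal_inf_tmp => _ [G [oG BG] <-].
by apply: ereal_inf_lbound; exists G => //; split => //; exact: subset_trans BG.
Qed.

Let outer_inner A G : open G -> A `<=` G -> outer A <= inner G.
Proof. by move=> oG AG; apply: ereal_inf_lbound; exists G. Qed.

Let outer_open G : open G -> outer G = inner G.
Proof.
move=> oG; apply/eqP; rewrite eq_le outer_inner//=.
by apply: le_ereal_inf_tmp => _ [H [oH GH] <-]; exact: le_inner.
Qed.

(** A Urysohn function equal to 0 on the part of [K] outside [H] and to 1 on the part outside [G] is
    cut at the level 1/2. *)
Let compact_split K G H : compact K -> open G -> open H -> K `<=` G `|` H ->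
  exists K1 K2 : set X, [/\ compact K1, compact K2, K1 `<=` G, K2 `<=` H & K = K1 `|` K2].
Proof.
move=> cK oG oH KGH; have clK := compact_closed_metric cK.
pose f := Urysohn (R := R) (K `\` H) (K `\` G).
have sep : uniform_separator (K `\` H) (K `\` G).
  apply: closed_separator.
  - by apply: closedI => //; exact: open_closedC.
  - by apply: closedI => //; exact: open_closedC.
  - apply/seteqP; split => // x [[Kx Hx] [_ Gx]].
    by case: (KGH _ Kx).
have cf : continuous f by exact: Urysohn_continuous.
exists (K `&` f @^-1` [set y | (y <= 2^-1)%R]), (K `&` f @^-1` [set y | (2^-1 <= y)%R]); split.
- apply: compact_closedI => //; apply: preimage_closed; last exact: closed_le.
  by move=> x _; exact: cf.
- apply: compact_closedI => //; apply: preimage_closed; last exact: closed_ge.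
  by move=> x _; exact: cf.
- move=> x [Kx /= fx]; apply: contrapT => Gx.
  have /= f1 := @Urysohn_sub1 _ R _ _ sep (f x) (ex_intro2 _ _ x (conj Kx Gx) erefl).
  by move: fx; rewrite f1; lra.
- move=> x [Kx /= fx]; apply: contrapT => Hx.
  have /= f0 := @Urysohn_sub0 _ R _ _ sep (f x) (ex_intro2 _ _ x (conj Kx Hx) erefl).
  by move: fx; rewrite f0; lra.
- rewrite -setIUr; apply/seteqP; split => [x Kx|x []//]; split => //=.
  by have [|/ltW] := leP (f x) 2^-1%R; [left|right].
Qed.

Let lam_bigsetU (G : nat -> set X) n K : (forall i, open (G i)) -> compact K ->
  K `<=` \big[setU/set0]_(i < n) G i -> lam K <= \sum_(i < n) inner (G i).
Proof.
move=> oG; elim: n K => [K cK|n IH K cK].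
  by rewrite !big_ord0 subset0 => ->; rewrite lam0.
rewrite !big_ord_recr/= => KG.
have [||K1 [K2 [cK1 cK2 K1G K2G ->]]] := compact_split cK _ _ KG => //.
  by rewrite -bigcup_mkord; exact: bigcup_open.
apply: le_trans (lamU cK1 cK2) _; apply: leeD; last exact: lam_inner.
exact: IH.
Qed.

Let inner_bigcup (G : nat -> set X) : (forall i, open (G i)) ->
  inner (\bigcup_i G i) <= \sum_(i <oo) inner (G i).
Proof.
move=> oG; apply: ge_ereal_sup => _ [K [cK KG] <-].
move: (cK); rewrite compact_cover => /(_ nat setT G)[//|//|s _ Ks].
apply: le_trans (nneseries_lim_ge (\max_(i <- enum_fset s) i).+1 _); last by move=> *.
rewrite big_mkord; apply: lam_bigsetU => //; apply: subset_trans Ks _ => x [i /= si Gx].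
rewrite -bigcup_mkord; exists i => //=; rewrite ltnS.
exact: leq_bigmax_seq.
Qed.

Let outer0 : outer set0 = 0.
Proof.
rewrite outer_open; last exact: open0.
apply/eqP; rewrite eq_le inner_ge0 andbT.
apply: ge_ereal_sup => _ [K [_ K0] <-]; move: K0; rewrite subset0 => ->.
by rewrite lam0.
Qed.

Let outer_le1 A : outer A <= 1.
Proof. by apply: le_trans (inner_le1 setT); apply: outer_inner => //; exact: openT. Qed.

Let outer_fin_num A : outer A \is a fin_num.
Proof. by rewrite ge0_fin_numE// (le_lt_trans (outer_le1 A))// ltry. Qed.

Let outer_adherent A (e : R) : (0 < e)%R ->
  exists G, [/\ open G, A `<=` G & inner G <= outer A + e%:E].
Proof.
move=> e0; have [_ [G [oG AG] <-] /ltW Ge] := lb_ereal_inf_adherent e0 (outer_fin_num A).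
by exists G.
Qed.

Let outer_sigma_subadditive : sigma_subadditive outer.
Proof.
move=> A; apply/lee_addgt0Pr => e e0.
apply: le_trans (epsilon_trick _ _ (ltW e0)) => //.
have en n : (0 < e / (2 ^ n.+1)%:R)%R by rewrite divr_gt0// ltr0n expn_gt0.
have /choice[G GP] n := outer_adherent (A n) (en n).
have oG n : open (G n) by case: (GP n).
apply: (@le_trans _ _ (\sum_(i <oo) inner (G i))).
  apply: le_trans (inner_bigcup oG); apply: outer_inner; first exact: bigcup_open.
  by apply: subset_bigcup => n _; case: (GP n).
by apply: lee_nneseries => // n _; case: (GP n).
Qed.

HB.instance Definition _ := isOuterMeasure.Build R X outer
  outer0 outer_ge0 le_outer outer_sigma_subadditive.

(** It suffices to test an open [U] containing [A]. For [K] compact in the intersection of [U] and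
    [G], and [L] compact in [U] minus [K], the sets [K] and [L] are disjoint, so [lam K + lam L] is
    at most [inner U]. Taking the supremum over [L], then over [K], gives the inequality, because
    [U] minus [G] is contained in [U] minus [K]. *)
Let outer_caratheodory_open G : open G -> outer.-caratheodory G.
Proof.
move=> oG; apply: le_caratheodory_measurable => A.
apply: le_ereal_inf_tmp => _ [U [oU AU] <-].
have oUG : open (U `&` G) by exact: openI.
apply: (@le_trans _ _ (inner (U `&` G) + outer (U `\` G))).
  by apply: leeD; [apply: outer_inner => //; exact: setSI|apply: le_outer; exact: setSI].
rewrite -leeBrDr//; apply: ge_ereal_sup => _ [K [cK KUG] <-].
have oUK : open (U `\` K).
  by apply: openI => //; apply: closed_openC; exact: compact_closed_metric.
rewrite leeBrDr// addeC.
apply: (@le_trans _ _ (inner (U `\` K) + lam K)).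
  apply: leeD => //; apply: outer_inner => //; apply: setDS.
  by apply: subset_trans KUG _; exact: subIsetr.
rewrite -leeBrDr ?ge0_fin_numE ?(le_lt_trans (lam_le1 _)) ?ltry//.
apply: ge_ereal_sup => _ [L [cL LUK] <-].
rewrite leeBrDr ?ge0_fin_numE ?(le_lt_trans (lam_le1 _)) ?ltry//.
apply: (@le_trans _ _ (lam (L `|` K))).
  apply: lamUd => //; apply/seteqP; split => // x [Lx Kx].
  by have [] := LUK _ Lx.
apply: lam_inner; first exact: compactU.
move=> x [/LUK[]//|/KUG[]//].
Qed.

Let borel_caratheodory (A : set (borel X)) : measurable A -> outer.-caratheodory A.
Proof.
move: A; apply: smallest_sub; last by move=> G; exact: outer_caratheodory_open.
split => //.
- exact: caratheodory_measurable_set0.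
- by move=> A mA; rewrite setTD; exact: caratheodory_measurable_setC.
- by move=> A mA; exact: caratheodory_measurable_bigcup.
Qed.

Let borel_outer : set (borel X) -> \bar R := outer.

Let borel_outer_sigma_additive : semi_sigma_additive borel_outer.
Proof.
move=> F mF tF mUF; apply: (@caratheodory_measure_sigma_additive R X outer) => //.
  by move=> i; exact: borel_caratheodory.
exact: borel_caratheodory.
Qed.

HB.instance Definition _ := isMeasure.Build _ _ _ borel_outer
  outer0 outer_ge0 borel_outer_sigma_additive.

Let borel_outer_setT : borel_outer setT <= 1.
Proof. exact: outer_le1. Qed.

HB.instance Definition _ := Measure_isSubProbability.Build _ _ _ borel_outer
  borel_outer_setT.

(** Serves twice: with limits of masses along an ultrafilter it produces the limit measure, and with
    the masses of a given measure it shows that this measure is regular. The first two conclusions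
    compare [nu] with [lam] in opposite directions on compact and on open sets. *)
Lemma measure_of_content : exists nu : subprobability (borel X) R,
  [/\ forall K, compact K -> lam K <= nu K,
      forall G c, open G -> (forall K, compact K -> K `<=` G -> lam K <= c) -> nu G <= c &
      forall A, nu A = ereal_inf [set nu G | G in [set G | open G /\ A `<=` G]]].
Proof.
exists borel_outer; split.
- move=> K cK; apply: le_ereal_inf_tmp => _ [G [oG KG] <-]; exact: lam_inner.
- move=> G c oG Gc; apply: le_trans (outer_inner oG (@subset_refl _ G)) _.
  by apply: ge_ereal_sup => _ [K [cK KG] <-]; exact: Gc.
- move=> A; apply: (congr1 (fun S : set (\bar R) => ereal_inf S)).
  by apply/seteqP; split => _ [G [oG AG] <-]; exists G => //; have /= := outer_open oG.
Qed.

End measure_of_content.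

(** * The vague topology *)

Section bounded_integrals.
Context d (T : measurableType d) (R : realType).
Implicit Types (m : {finite_measure set T -> \bar R}) (f g : T -> R).

Lemma integrable_bounded m f M : measurable_fun [set: T] f ->
  (forall x, `|f x| <= M)%R -> m.-integrable [set: T] (EFin \o f).
Proof.
move=> mf fM; apply: measurable_bounded_integrable => //.
  by rewrite ltey_eq fin_num_measure.
exists M; split; first exact: num_real.
by move=> N MN x _; apply: le_trans (fM x) (ltW MN).
Qed.

Lemma Rintegral_sum_indic m (A : nat -> set T) n :
  (forall k, measurable (A k)) ->
  (\int[m]_(x in [set: T]) (\sum_(k < n) \1_(A k) x) = \sum_(k < n) fine (m (A k)))%R.
Proof.
move=> mA; elim: n => [|n IH].
  under eq_Rintegral do rewrite big_ord0.
  by rewrite Rintegral_cst// mul0r big_ord0.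
under eq_Rintegral do rewrite big_ord_recr/=.
have le_n (x : T) : (0 <= (\sum_(k < n) \1_(A k) x : R) <= n%:R)%R.
  apply/andP; split; first by apply: sumr_ge0 => k _; rewrite indicE.
  rewrite -[n in (n%:R)%R]card_ord -sum1_card natr_sum.
  by apply: ler_sum => k _; rewrite indicE; case: (_ \in _).
rewrite RintegralD//.
- by rewrite big_ord_recr/= IH; congr (_ + _)%R; rewrite /Rintegral integral_indic// setIT.
- apply: (@integrable_bounded _ _ n%:R).
    by apply: measurable_sum => k; exact: measurable_indic.
  by move=> x; have /andP[s0 sn] := le_n x; rewrite ger0_norm.
- apply: (@integrable_bounded _ _ 1%R); first exact: measurable_indic.
  by move=> x; rewrite indicE; case: (_ \in _); rewrite ?normr1 ?normr0.
Qed.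

Lemma le_Rintegral_bounded m f g M : measurable_fun [set: T] f ->
  measurable_fun [set: T] g -> (forall x, `|f x| <= M)%R ->
  (forall x, `|g x| <= M)%R -> (forall x, f x <= g x)%R ->
  (\int[m]_(x in [set: T]) f x <= \int[m]_(x in [set: T]) g x)%R.
Proof.
by move=> mf mg fM gM fg; apply: le_Rintegral => //; exact: integrable_bounded.
Qed.

Lemma normr_Rintegral_le (nu : subprobability T R) f M :
  measurable_fun [set: T] f -> (forall x, `|f x| <= M)%R ->
  (`|\int[nu]_(x in [set: T]) f x| <= M)%R.
Proof.
move=> mf fM; have M0 : (0 <= M)%R by exact: le_trans (fM point).
apply: le_trans (le_normr_Rintegral _ _) _ => //; first exact: (integrable_bounded nu mf fM).
apply: (@le_trans _ _ (\int[nu]_(x in [set: T]) M)%R).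
  apply: (@le_Rintegral_bounded nu _ _ M) => //.
  - exact: measurableT_comp.
  - by move=> x; rewrite normr_id.
  - by move=> x; rewrite ger0_norm.
rewrite Rintegral_cst// ler_piMr// -lee_fin fineK ?fin_num_measure//.
exact: sprobability_setT.
Qed.

End bounded_integrals.

Section layer_cake.
Context (R : realType).

(** The sum counts the integers from 1 to [n] that are at most [z], so it is the integer part of
    [z]; with strict inequalities and integers from 0, as in the next lemma, it is the ceiling. The
    first staircase is cut out by closed superlevel sets, the second by open ones. *)
Lemma layer_cake_le (z : R) n : (0 <= z <= n%:R)%R ->
  (\sum_(k < n) (k.+1%:R <= z)%R%:R <= z <= \sum_(k < n) (k.+1%:R <= z)%R%:R + 1)%R.
Proof.
move=> /andP[z0 zn].
have sn m : (\sum_(k < m) (k.+1%:R <= z)%R%:R <= m%:R :> R)%R.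
  rewrite -[m in leRHS]card_ord -sum1_card natr_sum.
  by apply: ler_sum => k _; rewrite ler_nat; case: (_ <= z)%R.
(* The bound [z <= n] does not pass to smaller [n], so the induction carries the alternative that
   all [n] levels are counted. *)
have : (\sum_(k < n) (k.+1%:R <= z)%R%:R <= z)%R /\
    ((z <= \sum_(k < n) (k.+1%:R <= z)%R%:R + 1)%R \/
     (\sum_(k < n) (k.+1%:R <= z)%R%:R = n%:R :> R)%R).
  elim: n {zn} => [|n [IH1 IH2]]; first by rewrite !big_ord0; split => //; right.
  rewrite big_ord_recr/=; have := sn n; have [nz|nz] := leP n.+1%:R z => snn.
    split; first by apply: le_trans nz; rewrite -natr1 lerD2r.
    by case: IH2 => [|->] /=; [left; lra|right; rewrite natr1].
  rewrite addr0; split => //; left; case: IH2 => // ->.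
  by rewrite natr1 ltW.
by move=> [-> [->//|->]]; rewrite (le_trans zn)// lerDl.
Qed.

Lemma layer_cake_lt (z : R) n : (0 <= z <= n%:R)%R ->
  (z <= \sum_(k < n) (k%:R < z)%R%:R <= z + 1)%R.
Proof.
move=> /andP[z0 zn].
have sn m : (\sum_(k < m) (k%:R < z)%R%:R <= m%:R :> R)%R.
  rewrite -[m in leRHS]card_ord -sum1_card natr_sum.
  by apply: ler_sum => k _; rewrite ler_nat; case: (_ < z)%R.
have : (\sum_(k < n) (k%:R < z)%R%:R <= z + 1)%R /\
    ((z <= \sum_(k < n) (k%:R < z)%R%:R)%R \/
     (\sum_(k < n) (k%:R < z)%R%:R = n%:R :> R)%R).
  elim: n {zn} => [|n [IH1 IH2]]; first by rewrite !big_ord0; split; [rewrite addr_ge0|right].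
  rewrite big_ord_recr/=; have := sn n; have [nz|nz] := ltP n%:R z => snn.
    rewrite (_ : true%:R = 1%R :> R)//; split; first by lra.
    by case: IH2 => [|->] /=; [left; lra|right; rewrite natr1].
  by rewrite addr0; split => //; left; case: IH2 => // ->.
by move=> [-> [->//|->]]; rewrite zn.
Qed.

End layer_cake.

(** * Continuity and convergence for the vague topology *)

Section vague_topology.
Context (R : realType) (X : completeMetricType R).

Lemma continuous_borel (f : X -> R) : continuous f ->
  measurable_fun [set: borel X] (f : borel X -> R).
Proof.
move=> cf; apply: (measurability _ (RGenOpens.measurableE R)).
move=> _ [_ [a [b ->] <-]]; rewrite setTI; apply: sub_sigma_algebra.
by apply: open_comp; [move=> x _; exact: cf|exact: interval_open].
Qed.

Definition mkCc (f : X -> R) (cf : continuous f)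
    (kf : compact (closure [set x | f x != 0%R])) : Cc X :=
  exist (fun f : X -> R => continuous f /\ compact (closure [set x | f x != 0%R])) f
    (conj cf kf).

Lemma measurable_Cc (f : Cc X) : measurable_fun [set: borel X] (sval f : borel X -> R).
Proof. by apply: continuous_borel; case: f => f []. Qed.

Lemma Cc_bounded (f : Cc X) : exists2 M : R, (0 < M)%R & forall x, (`|sval f x| <= M)%R.
Proof.
case: f => f [cf kf] /=.
have : compact (f @` closure [set x | f x != 0%R]).
  by apply: continuous_compact => //; apply: continuous_subspaceT.
move=> /compact_bounded[M [_ /(_ (Num.max M 1 + 1)%R)]].
rewrite (le_lt_trans _ (ltr_pwDr _ (lexx _))) ?le_max ?lexx// => /(_ isT) fM.
have M1 : (0 < Num.max M 1 + 1 :> R)%R by rewrite addr_gt0// lt_max ltr01 orbT.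
exists (Num.max M 1 + 1)%R => // x.
have [->|fx] := eqVneq (f x) 0%R; first by rewrite normr0 ltW.
by apply: fM; exists x => //; exact: subset_closure.
Qed.

Lemma integrable_Cc (m : {finite_measure set (borel X) -> \bar R}) (f : Cc X) :
  m.-integrable [set: borel X] (EFin \o sval f).
Proof.
have [M _ fM] := Cc_bounded f.
by apply: (@integrable_bounded _ _ _ _ _ M) => //; exact: measurable_Cc.
Qed.

Local Notation "nu `[ f ]" := ((\int[nu]_(x in [set: borel X]) f x)%R)
  (at level 10, format "nu `[ f ]").

Lemma vague_continuous (f : Cc X) : continuous (fun nu : M1 X => nu`[sval f]).
Proof.
move=> nu.
have /(@cvg_sup _ _ (@vague R X) (nbhs nu) nu (nbhs_filter nu))/(_ f) : nbhs nu --> nu by [].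
move=> H A Anu; apply: H => /=.
exact: (@initial_continuous _ _ (fun nu : M1 X => nu`[sval f]) nu).
Qed.

Lemma vague_cvg (F : set_system (M1 X)) (nu : M1 X) : Filter F ->
  (forall f : Cc X, (fun nu' : M1 X => nu'`[sval f]) @ F --> nu`[sval f]) -> F --> nu.
Proof.
move=> FF H; apply/(@cvg_sup _ _ (@vague R X) F nu FF) => f A.
rewrite /= (@nbhsE (Topological.Pack (vague f))) => -[_ [[B oB <-] Bnu] BA].
apply: (filterS BA); apply: (H f); exact: open_nbhs_nbhs.
Qed.

End vague_topology.

(** The image filter has a cluster point in a compact segment, and an ultrafilter converges to each
    of its cluster points. *)
Lemma ultra_bounded_cvg (R : realType) T (U : set_system T) (f : T -> R) (M : R) :
  UltraFilter U -> (forall x, `|f x| <= M)%R -> exists l : R, f @ U --> l.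
Proof.
move=> UU fM.
have [l [_ cl]] : `[(- M)%R, M]%classic `&` cluster (f @ U) !=set0.
  apply: segment_compact; rewrite /fmap/=; apply: filterS filterT => x _.
  by rewrite /= in_itv/= -ler_norml.
exists l => B Bl; have [//|UB] := in_ultra_setVsetC (f @^-1` B) UU.
by have [y []] := cl (~` B) B UB Bl.
Qed.

Section layer_cake_integral.
Context d (T : measurableType d) (R : realType).
Variables (nu : subprobability T R) (g : T -> R) (n : nat).
Hypotheses (mg : measurable_fun [set: T] g) (g01 : forall x, (0 <= g x <= 1)%R).
Local Notation "nu `[ f ]" := ((\int[nu]_(x in [set: T]) f x)%R)
  (at level 10, format "nu `[ f ]").

Let A k := [set x | (k.+1%:R <= n%:R * g x)%R].
Let B k := [set x | (k%:R < n%:R * g x)%R].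

Let ng x : (0 <= n%:R * g x <= n%:R)%R.
Proof.
by have /andP[g0 g1] := g01 x; rewrite mulr_ge0//= ler_piMr.
Qed.

Let mng : measurable_fun [set: T] (fun x => n%:R * g x)%R.
Proof. exact: measurable_funM. Qed.

Let mA k : measurable (A k).
Proof.
rewrite (_ : A k = [set: T] `&` (fun x => n%:R * g x)%R @^-1` `[k.+1%:R, +oo[).
  by apply: mng => //; exact: measurable_itv.
by rewrite setTI; apply/seteqP; split => x /=; rewrite in_itv/= andbT.
Qed.

Let mB k : measurable (B k).
Proof.
rewrite (_ : B k = [set: T] `&` (fun x => n%:R * g x)%R @^-1` `]k%:R, +oo[).
  by apply: mng => //; exact: measurable_itv.
by rewrite setTI; apply/seteqP; split => x /=; rewrite in_itv/= andbT.
Qed.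

Let le_n (C : nat -> set T) x : (0 <= (\sum_(k < n) \1_(C k) x : R) <= n%:R)%R.
Proof.
apply/andP; split; first by apply: sumr_ge0 => k _; rewrite indicE.
rewrite -[n in (n%:R)%R]card_ord -sum1_card natr_sum.
by apply: ler_sum => k _; rewrite indicE; case: (_ \in _).
Qed.

Let msum (C : nat -> set T) : (forall k, measurable (C k)) ->
  measurable_fun [set: T] (fun x => \sum_(k < n) \1_(C k) x : R)%R.
Proof. by move=> mC; apply: measurable_sum => k; exact: measurable_indic. Qed.

Let isum (C : nat -> set T) : (forall k, measurable (C k)) ->
  nu.-integrable [set: T] (fun x => (\sum_(k < n) \1_(C k) x)%:E).
Proof.
move=> mC; apply: (@integrable_bounded _ _ _ _ _ n%:R); first exact: msum.
by move=> x; have /andP[s0 sn] := le_n C x; rewrite ger0_norm.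
Qed.

Let ing : nu.-integrable [set: T] (fun x => (n%:R * g x)%:E).
Proof.
apply: (@integrable_bounded _ _ _ _ _ n%:R) => // x.
by have /andP[s0 sn] := ng x; rewrite ger0_norm.
Qed.

Let i1 : nu.-integrable [set: T] (fun x => 1%R%:E).
Proof. by apply: (@integrable_bounded _ _ _ _ _ 1%R) => // x; rewrite normr1. Qed.

Let nuT1 : (\int[nu]_(x in [set: T]) (1 : R) <= 1)%R.
Proof.
rewrite Rintegral_cst// mul1r -lee_fin fineK ?fin_num_measure//.
exact: sprobability_setT.
Qed.

Let iE : (\int[nu]_(x in [set: T]) (n%:R * g x) = n%:R * nu`[g])%R.
Proof.
rewrite RintegralZl//; apply: (@integrable_bounded _ _ _ _ _ 1%R) => // x.
by have /andP[s0 sn] := g01 x; rewrite ger0_norm.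
Qed.

(** For [g] in [Cc] the sets [A k] are compact, and the sets [B k] of the companion lemma are open.
    Limits of masses are comparable with the limit measure in only one direction on each kind of
    set, which is why both staircases appear. *)
Lemma layer_cake_integral_le :
  (\sum_(k < n) fine (nu (A k)) <= n%:R * nu`[g] <= \sum_(k < n) fine (nu (A k)) + 1)%R.
Proof.
rewrite -iE -Rintegral_sum_indic//.
have E x : (\sum_(k < n) \1_(A k) x = \sum_(k < n) (k.+1%:R <= n%:R * g x)%R%:R :> R)%R.
  by apply: eq_bigr => k _; rewrite indicE; congr (nat_of_bool _)%:R; apply/asboolP/idP.
apply/andP; split.
  by apply: le_Rintegral => //; [exact: isum|move=> x _; rewrite E; have /andP[] := layer_cake_le (ng x)].
apply: (le_trans _ (lerD (lexx _) nuT1)); rewrite -RintegralD//; last exact: isum.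
apply: le_Rintegral => //; last by move=> x _; rewrite E; have /andP[] := layer_cake_le (ng x).
exact: (integrableD _ (isum mA) i1).
Qed.

Lemma layer_cake_integral_lt :
  (n%:R * nu`[g] <= \sum_(k < n) fine (nu (B k)) <= n%:R * nu`[g] + 1)%R.
Proof.
rewrite -iE -Rintegral_sum_indic//.
have E x : (\sum_(k < n) \1_(B k) x = \sum_(k < n) (k%:R < n%:R * g x)%R%:R :> R)%R.
  by apply: eq_bigr => k _; rewrite indicE; congr (nat_of_bool _)%:R; apply/asboolP/idP.
apply/andP; split.
  by apply: le_Rintegral => //; [exact: isum|move=> x _; rewrite E; have /andP[] := layer_cake_lt (ng x)].
apply: (le_trans _ (lerD (lexx _) nuT1)); rewrite -RintegralD//.
apply: le_Rintegral => //; last by move=> x _; rewrite E; have /andP[] := layer_cake_lt (ng x).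
- exact: isum.
- exact: (integrableD _ ing i1).
Qed.

End layer_cake_integral.

(** * Compactness of the space of subprobabilities *)

Section vague_compactness.
Context (R : realType) (X : completeMetricType R).
Hypotheses (X_second_countable : @second_countable X)
  (X_locally_compact : locally_compact [set: X]).
Local Notation "nu `[ f ]" := ((\int[nu]_(x in [set: borel X]) f x)%R)
  (at level 10, format "nu `[ f ]").

Lemma outer_regular_radon (nu : subprobability (borel X) R) :
  (forall A, measurable A ->
    nu A = ereal_inf [set nu G | G in [set G : set X | open G /\ A `<=` G]]) ->
  radon nu.
Proof.
move=> reg A mA; have mK := @compact_borel_measurable R X.
apply/eqP; rewrite eq_le; apply/andP; split; last first.
  by apply: ge_ereal_sup => _ [K [cK KA] <-]; apply: le_measure; rewrite ?inE//; exact: mK.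
have [L [cL ndL LT]] := sigma_compact X_second_countable X_locally_compact.
apply/lee_addgt0Pr => e e0.
have mAC : measurable (~` A) by exact: measurableC.
have fin_nu B : measurable B -> nu B \is a fin_num by exact: fin_num_measure.
have [G [oG AG nuG]] : exists G : set X, [/\ open G, ~` A `<=` G & nu G <= nu (~` A) + e%:E].
  rewrite (reg _ mAC); have := fin_nu _ mAC; rewrite (reg _ mAC) => fi.
  have [_ [G [oG AG] <-] /ltW Ge] := lb_ereal_inf_adherent e0 fi.
  by exists G.
have mG : measurable (G : set (borel X)) by exact: sub_sigma_algebra.
have GA : ~` G `<=` A by move=> x Gx; apply: contrapT => Ax; exact/Gx/AG.
have nuA : nu A <= nu (~` G) + e%:E.
  have nuC B : measurable B -> nu (~` B) = nu setT - nu B.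
    move=> mB; rewrite -[in RHS](setvU B) measureU ?setICl//; last exact: measurableC.
    by rewrite addeK// fin_nu.
  move: nuG; rewrite !nuC//.
  have := fin_nu _ mA; have := fin_nu _ mG; have := fin_nu _ measurableT.
  move: (nu setT) (nu G) (nu A) => [a| |] [b| |] [c| |]//= _ _ _.
  by rewrite !lee_fin; lra.
apply: le_trans nuA _; rewrite leeD2r//.
have mGL n : measurable (~` G `&` L n : set (borel X)).
  by apply: measurableI; [exact: measurableC|exact: mK].
have cvL : nu (~` G `&` L n) @[n --> \oo] --> nu (~` G).
  rewrite [X in _ --> nu X](_ : _ = \bigcup_n (~` G `&` L n)); last first.
    by rewrite -setI_bigcupr LT setIT.
  apply: nondecreasing_cvg_mu => //; first exact: bigcup_measurable.
  by move=> m n mn; apply/subsetPset; apply: setIS; apply/subsetPset; exact: ndL.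
rewrite -(cvg_lim _ cvL)//; apply: lime_le; first by apply/cvg_ex; eexists; exact: cvL.
apply: nearW => n; apply: ereal_sup_ubound; exists (~` G `&` L n) => //; split.
  by rewrite setIC; apply: compact_closedI => //; exact: open_closedC.
by apply: subset_trans GA; exact: subIsetl.
Qed.

(* The limits of the masses of compact sets along an ultrafilter generate a measure, which is the
   limit of the ultrafilter. *)
Lemma M1_compact : compact [set: M1 X].
Proof.
rewrite compact_ultra => U UU _ /=.
have mK := @compact_borel_measurable R X.
have mG (G : set X) : open G -> measurable (G : set (borel X)) by exact: sub_sigma_algebra.
have fin_nu (nu : M1 X) B : measurable B -> nu B \is a fin_num by exact: fin_num_measure.
have nu_le1 (nu : M1 X) B : measurable B -> nu B <= 1.
  move=> mB; apply: (@le_trans _ _ (nu setT)); last exact: sprobability_setT.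
  by apply: le_measure; rewrite ?inE.
have massU (B : set (borel X)) : exists l : R, measurable B ->
    (fun nu : M1 X => fine (nu B)) @ U --> l.
  have [mB|mB] := pselect (measurable B); last by exists 0%R => /mB.
  have [|l lP] := @ultra_bounded_cvg R _ U (fun nu : M1 X => fine (nu B)) 1%R UU.
    move=> nu; rewrite ger0_norm ?fine_ge0//.
    by rewrite -lee_fin fineK ?fin_nu// nu_le1.
  by exists l.
have /choice[l lP] := massU.
have l_ge0 B : measurable B -> (0 <= l B)%R.
  move=> mB; apply: cvgr_to_ge (lP B mB) _; apply: nearW => nu.
  by rewrite fine_ge0.
have l_le1 B : measurable B -> (l B <= 1)%R.
  move=> mB; apply: cvgr_to_le (lP B mB) _; apply: nearW => nu.
  by rewrite -lee_fin fineK ?fin_nu// nu_le1.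
have le_l A B : measurable A -> measurable B -> A `<=` B -> (l A <= l B)%R.
  move=> mA mB AB; apply: ler_cvg_to (lP A mA) (lP B mB) _; apply: nearW => nu.
  by rewrite fine_le ?fin_nu//; apply: le_measure; rewrite ?inE.
have lU A B : measurable A -> measurable B -> (l (A `|` B) <= l A + l B)%R.
  move=> mA mB; have mAB := measurableU _ _ mA mB.
  apply: ler_cvg_to (lP _ mAB) (cvgD (lP A mA) (lP B mB)) _; apply: nearW => nu /=.
  rewrite -[leRHS]/(fine (nu A) + fine (nu B))%R.
  by rewrite -fineD ?fin_nu// fine_le ?fin_numD ?fin_nu//; exact: measureU2.
have lUd A B : measurable A -> measurable B -> A `&` B = set0 ->
    (l A + l B <= l (A `|` B))%R.
  move=> mA mB AB; have mAB := measurableU _ _ mA mB.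
  apply: ler_cvg_to (cvgD (lP A mA) (lP B mB)) (lP _ mAB) _; apply: nearW => nu /=.
  rewrite -[leLHS]/(fine (nu A) + fine (nu B))%R.
  by rewrite -fineD ?fin_nu// measureU.
(* The bounds 0 and 1 are required of [lam] on all sets, hence the value 0 on non-measurable
   ones. *)
pose lam (K : set X) : \bar R :=
  if `[< measurable (K : set (borel X)) >] then (l K)%:E else 0.
have lamE K : measurable (K : set (borel X)) -> lam K = (l K)%:E.
  by move=> mB; rewrite /lam asboolT.
have l0 : l set0 = 0%R.
  apply/eqP; rewrite eq_le l_ge0// andbT.
  apply: cvgr_to_le (lP _ measurable0) _; apply: nearW => nu.
  by rewrite measure0.
have [|||||nu [nuK nuG nuR]] := @measure_of_content R X lam.
- by move=> K; rewrite /lam; case: asboolP => // mB; rewrite lee_fin l_ge0.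
- by rewrite lamE// l0.
- by move=> K; rewrite /lam; case: asboolP => // mB; rewrite lee_fin l_le1.
- move=> K L /mK mB /mK mC; rewrite !lamE//; last exact: measurableU.
  by rewrite -EFinD lee_fin lU.
- move=> K L /mK mB /mK mC KL; rewrite !lamE//; last exact: measurableU.
  by rewrite -EFinD lee_fin lUd.
have rnu : radon nu by apply: outer_regular_radon => A _; exact: nuR.
pose Nu := M1_of rnu.
have NuE (B : set (borel X)) : measurable B -> Nu B = nu B by move=> mB; exact: M1_ofE.
have l_nu K : compact K -> (l K <= fine (Nu K))%R.
  move=> cK; rewrite NuE; last exact: mK.
  rewrite -lee_fin fineK ?fin_num_measure//; last exact: mK.
  by rewrite -lamE; [exact: nuK|exact: mK].
have nu_l G : open G -> (fine (Nu G) <= l G)%R.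
  move=> oG; rewrite NuE; last exact: mG.
  rewrite -lee_fin fineK ?fin_num_measure//; last exact: mG.
  apply: nuG => // K cK KG; rewrite lamE; last exact: mK.
  by rewrite lee_fin le_l//; [exact: mK|exact: mG].
exists Nu; split => //; apply: vague_cvg => f.
have ig (nu' : M1 X) (g : Cc X) : nu'.-integrable [set: borel X] (EFin \o sval g).
  exact: integrable_Cc.
have lim01 (g : Cc X) : (forall x, 0 <= sval g x <= 1)%R ->
    (fun nu' : M1 X => nu'`[sval g]) @ U --> Nu`[sval g].
  move=> g01; have mg := measurable_Cc g.
  have [|L LP] := @ultra_bounded_cvg R _ U (fun nu' : M1 X => nu'`[sval g]) 1%R UU.
    move=> nu'; apply: normr_Rintegral_le => // x.
    by have /andP[g0 g1] := g01 x; rewrite ger0_norm.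
  (* On compact sets the limit masses [l] are at most those of [Nu], on open sets at least. The
     lower staircase then gives [n L <= n Nu(g) + 1] and the upper one the converse, so that [L] and
     [Nu(g)] differ by at most [1 / n]. *)
  suff -> : Nu`[sval g] = L by [].
  apply/eqP; rewrite -subr_eq0 -normr_eq0 eq_le normr_ge0 andbT.
  apply/ler_addgt0Pr => e e0; rewrite add0r.
  pose n := (Num.truncn e^-1).+1.
  have ne : (e^-1 < n%:R :> R)%R by rewrite truncnS_gt.
  have cg : continuous (fun x => n%:R * sval g x)%R.
    case: (g) => h [ch _] x /=; apply: cvgM; [exact: cvg_cst|exact: ch].
  pose A k := [set x | (k.+1%:R <= n%:R * sval g x)%R].
  pose B k := [set x | (k%:R < n%:R * sval g x)%R].
  have oB k : open (B k).
    apply: (@open_comp _ _ (fun x => n%:R * sval g x) [set y : R | k%:R < y])%R; [move=> x _; exact: cg|exact: open_gt].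
  have cA k : compact (A k).
    have : closed (A k).
      apply: (@preimage_closed _ _ (fun x => n%:R * sval g x) [set y : R | k.+1%:R <= y])%R; [move=> x _; exact: cg|exact: closed_ge].
    have [_ kh] := svalP g; move=> clA; apply: (subclosed_compact clA kh).
    (* The lowest level is 1 and not 0, so the closed superlevel sets stay in the support of [g] and
       are compact. *)
    move=> x; rewrite /A/= => nx; apply: subset_closure => /=; apply/eqP => hx0.
    by move: nx; rewrite hx0 mulr0 lern0.
  have cvL : (fun nu' : M1 X => n%:R * nu'`[sval g])%R @ U --> (n%:R * L)%R.
    by apply: cvgM => //; exact: cvg_cst.
  have cvS (C : nat -> set X) : (forall k, measurable (C k : set (borel X))) ->
      (fun nu' : M1 X => \sum_(k < n) fine (nu' (C k)))%R @ U --> (\sum_(k < n) l (C k))%R.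
    by move=> mC; apply: cvg_big; [exact: add_continuous|move=> k _; exact: lP].
  have c1 : (fun nu' : M1 X => 1%R : R) @ U --> (1%R : R) by exact: cvg_cst.
  have nL : (n%:R * L <= \sum_(k < n) l (A k) + 1)%R.
    apply: (ler_cvg_to cvL (cvgD (cvS _ (fun k => mK _ (cA k))) c1)).
    by apply: nearW => nu'; have /andP[_] := layer_cake_integral_le nu' n mg g01.
  have Ln : (\sum_(k < n) l (B k) <= n%:R * L + 1)%R.
    apply: (ler_cvg_to (cvS _ (fun k => mG _ (oB k))) (cvgD cvL c1)).
    by apply: nearW => nu'; have /andP[_] := layer_cake_integral_lt nu' n mg g01.
  have /andP[NA _] := layer_cake_integral_le Nu n mg g01.
  have /andP[NB _] := layer_cake_integral_lt Nu n mg g01.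
  have lA : (\sum_(k < n) l (A k) <= \sum_(k < n) fine (Nu (A k)))%R.
    by apply: ler_sum => k _; exact: l_nu.
  have lB : (\sum_(k < n) fine (Nu (B k)) <= \sum_(k < n) l (B k))%R.
    by apply: ler_sum => k _; exact: nu_l.
  have n0 : (0 < n%:R :> R)%R by rewrite ltr0n.
  have n1e : (n%:R^-1 <= e)%R by rewrite -[leRHS]invrK lef_pV2 ?posrE ?invr_gt0// ltW.
  apply: le_trans n1e; rewrite -[leRHS]mul1r ler_pdivlMr//.
  rewrite -[n%:R in leLHS]ger0_norm// -normrM ler_norml mulrBl !(mulrC _ n%:R).
  rewrite /A/B in NA NB lA lB nL Ln; lra.
have [M M0 fM] := Cc_bounded f.
(* With [s] equal to 1 and to -1, these are the positive and negative parts of [f], divided by the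
   bound [M] to have values in [0, 1]. *)
have part (s : R) : (`|s| = 1)%R -> exists g : Cc X,
    (forall x, sval g x = Num.max (s * sval f x) 0 / M)%R /\
    (forall x, 0 <= sval g x <= 1)%R.
  move=> s1; case: (f) fM => h [ch kh] /= hM.
  have cg : continuous (fun x => Num.max (s * h x) 0 / M)%R.
    move=> x; apply: cvgM; last exact: cvg_cst.
    apply: (@continuous_max _ _ (fun x => s * h x)%R (fun=> 0%R)) => /=; last exact: cvg_cst.
    by apply: cvgM; [exact: cvg_cst|exact: ch].
  have kg : compact (closure [set x | Num.max (s * h x) 0 / M != 0]%R).
    apply: (subclosed_compact _ kh); first exact: closed_closure.
    by apply: closureS => x /=; apply: contraNneq => ->; rewrite mulr0 maxxx mul0r.
  exists (mkCc cg kg); split => // x /=.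
  apply/andP; split; first by rewrite divr_ge0 ?le_max ?lexx ?orbT ?ltW.
  rewrite ler_pdivrMr// mul1r ge_max (ltW M0) andbT.
  by apply: le_trans (ler_norm _) _; rewrite normrM s1 mul1r.
have [p [pE p01]] := part 1%R (normr1 _).
have [q [qE q01]] := part (-1)%R (normrN1 _).
have fE : sval f = (fun x => M * sval p x - M * sval q x)%R.
  apply/funext => x; rewrite pE qE ![(M * (_ / _))%R]mulrC !divfK ?gt_eqF//.
  by rewrite mul1r mulN1r; have [fx|fx] := leP (sval f x) 0%R; [rewrite max_l|rewrite max_r]; lra.
have iE (nu' : M1 X) : nu'`[sval f] = (M * nu'`[sval p] - M * nu'`[sval q])%R.
  rewrite {1}fE RintegralB ?RintegralZl//; try exact: ig.
  - exact: (integrableZl _ M (ig nu' p)).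
  - exact: (integrableZl _ M (ig nu' q)).
rewrite iE (_ : (fun nu' : M1 X => _) = fun nu' : M1 X => M * nu'`[sval p] - M * nu'`[sval q])%R.
  by apply: cvgB; apply: cvgM; [exact: cvg_cst|exact: lim01|exact: cvg_cst|exact: lim01].
by apply/funext => nu'; exact: iE.
Qed.

End vague_compactness.

(** * Borel sets of the vague topology *)

Section vague_borel.
Context (R : realType) (X : completeMetricType R).
Hypotheses (X_second_countable : @second_countable X)
  (X_locally_compact : locally_compact [set: X]).
Local Notation "nu `[ f ]" := ((\int[nu]_(x in [set: borel X]) f x)%R)
  (at level 10, format "nu `[ f ]").

Lemma Rintegral_indic (nu : {finite_measure set (borel X) -> \bar R}) (A : set (borel X)) :
  measurable A -> nu`[\1_A] = fine (nu A).
Proof. by move=> mA; rewrite /Rintegral integral_indic// setIT. Qed.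

Lemma le_measure_bump (nu : M1 X) (g : Cc X) (K : set X) : compact K ->
  (forall x, 0 <= sval g x <= 1)%R -> (forall x, K x -> sval g x = 1%R) ->
  nu K <= (nu`[sval g])%:E.
Proof.
move=> cK g01 gK; have mK := compact_borel_measurable cK.
rewrite -[nu K]fineK ?fin_num_measure// lee_fin -Rintegral_indic//.
apply: (@le_Rintegral_bounded _ _ _ _ _ _ 1%R) => //.
- exact: measurable_Cc.
- by move=> x; rewrite indicE; case: (_ \in _); rewrite ?normr1 ?normr0.
- by move=> x; have /andP[? ?] := g01 x; rewrite ger0_norm.
- move=> x; rewrite indicE; have [/set_mem/gK ->//|_] := boolP (x \in K).
  by have /andP[] := g01 x.
Qed.

Lemma le_bump_measure (nu : M1 X) (g : Cc X) (G : set X) : open G ->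
  (forall x, 0 <= sval g x <= 1)%R -> (forall x, sval g x != 0%R -> G x) ->
  (nu`[sval g])%:E <= nu G.
Proof.
move=> oG g01 gG; have mG : measurable (G : set (borel X)) by exact: sub_sigma_algebra.
rewrite -[nu G]fineK ?fin_num_measure// lee_fin -Rintegral_indic//.
apply: (@le_Rintegral_bounded _ _ _ _ _ _ 1%R) => //.
- exact: measurable_Cc.
- by move=> x; have /andP[? ?] := g01 x; rewrite ger0_norm.
- by move=> x; rewrite indicE; case: (_ \in _); rewrite ?normr1 ?normr0.
- move=> x; rewrite indicE; have [->|/gG Gx] := eqVneq (sval g x) 0%R; first by case: (_ \in _).
  by rewrite mem_set//; have /andP[] := g01 x.
Qed.

(** A bump between a compact [K] and an open [G] gives [nu1 K <= nu1(D n) = nu2(D n) <= nu2 G]. The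
    Radon property passes to the supremum over [K], so the measures agree on open sets, which
    generate the Borel sets and are stable under intersection. *)
Lemma countable_separating : exists D : nat -> Cc X, forall nu nu' : M1 X,
  (forall n, nu`[sval (D n)] = nu'`[sval (D n)]) -> nu = nu'.
Proof.
have [D [D01 Dsep]] := countable_bumps X_second_countable X_locally_compact.
exists D => nu nu' nuD.
have le_open (nu1 nu2 : M1 X) : (forall n, nu1`[sval (D n)] = nu2`[sval (D n)]) ->
    forall G : set X, open G -> nu1 G <= nu2 G.
  move=> nu12 G oG; have mG : measurable (G : set (borel X)) by exact: sub_sigma_algebra.
  rewrite (M1_radon nu1 mG); apply: ge_ereal_sup => _ [K [cK KG] <-].
  have [n [DK DG]] := Dsep _ _ cK oG KG.
  apply: le_trans (le_measure_bump nu1 cK (D01 n) DK) _.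
  by rewrite nu12; exact: le_bump_measure.
apply: M1_ext => A mA; apply: (@measure_unique _ R (borel X) (@open X) (fun=> setT)) => //.
- exact: openI.
- by move=> _; exact: openT.
- by rewrite bigcup_const.
- move=> G oG; apply/eqP; rewrite eq_le (le_open nu nu')// (le_open nu' nu)//.
- by move=> _; rewrite ltey_eq fin_num_measure.
Qed.

(** The sets [H i] are rational half-spaces for a countable separating family. By compactness of
    [M1], their finite intersections form a base of the vague topology; there are countably many of
    them, so every open set has a measurable preimage. *)
Lemma measurable_M1 d (Omega : measurableType d) (F : Omega -> M1 X) :
  (forall f : Cc X, measurable_fun [set: Omega] (fun w => (F w)`[sval f])) ->
  measurable_fun [set: Omega] (F : Omega -> borel (M1 X)).
Proof.
move=> mF; have [D Dsep] := countable_separating.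
pose H (i : nat * rat * bool) : set (M1 X) :=
  let v (nu : M1 X) := nu`[sval (D i.1.1)] in
  if i.2 then [set nu | v nu < ratr i.1.2]%R else [set nu | ratr i.1.2 < v nu]%R.
have oH i : open (H i).
  rewrite /H; case: i.2.
    apply: (@open_comp _ _ (fun nu : M1 X => nu`[sval (D i.1.1)]) [set y : R | y < ratr i.1.2])%R.
      by move=> x _; exact: vague_continuous.
    exact: open_lt.
  apply: (@open_comp _ _ (fun nu : M1 X => nu`[sval (D i.1.1)]) [set y : R | ratr i.1.2 < y])%R.
    by move=> x _; exact: vague_continuous.
  exact: open_gt.
have mFH i : measurable (F @^-1` H i).
  rewrite /H; case: i.2.
    rewrite (_ : F @^-1` _ = [set: Omega] `&` (fun w => (F w)`[sval (D i.1.1)]) @^-1` `]-oo, ratr i.1.2[).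
      by apply: mF => //; exact: measurable_itv.
    by rewrite setTI; apply/seteqP; split => x /=; rewrite in_itv/=.
  rewrite (_ : F @^-1` _ = [set: Omega] `&` (fun w => (F w)`[sval (D i.1.1)]) @^-1` `]ratr i.1.2, +oo[).
    by apply: mF => //; exact: measurable_itv.
  by rewrite setTI; apply/seteqP; split => x /=; rewrite in_itv/= andbT.
(* Each measure outside [O] is separated from [nu] by a rational strictly between the values of some
   test function. The half-spaces opposite to those containing [nu], obtained by [~~ i.2], thus
   cover the compact complement of [O], and finitely many suffice. *)
have local (O : set (M1 X)) (nu : M1 X) : open O -> O nu ->
    exists s : seq (nat * rat * bool), \bigcap_(i in [set` s]) H i `<=` O /\
      (\bigcap_(i in [set` s]) H i) nu.
  move=> oO Onu.
  have : compact (~` O).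
    apply: (subclosed_compact _ (M1_compact X_second_countable X_locally_compact)) => //.
    exact: open_closedC.
  rewrite compact_cover => /(_ (nat * rat * bool)%type [set i | H i nu] (fun i => H (i.1, ~~ i.2))).
  case=> [i _|nu' Onu'|s sH sO]; first exact: oH.
    have [n nn] : exists n, nu`[sval (D n)] != nu'`[sval (D n)].
      apply: contrapT => /forallNP nD; apply: Onu'.
      rewrite (_ : nu' = nu)//; apply/esym/Dsep => n.
      by apply/eqP; have /negP := nD n; rewrite negbK.
    move: nn; rewrite neq_lt => /orP[]/rat_in_itvoo[q]; rewrite in_itv/= => /andP[q1 q2].
      by exists (n, q, true).
    by exists (n, q, false).
  exists (enum_fset s); split => [nu' sH'|i /= si]; last first.
    by have := sH i si; rewrite inE.
  apply: contrapT => /sO [i /= si]; have := sH' i si.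
  rewrite /H/=; case: i.2 => /= a b; first by have := lt_trans a b; rewrite ltxx.
  by have := lt_trans a b; rewrite ltxx.
apply: (@measurability _ _ _ (borel (M1 X)) _ _ (@open (M1 X))) => //.
move=> _ [G oO <-]; rewrite setTI; move: G oO => O oO.
rewrite (_ : F @^-1` O = \bigcup_(s in [set s : seq (nat * rat * bool) |
    \bigcap_(i in [set` s]) H i `<=` O]) \bigcap_(i in [set` s]) (F @^-1` H i)).
  rewrite bigcup_mkcond; apply: countable_bigcupT_measurable => [|s]; first exact: countableP.
  by case: ifP => _ //; apply: fin_bigcap_measurable => // i _; exact: mFH.
apply/seteqP; split => w /=; last by move=> [s sO Fs]; exact: sO.
by move=> /(local _ _ oO)[s [sO Fs]]; exists s.
Qed.

End vague_borel.

(** * Products of independent variables *)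

Section nonnegative_induction.
Context d (T : measurableType d) (R : realType).
Import HBNNSimple.

Lemma nonneg_measurable_ind (Q : (T -> \bar R) -> Prop) :
  (forall A, measurable A -> Q (fun x => (\1_A x)%:E)) ->
  (forall f g, measurable_fun [set: T] f -> measurable_fun [set: T] g ->
    (forall x, 0 <= f x) -> (forall x, 0 <= g x) -> Q f -> Q g ->
    Q (fun x => f x + g x)) ->
  (forall (c : R) f, (0 <= c)%R -> measurable_fun [set: T] f -> (forall x, 0 <= f x) ->
    Q f -> Q (fun x => c%:E * f x)) ->
  (forall (f : nat -> T -> \bar R), (forall n, measurable_fun [set: T] (f n)) ->
    (forall n x, 0 <= f n x) -> (forall x, nondecreasing_seq (f ^~ x)) ->
    (forall n, Q (f n)) -> Q (fun x => limn (f ^~ x))) ->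
  forall f, measurable_fun [set: T] f -> (forall x, 0 <= f x) -> Q f.
Proof.
move=> Qindic Qadd Qscale Qlim f mf f0.
pose f_ := nnsfun_approx measurableT mf.
have -> : f = fun x => limn (fun n => (f_ n x)%:E).
  apply/funext => x; apply/esym/cvg_lim => //.
  by apply: cvg_nnsfun_approx => // y _; exact: f0.
apply: Qlim.
- by move=> n; exact/measurable_EFinP.
- by move=> n x; rewrite lee_fin.
- by move=> x m n mn; rewrite lee_fin; exact/lefP/nd_nnsfun_approx.
move=> n; pose s := fset_set (f_ n @` setT).
have s0 i : (i < #|` s|)%N -> (0 <= s`_i)%R.
  move=> si; have : s`_i \in s by exact: mem_nth.
  by rewrite in_fset_set// inE => -[x _ <-].
have mA i : measurable (f_ n @^-1` [set s`_i]) by [].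
rewrite (_ : (fun x => _) = fun x => \sum_(i < #|` s|) (s`_i)%:E * (\1_(f_ n @^-1` [set s`_i]) x)%:E).
  have mg k : measurable_fun [set: T]
      (fun x => \sum_(i < k) (s`_i)%:E * (\1_(f_ n @^-1` [set s`_i]) x)%:E : \bar R).
    apply: emeasurable_sum => i; apply: measurable_funeM; apply/measurable_EFinP.
    exact: measurable_indic.
  elim: #|` s| s0 => [_|k IH s0].
    under eq_fun do rewrite big_ord0.
    rewrite (_ : (fun _ => _) = (fun x => (\1_(set0 : set T) x)%:E)); first exact: Qindic.
    by apply/funext => x; rewrite indic0.
  under eq_fun do rewrite big_ord_recr/=.
  have m1 : measurable_fun [set: T] (fun x => (\1_(f_ n @^-1` [set s`_k]) x)%:E : \bar R).
    by apply/measurable_EFinP; exact: measurable_indic.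
  apply: Qadd; first exact: mg.
  - exact: measurable_funeM.
  - move=> x; apply: sume_ge0 => i _; rewrite -EFinM lee_fin mulr_ge0//.
    by apply: s0; rewrite (ltn_trans (ltn_ord i)).
  - by move=> x; rewrite -EFinM lee_fin mulr_ge0// s0.
  - by apply: IH => i ik; apply: s0; rewrite (ltn_trans ik).
  - apply: Qscale => //; [exact: s0|exact: Qindic].
by apply/funext => x; rewrite fimfunEord -sumEFin; apply: eq_bigr => i _; rewrite EFinM.
Qed.

End nonnegative_induction.

Section integral_mdensity.
Context d (T : measurableType d) (R : realType).
Variables (m : {measure set T -> \bar R}) (f : T -> \bar R).
Hypotheses (mf : measurable_fun [set: T] f) (f0 : forall x, 0 <= f x).

Lemma integral_mdensity (g : T -> \bar R) : measurable_fun [set: T] g ->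
  (forall x, 0 <= g x) ->
  \int[mdensity m mf f0]_x g x = \int[m]_x (g x * f x).
Proof.
move: g; apply: nonneg_measurable_ind => [A mA|g h mg mh g0 h0 IHg IHh|c g c0 mg g0 IHg|g mg g0 nd_g IHg].
- rewrite integral_indic// setIT /= /mdensity integral_mkcond; apply: eq_integral => x _.
  by rewrite patchE indicE; case: (x \in A); rewrite ?mul1e ?mul0e.
- rewrite ge0_integralD// IHg IHh -ge0_integralD//.
  + by apply: eq_integral => x _; rewrite ge0_muleDl.
  + by move=> x _; exact: mule_ge0.
  + exact: emeasurable_funM.
  + by move=> x _; exact: mule_ge0.
  + exact: emeasurable_funM.
- rewrite ge0_integralZl// IHg -ge0_integralZl//.
  + by apply: eq_integral => x _; rewrite muleA.
  + exact: emeasurable_funM.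
  + by move=> x _; exact: mule_ge0.
- rewrite monotone_convergence// (_ : (fun n => _) = (fun n => \int[m]_x (g n x * f x))); last first.
    by apply/funext => n; exact: IHg.
  rewrite -monotone_convergence//.
  + apply: eq_integral => x _; apply/cvg_lim => //.
    have cg : g n x @[n --> \oo] --> limn (g ^~ x) by exact: ereal_nondecreasing_is_cvgn.
    (* Where the density is infinite, multiplication by it is not continuous at 0. Either all
       [g n x] vanish and the products are 0, or they are eventually positive and the products are
       eventually [+oo]. *)
    have [fx|] := boolP (f x \is a fin_num); first exact: cvgeZr.
    rewrite ge0_fin_numE// -leNgt leye_eq => /eqP fx.
    have [gx|gx] := pselect (forall n, g n x = 0).
      rewrite (_ : (fun n => _) = (fun n => 0)); last by apply/funext => n; rewrite gx mul0e.
      rewrite (_ : limn (g ^~ x) = 0) ?mul0e; first exact: cvg_cst.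
      by rewrite (_ : g ^~ x = fun=> 0) ?lim_cst//; apply/funext => n; rewrite gx.
    have [n0 gn0] : exists n0, 0 < g n0 x.
      move/existsNP : gx => [n0 /eqP gx]; exists n0.
      by rewrite lt_neqAle eq_sym gx g0.
    have gn n : (n0 <= n)%N -> 0 < g n x by move=> nn0; apply: lt_le_trans gn0 (nd_g _ _ _ nn0).
    have gl : 0 < limn (g ^~ x).
      apply: lt_le_trans gn0 _; apply: lime_ge; first exact: ereal_nondecreasing_is_cvgn.
      by exists n0 => // n /= nn0; exact: nd_g.
    rewrite fx gt0_muley//; apply: cvg_near_cst.
    by exists n0 => // n /= nn0; rewrite gt0_muley// gn.
  + by move=> n; exact: emeasurable_funM.
  + by move=> n x _; exact: mule_ge0.
  + by move=> x _ a b ab; apply: lee_pmul => //; exact: nd_g.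
Qed.

End integral_mdensity.

Section prod_ereal.
Context (R : realType) (I : Type) (s : seq I) (p : pred I).

Lemma emeasurable_prod d (T : measurableType d) (f : I -> T -> \bar R) :
  (forall i, measurable_fun [set: T] (f i)) ->
  measurable_fun [set: T] (fun x => \prod_(i <- s | p i) f i x).
Proof.
move=> mf; elim: s => [|i r IH].
  by under eq_fun do rewrite big_nil; exact: measurable_cst.
have [pi|/negbTE pi] := boolP (p i); last by under eq_fun do rewrite big_cons pi.
by under eq_fun do rewrite big_cons pi; exact: emeasurable_funM.
Qed.

Lemma prode_ge0 (f : I -> \bar R) : (forall i, 0 <= f i) -> 0 <= \prod_(i <- s | p i) f i.
Proof. by move=> f0; elim/big_ind : _ => // a b; exact: mule_ge0. Qed.

End prod_ereal.

(** * Expectations of products over independent samples *)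

Section iid_product.
Context d d' (Omega : measurableType d) (T : measurableType d') (R : realType).
Variables (P : probability Omega R) (mu : probability T R) (x : nat -> {RV P >-> T}).
Hypothesis x_iid : iid x mu.

(** The image under [Z] of the measure with density [Y] is [c] times [mu]: the hypothesis says so on
    sets, and integrating [phi] against both measures gives the conclusion. *)
Lemma integral_prod_indep (Y : Omega -> \bar R) (Z : {RV P >-> T}) (c : R) :
  measurable_fun [set: Omega] Y -> (forall w, 0 <= Y w) ->
  (forall A, measurable A -> \int[P]_w (Y w * (\1_A (Z w))%:E) = c%:E * mu A) ->
  forall phi, measurable_fun [set: T] phi -> (forall y, 0 <= phi y) ->
  \int[P]_w (Y w * phi (Z w)) = c%:E * \int[mu]_y phi y.
Proof.
move=> mY Y0 YA phi mphi phi0.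
have c0 : (0 <= c)%R.
  rewrite -lee_fin -[c%:E]mule1 -(probability_setT mu) -YA//.
  by apply: integral_ge0 => w _; rewrite mule_ge0.
have mZ : measurable_fun [set: Omega] Z by [].
transitivity (\int[pushforward (mdensity P mY Y0) Z]_y phi y).
  rewrite ge0_integral_pushforward// preimage_setT integral_mdensity//.
  - by apply: eq_integral => w _; rewrite muleC.
  - exact: measurableT_comp.
  - by move=> w; exact: phi0.
pose cn := NngNum c0.
transitivity (\int[mscale cn mu]_y phi y); last by rewrite ge0_integral_mscale.
apply: eq_measure_integral => A mA _.
transitivity (\int[P]_(w in Z @^-1` A) Y w); first by [].
transitivity (c%:E * mu A); last by [].
rewrite integral_mkcond -YA//; apply: eq_integral => w _; rewrite patchE indicE.
rewrite (_ : (w \in _) = (Z w \in A)); last by apply/idP/idP => /set_mem ?; exact/mem_set.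
by case: (Z w \in A); rewrite ?mule1 ?mule0.
Qed.

(** Independence is given for events only. Indicators are exchanged for functions one index at a
    time: the induction on [n] keeps [m] further factors that are still indicators, so that the next
    factor can be tested on sets. *)
Lemma integral_prod_iid (phi : nat -> T -> \bar R) n :
  (forall i, measurable_fun [set: T] (phi i)) -> (forall i y, 0 <= phi i y) ->
  (forall i, \int[mu]_y phi i y < +oo) ->
  \int[P]_w \prod_(i < n) phi i (x i w) = \prod_(i < n) \int[mu]_y phi i y.
Proof.
have [x_mu x_ind] := x_iid.
move=> mphi phi0 phioo.
have mx (A : set T) i : measurable A -> measurable (x i @^-1` A).
  by move=> mA; rewrite -[_ @^-1` _]setTI; exact: measurable_funP.
have mphix i : measurable_fun [set: Omega] (fun w => phi i (x i w)).
  exact: measurableT_comp.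
have mind (A : set T) i : measurable A ->
    measurable_fun [set: Omega] (fun w => (\1_A (x i w))%:E : \bar R).
  by move=> mA; apply/measurable_EFinP; apply: measurableT_comp.
suff gen m (A : nat -> set T) : (forall i, measurable (A i)) ->
    \int[P]_w (\prod_(i < n) phi i (x i w) * \prod_(n <= i < n + m) (\1_(A i) (x i w))%:E) =
    \prod_(i < n) \int[mu]_y phi i y * \prod_(n <= i < n + m) mu (A i).
  have := gen 0%N (fun=> setT) (fun=> measurableT).
  rewrite addn0 big_geq// mule1 => <-; apply: eq_integral => w _.
  by rewrite big_geq// mule1.
elim: n m A => [m A mA|n IH m A mA].
  rewrite big_ord0 mul1e add0n.
  under eq_integral do rewrite big_ord0 mul1e.
  pose J : nat -> {fset nat} := nat_rect (fun=> {fset nat}) fset0%fset (fun k Jk => (k |` Jk)%fset).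
  have JE k i : (i \in J k) = (i < k)%N.
    elim: k => [|k IH]; first by rewrite in_fset0.
    rewrite (_ : J k.+1 = (k |` J k)%fset)// in_fset1U IH.
    by rewrite [RHS]ltnS [RHS]leq_eqVlt.
  have E w k : \prod_(0 <= i < k) (\1_(A i) (x i w))%:E =
      (\1_(\bigcap_(i in [set` J k]) (x i @^-1` A i)) w)%:E :> \bar R.
    elim: k => [|k IH]; first by rewrite big_geq//= set_fset0 bigcap_set0 indicT.
    rewrite big_nat_recr//= IH -EFinM; congr EFin; rewrite !indicE -natrM mulnb.
    congr (nat_of_bool _)%:R; apply/idP/idP.
      move=> /andP[/set_mem Ak /set_mem Akw]; apply/mem_set => i /=.
      by rewrite in_fset1U => /predU1P[->//|]; exact: Ak.
    move=> /set_mem Ak; apply/andP; split; apply/mem_set.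
      by move=> i /= ik; apply: Ak; rewrite /= in_fset1U; apply/orP; right.
    by apply: Ak; rewrite /= in_fset1U eqxx.
  under eq_integral do rewrite E.
  rewrite integral_indic// ?setIT; last first.
    by apply: fin_bigcap_measurable => // i _; exact: mx.
  transitivity (\prod_(i <- J m) P (x i @^-1` A i)); first exact: x_ind.
  elim: m => [|k IH]; first by rewrite big_geq// big_seq_fset0.
  rewrite big_nat_recr//= big_fsetU1/= ?JE ?ltnn// IH muleC; congr (_ * _).
  exact: x_mu.
pose Y w := \prod_(i < n) phi i (x i w) * \prod_(n.+1 <= i < n.+1 + m) (\1_(A i) (x i w))%:E.
pose c : \bar R := \prod_(i < n) \int[mu]_y phi i y * \prod_(n.+1 <= i < n.+1 + m) mu (A i).
have cfin : c \is a fin_num.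
  apply: fin_numM; elim/big_ind : _ => // [a b|i _]; try exact: fin_numM.
    by rewrite ge0_fin_numE// integral_ge0.
  exact: fin_num_measure.
have := @integral_prod_indep Y (x n) (fine c) _ _ _ (phi n) (mphi n) (phi0 n).
rewrite fineK// => H.
under eq_integral do rewrite big_ord_recr/= muleAC.
rewrite H; first by rewrite /c big_ord_recr/= muleAC.
- apply: emeasurable_funM.
    exact: (@emeasurable_prod _ _ _ _ _ _ (fun (i : 'I_n) w => phi i (x i w))).
  by apply: (@emeasurable_prod _ _ _ _ _ _ (fun i w => (\1_(A i) (x i w))%:E)) => i; exact: mind.
- move=> w; by rewrite mule_ge0//; apply: prode_ge0 => i.
(* Testing the factor of index [n] on [B] is the induction hypothesis with one more indicator, [B]
   at the index [n]. *)
- move=> B mB; pose A' i := if i == n then B else A i.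
  have mA' i : measurable (A' i) by rewrite /A'; case: ifP.
  have A'E (F : nat -> set T -> \bar R) :
      \prod_(n.+1 <= i < n.+1 + m) F i (A' i) = \prod_(n.+1 <= i < n.+1 + m) F i (A i).
    by apply: eq_big_nat => i /andP[ni _]; rewrite /A' gtn_eqF.
  have := IH m.+1 A' mA'; rewrite -addSnnS big_ltn ?ltnS ?leq_addr//.
  rewrite (A'E (fun _ A => mu A)) /A' eqxx muleCA muleC => <-.
  apply: eq_integral => w _; rewrite big_ltn ?ltnS ?leq_addr// eqxx.
  rewrite (A'E (fun i A => (\1_A (x i w))%:E)) /Y.
  by rewrite muleAC muleA.
Qed.

End iid_product.

(** * The empirical measure *)

Section empirical_integral.
Context (R : realType) (X : completeMetricType R).
Variables (tau : X -> \bar R).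

Lemma measurable_renewal_reward (x : nat -> X) :
  measurable_fun [set: R] (renewal_reward tau x).
Proof.
have mc := measurable_counting_process tau x.
rewrite (_ : renewal_reward tau x = (fun n => x n : borel X) \o counting_process tau x)//.
exact: measurableT_comp.
Qed.

Lemma empiricalE (x : nat -> X) (t : R) (A : set (borel X)) : measurable A ->
  empirical tau x t A = occupation tau x t A.
Proof. by move=> mA; exact: M1_ofE. Qed.

Lemma ge0_integral_empirical (x : nat -> X) (t : R) (f : borel X -> \bar R) : (0 < t)%R ->
  measurable_fun [set: borel X] f -> (forall y, 0 <= f y) ->
  \int[empirical tau x t]_y f y =
  (t^-1)%:E * \int[lebesgue_measure]_(s in `[0%R, t[) f (renewal_reward tau x s).
Proof.
move=> t0 mf f0; have t1 : (0 <= t^-1)%R by rewrite invr_ge0 ltW.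
have mZ := measurable_renewal_reward x.
have mI : measurable (`[0%R, t[%classic : set R) by exact: measurable_itv.
have mfZ (g : borel X -> \bar R) : measurable_fun [set: borel X] g ->
    measurable_fun (`[0%R, t[%classic : set R) (fun s => g (renewal_reward tau x s)).
  by move=> mg; apply: measurable_funTS; exact: measurableT_comp.
move: f mf f0; apply: nonneg_measurable_ind => [A mA|f g mf mg f0 g0 IHf IHg|c f c0 mf f0 IHf|f mf f0 nd_f IHf].
- transitivity (occupation tau x t A).
    by rewrite integral_indic// setIT; exact: empiricalE.
  by rewrite /occupation; congr (_ * _).
- rewrite ge0_integralD// IHf IHg ge0_integralD//; try exact: mfZ.
  by rewrite [RHS]ge0_muleDr//; apply: integral_ge0 => s _.
- rewrite ge0_integralZl// IHf muleCA ge0_integralZl//; exact: mfZ.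
- have cv := @cvg_monotone_convergence _ _ _ (empirical tau x t) _ measurableT f mf
    (fun n y _ => f0 n y) (fun y _ => nd_f y).
  apply: (cvg_unique (@ereal_hausdorff R) cv).
  rewrite (_ : (fun n => _) = (fun n => (t^-1)%:E *
      \int[lebesgue_measure]_(s in `[0%R, t[) f n (renewal_reward tau x s))); last first.
    by apply/funext => n; exact: IHf.
  apply: cvgeZl => //; apply: (@cvg_monotone_convergence _ _ _ lebesgue_measure _ mI
    (fun n s => f n (renewal_reward tau x s))) => //.
  + by move=> n; exact: mfZ.
Qed.

(** Adding [M] makes the integrand nonnegative. For [t > 0] the empirical measure has mass 1, so
    both sides shift by the same constant. *)
Lemma Rintegral_empirical (x : nat -> X) (t : R) (f : borel X -> R) (M : R) : (0 < t)%R ->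
  measurable_fun [set: borel X] f -> (forall y, `|f y| <= M)%R ->
  (\int[empirical tau x t]_(y in [set: borel X]) f y =
   t^-1 * \int[lebesgue_measure]_(s in `[0%R, t[) f (renewal_reward tau x s))%R.
Proof.
move=> t0 mf fM; have mI : measurable (`[0%R, t[%classic : set R) by exact: measurable_itv.
have lI : (lebesgue_measure (`[0%R, t[%classic : set R) = t%:E).
  by rewrite lebesgue_measure_itv/= lte_fin t0 oppr0 adde0.
have mfM : measurable_fun [set: borel X] (fun y => f y + M)%R by exact: measurable_funD.
have fM0 y : (0 <= f y + M)%R by have := fM y; rewrite ler_norml => /andP[]; lra.
have mZ : measurable_fun (`[0%R, t[%classic : set R) (fun s => f (renewal_reward tau x s)).
  by apply: measurable_funTS; apply: measurableT_comp => //; exact: measurable_renewal_reward.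
have iM : (empirical tau x t).-integrable [set: borel X] (fun=> M%:E).
  by apply: (@integrable_bounded _ _ _ _ _ `|M|%R).
have iI (g : R -> R) (b : R) : measurable_fun (`[0%R, t[%classic : set R) g -> (forall s, `|g s| <= b)%R ->
    lebesgue_measure.-integrable `[0%R, t[%classic (EFin \o g).
  move=> mg gb; apply: measurable_bounded_integrable => //; first by rewrite [X in X < _]lI ltry.
  by exists b; split; [exact: num_real|move=> z bz s _; exact: le_trans (gb s) (ltW bz)].
have iZ := iI _ M mZ (fun s => fM (renewal_reward tau x s)).
have /(congr1 fine) : \int[empirical tau x t]_y (f y + M)%:E =
    (t^-1)%:E * \int[lebesgue_measure]_(s in `[0%R, t[) (f (renewal_reward tau x s) + M)%:E.
  by apply: ge0_integral_empirical => //; exact/measurable_EFinP.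
have -> : fine (\int[empirical tau x t]_y (f y + M)%:E) =
    (\int[empirical tau x t]_(y in [set: borel X]) f y + M)%R.
  rewrite -[LHS]/(\int[empirical tau x t]_(y in [set: borel X]) (f y + M))%R.
  rewrite RintegralD//; last exact: (integrable_bounded _ mf fM).
  have e1 : empirical tau x t [set: borel X] = 1 by rewrite empiricalE// occupation_setT.
  by rewrite Rintegral_cst//= [X in fine X]e1 mulr1.
have -> : \int[lebesgue_measure]_(s in `[0%R, t[) (f (renewal_reward tau x s) + M)%:E =
    (\int[lebesgue_measure]_(s in `[0%R, t[) f (renewal_reward tau x s) + t * M)%R%:E.
  have iM' := iI (fun=> M) `|M|%R (measurable_cst _) (fun=> lexx _).
  rewrite -[LHS]fineK; last first.
    by apply: integrable_fin_num => //; apply: (integrableD _ iZ iM').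
  congr EFin.
  rewrite -[LHS]/(\int[lebesgue_measure]_(s in `[0%R, t[) (f (renewal_reward tau x s) + M))%R.
  by rewrite RintegralD// Rintegral_cst//= [lebesgue_measure _]lI/= mulrC.
rewrite -EFinM /= mulrDr mulrA mulVf ?gt_eqF// mul1r.
exact: addIr.
Qed.

Section renewal_intervals.
Variables (x : nat -> X) (th : nat -> R).
Hypotheses (tauE : forall i, tau (x i) = (th i)%:E) (th_gt0 : forall i, (0 < th i)%R).
Let S n := (\sum_(i < n) th i)%R.

Let S_S n : S n.+1 = (S n + th n)%R. Proof. by rewrite /S big_ord_recr. Qed.

Let S_ge0 n : (0 <= S n)%R. Proof. by apply: sumr_ge0 => i _; exact: ltW. Qed.

Let renewalE n : renewal tau x n = (S n)%:E.
Proof. by rewrite /renewal -sumEFin; apply: eq_bigr => i _. Qed.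

Lemma counting_processE n u : (S n < u <= S n.+1)%R -> counting_process tau x u = n.
Proof.
move=> /andP[Snu uSn]; have leS : {homo S : m n / (m <= n)%N >-> (m <= n)%R}.
  by apply: homo_leq => [//|a b c ab bc|m]; [exact: le_trans bc|rewrite S_S lerDl ltW].
rewrite /counting_process; case: pselect => [h|[]]; last by exists n; rewrite renewalE lee_fin.
case: ex_minnP => m; rewrite renewalE lee_fin => um minm.
apply/eqP; rewrite eqn_leq minm ?renewalE ?lee_fin//= leqNgt; apply/negP => mn.
by move: Snu; rewrite ltNge (le_trans um)// leS.
Qed.

Lemma integral_renewal_reward (f : borel X -> R) (M t : R) N :
  measurable_fun [set: borel X] f -> (forall y, `|f y| <= M)%R ->
  (S N <= t <= S N.+1)%R ->
  (\int[lebesgue_measure]_(s in `[0%R, t[) f (renewal_reward tau x s) =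
   \sum_(i < N) th i * f (x i) + (t - S N) * f (x N))%R.
Proof.
move=> mf fM.
have fin_itv (a b : R) : lebesgue_measure (`[a, b[%classic : set R) < +oo.
  by rewrite lebesgue_measure_itv/=; case: ifP => _; rewrite ?ltry.
have itvE (a b : R) : (a < b)%R -> lebesgue_measure (`]a, b[%classic : set R) = (b - a)%:E.
  by move=> ab; rewrite lebesgue_measure_itv/= lte_fin ab EFinD.
have iZ (a b : R) : lebesgue_measure.-integrable (`[a, b[%classic : set R)
    (EFin \o (fun s => f (renewal_reward tau x s))).
  apply: measurable_bounded_integrable => //.
  - exact: fin_itv.
  - by apply: measurable_funTS; apply: measurableT_comp => //; exact: measurable_renewal_reward.
  - by exists M; split; [exact: num_real|move=> z bz s _; exact: le_trans (fM _) (ltW bz)].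
have step n u : (S n <= u <= S n.+1)%R ->
    (\int[lebesgue_measure]_(s in `[0%R, u[) f (renewal_reward tau x s) =
     \int[lebesgue_measure]_(s in `[0%R, S n[) f (renewal_reward tau x s) + (u - S n) * f (x n))%R.
  move=> /andP[Snu uSn]; have [->|un] := eqVneq u (S n); first by rewrite subrr mul0r addr0.
  have {un}Snu' : (S n < u)%R by rewrite lt_neqAle eq_sym un.
  rewrite (@itv_bndbnd_setU _ _ (BLeft 0%R) (BLeft (S n)) (BLeft u)) ?bnd_simp//.
  rewrite Rintegral_setU//; last 2 first.
    - by rewrite -itv_bndbnd_setU ?bnd_simp.
    - by apply/disj_setPS => s [] /=; rewrite !in_itv/= => /andP[_ s1] /andP[]; rewrite leNgt s1.
  congr (_ + _)%R.
  (* The sample [x n] is in force on the interval open at [S n] and closed at [S n.+1]: at the time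
     [S n] itself the previous sample still is. The endpoint is exchanged at no cost for the
     Lebesgue measure. *)
  rewrite -Rintegral_itv_obnd_cbnd; last first.
    apply: integrableS (iZ (S n) u) => //.
    by move=> s /=; rewrite !in_itv/= => /andP[/ltW -> ->].
  rewrite (@eq_Rintegral _ _ _ _ _ (fun=> f (x n))).
    by rewrite Rintegral_cst//= [lebesgue_measure _]itvE//= mulrC.
  move=> s; rewrite inE/= in_itv/= => /andP[s1 s2].
  by rewrite /renewal_reward (@counting_processE n)// s1/= (le_trans (ltW s2)).
move=> StN; rewrite (step _ _ StN); congr (_ + _)%R.
elim: N {StN t} => [|n IH]; first by rewrite /S !big_ord0 set_itvco0 Rintegral_set0.
rewrite (step n) ?S_S ?lexx ?lerDl ?ltW// IH big_ord_recr/=; congr (_ + _)%R.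
by rewrite addrAC subrr add0r.
Qed.

Lemma Rintegral_empiricalE (f : borel X -> R) (M t : R) N : (0 < t)%R ->
  measurable_fun [set: borel X] f -> (forall y, `|f y| <= M)%R ->
  (S N <= t <= S N.+1)%R ->
  (t * \int[empirical tau x t]_(y in [set: borel X]) f y =
   \sum_(i < N) th i * f (x i) + (t - S N) * f (x N))%R.
Proof.
move=> t0 mf fM StN; rewrite (Rintegral_empirical x t0 mf fM).
by rewrite mulrA mulfV ?gt_eqF// mul1r (integral_renewal_reward mf fM StN).
Qed.

End renewal_intervals.

Section measurability.
Context d (Omega : measurableType d) (P : probability Omega R) (x : nat -> {RV P >-> borel X}).
Hypothesis mtau : measurable_fun [set: borel X] tau.
Let xw w : nat -> X := fun i => x i w.

Let mS n : measurable_fun [set: Omega] (fun w => renewal tau (xw w) n).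
Proof.
by apply: emeasurable_sum => i; exact: measurableT_comp.
Qed.

Let measurable_before n : measurable [set ws : Omega * R | ws.2%:E <= renewal tau (xw ws.1) n].
Proof.
rewrite -[X in measurable X]setTI; apply: measurable_lee => //.
- by apply/measurable_EFinP.
- by apply: (measurableT_comp (mS n)).
Qed.

Let measurable_counting_eq n :
  measurable [set ws : Omega * R | counting_process tau (xw ws.1) ws.2 = n].
Proof.
pose B m := [set ws : Omega * R | ws.2%:E <= renewal tau (xw ws.1) m.+1].
have mB m : measurable (B m) by exact: measurable_before.
have mBC m : measurable (~` B m) by exact: measurableC.
rewrite (_ : [set _ | _] = (B n `&` \bigcap_(m in [set m | (m < n)%N]) ~` B m)
    `|` (\bigcap_m ~` B m `&` [set s | n = 0%N])).
  apply: measurableU; apply: measurableI => //.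
  - by apply: bigcap_measurableType => m _.
  - by apply: bigcap_measurableType => m _.
  - have [n0|n0] := pselect (n = 0%N).
      by rewrite (_ : [set s | _] = setT)//; apply/seteqP; split.
    by rewrite (_ : [set s | _] = set0)//; apply/seteqP; split.
apply/seteqP; split => -[w s] /=; rewrite /counting_process.
  case: pselect => [h|h]; last first.
    by move=> <-; right; split => // m _ /= sm; apply: h; exists m.
  case: ex_minnP => k sk kmin <-; left; split => // m /= mk sm.
  by move: (kmin _ sm); rewrite leqNgt mk.
case: pselect => [h|h].
  case: ex_minnP => k sk kmin [[sn nmin]|[sN _]]; last first.
    by have := sN k Logic.I.
  apply/eqP; rewrite eqn_leq kmin//= leqNgt; apply/negP => kn.
  exact: (nmin _ kn).
by move=> [[sn _]|[_ ->]] //; exfalso; apply: h; exists n.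
Qed.

(** Measurability jointly in the sample and in time is what makes the time average measurable in the
    sample, by Tonelli. *)
Let measurable_joint : measurable_fun [set: Omega * R]
  (fun ws => renewal_reward tau (xw ws.1) ws.2 : borel X).
Proof.
move=> _ B mB; rewrite setTI.
rewrite (_ : _ @^-1` B = \bigcup_n ([set ws | counting_process tau (xw ws.1) ws.2 = n] `&`
    ((x n) @^-1` B) `*` setT)); last first.
  apply/seteqP; split => [[w s] /= Bws|[w s] [n _] /= [<- [Bx _]]]; last by [].
  by exists (counting_process tau (xw w) s).
apply: bigcup_measurable => n _; apply: measurableI => //.
apply: measurableX => //; rewrite -[_ @^-1` _]setTI; exact: measurable_funP.
Qed.

Lemma measurable_Rintegral_empirical (t : R) (f : borel X -> R) (M : R) : (0 < t)%R ->
  measurable_fun [set: borel X] f -> (forall y, `|f y| <= M)%R ->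
  measurable_fun [set: Omega]
    (fun w => (\int[empirical tau (xw w) t]_(y in [set: borel X]) f y)%R).
Proof.
move=> t0 mf fM; have mI : measurable (`[0%R, t[%classic : set R) by exact: measurable_itv.
pose g (ws : Omega * R) : \bar R :=
  ((f (renewal_reward tau (xw ws.1) ws.2) + M) * \1_(`[0%R, t[%classic) ws.2)%:E.
have fM0 y : (0 <= f y + M)%R by have := fM y; rewrite ler_norml => /andP[]; lra.
have mg : measurable_fun [set: Omega * R] g.
  apply/measurable_EFinP; apply: measurable_funM.
    by apply: measurable_funD => //; exact: measurableT_comp.
  by apply: measurableT_comp.
have g0 ws : 0 <= g ws by rewrite lee_fin mulr_ge0.
have mF : measurable_fun [set: Omega] (fun w => \int[lebesgue_measure]_s g (w, s)).
  exact: (measurable_fun_fubini_tonelli_F (m2 := @lebesgue_measure R) g mg g0).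
rewrite (_ : (fun w => _) = (fun w => t^-1 * fine (\int[lebesgue_measure]_s g (w, s)) - M)%R).
  by apply: measurable_funB => //; apply: measurable_funM => //; exact: measurableT_comp.
apply/funext => w.
have M1 : (\int[empirical tau (xw w) t]_(y in [set: borel X]) (f y + M) =
    \int[empirical tau (xw w) t]_(y in [set: borel X]) f y + M)%R.
  rewrite RintegralD//; last by apply: (@integrable_bounded _ _ _ _ _ `|M|%R).
    have e1 : empirical tau (xw w) t [set: borel X] = 1 by rewrite empiricalE// occupation_setT.
    by rewrite Rintegral_cst//= [X in fine X]e1 mulr1.
  exact: (integrable_bounded _ mf fM).
apply: (@addIr _ M); rewrite subrK -M1.
rewrite (@Rintegral_empirical _ _ _ (M + `|M|)%R)//; last 2 first.
- exact: measurable_funD.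
- by move=> y; rewrite (le_trans (ler_normD _ _))// lerD2r.
congr (_ * _)%R; rewrite /Rintegral integral_mkcond; congr fine; apply: eq_integral => s _.
by rewrite patchE /g/= indicE; case: (s \in _); rewrite ?mulr1 ?mulr0.
Qed.

End measurability.

End empirical_integral.

(** * The renewal process and the upper bound *)

Section renewal_process.
Context (R : realType) (X : completeMetricType R).
Variables (mu : probability (borel X) R) (tau : borel X -> \bar R).
Hypotheses (mtau : measurable_fun [set: borel X] tau)
  (tau_ge0 : forall x, 0 <= tau x)
  (tau_neq0 : mu [set x | tau x = 0] = 0)
  (tau_finite : mu [set x | tau x = +oo] = 0).
Context d (Omega : measurableType d) (P : probability Omega R) (x : nat -> {RV P >-> borel X}).
Hypothesis x_iid : iid x mu.

Let th (y : borel X) : R := fine (tau y).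
Let xw w : nat -> X := fun i => x i w.

Lemma measurable_fine_tau : measurable_fun [set: borel X] th.
Proof. by apply: measurableT_comp => //; exact: measurable_fine. Qed.
Let mth := measurable_fine_tau.

Let th_ge0 y : (0 <= th y)%R. Proof. exact: fine_ge0. Qed.

Let mtau0 : measurable [set y | tau y = 0].
Proof. by have := mtau measurableT (emeasurable_set1 (0 : \bar R)); rewrite setTI. Qed.

Let mtauy : measurable [set y | tau y = +oo].
Proof. by have := mtau measurableT (emeasurable_set1 (+oo : \bar R)); rewrite setTI. Qed.

Lemma integral_prod_real (phi : nat -> borel X -> R) n :
  (forall i, measurable_fun [set: borel X] (phi i)) -> (forall i y, (0 <= phi i y)%R) ->
  (forall i, \int[mu]_y (phi i y)%:E < +oo) ->
  \int[P]_w (\prod_(i < n) phi i (x i w))%:E = (\prod_(i < n) fine (\int[mu]_y (phi i y)%:E))%:E.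
Proof.
move=> mphi phi0 phioo.
have prodE (F : nat -> R) : (\prod_(i < n) F i)%:E = \prod_(i < n) (F i)%:E :> \bar R.
  elim: n => [|k IH]; first by rewrite !big_ord0.
  by rewrite !big_ord_recr/= EFinM IH.
under eq_integral do rewrite (prodE (fun i => phi i (x i _))).
rewrite (@integral_prod_iid _ _ _ _ _ P mu x x_iid (fun i y => (phi i y)%:E))//.
- rewrite (prodE (fun i => fine (\int[mu]_y (phi i y)%:E))); apply: eq_bigr => i _.
  by rewrite fineK// ge0_fin_numE ?integral_ge0// => y _; rewrite lee_fin.
- by move=> i; apply/measurable_EFinP.
Qed.

(** The event of probability 1 on which every [t > 0] falls in a renewal interval of positive finite
    length, so that the explicit formula for the empirical measure holds and no default value of
    [counting_process] intervenes. *)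
Definition good_sample (w : Omega) :=
  (forall i, 0 < tau (x i w) < +oo) /\ (forall n : nat, exists m, n%:R%:E <= renewal tau (xw w) m).

Let mrenewal n : measurable_fun [set: Omega] (fun w => renewal tau (xw w) n).
Proof. by apply: emeasurable_sum => i; exact: measurableT_comp. Qed.

Let bad_at i := x i @^-1` [set y | tau y = 0] `|` x i @^-1` [set y | tau y = +oo].
Let bounded_by (n : nat) := [set w | (forall i, 0 < tau (x i w) < +oo) /\
  forall m, ~ n%:R%:E <= renewal tau (xw w) m].

Let mx (A : set (borel X)) i : measurable A -> measurable (x i @^-1` A).
Proof. by move=> mA; rewrite -[_ @^-1` _]setTI; exact: measurable_funP. Qed.

Let mbad i : measurable (bad_at i).
Proof. by apply: measurableU; exact: mx. Qed.

Let tau_cond y : ~ (0 < tau y < +oo) -> tau y = 0 \/ tau y = +oo.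
Proof.
have := tau_ge0 y; rewrite le_eqVlt => /orP[/eqP <-|->]; first by left.
by rewrite /= ltey => /negP; rewrite negbK => /eqP; right.
Qed.

Let mbounded n : measurable (bounded_by n).
Proof.
rewrite (_ : bounded_by n = (\bigcap_i ~` bad_at i) `&`
    \bigcap_m ~` [set w | n%:R%:E <= renewal tau (xw w) m]).
  apply: measurableI; first by apply: bigcapT_measurable => i; exact: measurableC.
  apply: bigcapT_measurable => m; apply: measurableC; rewrite -[X in measurable X]setTI.
  by apply: measurable_lee => //; exact: mrenewal.
apply/seteqP; split => w /= [w1 w2]; split.
- move=> i _ [/= t0|/= ty]; have := w1 i; first by rewrite t0 ltxx.
  by rewrite ty ltxx andbF.
- by move=> m _; exact: w2.
- move=> i; apply: contrapT => /tau_cond[t0|ty]; apply: (w1 i Logic.I); first by left.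
  by right.
- by move=> m; exact: (w2 m Logic.I).
Qed.

Let Pbad i : P (bad_at i) = 0.
Proof.
have [x_mu _] := x_iid; apply/eqP; rewrite eq_le measure_ge0 andbT.
apply: le_trans (measureU2 _ _ _) _; [exact: mx|exact: mx|].
rewrite -[X in X + _]/(distribution P (x i) [set y | tau y = 0]).
rewrite -[X in _ + X]/(distribution P (x i) [set y | tau y = +oo]).
by rewrite !x_mu// tau_neq0 tau_finite adde0.
Qed.

(** Equality would force [e^(-c tau) = 1], hence [tau = 0], almost everywhere. *)
Lemma laplace_lt1 (c : R) : (0 < c)%R -> \int[mu]_y (expR (- (c * th y)))%:E < 1.
Proof.
move=> c0.
have mphi : measurable_fun [set: borel X] (fun y => expR (- (c * th y))).
  by do 2 apply: measurableT_comp => //; exact: measurable_funM.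
have phi1 y : (expR (- (c * th y)) <= 1)%R by rewrite -expR0 ler_expR oppr_le0 mulr_ge0// ltW.
have le1 : \int[mu]_y (expR (- (c * th y)))%:E <= 1.
  rewrite -(probability_setT mu) -[leRHS]mul1e -integral_cst//.
  apply: ge0_le_integral.
  - by [].
  - by move=> y _; rewrite lee_fin expR_ge0.
  - exact/measurable_EFinP.
  - exact: measurable_cst.
  - by move=> y _; rewrite lee_fin.
rewrite lt_neqAle le1 andbT; apply/eqP => eq1.
have i1 : mu.-integrable [set: borel X] (EFin \o (fun y => expR (- (c * th y)))).
  by apply: (integrable_bounded mu mphi (M := 1%R)) => y; rewrite ger0_norm ?expR_ge0.
have : \int[mu]_y `|(1 - expR (- (c * th y)))%:E| = 0.
  under eq_integral do rewrite gee0_abs ?lee_fin ?subr_ge0//.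
  under eq_integral do rewrite EFinB.
  rewrite integralB//; last by apply: (integrable_bounded mu (M := 1%R)) => // y; rewrite normr1.
  by rewrite integral_cst//= mul1e [X in X - _]probability_setT [X in _ - X]eq1 subee.
move/ae_eq_integral_abs => [//||N [mN muN NE]].
  by apply/measurable_EFinP; exact: measurable_funB.
have : mu [set: borel X] <= 0.
  apply: (@le_trans _ _ (mu (([set y | tau y = 0] `|` [set y | tau y = +oo]) `|` N))).
    apply: le_measure; rewrite ?inE//; first by apply: measurableU => //; exact: measurableU.
    move=> y _; have [/andP[t0 ty]|tau0] := pselect (0 < tau y < +oo); last first.
      by left; exact: tau_cond.
    right; apply: NE => /= /(_ Logic.I)/eqP.
    rewrite eqe subr_eq0 eq_sym => /eqP/(congr1 (@ln R)); rewrite expRK ln1 => /eqP.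
    by rewrite oppr_eq0 gt_eqF// mulr_gt0// fine_gt0// t0.
  apply: le_trans (measureU2 _ _ _) _ => //; first exact: measurableU.
  rewrite [X in _ + X]muN adde0; apply: le_trans (measureU2 _ _ _) _ => //.
  by rewrite [X in X + _]tau_neq0 [X in _ + X]tau_finite adde0.
by rewrite probability_setT leNgt lte01.
Qed.

Let laplace1 : \int[mu]_y (expR (- th y))%:E < 1.
Proof. by have := laplace_lt1 ltr01; under eq_integral do rewrite mul1r. Qed.

(** Where all partial sums stay below [n], the variable [e^(-S_m)] is at least [e^(-n)], whereas its
    expectation is the [m]-th power of a number less than 1. Letting [m] grow gives probability
    0. *)
Let Pbounded n : P (bounded_by n) = 0.
Proof.
have mphi : measurable_fun [set: borel X] (fun y => expR (- th y)).
  by apply: measurableT_comp => //; exact: measurableT_comp.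
set l := fine (\int[mu]_y (expR (- th y))%:E).
have l0 : (0 <= l)%R by rewrite fine_ge0// integral_ge0// => y _; rewrite lee_fin expR_ge0.
have lE : \int[mu]_y (expR (- th y))%:E = l%:E.
  rewrite fineK// ge0_fin_numE ?(lt_trans laplace1) ?ltry//.
  by apply: integral_ge0 => y _; rewrite lee_fin expR_ge0.
have l1 : (l < 1)%R by rewrite -lte_fin -lE laplace1.
have bound m : (expR (- n%:R))%:E * P (bounded_by n) <= (l ^+ m)%:E.
  have := @integral_prod_real (fun=> fun y => expR (- th y)) m (fun=> mphi) (fun _ _ => expR_ge0 _) _.
  rewrite lE => /(_ (fun=> ltry _)); rewrite big_const_ord iter_mulr_1/= => <-.
  rewrite -[X in _ * P X]setIT -integral_indic// -ge0_integralZl//; last first.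
    exact/measurable_EFinP/measurable_indic.
  apply: ge0_le_integral.
  - by [].
  - by move=> w _; rewrite mule_ge0 ?lee_fin ?expR_ge0.
  - by apply: measurable_funeM; exact/measurable_EFinP/measurable_indic.
  - apply/measurable_EFinP.
    apply: (measurable_prod (h := fun (i : 'I_m) w => expR (- th (x i w)))) => i _.
    exact: (measurableT_comp mphi).
  - move=> w _; rewrite -EFinM lee_fin -expR_sum sumrN indicE.
    have [/set_mem [wt wm]|_] := boolP (w \in bounded_by n); last by rewrite mulr0 expR_ge0.
    rewrite mulr1 ler_expR lerN2 leNgt; apply/negP => /ltW nS; apply: (wm m).
    rewrite /renewal (_ : \sum_(i < m) _ = (\sum_(i < m) th (x i w))%:E) ?lee_fin//.
    rewrite -sumEFin; apply: eq_bigr => i _; rewrite fineK//.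
    by have /andP[t0 ty] := wt i; rewrite ge0_fin_numE.
have cv : (l ^+ m)%:E @[m --> \oo] --> 0.
  by apply/cvg_EFin; [exact: nearW|apply: cvg_expr; rewrite ger0_norm].
have /eqP : (expR (- n%:R))%:E * P (bounded_by n) = 0.
  apply/eqP; rewrite eq_le; apply/andP; split.
    by rewrite -(cvg_lim _ cv)//; apply: lime_ge; [apply/cvg_ex; eexists; exact: cv|exact: nearW].
  by rewrite mule_ge0// lee_fin expR_ge0.
by rewrite mule_eq0 eqe gt_eqF ?expR_gt0//= => /eqP.
Qed.

Lemma measurable_good_sample : measurable good_sample.
Proof.
rewrite (_ : good_sample = ~` (\bigcup_i bad_at i `|` \bigcup_n bounded_by n)).
  by apply: measurableC; apply: measurableU; apply: bigcup_measurable.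
apply/seteqP; split => w /=.
  move=> [wt wm] [[i _]|[n _ [_ nm]]]; last by have [m /nm] := wm n.
  by move=> [] /= ti; have := wt i; rewrite ti ltxx ?andbF.
move/not_orP => [wb wn].
have wt i : 0 < tau (x i w) < +oo.
  by apply: contrapT => /tau_cond[t0|ty]; apply: wb; exists i => //; [left|right].
split => // n; apply: contrapT => /forallNP nm; apply: wn; exists n => //.
Qed.

Lemma good_sample_ae (A : set Omega) : measurable A -> P A = P (A `&` good_sample).
Proof.
move=> mA; have mG := measurable_good_sample.
apply/eqP; rewrite eq_le; apply/andP; split; last first.
  by apply: le_measure; rewrite ?inE//; exact: measurableI.
have PGC : P (~` good_sample) = 0.
  apply/eqP; rewrite eq_le measure_ge0 andbT.
  apply: (@le_trans _ _ (P (\bigcup_i bad_at i `|` \bigcup_n bounded_by n))).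
    apply: le_measure; rewrite ?inE//; first exact: measurableC.
      by apply: measurableU; apply: bigcup_measurable.
    move=> w Gw; apply: contrapT => /not_orP[wb wn]; apply: Gw.
    have wt i : 0 < tau (x i w) < +oo.
      by apply: contrapT => /tau_cond[t0|ty]; apply: wb; exists i => //; [left|right].
    split => // n; apply: contrapT => /forallNP nm; apply: wn; exists n => //.
  apply: le_trans (measureU2 _ _ _) _; [exact: bigcup_measurable|exact: bigcup_measurable|].
  have P0 (F : nat -> set Omega) : (forall n, measurable (F n)) -> (forall n, P (F n) = 0) ->
      P (\bigcup_n F n) = 0.
    move=> mF F0; apply/eqP; rewrite eq_le measure_ge0 andbT.
    apply: le_trans (measure_sigma_subadditive _ mF _ (@subset_refl _ _)) _.
      exact: bigcup_measurable.
    by rewrite eseries0// => n _ _; exact: F0.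
  by rewrite [X in X + _](P0 bad_at)// [X in _ + X](P0 bounded_by)// adde0.
apply: (@le_trans _ _ (P ((A `&` good_sample) `|` ~` good_sample))).
  apply: le_measure; rewrite ?inE//.
    by apply: measurableU; [exact: measurableI|exact: measurableC].
  by move=> w Aw; have [Gw|Gw] := pselect (good_sample w); [left|right].
apply: le_trans (measureU2 _ _ _) _; [exact: measurableI|exact: measurableC|].
by rewrite [X in _ + X]PGC adde0.
Qed.

Lemma good_sample_tauE w i : good_sample w -> tau (x i w) = (th (x i w))%:E.
Proof. by move=> [/(_ i)/andP[t0 ty] _]; rewrite fineK// ge0_fin_numE. Qed.

Lemma good_sample_gt0 w i : good_sample w -> (0 < th (x i w))%R.
Proof. by move=> [wt _]; rewrite fine_gt0. Qed.

Lemma good_sample_renewal w (t : R) : good_sample w -> (0 < t)%R ->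
  exists N, (\sum_(i < N) th (x i w) < t <= \sum_(i < N.+1) th (x i w))%R.
Proof.
move=> Gw t0.
have ex : exists n, (t <= \sum_(i < n) th (x i w))%R.
  have [m tm] := Gw.2 (Num.truncn t).+1; exists m.
  apply: le_trans (ltW (truncnS_gt t)) _.
  rewrite -lee_fin (le_trans tm)// /renewal -sumEFin; apply: lee_sum => i _.
  by rewrite good_sample_tauE.
case: (ex_minnP ex) => -[|N] tN minN; first by rewrite big_ord0 leNgt t0 in tN.
exists N; rewrite tN andbT ltNge; apply/negP => /minN.
by rewrite ltnn.
Qed.

(** The real-valued [th] replaces [tau]; they differ only on a null set. *)
Definition exp_functional (f : borel X -> R) : \bar R := \int[mu]_y (expR (th y * f y))%:E.

Lemma measurable_exp_integrand (f : borel X -> R) : measurable_fun [set: borel X] f ->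
  measurable_fun [set: borel X] (fun y => expR (th y * f y)).
Proof. by move=> mf; apply: measurableT_comp => //; exact: measurable_funM. Qed.

(* The last, incomplete, renewal interval has length at most [tau] of its sample, so that
   [t * pi_t f] is at most [sum_(i < N) tau f (x_i) + tau f^+ (x_N)] on [S_N < t <= S_(N+1)];
   the sum over all [N] of the expectations of the exponentials is geometric. *)
Lemma exponential_chebyshev (f : borel X -> R) (M : R) : measurable_fun [set: borel X] f ->
  (forall y, `|f y| <= M)%R -> exp_functional f < 1 ->
  exists2 C : R, (0 < C)%R & forall (t b : R) (A : set Omega), (0 < t)%R -> measurable A ->
    (forall w, A w -> b <= \int[empirical tau (xw w) t]_(y in [set: borel X]) f y)%R ->
    P A <= (C * expR (- (t * b)))%:E.
Proof.
move=> mf fM ef1.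
pose fp y := Num.max (f y) 0%R.
have le_fp y : (f y <= fp y)%R by rewrite /fp le_max lexx.
have fp_ge0 y : (0 <= fp y)%R by rewrite /fp le_max lexx orbT.
have mfp : measurable_fun [set: borel X] fp by exact: measurable_maxr.
(* The product over [i <= n] bounds the exponential when the interval of index [n] contains [t]:
   complete intervals contribute [f], the incomplete one its positive part. *)
pose phi (n i : nat) y := expR (th y * (if (i < n)%N then f y else fp y)).
have mphi n i : measurable_fun [set: borel X] (phi n i).
  by rewrite /phi; case: (i < n)%N; exact: measurable_exp_integrand.
have phi_ge0 n i y : (0 <= phi n i y)%R by exact: expR_ge0.
have ef0 : 0 <= exp_functional f by apply: integral_ge0 => y _; rewrite lee_fin expR_ge0.
(* Pointwise, [e^(tau f^+)] is at most [1 + e^(tau f)], and the second term has integral less than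
   1. *)
have efpoo : exp_functional fp <= 2%:E.
  apply: (@le_trans _ _ (\int[mu]_y (1 + (expR (th y * f y))%:E))).
    apply: ge0_le_integral.
    - by [].
    - by move=> y _; rewrite lee_fin expR_ge0.
    - by apply/measurable_EFinP; exact: measurable_exp_integrand.
    - by apply: emeasurable_funD => //; apply/measurable_EFinP; exact: measurable_exp_integrand.
    - move=> y _; rewrite -EFinD lee_fin /fp; have [_|f0] := leP 0%R (f y).
        by rewrite lerDr ler01.
      by rewrite mulr0 expR0 lerDl expR_ge0.
  rewrite ge0_integralD//; last by apply/measurable_EFinP; exact: measurable_exp_integrand.
  rewrite integral_cst//= mul1e [X in X + _]probability_setT (_ : 2%:E = 1 + 1); last by rewrite -EFinD.
  by rewrite leeD2l// ltW.
have efp0 : 0 <= exp_functional fp by apply: integral_ge0 => y _; rewrite lee_fin expR_ge0.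
set r := fine (exp_functional f).
set rp := fine (exp_functional fp).
have rE : exp_functional f = r%:E by rewrite fineK// ge0_fin_numE// (lt_trans ef1)// ltry.
have rpE : exp_functional fp = rp%:E by rewrite fineK// ge0_fin_numE// (le_lt_trans efpoo)// ltry.
have r0 : (0 <= r)%R by rewrite -lee_fin -rE.
have rp0 : (0 <= rp)%R by rewrite -lee_fin -rpE.
have r1 : (r < 1)%R by rewrite -lte_fin -rE.
pose Y n w := (\prod_(i < n.+1) phi n i (x i w))%R.
have mY n : measurable_fun [set: Omega] (fun w => (Y n w)%:E : \bar R).
  apply/measurable_EFinP; apply: (measurable_prod (h := fun (i : 'I_n.+1) w => phi n i (x i w))) => i _.
  exact: measurableT_comp.
have Y0 n w : 0 <= (Y n w)%:E by rewrite lee_fin prodr_ge0.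
have phiE n i : \int[mu]_y (phi n i y)%:E = (if (i < n)%N then r else rp)%:E.
  by rewrite /phi; case: (i < n)%N; [rewrite -rE|rewrite -rpE].
have EY n : \int[P]_w (Y n w)%:E = (rp * r ^+ n)%:E.
  rewrite (integral_prod_real _ (phi := phi n)) => //; last by move=> i; rewrite phiE ltry.
  rewrite big_ord_recr/= phiE ltnn/= mulrC; congr (_ * _)%:E.
  under eq_bigr => i _ do rewrite phiE ltn_ord/=.
  by rewrite big_const_ord iter_mulr_1.
(* The sum of the geometric series of terms [rp * r ^+ n]; the added 1 makes the constant
   positive. *)
exists (rp / (1 - r) + 1)%R.
  by rewrite ltr_pwDr// divr_ge0// subr_ge0 ltW.
move=> t b A t0 mA Ab.
rewrite (good_sample_ae mA); have mAG := measurableI _ _ mA measurable_good_sample.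
have key w : (A `&` good_sample) w -> (expR (t * b))%:E <= \sum_(n <oo) (Y n w)%:E.
  move=> [Aw Gw]; have [N SN] := good_sample_renewal Gw t0.
  apply: (@le_trans _ _ (Y N w)%:E); last first.
    apply: le_trans (nneseries_lim_ge N.+1 _); last by move=> n _ _; exact: Y0.
    by rewrite big_nat_recr//= leeDr// sume_ge0.
  have tb : (t * b <= t * \int[empirical tau (xw w) t]_(y in [set: borel X]) f y)%R.
    by rewrite ler_pM2l// Ab.
  rewrite lee_fin; apply: (@le_trans _ _ (expR (\sum_(i < N) th (x i w) * f (x i w) +
      th (x N w) * fp (x N w)))); last first.
    rewrite /Y big_ord_recr/= {2}/phi ltnn expRD expR_sum.
    by under [in leRHS]eq_bigr => i _ do rewrite /phi ltn_ord.
  rewrite ler_expR; apply: (le_trans tb).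
  have /andP[SN1 SN2] := SN.
  rewrite (Rintegral_empiricalE (fun i => good_sample_tauE i Gw)
    (fun i => good_sample_gt0 i Gw) t0 mf fM (N := N)); last by rewrite ltW.
  rewrite lerD2l; apply: (@le_trans _ _ ((t - \sum_(i < N) th (x i w)) * fp (x N w)))%R.
    by apply: ler_wpM2l => //; rewrite subr_ge0 ltW.
  rewrite ler_wpM2r//.
  by move: SN2; rewrite lerBlDl big_ord_recr.
have : (expR (t * b))%:E * P (A `&` good_sample) <= (rp / (1 - r))%:E.
  apply: (@le_trans _ _ (\int[P]_w \sum_(n <oo) (Y n w)%:E)).
    rewrite -[X in _ * P X]setIT -integral_indic// -ge0_integralZl//; last first.
      exact/measurable_EFinP/measurable_indic.
    apply: ge0_le_integral.
    - by [].
    - by move=> w _; rewrite -EFinM lee_fin mulr_ge0// expR_ge0.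
    - by apply: measurable_funeM; exact/measurable_EFinP/measurable_indic.
    - by apply: ge0_emeasurable_sum => // n w _ _; exact: Y0.
    - move=> w _; rewrite indicE; have [/set_mem/key Aw|_] := boolP (w \in _).
        by rewrite mule1.
      by rewrite mule0; apply: nneseries_ge0 => n _ _; exact: Y0.
  rewrite integral_nneseries//.
  under eq_eseriesr do rewrite EY.
  apply: lime_le; first by apply: is_cvg_nneseries => n _ _; rewrite lee_fin mulr_ge0// exprn_ge0.
  apply: nearW => k; rewrite sumEFin lee_fin.
  have := geometric_seriesE rp (negbT (lt_eqF r1)); rewrite /series/= => /(congr1 (@^~ k)) /= ->.
  rewrite ler_pM2r ?invr_gt0 ?subr_gt0//.
  by rewrite ler_piMr// lerBlDr lerDl exprn_ge0.
rewrite -lee_pdivlMl ?expR_gt0// => /le_trans; apply.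
rewrite -EFinM lee_fin -expRN mulrC ler_pM2r ?expR_gt0//.
by rewrite lerDl.
Qed.

End renewal_process.

(** * Exponential bound on closed sets *)

Section upper_bound.
Context (R : realType) (X : completeMetricType R).
Hypotheses (X_second_countable : @second_countable X)
  (X_locally_compact : locally_compact [set: X]).
Variables (mu : probability (borel X) R) (tau : borel X -> \bar R).
Hypotheses (mtau : measurable_fun [set: borel X] tau)
  (tau_ge0 : forall x, 0 <= tau x)
  (tau_neq0 : mu [set x | tau x = 0] = 0)
  (tau_finite : mu [set x | tau x = +oo] = 0).
Context d (Omega : measurableType d) (P : probability Omega R) (x : nat -> {RV P >-> borel X}).
Hypothesis x_iid : iid x mu.
Local Notation "nu `[ f ]" := ((\int[nu]_(x in [set: borel X]) f x)%R)
  (at level 10, format "nu `[ f ]").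

Definition dual_rate (nu : M1 X) : \bar R :=
  ereal_sup [set (cg.1 + nu`[sval cg.2])%:E | cg in
    [set cg : R * Cc X | exp_functional mu tau (fun y => cg.1 + sval cg.2 y)%R < 1]].

Definition empirical_rv (t : R) (w : Omega) : M1 X := empirical tau (fun i => x i w) t.

Lemma measurable_empirical_rv (t : R) : (0 < t)%R ->
  measurable_fun [set: Omega] (empirical_rv t : Omega -> borel (M1 X)).
Proof.
move=> t0; apply: measurable_M1 => // f; have [M _ fM] := Cc_bounded f.
apply: (measurable_Rintegral_empirical _ mtau t0 _ fM).
exact: measurable_Cc.
Qed.

Lemma measurable_preimage_empirical (t : R) (A : set (borel (M1 X))) : (0 < t)%R ->
  measurable A -> measurable (empirical_rv t @^-1` A).
Proof. by move=> t0 mA; rewrite -[_ @^-1` _]setTI; exact: measurable_empirical_rv. Qed.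

Lemma measurable_open_M1 (O : set (M1 X)) : open O -> measurable (O : set (borel (M1 X))).
Proof. exact: sub_sigma_algebra. Qed.

Lemma measurable_closed_M1 (C : set (M1 X)) : closed C -> measurable (C : set (borel (M1 X))).
Proof.
by move=> cC; rewrite -(setCK C); apply: measurableC; apply: measurable_open_M1; exact: closed_openC.
Qed.

Lemma measure_bigsetU_le d' (T : measurableType d') (m : {measure set T -> \bar R})
    (I : Type) (s : seq I) (F : I -> set T) : (forall i, measurable (F i)) ->
  m (\big[setU/set0]_(i <- s) F i) <= \sum_(i <- s) m (F i).
Proof.
move=> mF; elim: s => [|i s IH]; first by rewrite !big_nil measure0.
rewrite !big_cons; apply: le_trans (measureU2 _ _ _) _ => //.
  by apply: bigsetU_measurable.
exact: leeD2l.
Qed.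

(** Every point of [C] lies in an open half-space where an admissible affine test exceeds [M]; by
    compactness finitely many of them cover [C], and the exponential Chebyshev bounds add up. The
    bound holds for every [t > 0] with one constant, and not only in the limit, so that it can be
    confronted with the lower bound at a chosen time. *)
Lemma upper_bound_closed (C : set (M1 X)) (M : R) : closed C ->
  (forall nu, C nu -> M%:E < dual_rate nu) ->
  exists2 K : R, (0 < K)%R & forall t, (0 < t)%R ->
    P (empirical_rv t @^-1` C) <= (K * expR (- (t * M)))%:E.
Proof.
move=> clC CM.
have ex (nu : M1 X) : exists cg : R * Cc X, C nu ->
    exp_functional mu tau (fun y => cg.1 + sval cg.2 y)%R < 1 /\ (M < cg.1 + nu`[sval cg.2])%R.
  have [Cnu|] := pselect (C nu); last first.
    have [D _] := countable_bumps X_second_countable X_locally_compact.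
    by exists (0%R, D 0%N).
  have /ereal_sup_gt[_ [cg cg1 <-]] := CM nu Cnu.
  by rewrite lte_fin => Mcg; exists cg.
have /choice[cg cgP] := ex.
have oU nu : open [set nu' : M1 X | (M < (cg nu).1 + nu'`[sval (cg nu).2])%R].
  apply: (@open_comp _ _ (fun nu' : M1 X => (cg nu).1 + nu'`[sval (cg nu).2])%R [set y : R | M < y])%R.
    move=> nu' _; apply: (@continuousD _ _ _ (fun=> (cg nu).1) (fun nu' : M1 X => nu'`[sval (cg nu).2])).
      exact: cst_continuous.
    exact: vague_continuous.
  exact: open_gt.
have cC : compact C.
  by apply: (subclosed_compact clC (M1_compact X_second_countable X_locally_compact)).
move: cC; rewrite compact_cover.
move=> /(_ (M1 X) C (fun nu => [set nu' | (M < (cg nu).1 + nu'`[sval (cg nu).2])%R])).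
case=> [nu _|nu Cnu|s sC Cs]; first exact: oU.
  by exists nu => //=; have [] := cgP nu Cnu.
have exK (nu : M1 X) : exists K : R, (0 < K)%R /\ (C nu -> forall t, (0 < t)%R ->
    P (empirical_rv t @^-1` [set nu' | (M < (cg nu).1 + nu'`[sval (cg nu).2])%R]) <=
      (K * expR (- (t * M)))%:E).
  have [Cnu|] := pselect (C nu); last by exists 1%R.
  have [cg1 _] := cgP nu Cnu; have [L L0 gL] := Cc_bounded (cg nu).2.
  have mg : measurable_fun [set: borel X] (fun y => (cg nu).1 + sval (cg nu).2 y)%R.
    by apply: measurable_funD => //; exact: measurable_Cc.
  have gL' y : (`|(cg nu).1 + sval (cg nu).2 y| <= `|(cg nu).1| + L)%R.
    by rewrite (le_trans (ler_normD _ _))// lerD2l.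
  have [K K0 KP] := exponential_chebyshev mtau tau_ge0 tau_neq0 tau_finite x_iid mg gL' cg1.
  exists K; split => // _ t t0; apply: KP => //.
    exact: (measurable_preimage_empirical t0 (measurable_open_M1 (oU nu))).
  move=> w /ltW Mw; apply: le_trans Mw _.
  rewrite RintegralD//; last first.
  - exact: integrable_Cc.
  - by apply: (@integrable_bounded _ _ _ _ _ `|(cg nu).1|%R).
  rewrite lerD2r Rintegral_cst//.
  have e1 : empirical tau (fun i => x i w) t [set: borel X] = 1.
    by rewrite empiricalE// occupation_setT.
  by rewrite [X in fine X]e1 mulr1.
have /choice[K KP] := exK.
exists (\sum_(nu <- enum_fset s) K nu + 1)%R.
  by rewrite ltr_pwDr// sumr_ge0// => nu _; exact/ltW/(KP nu).1.
move=> t t0.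
pose F nu := empirical_rv t @^-1` [set nu' | (M < (cg nu).1 + nu'`[sval (cg nu).2])%R].
have mF nu : measurable (F nu).
  exact: (measurable_preimage_empirical t0 (measurable_open_M1 (oU nu))).
apply: (@le_trans _ _ (P (\big[setU/set0]_(nu <- enum_fset s) F nu))).
  apply: le_measure; rewrite ?inE//.
  - exact: (measurable_preimage_empirical t0 (measurable_closed_M1 clC)).
  - exact: bigsetU_measurable.
  - move=> w /Cs [nu /= snu wnu]; rewrite -bigcup_seq.
    by exists nu.
apply: le_trans (measure_bigsetU_le _ _ mF) _.
rewrite mulrDl mul1r mulr_suml; apply: (@le_trans _ _ (\sum_(nu <- enum_fset s) K nu * expR (- (t * M)))%:E); last first.
  by rewrite lee_fin lerDl expR_ge0.
rewrite -sumEFin big_seq [leRHS]big_seq; apply: lee_sum => nu snu.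
by have [_] := KP nu; apply => //; have := sC nu snu; rewrite inE.
Qed.

End upper_bound.

(** * Approximation by compactly supported functions *)

Section Cc_operations.
Context (R : realType) (X : completeMetricType R).

Lemma Cc_fun2 (h : R -> R -> R) (f g : Cc X) : h 0%R 0%R = 0%R ->
  continuous (fun y => h (sval f y) (sval g y)) ->
  exists k : Cc X, forall y, sval k y = h (sval f y) (sval g y).
Proof.
move=> h0 ch; have [_ kf] := svalP f; have [_ kg] := svalP g.
have kh : compact (closure [set y | h (sval f y) (sval g y) != 0%R]).
  apply: (subclosed_compact _ (compactU kf kg)); first exact: closed_closure.
  rewrite -closureU; apply: closureS => y /= hy.
  have [fy|] := eqVneq (sval f y) 0%R; last by left.
  by right; apply: contraNneq hy => gy; rewrite fy gy h0.
by exists (mkCc ch kh).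
Qed.

Lemma Cc_continuous (f : Cc X) : continuous (sval f).
Proof. by have [] := svalP f. Qed.

Lemma Cc_add (f g : Cc X) : exists k : Cc X, forall y, sval k y = (sval f y + sval g y)%R.
Proof.
apply: (@Cc_fun2 (fun a b => a + b)%R f g); first by rewrite addr0.
by move=> y; apply: continuousD; exact: Cc_continuous.
Qed.

Lemma Cc_scale (c : R) (f : Cc X) : exists k : Cc X, forall y, sval k y = (c * sval f y)%R.
Proof.
apply: (@Cc_fun2 (fun a _ => c * a)%R f f); first by rewrite mulr0.
by move=> y; apply: continuousM; [exact: cst_continuous|exact: Cc_continuous].
Qed.

Lemma Cc_sum (c : R) (n : nat) (F : nat -> Cc X) :
  exists k : Cc X, forall y, sval k y = (c * \sum_(i < n) sval (F i) y)%R.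
Proof.
elim: n => [|n [k kE]].
  have [k kE] := Cc_scale 0 (F 0%N); exists k => y.
  by rewrite kE mul0r big_ord0 mulr0.
have [l lE] := Cc_scale c (F n); have [m mE] := Cc_add k l.
by exists m => y; rewrite mE kE lE big_ord_recr/= mulrDr.
Qed.

End Cc_operations.

(** * Regularity of finite Borel measures and density of compactly supported functions *)

Section approximation.
Context (R : realType) (X : completeMetricType R).
Hypotheses (X_second_countable : @second_countable X)
  (X_locally_compact : locally_compact [set: X]).
Local Notation "nu `[ f ]" := ((\int[nu]_(x in [set: borel X]) f x)%R)
  (at level 10, format "nu `[ f ]").
Variable p : subprobability (borel X) R.

Let mG (G : set X) : open G -> measurable (G : set (borel X)).
Proof. exact: sub_sigma_algebra. Qed.

Let fin_p (A : set (borel X)) : measurable A -> p A \is a fin_num.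
Proof. exact: fin_num_measure. Qed.

Lemma open_inner_regular (G : set X) (c : \bar R) : open G ->
  (forall K, compact K -> K `<=` G -> p K <= c) -> p G <= c.
Proof.
move=> oG Gc; have [e [eo en]] := relatively_compact_basis X_second_countable X_locally_compact.
pose L n := \big[setU/set0]_(i < n) (if `[< closure (e i) `<=` G >] then closure (e i) else set0).
have cL n : compact (L n).
  apply: bigsetU_compact => i _; case: asboolP => _; last exact: compact0.
  by have [] := eo i.
have LG n : L n `<=` G.
  apply: (big_ind (fun A => A `<=` G)) => [//|A B AG BG y [/AG|/BG]//|i _].
  by case: asboolP => // _; exact: sub0set.
have mL n : measurable (L n : set (borel X)) by exact: compact_borel_measurable.
have ndL : nondecreasing_seq L.
  move=> m n mn; apply/subsetPset.
  exact: (@subset_bigsetU _ (fun i => if `[< closure (e i) `<=` G >] then closure (e i) else set0)).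
have cv : p (L n) @[n --> \oo] --> p (\bigcup_n L n).
  by apply: nondecreasing_cvg_mu => //; exact: bigcup_measurable.
rewrite (_ : G = \bigcup_n L n).
  rewrite -(cvg_lim _ cv)//; apply: lime_le; first by apply/cvg_ex; eexists; exact: cv.
  by apply: nearW => n; apply: Gc.
apply/seteqP; split => [y Gy|y [n _ /LG//]].
have [i [ei eG]] := en y G (open_nbhs_nbhs (conj oG Gy)).
exists i.+1 => //; rewrite /L big_ord_recr/=; right; rewrite asboolT//.
exact: subset_closure.
Qed.

(** The measure generated by the masses of compact sets is outer regular by construction, hence
    Radon. It agrees with [p] on open sets, which are increasing unions of compact sets, and
    therefore on all Borel sets. *)
Lemma borel_regular (A : set (borel X)) (eps : R) : measurable A -> (0 < eps)%R ->
  exists K G : set X, [/\ compact K, open G, K `<=` A, A `<=` G & p G <= p K + eps%:E].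
Proof.
move=> mA e0.
have mK := @compact_borel_measurable R X.
have p1 (B : set (borel X)) : measurable B -> p B <= 1.
  move=> mB; apply: (@le_trans _ _ (p setT)); last exact: sprobability_setT.
  by apply: le_measure; rewrite ?inE.
pose lam (K : set X) : \bar R := if `[< measurable (K : set (borel X)) >] then p K else 0.
have lamE K : measurable (K : set (borel X)) -> lam K = p K.
  by move=> mB; rewrite /lam asboolT.
have [|||||nu [nuK nuG nuR]] := @measure_of_content R X lam.
- by move=> K; rewrite /lam; case: asboolP.
- by rewrite lamE// measure0.
- by move=> K; rewrite /lam; case: asboolP => // mB; exact: p1.
- by move=> K L /mK mB /mK mC; rewrite !lamE//; [exact: measureU2|exact: measurableU].
- by move=> K L /mK mB /mK mC KL; rewrite !lamE//; [rewrite measureU|exact: measurableU].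
have nup B : measurable B -> nu B = p B.
  move=> mB; apply: (@measure_unique _ R (borel X) (@open X) (fun=> setT)) => //.
  - exact: openI.
  - by move=> _; exact: openT.
  - by rewrite bigcup_const.
  - move=> G oG; apply/eqP; rewrite eq_le; apply/andP; split.
      apply: nuG => // K cK KG; rewrite lamE; last exact: mK.
      by apply: le_measure; rewrite ?inE//; [exact: mK|exact: mG].
    apply: open_inner_regular => // K cK KG; rewrite -lamE; last exact: mK.
    apply: le_trans (nuK _ cK) _.
    by apply: le_measure; rewrite ?inE//; [exact: mK|exact: mG].
  - by move=> _; rewrite ltey_eq fin_num_measure.
have rnu : radon nu.
  by apply: outer_regular_radon => // B _; exact: nuR.
have e20 : (0 < eps / 2)%R by rewrite divr_gt0.
have [G [oG AG pG]] : exists G : set X, [/\ open G, A `<=` G & p G <= p A + (eps / 2)%:E].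
  have := fin_p mA; rewrite -nup// nuR => fi.
  have [_ [G [oG AG] <-] /ltW Ge] := lb_ereal_inf_adherent e20 fi.
  by exists G; split => //; rewrite -[X in X <= _]nup//; exact: mG.
have [K [cK KA pK]] : exists K : set X, [/\ compact K, K `<=` A & p A <= p K + (eps / 2)%:E].
  have := fin_p mA; rewrite -nup// (rnu A mA) => fi.
  have [_ [K [cK KA] <-] /ltW Ke] := ub_ereal_sup_adherent e20 fi.
  exists K; split => //; rewrite -[X in _ <= X + _]nup; last exact: mK.
  by rewrite -leeBlDr.
exists K, G; split => //; apply: (le_trans pG).
by rewrite [in leRHS](splitr eps) EFinD addeA leeD2r.
Qed.

(* [Cc] is dense in [L^1] with values kept in [0, 1]: indicators by regularity and Urysohn,
   then a staircase of indicators. *)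
Lemma Cc_approximation (phi : borel X -> R) (eps : R) : measurable_fun [set: borel X] phi ->
  (forall y, 0 <= phi y <= 1)%R -> (0 < eps)%R ->
  exists g : Cc X, (forall y, 0 <= sval g y <= 1)%R /\
    (\int[p]_(y in [set: borel X]) `|sval g y - phi y| <= eps)%R.
Proof.
move=> mphi phi01 e0.
have [D [D01 Dsep]] := countable_bumps X_second_countable X_locally_compact.
have indic_approx (A : set (borel X)) (eta : R) : measurable A -> (0 < eta)%R ->
    exists g : Cc X, (forall y, 0 <= sval g y <= 1)%R /\
      (\int[p]_(y in [set: borel X]) `|sval g y - \1_A y| <= eta)%R.
  move=> mA eta0; have [K [G [cK oG KA AG pGK]]] := borel_regular mA eta0.
  have mK := compact_borel_measurable cK; have mG' := mG oG.
  have [n [DK DG]] := Dsep _ _ cK oG (subset_trans KA AG).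
  exists (D n); split => //.
  have iGK : (\int[p]_(y in [set: borel X]) (\1_G y - \1_K y : R) <= eta)%R.
    rewrite RintegralB//; last first.
    - by apply: (@integrable_bounded _ _ _ _ _ 1%R) => // y; rewrite indicE; case: (_ \in _); rewrite ?normr1 ?normr0.
    - by apply: (@integrable_bounded _ _ _ _ _ 1%R) => // y; rewrite indicE; case: (_ \in _); rewrite ?normr1 ?normr0.
    rewrite !Rintegral_indic// lerBlDl -lee_fin EFinD !fineK//; exact: fin_p.
  apply: le_trans iGK; apply: (@le_Rintegral_bounded _ _ _ _ _ _ 1%R).
  - apply: measurableT_comp => //; apply: measurable_funB => //; exact: measurable_Cc.
  - exact: measurable_funB.
  - move=> y; rewrite normr_id indicE; have /andP[? ?] := D01 n y.
    by case: (_ \in _); rewrite ler_norml /=; lra.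
  - by move=> y; rewrite !indicE; case: (_ \in _); case: (_ \in _); rewrite ?subrr ?subr0 ?sub0r ?normrN ?normr1 ?normr0.
  - move=> y; rewrite !indicE; have /andP[? ?] := D01 n y.
    have [Ky|Ky] := boolP (y \in K).
      have yA : y \in A by move: Ky => /set_mem/KA/mem_set.
      have yG : y \in G by move: yA => /set_mem/AG/mem_set.
      by rewrite yA yG DK ?subrr ?normr0//; exact: set_mem.
    have [yG|yG] := boolP (y \in G).
      by case: (y \in A); rewrite ler_norml /=; lra.
    have yA : y \in A = false by apply/negP => /set_mem/AG yG'; move: yG; rewrite mem_set.
    have -> : sval (D n) y = 0%R by apply/eqP; apply: contraNT yG => /DG; exact: mem_set.
    by rewrite yA subr0 normr0.
(* Half of [eps] pays for the staircase, of step [1 / n], and half for the mean of the [n] errors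
   made on its indicators. *)
pose n := (Num.truncn (2 / eps)).+1.
have n0 : (0 < n%:R :> R)%R by rewrite ltr0n.
have n2e : (n%:R^-1 <= eps / 2)%R.
  by rewrite -[leRHS]invrK lef_pV2 ?posrE ?invr_gt0 ?divr_gt0// invf_div ltW// truncnS_gt.
pose A k := [set y | (k.+1%:R <= n%:R * phi y)%R].
have mA k : measurable (A k).
  rewrite (_ : A k = [set: borel X] `&` (fun y => n%:R * phi y)%R @^-1` `[k.+1%:R, +oo[).
    by apply: measurable_funM => //; exact: measurable_itv.
  by rewrite setTI; apply/seteqP; split => y /=; rewrite in_itv/= andbT.
have e20 : (0 < eps / 2)%R by rewrite divr_gt0.
have /choice[F FP] k := indic_approx (A k) _ (mA k) e20.
have [g gE] := Cc_sum n%:R^-1 n F.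
have g01 y : (0 <= sval g y <= 1)%R.
  rewrite gE; have F01 k : (0 <= sval (F k) y <= 1)%R by have [-> _] := FP k.
  apply/andP; split.
    by rewrite mulr_ge0 ?invr_ge0 ?ler0n// sumr_ge0// => k _; case/andP: (F01 k).
  rewrite ler_pdivrMl// mulr1 -[n in leRHS]card_ord -sum1_card natr_sum.
  by apply: ler_sum => k _; case/andP: (F01 k).
exists g; split => //.
have iF k : p.-integrable [set: borel X] (fun y => (`|sval (F k) y - \1_(A k) y|)%:E).
  apply: (@integrable_bounded _ _ _ _ _ 1%R).
    apply: measurableT_comp => //; apply: measurable_funB; first exact: measurable_Cc.
    exact: measurable_indic.
  move=> y; rewrite normr_id indicE; have /andP[? ?] : (0 <= sval (F k) y <= 1)%R by have [-> _] := FP k.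
  by case: (_ \in _); rewrite ler_norml /=; lra.
have sumF m : p.-integrable [set: borel X] (fun y => (\sum_(k < m) `|sval (F k) y - \1_(A k) y|)%:E) /\
    (\int[p]_(y in [set: borel X]) (\sum_(k < m) `|sval (F k) y - \1_(A k) y|) <= m%:R * (eps / 2))%R.
  elim: m => [|m [iS IH]].
    under eq_fun do rewrite big_ord0; split; first exact: integrable0.
    by under eq_Rintegral do rewrite big_ord0; rewrite Rintegral_cst// !mul0r.
  under eq_fun do rewrite big_ord_recr/= EFinD; split; first exact: (integrableD _ iS (iF m)).
  under eq_Rintegral do rewrite big_ord_recr/=.
  rewrite (RintegralD measurableT iS (iF m)) -(natr1 m) mulrDl mul1r.
  by apply: lerD => //; have [_] := FP m.
have [iS leS] := sumF n.
have mS : measurable_fun [set: borel X] (fun y => \sum_(k < n) `|sval (F k) y - \1_(A k) y|)%R.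
  by have /integrableP[/measurable_EFinP] := iS.
have leD y : (`|sval g y - phi y| <=
    n%:R^-1 * (\sum_(k < n) `|sval (F k) y - \1_(A k) y|) + n%:R^-1)%R.
  have nphi : (0 <= n%:R * phi y <= n%:R)%R.
    by have /andP[p0 p1] := phi01 y; rewrite mulr_ge0 ?ler0n// ler_piMr ?ler0n.
  have /andP[l1 l2] := layer_cake_le nphi; rewrite gE.
  have sE : (\sum_(k < n) (k.+1%:R <= n%:R * phi y)%R%:R = \sum_(k < n) \1_(A k) y :> R)%R.
    apply: eq_bigr => k _; rewrite indicE; congr (nat_of_bool _)%:R.
    by apply/idP/idP => [?|/set_mem//]; exact: mem_set.
  rewrite sE in l1 l2.
  rewrite (_ : _ - _ = n%:R^-1 * (\sum_(k < n) (sval (F k) y - \1_(A k) y)) +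
      n%:R^-1 * (\sum_(k < n) \1_(A k) y - n%:R * phi y))%R; last first.
    by rewrite sumrB; field; rewrite gt_eqF.
  apply: le_trans (ler_normD _ _) _; apply: lerD.
    by rewrite normrM ger0_norm ?invr_ge0 ?ler0n// ler_pM2l ?invr_gt0//; exact: ler_norm_sum.
  rewrite normrM ger0_norm ?invr_ge0 ?ler0n// ler_piMr ?invr_ge0 ?ler0n//.
  by rewrite ler_norml; lra.
apply: (@le_trans _ _ (\int[p]_(y in [set: borel X])
   (n%:R^-1 * (\sum_(k < n) `|sval (F k) y - \1_(A k) y|) + n%:R^-1)))%R.
  apply: (@le_Rintegral_bounded _ _ _ _ _ _ 2%R).
  - by apply: measurableT_comp => //; apply: measurable_funB => //; exact: measurable_Cc.
  - by apply: measurable_funD => //; apply: measurable_funM.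
  - move=> y; rewrite normr_id; have /andP[? ?] := phi01 y; have /andP[? ?] := g01 y.
    by rewrite ler_norml; lra.
  - move=> y; rewrite ger0_norm; last by apply: le_trans (leD y).
    have n1 : (n%:R^-1 <= 1 :> R)%R by rewrite invf_le1// ler1n.
    rewrite -[leRHS]/(1 + 1)%R lerD// ler_pdivrMl// mulr1 -[n in leRHS]card_ord -sum1_card natr_sum.
    apply: ler_sum => k _; have /andP[? ?] : (0 <= sval (F k) y <= 1)%R by have [-> _] := FP k.
    by rewrite indicE; case: (_ \in _); rewrite ler_norml /=; lra.
  - exact: leD.
have iZ : p.-integrable [set: borel X]
    (fun y => (n%:R^-1 * \sum_(k < n) `|sval (F k) y - \1_(A k) y|)%:E).
  by under eq_fun do rewrite EFinM; exact: integrableZl.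
rewrite (RintegralD measurableT iZ); last first.
  by apply: (@integrable_bounded _ _ _ _ _ n%:R^-1%R) => // y; rewrite ger0_norm ?invr_ge0 ?ler0n.
rewrite RintegralZl// Rintegral_cst// [leRHS](splitr eps); apply: lerD.
  by rewrite ler_pdivrMl.
apply: le_trans n2e; rewrite ler_piMr ?invr_ge0 ?ler0n//.
by rewrite -lee_fin fineK ?fin_num_measure//; exact: sprobability_setT.
Qed.

End approximation.

(** * Exponential weights and the dual functional *)

Section exponential_weights.
Context (R : realType) (X : completeMetricType R).
Hypotheses (X_second_countable : @second_countable X)
  (X_locally_compact : locally_compact [set: X]).
Variables (mu : probability (borel X) R) (tau : borel X -> \bar R).
Hypotheses (mtau : measurable_fun [set: borel X] tau)
  (tau_ge0 : forall x, 0 <= tau x)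
  (tau_finite : mu [set x | tau x = +oo] = 0).

Let th (y : borel X) : R := fine (tau y).
Let mth : measurable_fun [set: borel X] th. Proof. exact: measurable_fine_tau. Qed.
Let th_ge0 y : (0 <= th y)%R. Proof. exact: fine_ge0. Qed.

Lemma metric_ball_open (x : X) (e : R) : open (ball x e).
Proof.
rewrite openE => y; rewrite ballEmdist /interior => xy /=; apply/nbhs_ballP.
exists (e - mdist x y)%R; first by rewrite /= subr_gt0.
move=> z; rewrite ballEmdist /= ltrBrDl; exact/le_lt_trans/metric_triangle.
Qed.

Lemma measurable_expR_tau (c : R) : measurable_fun [set: borel X] (fun y => expR (c * th y)).
Proof. by apply: measurableT_comp => //; exact: measurable_funM. Qed.

Lemma integral_expeR_tau (A : set (borel X)) (c : R) : measurable A -> (0 <= c)%R ->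
  \int[mu]_(y in A) expeR (c%:E * tau y) = \int[mu]_(y in A) (expR (c * th y))%:E.
Proof.
move=> mA c0.
have mE : measurable_fun [set: borel X] (fun y => expeR (c%:E * tau y)).
  rewrite (_ : (fun y => _) = fun y => if tau y == +oo then expeR (c%:E * +oo) else (expR (c * th y))%:E).
    apply: measurable_fun_ifT => //; last by apply/measurable_EFinP; exact: measurable_expR_tau.
    apply: (measurable_fun_bool true); rewrite setTI.
    have := mtau measurableT (emeasurable_set1 (+oo : \bar R)); rewrite setTI.
    by congr measurable; apply/seteqP; split => y /= /eqP.
  apply/funext => y; have [->//|ty] := eqVneq (tau y) +oo.
  by rewrite -[in LHS](@fineK _ (tau y))// ge0_fin_numE// ltey.
have mR : measurable_fun [set: borel X] (fun y => (expR (c * th y))%:E).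
  by apply/measurable_EFinP; exact: measurable_expR_tau.
apply: ge0_ae_eq_integral => //.
- exact: measurable_funTS.
- exact: measurable_funTS.
- by move=> y _; exact: expeR_ge0.
exists [set y | tau y = +oo]; split => //.
  by have := mtau measurableT (emeasurable_set1 (+oo : \bar R)); rewrite setTI.
move=> y /= nE; apply/eqP; apply: contra_notT nE => ty _.
by rewrite -[in LHS](@fineK _ (tau y))// ge0_fin_numE// ltey.
Qed.

Lemma exp_moments0 (A : set (borel X)) : measurable A -> exp_moments mu tau A 0.
Proof.
move=> mA; exists 0%R => //; split => //; rewrite integral_expeR_tau//.
under eq_integral do rewrite mul0r expR0.
by rewrite integral_cst//= mul1e (le_lt_trans (probability_le1 _ _)) ?ltry.
Qed.

Lemma xi_ge0 x : 0 <= xi mu tau x.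
Proof.
apply: (@le_trans _ _ (ereal_sup (exp_moments mu tau (ball x 1%R)))).
  by apply: ereal_sup_ubound; apply: exp_moments0; apply: sub_sigma_algebra; exact: metric_ball_open.
by apply: ereal_sup_ubound; exists 1%R => /=.
Qed.

Lemma xi_infty_ge0 : 0 <= xi_infty mu tau.
Proof.
apply: (@le_trans _ _ (ereal_sup (exp_moments mu tau (~` (set0 : set X))))).
  by apply: ereal_sup_ubound; apply: exp_moments0; exact: measurableC.
by apply: ereal_sup_ubound; exists set0 => //=; exact: compact0.
Qed.

Definition affine_Cc (cu : R * Cc X) (y : borel X) : R := (cu.1 + sval cu.2 y)%R.

Lemma measurable_affine_Cc (cu : R * Cc X) : measurable_fun [set: borel X] (affine_Cc cu).
Proof. by apply: measurable_funD => //; exact: measurable_Cc. Qed.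

(** The constant [cu.1] is the value of the weight outside a compact set, hence its comparison with
    [xi_infty], whereas the weight itself is compared with [xi]. *)
Definition admissible (cu : R * Cc X) :=
  [/\ (0 <= cu.1)%R, (forall y, 0 <= affine_Cc cu y)%R & exp_functional mu tau (affine_Cc cu) < +oo].

Let mexp cu : measurable_fun [set: borel X] (fun y => (expR (th y * affine_Cc cu y))%:E : \bar R).
Proof.
by apply/measurable_EFinP; apply: measurable_exp_integrand => //; exact: measurable_affine_Cc.
Qed.

Let join (cu cv : R * Cc X) : admissible cu -> admissible cv ->
  exists cw, [/\ admissible cw, cw.1 = Num.max cu.1 cv.1 & forall y, affine_Cc cw y = Num.max (affine_Cc cu y) (affine_Cc cv y)].
Proof.
move=> [cu0 wu0 eu] [cv0 wv0 ev].
have [||k kE] := @Cc_fun2 R X (fun a b => Num.max (cu.1 + a) (cv.1 + b) - Num.max cu.1 cv.1)%R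
  cu.2 cv.2.
- by rewrite !addr0 subrr.
- move=> y; apply: (@continuousB _ _ _ (fun y => Num.max (cu.1 + sval cu.2 y) (cv.1 + sval cv.2 y))%R
    (fun=> Num.max cu.1 cv.1)); last exact: cst_continuous.
  by apply: (@continuous_max _ _ (fun y => cu.1 + sval cu.2 y) (fun y => cv.1 + sval cv.2 y))%R;
    apply: continuousD; try exact: cst_continuous; exact: Cc_continuous.
exists (Num.max cu.1 cv.1, k).
have wE y : affine_Cc (Num.max cu.1 cv.1, k) y = Num.max (affine_Cc cu y) (affine_Cc cv y).
  by rewrite /affine_Cc/= kE addrC subrK.
split => //; split => /=.
- by rewrite le_max cu0.
- by move=> y; rewrite wE le_max wu0.
- apply: (@le_lt_trans _ _ (exp_functional mu tau (affine_Cc cu) + exp_functional mu tau (affine_Cc cv))); last first.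
    exact: lte_add_pinfty.
  rewrite /exp_functional -ge0_integralD//.
  apply: ge0_le_integral => //.
  + by apply: emeasurable_funD; exact: mexp.
  + move=> y _; rewrite wE -EFinD lee_fin; have [_|_] := leP (affine_Cc cu y) (affine_Cc cv y).
      by rewrite lerDr expR_ge0.
    by rewrite lerDl expR_ge0.
Qed.

(* Countably many balls and compact sets suffice to reach [xi] and [xi_infty]; the maxima of the
   corresponding weights keep a finite exponential moment. *)
Lemma weights_exist : exists cu : nat -> R * Cc X,
  [/\ (forall n, admissible (cu n)),
      (forall n y, affine_Cc (cu n) y <= affine_Cc (cu n.+1) y)%R,
      (forall n, (cu n).1 <= (cu n.+1).1)%R,
      (forall x, xi mu tau x <= ereal_sup (range (fun n => (affine_Cc (cu n) x)%:E))) &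
      xi_infty mu tau <= ereal_sup (range (fun n => (cu n).1%:E))].
Proof.
have [D [D01 Dsep]] := countable_bumps X_second_countable X_locally_compact.
have [z zE] := Cc_scale 0 (D 0%N).
have adm0 : admissible (0%R, z).
  have w0 y : affine_Cc (0%R, z) y = 0%R by rewrite /affine_Cc zE mul0r addr0.
  split => //; first by move=> y; rewrite w0.
  rewrite /exp_functional; under eq_integral do rewrite w0 mulr0 expR0.
  by rewrite integral_cst//= mul1e (le_lt_trans (probability_le1 _ _)) ?ltry.
pose q (ij : nat * nat) : R := (ij.1%:R / ij.2.+1%:R)%R.
have q0 ij : (0 <= q ij)%R by rewrite divr_ge0.
(* A code gives a nonnegative rational [q], a bump [D k] and a kind: [q * (1 - D k)] for moments
   near infinity, [q * D k] for moments near a point. Codes without an admissible weight receive the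
   zero weight. *)
have candE (p : nat * nat * nat * bool) : exists cu, admissible cu /\
    forall cv, admissible cv -> cv.1 = (if p.2 then q p.1.1 else 0)%R ->
      (forall y, affine_Cc cv y = if p.2 then q p.1.1 * (1 - sval (D p.1.2) y) else q p.1.1 * sval (D p.1.2) y)%R ->
    cu.1 = cv.1 /\ affine_Cc cu = affine_Cc cv.
  have [[cv [av c1 wv]]|nex] := pselect (exists cv, [/\ admissible cv,
      cv.1 = (if p.2 then q p.1.1 else 0)%R &
      (forall y, affine_Cc cv y = if p.2 then q p.1.1 * (1 - sval (D p.1.2) y) else q p.1.1 * sval (D p.1.2) y)%R]).
    exists cv; split => // cv' _ c1' wv'; rewrite c1 c1'; split => //.
    by apply/funext => y; rewrite wv wv'.
  by exists (0%R, z); split => // cv av c1 wv; exfalso; apply: nex; exists cv.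
have /choice[cand candP] := candE.
pose cn n := if choice.unpickle n is Some p then cand p else (0%R, z).
have acn n : admissible (cn n).
  by rewrite /cn; case: (choice.unpickle n) => // p; have [] := candP p.
have /choice[J JP] (cucv : (R * Cc X) * (R * Cc X)) : exists cw, admissible cucv.1 -> admissible cucv.2 ->
    [/\ admissible cw, cw.1 = Num.max cucv.1.1 cucv.2.1 &
        forall y, affine_Cc cw y = Num.max (affine_Cc cucv.1 y) (affine_Cc cucv.2 y)].
  have [[a1 a2]|na] := pselect (admissible cucv.1 /\ admissible cucv.2).
    by have [cw] := join a1 a2; exists cw.
  by exists (0%R, z) => a1 a2; exfalso; apply: na.
pose W := fix W n := if n is m.+1 then J (W m, cn m.+1) else cn 0%N.
have aW n : admissible (W n).
  by elim: n => [|n IH]; [exact: acn|have [] := JP (W n, cn n.+1) IH (acn _)].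
have WS n : (W n.+1).1 = Num.max (W n).1 (cn n.+1).1 /\
    forall y, affine_Cc (W n.+1) y = Num.max (affine_Cc (W n) y) (affine_Cc (cn n.+1) y).
  by have [_ ? ?] := JP (W n, cn n.+1) (aW n) (acn _).
have leW n : ((cn n).1 <= (W n).1)%R /\ forall y, (affine_Cc (cn n) y <= affine_Cc (W n) y)%R.
  case: n => [//|n]; have [-> wE] := WS n; split; first by rewrite le_max lexx orbT.
  by move=> y; rewrite wE le_max lexx orbT.
have dense (c : R) (F : nat -> R) : (0 <= c)%R -> (forall n, 0 <= F n)%R ->
    (forall ij, (q ij < c)%R -> exists n, (q ij <= F n)%R) ->
    c%:E <= ereal_sup (range (fun n => (F n)%:E)).
  move=> c0 F0 qF; apply/lee_addgt0Pr => e e0.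
  have [ce|ec] := leP c e.
    apply: (@le_trans _ _ (0 + e%:E)); first by rewrite add0e lee_fin.
    by rewrite leeD2r// (le_trans _ (ereal_sup_ubound (ex_intro2 _ _ 0%N _ erefl))) ?lee_fin.
  (* The multiples of [1 / j.+1] have spacing less than [e], so the first one above [c - e] is still
     below [c]. *)
  pose j := Num.truncn e^-1; pose i := Num.truncn ((c - e) * j.+1%:R).
  have j0 : (0 < j.+1%:R :> R)%R by rewrite ltr0n.
  have je : (e^-1 < j.+1%:R)%R by exact: truncnS_gt.
  have je1 : (1 < e * j.+1%:R)%R by rewrite -ltr_pdivrMl// mulr1.
  have ce0 : (0 <= (c - e) * j.+1%:R)%R by rewrite mulr_ge0 ?subr_ge0 ?ltW.
  have /andP[i1 i2] := truncn_itv ce0.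
  have qij : (c - e < q (i.+1, j) < c)%R.
    rewrite /q/= ltr_pdivlMr// ltr_pdivrMr// i2/=.
    by move: i1 i2; rewrite -/i -[i.+1%:R]natr1 !mulrBl; lra.
  have /andP[q1 /qF[n qn]] := qij.
  apply: (@le_trans _ _ ((F n)%:E + e%:E)); last by rewrite leeD2r//; apply: ereal_sup_ubound; exists n.
  by rewrite -EFinD lee_fin; lra.
(* A weight at most [c] that vanishes outside [A] satisfies [e^(tau v) <= 1 + e^(c tau) 1_A]. *)
have int_lt (A : set (borel X)) (c q' : R) : measurable A -> (0 <= c)%R -> (q' <= c)%R ->
    \int[mu]_(y in A) expeR (c%:E * tau y) < +oo ->
    forall v : borel X -> R, measurable_fun [set: borel X] v ->
      (forall y, v y <= c)%R -> (forall y, ~ A y -> v y = 0)%R -> exp_functional mu tau v < +oo.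
  move=> mA c0 qc; rewrite integral_expeR_tau// => Aoo v mv vc vA.
  apply: (@le_lt_trans _ _ (\int[mu]_y (1 + (expR (c * th y) * \1_A y)%:E))).
    apply: ge0_le_integral => //.
    - by apply/measurable_EFinP; exact: measurable_exp_integrand.
    - apply: emeasurable_funD => //; apply/measurable_EFinP; apply: measurable_funM => //.
      exact: measurable_expR_tau.
    - move=> y _; rewrite -EFinD lee_fin indicE; have [/set_mem Ay|Ay] := boolP (y \in A).
        rewrite mulr1 (le_trans (y := expR (c * th y))) ?lerDr ?ler01// ler_expR mulrC.
        exact: (ler_wpM2r (th_ge0 y) (vc y)).
      by rewrite vA ?mulr0 ?expR0 ?addr0//; move: Ay; rewrite notin_setE.
  rewrite ge0_integralD//; last first.
    by apply/measurable_EFinP; apply: measurable_funM => //; exact: measurable_expR_tau.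
  rewrite integral_cst//= mul1e lte_add_pinfty//.
    by rewrite (le_lt_trans (probability_le1 _ _)) ?ltry.
  under eq_integral do rewrite EFinM.
  rewrite (_ : \int[mu]_x _ = \int[mu]_(y in A) (expR (c * th y))%:E)// [RHS]integral_mkcond.
  by apply: eq_integral => y _; rewrite patchE indicE; case: ifP => _; rewrite ?mule1 ?mule0.
exists W; split => //.
- by move=> n y; have [_ ->] := WS n; rewrite le_max lexx.
- by move=> n; have [-> _] := WS n; rewrite le_max lexx.
- move=> x; apply: ge_ereal_sup => _ [delta /= d0 <-]; apply: ge_ereal_sup => _ [c [c0 coo] <-].
  have mB : measurable (ball x delta : set (borel X)).
    by apply: sub_sigma_algebra; exact: metric_ball_open.
  apply: dense => //; first by move=> n; have [] := aW n.
  move=> ij qc.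
  have [k [Dk1 Dk2]] := Dsep [set x] (ball x delta) (@compact_set1 _ x) (metric_ball_open x delta)
    (fun y yx => eq_ind_r (ball x delta) (ballxx x d0) yx).
  have [u uE] := Cc_scale (q ij) (D k).
  have wE y : affine_Cc (0%R, u) y = (q ij * sval (D k) y)%R by rewrite /affine_Cc add0r uE.
  have au : admissible (0%R, u).
    split => //; first by move=> y; rewrite wE mulr_ge0//; case/andP: (D01 k y).
    apply: (int_lt _ c (q ij) mB) => //; first exact: ltW; first exact: measurable_affine_Cc.
      by move=> y; rewrite wE (le_trans _ (ltW qc))// ler_piMr//; case/andP: (D01 k y).
    by move=> y; rewrite wE => By; have [->|/Dk2//] := eqVneq (sval (D k) y) 0%R; rewrite mulr0.
  have [_ /(_ _ au erefl wE)[_ cE]] := candP (ij, k, false).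
  exists (choice.pickle (ij, k, false)).
  apply: le_trans ((leW _).2 _); rewrite /cn choice.pickleK cE wE Dk1// mulr1//.
- apply: ge_ereal_sup => _ [K cK <-]; apply: ge_ereal_sup => _ [c [c0 coo] <-].
  have mKC : measurable (~` K : set (borel X)) by apply: measurableC; exact: compact_borel_measurable.
  apply: dense => //; first by move=> n; have [] := aW n.
  move=> ij qc.
  have [k [Dk1 _]] := Dsep K setT cK openT (@subsetT _ _).
  have [u uE] := Cc_scale (- q ij) (D k).
  have wE y : affine_Cc (q ij, u) y = (q ij * (1 - sval (D k) y))%R by rewrite /affine_Cc uE/= mulrBr mulr1 mulNr.
  have au : admissible (q ij, u).
    split; [exact: q0|by move=> y; rewrite wE mulr_ge0// subr_ge0; case/andP: (D01 k y)|].
    apply: (int_lt _ c (q ij) mKC) => //; first exact: ltW; first exact: measurable_affine_Cc.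
      move=> y; rewrite wE (le_trans _ (ltW qc))// ler_piMr// lerBlDr lerDl.
      by case/andP: (D01 k y).
    by move=> y; rewrite wE => /contrapT Ky; rewrite Dk1// subrr mulr0.
  have [_ /(_ _ au erefl wE)[cE _]] := candP (ij, k, true).
  exists (choice.pickle (ij, k, true)).
  by apply: le_trans (leW _).1; rewrite /cn choice.pickleK cE.
Qed.

(** By continuity the weight exceeds its value at [x] minus [e] on a small ball, where its
    exponential moment dominates the one that defines [xi]. *)
Lemma affine_le_xi (cu : R * Cc X) x : admissible cu -> (affine_Cc cu x)%:E <= xi mu tau x.
Proof.
move=> [c0 w0 eoo]; apply/lee_addgt0Pr => e e0.
have [we|ew] := leP (affine_Cc cu x) e.
  by rewrite -[leLHS]add0e leeD ?xi_ge0// lee_fin.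
have cw : continuous (fun y : X => cu.1 + sval cu.2 y)%R.
  by move=> y; apply: continuousD; [exact: cst_continuous|exact: Cc_continuous].
have oG : open [set y : X | (affine_Cc cu x - e < cu.1 + sval cu.2 y)%R].
  apply: (@open_comp _ _ (fun y : X => cu.1 + sval cu.2 y)%R [set y : R | affine_Cc cu x - e < y])%R.
    by move=> y _; exact: cw.
  exact: open_gt.
have : nbhs x [set y : X | (affine_Cc cu x - e < cu.1 + sval cu.2 y)%R].
  by apply: open_nbhs_nbhs; split => //=; rewrite ltrBlDr ltrDl.
move=> /nbhs_ballP[delta /= d0 dG].
have mB : measurable (ball x delta : set (borel X)).
  by apply: sub_sigma_algebra; exact: metric_ball_open.
have we0 : (0 <= affine_Cc cu x - e)%R by rewrite subr_ge0 ltW.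
rewrite -leeBlDr// -EFinB; apply: (@le_trans _ _ (ereal_sup (exp_moments mu tau (ball x delta)))).
  apply: ereal_sup_ubound; exists (affine_Cc cu x - e)%R => //; split => //.
  rewrite integral_expeR_tau//; apply: le_lt_trans eoo.
  apply: (@le_trans _ _ (\int[mu]_(y in ball x delta) (expR (th y * affine_Cc cu y))%:E)).
    apply: ge0_le_integral => //.
    - by apply/measurable_EFinP; apply: measurable_funTS; exact: measurable_expR_tau.
    - by apply: measurable_funTS; exact: mexp.
    - move=> y By; rewrite lee_fin ler_expR mulrC ler_wpM2l//.
      by apply: ltW; exact: dG.
  by apply: ge0_subset_integral => //; exact: mexp.
by apply: ereal_sup_ubound; exists delta.
Qed.

Lemma xi_approximation : exists cu : nat -> R * Cc X,
  [/\ (forall n, admissible (cu n)),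
      (forall n y, affine_Cc (cu n) y <= affine_Cc (cu n.+1) y)%R,
      (forall x, (affine_Cc (cu n) x)%:E @[n --> \oo] --> xi mu tau x) &
      exists l, ((cu n).1)%:E @[n --> \oo] --> l /\ xi_infty mu tau <= l].
Proof.
have [cu [acu cuS cS xile xiile]] := weights_exist.
exists cu; split => //.
  move=> x; rewrite (_ : xi mu tau x = ereal_sup (range (fun n => (affine_Cc (cu n) x)%:E))).
    by apply: ereal_nondecreasing_cvgn; apply/nondecreasing_seqP => n; rewrite lee_fin.
  apply/eqP; rewrite eq_le xile/=; apply: ge_ereal_sup => _ [n _ <-].
  exact: affine_le_xi.
exists (ereal_sup (range (fun n => ((cu n).1)%:E))); split => //.
by apply: ereal_nondecreasing_cvgn; apply/nondecreasing_seqP => n; rewrite lee_fin.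
Qed.

Lemma measurable_xi : measurable_fun [set: borel X] (xi mu tau).
Proof.
have [cu [_ _ cuxi _]] := xi_approximation.
apply: (emeasurable_fun_cvg (fun n y => (affine_Cc (cu n) y)%:E)) => //.
by move=> n; apply/measurable_EFinP; exact: measurable_affine_Cc.
Qed.

End exponential_weights.

(** * The dual functional on the singular part and on the missing mass *)

Section dual_lower_bound.
Context (R : realType) (X : completeMetricType R).
Hypotheses (X_second_countable : @second_countable X)
  (X_locally_compact : locally_compact [set: X]).
Variables (mu : probability (borel X) R) (tau : borel X -> \bar R).
Hypotheses (mtau : measurable_fun [set: borel X] tau)
  (tau_ge0 : forall x, 0 <= tau x)
  (tau_neq0 : mu [set x | tau x = 0] = 0)
  (tau_finite : mu [set x | tau x = +oo] = 0)
  (xi_infinite : mu [set x | xi mu tau x < +oo] = 0).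
Local Notation "nu `[ f ]" := ((\int[nu]_(x in [set: borel X]) f x)%R)
  (at level 10, format "nu `[ f ]").

Let th (y : borel X) : R := fine (tau y).
Let mth : measurable_fun [set: borel X] th. Proof. exact: measurable_fine_tau. Qed.
Let th_ge0 y : (0 <= th y)%R. Proof. exact: fine_ge0. Qed.

(** Reduces to values in [0, 1] by [- phi / M] and to mass at most 1 by normalisation. The bound
    [- M <= g <= 0] is kept, because a correction added to a weight must not increase it. The
    [a + 1] in the tolerance avoids dividing by a zero mass. *)
Lemma Cc_approximation_finite (m : {measure set (borel X) -> \bar R}) (phi : borel X -> R)
    (M eps : R) : m [set: borel X] < +oo -> measurable_fun [set: borel X] phi ->
  (0 < M)%R -> (forall y, - M <= phi y <= 0)%R -> (0 < eps)%R ->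
  exists g : Cc X, (forall y, - M <= sval g y <= 0)%R /\
    \int[m]_y (`|sval g y - phi y|)%:E <= eps%:E.
Proof.
move=> moo mphi M0 phiM e0.
have mfin : m [set: borel X] \is a fin_num by rewrite ge0_fin_numE.
pose p := mnormalize m (dirac (point : borel X)).
set a := fine (m [set: borel X]).
have a0 : (0 <= a)%R by exact: fine_ge0.
pose phi' y := (- phi y / M)%R.
have mphi' : measurable_fun [set: borel X] phi'.
  by apply: measurable_funM => //; exact: measurableT_comp.
have phi'01 y : (0 <= phi' y <= 1)%R.
  have /andP[? ?] := phiM y; rewrite /phi'; apply/andP; split.
    by rewrite mulr_ge0 ?oppr_ge0 ?invr_ge0 ?(ltW M0).
  by rewrite ler_pdivrMr//; lra.
have d0 : (0 < eps / (M * (a + 1)))%R by rewrite divr_gt0// mulr_gt0// ltr_wpDl.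
have [g [g01 ge]] := Cc_approximation X_second_countable X_locally_compact p mphi' phi'01 d0.
have [h hE] := Cc_scale (- M) g.
exists h; split.
  move=> y; rewrite hE; have /andP[? ?] := g01 y; rewrite mulNr lerN2 oppr_le0.
  by apply/andP; split; [rewrite ler_piMr// ltW|rewrite mulr_ge0// ltW].
have mg : measurable_fun [set: borel X] (fun y => `|sval g y - phi' y|)%R.
  by apply: measurableT_comp => //; apply: measurable_funB => //; exact: measurable_Cc.
have hgE y : (`|sval h y - phi y| = M * `|sval g y - phi' y|)%R.
  rewrite hE -[M in RHS]ger0_norm ?ltW// -normrM mulrBr /phi' -normrN.
  by congr (`| _ |)%R; field; rewrite gt_eqF.
under eq_integral do rewrite hgE EFinM.
rewrite ge0_integralZl_EFin//; last 2 first.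
- exact/measurable_EFinP.
- exact: ltW.
have [a_eq0|a_neq0] := eqVneq (m [set: borel X]) 0.
  rewrite (_ : \int[m]_x _ = 0) ?mule0 ?lee_fin ?(ltW e0)//.
  apply/eqP; rewrite eq_le; apply/andP; split; last exact: integral_ge0.
  apply: (@le_trans _ _ (\int[m]_x (cst 1%E x))).
    apply: ge0_le_integral => //; first exact/measurable_EFinP.
    move=> y _; rewrite lee_fin; have /andP[? ?] := g01 y; have /andP[? ?] := phi'01 y.
    by rewrite ler_norml; lra.
  by rewrite integral_cst// mul1e [leLHS]a_eq0.
have a_gt0 : (0 < a)%R.
  by rewrite fine_gt0// moo andbT lt_neqAle measure_ge0 eq_sym a_neq0.
have a1 : (0 <= a^-1)%R by rewrite invr_ge0.
have pE : \int[p]_y (`|sval g y - phi' y|)%:E = (a^-1)%:E * \int[m]_y (`|sval g y - phi' y|)%:E.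
  rewrite -(ge0_integral_mscale m measurableT (NngNum a1))//; last exact/measurable_EFinP.
  apply: eq_measure_integral => A mA _; rewrite /p/= /mnormalize/= (negbTE a_neq0) (lt_eqF moo)/=.
  by rewrite /mscale/= muleC.
have ip : p.-integrable [set: borel X] (EFin \o (fun y => `|sval g y - phi' y|)%R).
  apply: (@integrable_bounded _ _ _ _ _ 1%R) => // y; rewrite normr_id.
  have /andP[? ?] := g01 y; have /andP[? ?] := phi'01 y.
  by rewrite ler_norml; lra.
have : (a^-1)%:E * \int[m]_y (`|sval g y - phi' y|)%:E <= (eps / (M * (a + 1)))%:E.
  rewrite -pE -[leLHS]fineK ?lee_fin//; exact: integrable_fin_num.
rewrite -lee_pdivlMl ?invr_gt0// invrK -EFinM.
move=> le_m; apply: (@le_trans _ _ (M%:E * (a * (eps / (M * (a + 1))))%:E)).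
  by rewrite lee_wpmul2l// lee_fin ltW.
rewrite -EFinM lee_fin (_ : (M * (a * (eps / (M * (a + 1)))) = eps * (a / (a + 1)))%R); last first.
  by field; rewrite !gt_eqF// ltr_wpDl.
apply: ler_piMr; first exact: ltW.
by rewrite ler_pdivrMr ?mul1r ?lerDl// ltr_wpDl.
Qed.

(* The dual functional may be tested against any measurable minorant of an admissible
   weight: approximate [phi - w] in [L^1] of [nu + e^(tau w) mu]. *)
Lemma dual_rate_ge (nu : M1 X) (cu : R * Cc X) (phi : borel X -> R) (M eta : R) :
  exp_functional mu tau (fun y => cu.1 + sval cu.2 y)%R < +oo ->
  measurable_fun [set: borel X] phi -> (forall y, `|phi y| <= M)%R ->
  (forall y, phi y <= cu.1 + sval cu.2 y)%R -> (0 < eta)%R ->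
  exp_functional mu tau (fun y => phi y + eta)%R < 1 ->
  (nu`[phi])%:E + (1 - nu [set: borel X]) * (cu.1)%:E <= dual_rate mu tau nu.
Proof.
move=> eoo mphi phiM phiw eta0 e1.
pose w y := (cu.1 + sval cu.2 y)%R.
have mw : measurable_fun [set: borel X] w by exact: measurable_affine_Cc.
have mew : measurable_fun [set: borel X] (fun y => (expR (th y * w y))%:E).
  by apply/measurable_EFinP; exact: measurable_exp_integrand.
have ew0 y : 0 <= (expR (th y * w y))%:E by rewrite lee_fin expR_ge0.
pose m2 := mdensity mu mew ew0.
pose m := measure_add nu m2.
have mE : m [set: borel X] < +oo.
  rewrite /m measure_addE lte_add_pinfty//.
  by rewrite (le_lt_trans sprobability_setT) ?ltry.
have [L L0 uL] := Cc_bounded cu.2.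
have M0 : (0 <= M)%R by exact: le_trans (normr_ge0 _) (phiM point).
pose M' := (M + `|cu.1| + L)%R.
have M'0 : (0 < M')%R by rewrite ltr_wpDl// addr_ge0.
have mphiw : measurable_fun [set: borel X] (fun y => phi y - w y)%R by exact: measurable_funB.
have phiwM y : (- M' <= phi y - w y <= 0)%R.
  apply/andP; split; last by rewrite subr_le0 phiw.
  rewrite /M' /w; have := phiM y; have := uL y; have := ler_norm cu.1.
  by rewrite !ler_norml => ? /andP[? ?] /andP[? ?]; lra.
have nufin : nu [set: borel X] \is a fin_num by rewrite fin_num_measure.
set E := exp_functional mu tau (fun y => phi y + eta)%R in e1.
have E0 : 0 <= E by apply: integral_ge0 => y _; rewrite lee_fin expR_ge0.
have EE : E = (fine E)%:E by rewrite fineK// ge0_fin_numE// (lt_trans e1)// ltry.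
have fE1 : (fine E < 1)%R by rewrite -lte_fin -EE.
apply/lee_addgt0Pr => eps eps0.
(* The first bound controls the integral under [nu]; the second leaves half of the gap [1 - E] after
   the factor [1 / eta] of the Markov inequality below. *)
pose eps' := Num.min eps (eta * (1 - fine E) / 2)%R.
have eps'0 : (0 < eps')%R by rewrite /eps' lt_min eps0 divr_gt0// mulr_gt0// subr_gt0.
have [g [gM ge]] := Cc_approximation_finite mE mphiw M'0 phiwM eps'0.
have [f fE] := Cc_add cu.2 g.
have mg : measurable_fun [set: borel X] (sval g) by exact: measurable_Cc.
have md : measurable_fun [set: borel X] (fun y => (`|sval g y - (phi y - w y)|)%:E).
  by apply/measurable_EFinP; apply: measurableT_comp => //; exact: measurable_funB.
move: ge; rewrite ge0_integral_measure_add// [X in _ + X]integral_mdensity//.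
move=> ge.
have ge1 : \int[nu]_y (`|sval g y - (phi y - w y)|)%:E <= eps%:E.
  apply: (@le_trans _ _ eps'%:E); last by rewrite lee_fin /eps' ge_min lexx.
  apply: le_trans ge; rewrite leeDl//; apply: integral_ge0 => y _.
  by rewrite mule_ge0// lee_fin.
have ge2 : \int[mu]_y ((`|sval g y - (phi y - w y)|)%:E * (expR (th y * w y))%:E) <=
    (eta * (1 - fine E) / 2)%:E.
  apply: (@le_trans _ _ eps'%:E); last by rewrite lee_fin /eps' ge_min lexx orbT.
  by apply: le_trans ge; rewrite leeDr//; apply: integral_ge0 => y _.
have f1 : exp_functional mu tau (fun y => cu.1 + sval f y)%R < 1.
  apply: (@le_lt_trans _ _ (E + (eta^-1)%:E *
      \int[mu]_y ((`|sval g y - (phi y - w y)|)%:E * (expR (th y * w y))%:E))).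
    rewrite -ge0_integralZl//; last 2 first.
    - exact: emeasurable_funM.
    - by rewrite lee_fin invr_ge0 ltW.
    have mphieta : measurable_fun [set: borel X] (fun y => (expR (th y * (phi y + eta)))%:E).
      by apply/measurable_EFinP; apply: measurable_exp_integrand => //; exact: measurable_funD.
    have mgw : measurable_fun [set: borel X] (fun y => (eta^-1)%:E *
        ((`|sval g y - (phi y - w y)|)%:E * (expR (th y * w y))%:E)).
      by apply: measurable_funeM; exact: emeasurable_funM.
    rewrite -ge0_integralD//; last first.
      by move=> y _; rewrite !mule_ge0// lee_fin ?invr_ge0 ?ltW// lee_fin.
    apply: ge0_le_integral => //.
    - by apply/measurable_EFinP; apply: measurable_exp_integrand => //; apply: measurable_funD => //; exact: measurable_Cc.
    - exact: emeasurable_funD.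
    - move=> y _; rewrite -!EFinM -EFinD lee_fin fE addrA -/(w y) -/(th y).
      have /andP[g1 g2] := gM y.
      (* Either [w + g] is below [phi + eta], whose exponential functional is [E < 1], or the error
         of [g] exceeds [eta]; in that case [e^(tau (w + g)) <= e^(tau w)], since [g <= 0], and this
         is at most the error divided by [eta] times [e^(tau w)]. *)
      have [small|large] := leP (w y + sval g y)%R (phi y + eta)%R.
        apply: (@le_trans _ _ (expR (th y * (phi y + eta)))%R).
          by rewrite ler_expR ler_wpM2l.
        rewrite lerDl; apply: mulr_ge0; first by rewrite invr_ge0; exact: ltW.
        by rewrite mulr_ge0// expR_ge0.
      apply: (@le_trans _ _ (expR (th y * w y))%R).
        by rewrite ler_expR ler_wpM2l// gerDl.
      rewrite mulrA -[leLHS]add0r lerD ?expR_ge0// ler_peMl ?expR_ge0//.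
      rewrite mulrC ler_pdivlMr// mul1r; apply: le_trans (ler_norm _).
      by rewrite opprB addrCA addrA; move: large => /ltW; lra.
  rewrite [X in X + _]EE; apply: (@le_lt_trans _ _ ((fine E)%:E + (eta^-1 * (eta * (1 - fine E) / 2))%:E)).
    by rewrite leeD2l// EFinM lee_wpmul2l// lee_fin invr_ge0 ltW.
  rewrite -EFinD lte_fin -!mulrA mulKf ?gt_eqF//.
  by move: fE1; lra.
have dual_f : (cu.1 + nu`[sval f])%:E <= dual_rate mu tau nu.
  by apply: ereal_sup_ubound; exists (cu.1, f).
apply: (@le_trans _ _ ((cu.1 + nu`[sval f])%:E + eps%:E)); last by rewrite leeD2r.
have iphi : nu.-integrable [set: borel X] (EFin \o phi) by exact: (integrable_bounded nu mphi phiM).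
have iw : nu.-integrable [set: borel X] (EFin \o (fun=> cu.1)).
  by apply: (@integrable_bounded _ _ _ _ _ `|cu.1|%R).
have idf : nu.-integrable [set: borel X] (EFin \o (fun y => phi y - cu.1)%R).
  exact: (integrableB measurableT iphi iw).
have nuD : (nu`[phi] - cu.1 * fine (nu setT) <= nu`[sval f] + eps)%R.
  rewrite -(Rintegral_cst _ measurableT cu.1)// -RintegralB// -lerBlDl.
  rewrite -RintegralB//; last exact: integrable_Cc.
  have ig : nu.-integrable [set: borel X] (EFin \o (fun y => `|sval g y - (phi y - w y)|)%R).
    apply: (@integrable_bounded _ _ _ _ _ M'); first exact/measurable_EFinP.
    move=> y; rewrite normr_id; have /andP[? ?] := gM y; have /andP[? ?] := phiwM y.
    by rewrite ler_norml; lra.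
  apply: (@le_trans _ _ (nu`[fun y => `|sval g y - (phi y - w y)|]))%R.
    apply: le_Rintegral => //.
      exact: (integrableB measurableT idf (integrable_Cc nu f)).
    move=> y _; rewrite fE /w -normrN; apply: le_trans (ler_norm _).
    by rewrite le_eqVlt; apply/orP; left; apply/eqP; ring.
  by rewrite -lee_fin fineK//; exact: integrable_fin_num.
rewrite -[X in 1 - X]fineK// -!EFinB -!EFinM -!EFinD lee_fin.
by move: nuD; rewrite mulrBl mul1r; set z := (fine _); rewrite (mulrC z); lra.
Qed.

Let admissible := admissible mu tau.

Lemma integral_ac_sing (nu : M1 X) (f : borel X -> R) (M : R) :
  measurable_fun [set: borel X] f -> (forall y, `|f y| <= M)%R ->
  (nu`[f])%:E = \int[ac_part mu nu]_y (f y)%:E + \int[sing_part mu nu]_y (f y)%:E.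
Proof.
move=> mf fM; have [_ _ dec] := svalP (cid (lebesgue_decomposition_exists mu nu)).
rewrite fineK; last by apply: integrable_fin_num => //; exact: (integrable_bounded nu mf fM).
rewrite -integral_measure_add//; last 2 first.
- exact: (integrable_bounded _ mf fM).
- exact: (integrable_bounded _ mf fM).
apply: eq_measure_integral => A mA _.
exact: (etrans (dec A mA) (esym (measure_addE _ _ A))).
Qed.

Lemma ac_part_dominates (nu : M1 X) (A : set (borel X)) : measurable A -> mu A = 0 ->
  ac_part mu nu A = 0.
Proof.
have [dom _ _] := svalP (cid (lebesgue_decomposition_exists mu nu)).
by move/null_content_dominatesP : dom; exact.
Qed.

(** Let [N] be a [mu]-null set carrying [nu_s]. The test function is the weight [w_n] on [N] and the
    minimum of [psi - eta] and [w_n] elsewhere: the exponential functional ignores [N] and stays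
    below that of [psi]. The loss [eta] is the margin required by [dual_rate_ge], and the conclusion
    is the limit in [n]. *)
Lemma dual_rate_ge_parts (nu : M1 X) (psi : borel X -> R) (M : R) :
  measurable_fun [set: borel X] psi -> (forall y, `|psi y| <= M)%R ->
  exp_functional mu tau psi < 1 ->
  \int[ac_part mu nu]_y (psi y)%:E + (\int[sing_part mu nu]_y xi mu tau y
    + (1 - nu [set: borel X]) * xi_infty mu tau) <= dual_rate mu tau nu.
Proof.
move=> mpsi psiM e1.
have [_ [N [mN sN muN]] dec] := svalP (cid (lebesgue_decomposition_exists mu nu)).
have naN : ac_part mu nu N = 0 by exact: ac_part_dominates.
have mxi := measurable_xi X_second_countable X_locally_compact mtau tau_ge0 tau_finite.
have [cu [acu cuS cuxi [l [cl lxi]]]] :=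
  xi_approximation X_second_countable X_locally_compact mtau tau_ge0 tau_finite.
have w0 n y : (0 <= affine_Cc (cu n) y)%R by have [] := acu n.
have mw n : measurable_fun [set: borel X] (affine_Cc (cu n)) by exact: measurable_affine_Cc.
have cu0 n : (0 <= (cu n).1)%R by have [] := acu n.
have nu1 : 0 <= 1 - nu [set: borel X] by rewrite sube_ge0 ?sprobability_setT// fin_num_measure.
have nufin : nu [set: borel X] \is a fin_num by rewrite fin_num_measure.
apply/lee_addgt0Pr => eta eta0.
pose f n y := Num.min (psi y - eta)%R (affine_Cc (cu n) y).
have mpe : measurable_fun [set: borel X] (fun y => psi y - eta)%R by exact: measurable_funB.
have mf n : measurable_fun [set: borel X] (f n) by exact: measurable_minr.
have psiM' y : (- M <= psi y <= M)%R by have := psiM y; rewrite ler_norml.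
have fM n y : (`|f n y| <= M + eta)%R.
  have := w0 n y; have /andP[? ?] := psiM' y.
  rewrite /f ler_norml; have [?|?] := leP (psi y - eta)%R (affine_Cc (cu n) y); lra.
have step n : \int[ac_part mu nu]_y (f n y)%:E + (\int[sing_part mu nu]_y (affine_Cc (cu n) y)%:E
    + (1 - nu [set: borel X]) * ((cu n).1)%:E) <= dual_rate mu tau nu.
  pose phi y := if y \in N then affine_Cc (cu n) y else f n y.
  have mphi : measurable_fun [set: borel X] phi.
    apply: measurable_fun_ifT => //; apply: (measurable_fun_bool true); rewrite setTI.
    by rewrite (_ : _ @^-1` _ = N)//; apply/seteqP; split => y /=; [exact: set_mem|exact: mem_set].
  have [L L0 uL] := Cc_bounded (cu n).2.
  have phiM y : (`|phi y| <= M + eta + (`|(cu n).1| + L))%R.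
    have fMy := fM n y; have wL : (`|affine_Cc (cu n) y| <= `|(cu n).1| + L)%R.
      by rewrite (le_trans (ler_normD _ _))// lerD2l.
    have := normr_ge0 (f n y); have := normr_ge0 (affine_Cc (cu n) y).
    by rewrite /phi; case: ifP => _; lra.
  have phiw y : (phi y <= (cu n).1 + sval (cu n).2 y)%R.
    by rewrite /phi; case: ifP => // _; rewrite /f ge_min lexx orbT.
  have mef : measurable_fun [set: borel X] (fun y => (expR (th y * (f n y + eta)))%:E).
    by apply/measurable_EFinP; apply: measurable_exp_integrand => //; exact: measurable_funD.
  have ephi : exp_functional mu tau (fun y => phi y + eta)%R < 1.
    apply: le_lt_trans e1; rewrite /exp_functional.
    rewrite (_ : \int[mu]_y _ = \int[mu]_y (expR (th y * (f n y + eta)))%:E); last first.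
      apply: ge0_ae_eq_integral => //.
      - by apply/measurable_EFinP; apply: measurable_exp_integrand => //; exact: measurable_funD.
      - exists N; split => // y /= h; apply: contrapT => Ny; apply: h => _.
        by rewrite /phi memNset.
    apply: ge0_le_integral => //.
      by apply/measurable_EFinP; apply: measurable_exp_integrand.
    move=> y _; rewrite lee_fin ler_expR ler_wpM2l// /f.
    by have [?|?] := leP (psi y - eta)%R (affine_Cc (cu n) y); lra.
  have [_ _ eoo] := acu n.
  have := dual_rate_ge nu eoo mphi phiM phiw eta0 ephi.
  rewrite (integral_ac_sing nu mphi phiM) -addeA.
  rewrite (_ : \int[ac_part mu nu]_y (phi y)%:E = \int[ac_part mu nu]_y (f n y)%:E); last first.
    apply: ae_eq_integral => //; [exact/measurable_EFinP|exact/measurable_EFinP|].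
    exists N; split => // y /= h; apply: contrapT => Ny; apply: h => _.
    by rewrite /phi memNset.
  rewrite (_ : \int[sing_part mu nu]_y (phi y)%:E = \int[sing_part mu nu]_y (affine_Cc (cu n) y)%:E)//.
  apply: ae_eq_integral => //; [exact/measurable_EFinP|exact/measurable_EFinP|].
  exists (~` N); split => //; first exact: measurableC.
  by move=> y /= h Ny; apply: h => _; rewrite /phi mem_set.
have cvA : \int[ac_part mu nu]_y (f n y)%:E @[n --> \oo] --> \int[ac_part mu nu]_y (psi y - eta)%:E.
  have [] := @dominated_convergence _ _ _ (ac_part mu nu) setT measurableT
    (fun n y => (f n y)%:E) (fun y => (psi y - eta)%:E) (fun=> (M + eta)%:E) => //.
  - by move=> n; exact/measurable_EFinP.
  - exact/measurable_EFinP.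
  (* Where [xi] is infinite, the weights eventually exceed [psi - eta] and the minimum equals it.
     The exceptional set is [mu]-null by assumption, hence null for [nu_a]. *)
  - exists [set x | xi mu tau x < +oo]; split.
    + by rewrite -[X in measurable X]setTI; exact: emeasurable_fun_infty_o.
    + apply: ac_part_dominates => //.
      by rewrite -[X in measurable X]setTI; exact: emeasurable_fun_infty_o.
    move=> y /= h; rewrite ltey; apply/eqP => xiy; apply: h => _.
    apply: cvg_near_cst.
    have := cuxi y; rewrite xiy => /cvgeyPge/(_ (psi y - eta)%R).
    by apply: filterS => n; rewrite lee_fin /f => h; rewrite min_l.
  - by apply: (@integrable_bounded _ _ _ _ _ `|M + eta|%R).
  - by apply: aeW => y n _; rewrite /= lee_fin.
have cvB : \int[sing_part mu nu]_y (affine_Cc (cu n) y)%:E @[n --> \oo] -->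
    \int[sing_part mu nu]_y xi mu tau y.
  rewrite (_ : \int[sing_part mu nu]_y xi mu tau y =
    \int[sing_part mu nu]_y limn (fun n => (affine_Cc (cu n) y)%:E)); last first.
    by apply: eq_integral => y _; apply/esym/cvg_lim.
  apply: cvg_monotone_convergence => //.
  - by move=> n; exact/measurable_EFinP.
  - by move=> n y _; rewrite lee_fin.
  - by move=> y _; apply/nondecreasing_seqP => n; rewrite lee_fin.
have cvC : (1 - nu [set: borel X]) * ((cu n).1)%:E @[n --> \oo] --> (1 - nu [set: borel X]) * l.
  by apply: cvgeZl => //; rewrite fin_numB nufin.
have l0 : 0 <= l by apply: le_trans lxi; exact: xi_infty_ge0.
have xi0 : 0 <= \int[sing_part mu nu]_y xi mu tau y.
  by apply: integral_ge0 => y _; exact: xi_ge0.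
have iA : (ac_part mu nu).-integrable [set: borel X] (fun y => (psi y - eta)%:E).
  apply: (@integrable_bounded _ _ _ _ _ (M + eta)%R) => // y.
  by have /andP[? ?] := psiM' y; rewrite ler_norml; lra.
have cvT : \int[ac_part mu nu]_y (f n y)%:E + (\int[sing_part mu nu]_y (affine_Cc (cu n) y)%:E
    + (1 - nu [set: borel X]) * ((cu n).1)%:E) @[n --> \oo] -->
    \int[ac_part mu nu]_y (psi y - eta)%:E + (\int[sing_part mu nu]_y xi mu tau y +
       (1 - nu [set: borel X]) * l).
  apply: cvgeD => //; last first.
    by apply: cvgeD => //; apply: ge0_adde_def; rewrite inE// mule_ge0.
  by apply: fin_num_adde_defr; exact: integrable_fin_num.
have : \int[ac_part mu nu]_y (psi y - eta)%:E + (\int[sing_part mu nu]_y xi mu tau y +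
       (1 - nu [set: borel X]) * l) <= dual_rate mu tau nu.
  rewrite -(cvg_lim _ cvT)//; apply: lime_le; first by apply/cvg_ex; eexists; exact: cvT.
  exact: nearW.
move=> leJ; rewrite -leeBlDr//; apply: le_trans leJ.
rewrite addeAC leeD//; last by rewrite leeD2l// lee_wpmul2l.
under [leRHS]eq_integral do rewrite EFinB.
rewrite integralB//; last 2 first.
- exact: (integrable_bounded _ mpsi psiM).
- by apply: (@integrable_bounded _ _ _ _ _ `|eta|%R).
rewrite leeB// integral_cst// -[leRHS]mule1 lee_wpmul2l ?lee_fin ?(ltW eta0)//.
apply: le_trans (@sprobability_setT _ _ _ nu).
by rewrite [leRHS]dec// leeDl.
Qed.

End dual_lower_bound.

(** * Relative entropy in terms of a density *)

Section entropy_density.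
Context d (T : measurableType d) (R : realType).
Local Open Scope charge_scope.

Lemma measurable_ltr_set (f g : T -> R) : measurable_fun [set: T] f ->
  measurable_fun [set: T] g -> measurable [set y | (f y < g y)%R].
Proof.
move=> mf mg; have mt : measurable [set true] by [].
by have := measurable_fun_ltr mf mg measurableT mt; rewrite setTI.
Qed.

Lemma integral_density (q mu : {measure set T -> \bar R}) (rho : T -> R) (f : T -> \bar R) :
  measurable_fun [set: T] rho -> (forall y, 0 <= rho y)%R ->
  (forall A, measurable A -> q A = \int[mu]_(y in A) (rho y)%:E) ->
  measurable_fun [set: T] f -> (forall y, 0 <= f y) ->
  \int[q]_y f y = \int[mu]_y (f y * (rho y)%:E).
Proof.
move=> mrho rho0 qE mf f0.
have mr : measurable_fun [set: T] (fun y => (rho y)%:E : \bar R) by exact/measurable_EFinP.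
have r0 y : 0 <= (rho y)%:E by rewrite lee_fin.
rewrite -(integral_mdensity mu mr r0)//.
by apply: eq_measure_integral => A mA _; exact: qE.
Qed.

(** The Radon-Nikodym derivative of a charge may be negative on a null set; its positive part is a
    density that is nonnegative everywhere and has the same entropy. *)
Lemma rel_entropy_density (q mu : probability T R) : q `<< mu -> exists rho : T -> R,
  [/\ measurable_fun [set: T] rho, (forall y, 0 <= rho y)%R,
      (forall A, measurable A -> q A = \int[mu]_(y in A) (rho y)%:E) &
      rel_entropy q mu = \int[mu]_y (entropy_fun (rho y))%:E].
Proof.
move=> qmu; pose cq := charge_of_finite_measure q.
have qmu' : cq `<< mu by [].
pose rn := 'd cq '/d mu.
have irn : mu.-integrable [set: T] rn by exact: Radon_Nikodym_integrable.
have mrn : measurable_fun [set: T] rn by exact: (measurable_int mu).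
have frn y : rn y = (fine (rn y))%:E by rewrite fineK//; exact: Radon_Nikodym_fin_num.
have mfrn : measurable_fun [set: T] (fun y => fine (rn y)) by exact: measurableT_comp.
have qrn A : measurable A -> q A = \int[mu]_(y in A) rn y.
  by move=> mA; rewrite -(Radon_Nikodym_integral qmu').
pose rho y := Num.max (fine (rn y)) 0%R.
have mrho : measurable_fun [set: T] rho by exact: measurable_maxr.
pose N := [set y | (fine (rn y) < 0)%R].
have mN : measurable N by exact: measurable_ltr_set.
have mNC : measurable (~` N) by exact: measurableC.
have qrho A : measurable A -> q A = \int[mu]_(y in A) (rho y)%:E.
  move=> mA; have mAN : measurable (A `&` N) by exact: measurableI.
  have mANC : measurable (A `&` ~` N) by exact: measurableI.
  have qAN : q (A `&` N) = 0.
    apply/eqP; rewrite eq_le measure_ge0 andbT qrn//.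
    rewrite -(integral0 mu (A `&` N)); apply: le_integral => //.
    - exact: (integrableS measurableT).
    - exact: integrable0.
    - by move=> y; rewrite inE => -[_ Ny]; rewrite frn lee_fin; exact: ltW.
  have dec : A = (A `&` N) `|` (A `&` ~` N) by rewrite -setIUr setUv setIT.
  have disj : [disjoint A `&` N & A `&` ~` N].
    by apply/disj_setPS; rewrite setIACA setICr setI0.
  rewrite {2}dec ge0_integral_setU//; last 2 first.
  - by apply: measurable_funTS; exact/measurable_EFinP.
  - by move=> y _; rewrite lee_fin /rho le_max lexx orbT.
  rewrite (_ : \int[mu]_(y in A `&` N) _ = 0) ?add0e; last first.
    rewrite -(integral0 mu (A `&` N)); apply: eq_integral => y /set_mem[_ Ny].
    by rewrite /rho max_r// ltW.
  have -> : q A = q (A `&` N) + q (A `&` ~` N).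
    by rewrite {1}dec measureU//; rewrite setIACA setICr setI0.
  rewrite [X in X + _]qAN add0e qrn//; apply: eq_integral => y /set_mem[_ /negP].
  by rewrite -leNgt => rn0; rewrite /rho max_l// -frn.
exists rho; split => //.
  by move=> y; rewrite /rho le_max lexx orbT.
rewrite /rel_entropy asboolT//.
have ment (f : T -> R) : measurable_fun [set: T] f ->
    measurable_fun [set: T] (fun y => (entropy_fun (f y))%:E).
  move=> mf; apply/measurable_EFinP; apply: measurable_funD => //; apply: measurable_funM => //.
  by apply: measurable_funB => //; apply: measurableT_comp => //; exact: measurable_ln.
have irho : mu.-integrable [set: T] (fun y => (rho y)%:E).
  apply: (le_integrable measurableT _ _ irn); first exact/measurable_EFinP.
  move=> y _; rewrite [in leRHS]frn /= lee_fin /rho.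
  by have [?|?] := leP (fine (rn y)) 0%R; rewrite ?normr0.
have ae : ae_eq mu setT rn (fun y => (rho y)%:E).
  apply: integral_ae_eq => //; first exact/measurable_EFinP.
  by move=> A _ mA; rewrite -qrn// qrho.
apply: ae_eq_integral => //; [exact: ment|exact: ment|].
apply: filterS ae => y /= /(_ Logic.I) rhoE _.
by congr (entropy_fun _)%:E; exact: (congr1 fine rhoE).
Qed.

End entropy_density.

Section entropy_function.
Context (R : realType).

Lemma entropy_fun_ge0 (r : R) : (0 <= r)%R -> (0 <= entropy_fun r)%R.
Proof.
rewrite le_eqVlt /entropy_fun => /orP[/eqP <-|r0]; first by rewrite mul0r add0r.
have := expR_ge1Dx (ln r^-1); rewrite lnK ?posrE ?invr_gt0// lnV ?posrE// => h.
have := ler_wpM2l (ltW r0) h; rewrite mulfV ?gt_eqF//.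
by rewrite mulrDr mulr1 mulrN mulrBr mulr1; lra.
Qed.

Lemma measurable_entropy d (T : measurableType d) (f : T -> R) : measurable_fun [set: T] f ->
  measurable_fun [set: T] (fun y => entropy_fun (f y)).
Proof.
move=> mf; apply: measurable_funD => //; apply: measurable_funM => //.
by apply: measurable_funB => //; apply: measurableT_comp => //; exact: measurable_ln.
Qed.

Lemma measurable_inv_fun d (T : measurableType d) (f : T -> R) : measurable_fun [set: T] f ->
  measurable_fun [set: T] (fun y => (f y)^-1)%R.
Proof.
move=> mf; rewrite (_ : (fun y => _) = fun y => fine ((f y)%:E^-1)); last first.
  by apply/funext => y; rewrite inver; case: eqP => [->|//]; rewrite invr0.
apply: measurableT_comp => //.
by apply: (measurableT_comp (@measurable_inve R)); exact/measurable_EFinP.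
Qed.

Lemma cvge_near_lt (u : nat -> \bar R) (l c : \bar R) : u n @[n --> \oo] --> l -> l < c ->
  \forall n \near \oo, u n < c.
Proof.
move=> cu lc.
have : nbhs l [set y | y < c] by apply: open_nbhs_nbhs; split => //; exact: open_ereal_lt_ereal.
by move=> /cu.
Qed.

End entropy_function.

(** * The dual functional on the absolutely continuous part *)

Section dual_lower_bound_rate.
Context (R : realType) (X : completeMetricType R).
Hypotheses (X_second_countable : @second_countable X)
  (X_locally_compact : locally_compact [set: X]).
Variables (mu : probability (borel X) R) (tau : borel X -> \bar R).
Hypotheses (mtau : measurable_fun [set: borel X] tau)
  (tau_ge0 : forall x, 0 <= tau x)
  (tau_neq0 : mu [set x | tau x = 0] = 0)
  (tau_finite : mu [set x | tau x = +oo] = 0)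
  (xi_infinite : mu [set x | xi mu tau x < +oo] = 0).

Let th (y : borel X) : R := fine (tau y).
Let mth : measurable_fun [set: borel X] th. Proof. exact: measurable_fine_tau. Qed.
Let th_ge0 y : (0 <= th y)%R. Proof. exact: fine_ge0. Qed.

Let mtau0 : measurable [set y | tau y = 0].
Proof. by have := mtau measurableT (emeasurable_set1 (0 : \bar R)); rewrite setTI. Qed.

Let mtauy : measurable [set y | tau y = +oo].
Proof. by have := mtau measurableT (emeasurable_set1 (+oo : \bar R)); rewrite setTI. Qed.

Lemma tau_gt0_finite (m : {measure set (borel X) -> \bar R}) :
  (forall A : set (borel X), measurable A -> mu A = 0 -> m A = 0) ->
  {ae m, forall y, 0 < tau y < +oo}.
Proof.
move=> dom; exists ([set y | tau y = 0] `|` [set y | tau y = +oo]); split.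
- exact: measurableU.
- apply/eqP; rewrite eq_le measure_ge0 andbT; apply: le_trans (measureU2 _ _ _) _ => //.
  by rewrite [X in X + _]dom// [X in _ + X]dom// adde0.
- move=> y /= /negP; rewrite negb_and -leNgt -leNgt leye_eq => /orP[|/eqP]; last by right.
  by move=> t0; left; apply/eqP; rewrite eq_le t0 tau_ge0.
Qed.

Variable nu : M1 X.
Let na := ac_part mu nu.
Let a := inv_tau_mass mu tau nu.
Let na_dom := @ac_part_dominates R X mu nu.
Let mr : measurable_fun [set: borel X] (fun y => (tau y)^-1) := measurable_inv_tau mtau.
Let r0 y : 0 <= (tau y)^-1 := inv_tau_ge0 tau_ge0 y.

Lemma ac_bar_dominated : ac_bar mu mtau tau_ge0 nu `<< mu.
Proof.
apply/null_content_dominatesP => A mA muA; rewrite /ac_bar /= /mnormalize.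
case: ifPn => _ //; rewrite [X in X * _](_ : _ = 0) ?mul0e//.
by rewrite /mdensity/=; apply: null_set_integral => //; [exact: measurable_funTS|exact: na_dom].
Qed.

(** By its definition [ac_bar] has density [1 / (a tau)] with respect to [nu_a], and [tau] is
    positive and finite [nu_a]-almost everywhere. This inverts to [nu_a = a tau rho mu]. *)
Lemma integral_ac_part (f : borel X -> R) (rho : borel X -> R) : 0 < a -> a < +oo ->
  measurable_fun [set: borel X] f -> (forall y, 0 <= f y)%R ->
  measurable_fun [set: borel X] rho -> (forall y, 0 <= rho y)%R ->
  (forall A, measurable A -> ac_bar mu mtau tau_ge0 nu A = \int[mu]_(y in A) (rho y)%:E) ->
  \int[na]_y (f y)%:E = a * \int[mu]_y (f y * th y * rho y)%:E.
Proof.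
move=> a0 aoo mf f0 mrho rho0 qE.
have mft : measurable_fun [set: borel X] (fun y => (f y * th y)%:E : \bar R).
  by apply/measurable_EFinP; exact: measurable_funM.
have ft0 y : 0 <= (f y * th y)%:E by rewrite lee_fin mulr_ge0.
under [in RHS]eq_integral do rewrite EFinM.
rewrite -(integral_density mrho rho0 qE mft ft0).
have af : a = (fine a)%:E by rewrite fineK// ge0_fin_numE// ltW.
have a0' : (0 <= (fine a)^-1)%R by rewrite invr_ge0 fine_ge0// ltW.
have fa0 : fine a != 0%R by rewrite gt_eqF// fine_gt0// a0.
pose q := mdensity na mr r0.
have qT : q setT = a by rewrite /q /mdensity/=.
rewrite [X in a * X](_ : _ = \int[mscale (NngNum a0') q]_y (f y * th y)%:E); last first.
  apply: eq_measure_integral => A mA _.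
  rewrite /ac_bar/= /mnormalize/= [mdensity _ _ _ setT](_ : _ = a)// (gt_eqF a0) (lt_eqF aoo)/=.
  by rewrite /mscale/= muleC.
rewrite ge0_integral_mscale//= integral_mdensity// muleA {1}af -EFinM mulfV// mul1e.
apply: ge0_ae_eq_integral => //.
- exact/measurable_EFinP.
- exact: emeasurable_funM.
- by move=> y _; rewrite lee_fin.
- by move=> y _; rewrite mule_ge0.
have := tau_gt0_finite na_dom; apply: filterS => y /andP[t0 ty] _.
rewrite EFinM -muleA -[X in _ = _ * (X%:E * _)]/(fine (tau y)) fineK ?ge0_fin_numE//.
by rewrite divee ?mule1// ?gt_eqF// ge0_fin_numE.
Qed.

Let B := \int[sing_part mu nu]_y xi mu tau y + (1 - nu [set: borel X]) * xi_infty mu tau.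

Let nu1 : 0 <= 1 - nu [set: borel X].
Proof. by rewrite sube_ge0 ?sprobability_setT// fin_num_measure. Qed.

Let B0 : 0 <= B.
Proof.
rewrite adde_ge0// ?mule_ge0//; last exact: xi_infty_ge0.
by apply: integral_ge0 => y _; exact: xi_ge0.
Qed.

Let na1 : na [set: borel X] <= 1.
Proof.
have [_ _ dec] := svalP (cid (lebesgue_decomposition_exists mu nu)).
by apply: le_trans (@sprobability_setT _ _ _ nu); rewrite [leRHS]dec// leeDl.
Qed.

Let nafin : na [set: borel X] \is a fin_num. Proof. exact: fin_num_measure. Qed.

Let dual_parts (psi : borel X -> R) (M : R) : measurable_fun [set: borel X] psi ->
  (forall y, `|psi y| <= M)%R -> exp_functional mu tau psi < 1 ->
  \int[na]_y (psi y)%:E + B <= dual_rate mu tau nu.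
Proof. exact: dual_rate_ge_parts. Qed.

Let integral_na_shift (psi : borel X -> R) (M c : R) : measurable_fun [set: borel X] psi ->
  (forall y, `|psi y| <= M)%R ->
  \int[na]_y (psi y + c)%:E = \int[na]_y (psi y)%:E + c%:E * na [set: borel X].
Proof.
move=> mpsi psiM; under eq_integral do rewrite EFinD.
rewrite integralD//; first by rewrite integral_cst.
  exact: (integrable_bounded _ mpsi psiM).
by apply: (@integrable_bounded _ _ _ _ _ `|c|%R).
Qed.

(** Tested by truncations of [1 / tau] on a set [E] where [tau < eta], and by a negative constant
    elsewhere. On [E] the exponential is at most [e], so the constraint holds once [mu E] is small.
    Off [E] the function [1 / tau] is bounded, so its infinite integral comes from [E]. *)
Lemma dual_rate_ge_infinite : a = +oo -> dual_rate mu tau nu = +oo.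
Proof.
move=> aoo; pose F (k : nat) := [set y | (th y < k.+1%:R^-1)%R].
have mF k : measurable (F k) by exact: measurable_ltr_set.
have capF : mu (\bigcap_k F k) = 0.
  apply/eqP; rewrite eq_le measure_ge0 andbT.
  apply: (@le_trans _ _ (mu ([set y | tau y = 0] `|` [set y | tau y = +oo]))).
    apply: le_measure; rewrite ?inE//; [exact: bigcap_measurable|exact: measurableU|].
    move=> y Fy; apply: contrapT => /not_orP[t0 ty].
    have thy : (0 < th y)%R.
      by rewrite fine_gt0// ltey lt_neqAle tau_ge0 eq_sym andbT; apply/andP; split; exact/eqP.
    have := truncnS_gt (th y)^-1; set k := Num.truncn _ => thk.
    have : (th y < k.+1%:R^-1)%R := Fy k Logic.I.
    rewrite ltNge => /negP; apply.
    by rewrite -[leRHS]invrK lef_pV2 ?posrE ?invr_gt0 ?ltr0n// ltW.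
  apply: le_trans (measureU2 _ _ _) _ => //.
  by rewrite [X in X + _]tau_neq0 [X in _ + X]tau_finite adde0.
have cvF : mu (F k) @[k --> \oo] --> 0.
  rewrite -capF; apply: nonincreasing_cvg_mu => //.
  - by rewrite (le_lt_trans (probability_le1 _ _)) ?ltry.
  - exact: bigcap_measurable.
  - move=> m n mn; apply/subsetPset => y /= /lt_le_trans; apply.
    by rewrite lef_pV2 ?posrE ?ltr0n// ler_nat.
(* With [mu E] below this constant, [E] contributes at most 1/2 to the exponential functional; the
   complement contributes at most 1/3. *)
have e0 : (0 < (expR 1 * 2)^-1 :> R)%R by rewrite invr_gt0 mulr_gt0// expR_gt0.
have [k Fk] : exists k, mu (F k) < ((expR 1 * 2)^-1)%:E.
  have [k _ /(_ k)/= kF] := cvge_near_lt cvF (e0 : 0 < _%:E); exists k; exact: kF.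
pose E := F k; have mE : measurable E := mF k; pose eta := (k.+1%:R^-1 : R)%R.
have eta0 : (0 < eta)%R by rewrite invr_gt0 ltr0n.
(* Off [E] one has [tau m' >= 2], so [e^(- tau m') <= 1 / (1 + 2) = 1/3]. *)
pose m' := (2 / eta)%R.
have m'0 : (0 <= m')%R by rewrite divr_ge0// ltW.
pose v (m : nat) y := Num.min (m%:R : R) (th y)^-1%R.
have v0 m y : (0 <= v m y <= m%:R)%R.
  by rewrite /v le_min ler0n invr_ge0 th_ge0 ge_min lexx.
have mv m : measurable_fun [set: borel X] (v m).
  by apply: measurable_minr => //; exact: measurable_inv_fun.
pose psi m y := if (th y < eta)%R then v m y else (- m')%R.
have mpsi m : measurable_fun [set: borel X] (psi m).
  by apply: measurable_fun_ifT => //; exact: measurable_fun_ltr.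
have psiM m y : (`|psi m y| <= m%:R + m')%R.
  rewrite /psi; case: ifP => _; last by rewrite normrN ger0_norm// lerDr.
  by have /andP[? ?] := v0 m y; rewrite ger0_norm// (le_trans (y := m%:R))// lerDl.
have epsi m : exp_functional mu tau (psi m) < 1.
  apply: (@le_lt_trans _ _ (\int[mu]_y ((expR 1)%:E * (\1_E y)%:E + (3^-1)%:E))).
    apply: ge0_le_integral => //.
    - by apply/measurable_EFinP; exact: measurable_exp_integrand.
    - apply: emeasurable_funD => //; apply: measurable_funeM; exact/measurable_EFinP/measurable_indic.
    - move=> y _; rewrite -EFinM -EFinD lee_fin /psi indicE.
      have [yE|yE] := ltP (th y) eta.
        rewrite mem_set// mulr1; apply: (@le_trans _ _ (expR 1)); last by rewrite lerDl invr_ge0.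
        rewrite ler_expR -/(th y); have [->|t0] := eqVneq (th y) 0%R; first by rewrite mul0r.
        have thy : (0 < th y)%R by rewrite lt_neqAle eq_sym t0 th_ge0.
        by rewrite -(@mulfV _ (th y))// ler_pM2l// /v ge_min lexx orbT.
      rewrite memNset ?mulr0 ?add0r; last by rewrite /E/F/= ltNge yE.
      have tm : (2 <= th y * m')%R by rewrite /m' mulrC -mulrA ler_peMr// mulrC ler_pdivlMr// mul1r.
      rewrite mulrN expRN lef_pV2 ?posrE ?expR_gt0//.
      by apply: le_trans (expR_ge1Dx _); rewrite -/(th y); lra.
  rewrite ge0_integralD//; last first.
    by apply: measurable_funeM; exact/measurable_EFinP/measurable_indic.
  rewrite ge0_integralZl//; last exact/measurable_EFinP/measurable_indic.
  rewrite integral_indic// setIT integral_cst// [X in _ + _ * X]probability_setT mule1.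
  have muE : mu E = (fine (mu E))%:E by rewrite fineK// fin_num_measure.
  have : (fine (mu E) < (expR 1 * 2)^-1)%R by rewrite -lte_fin -muE.
  rewrite invfM => lt2; have : (expR 1 * fine (mu E) < 2^-1 :> R)%R.
    by rewrite -ltr_pdivlMl ?expR_gt0.
  by rewrite [X in _ * X + _]muE -EFinM -EFinD lte_fin; lra.
have part m : (\int[na]_(y in E) (v m y)%:E) <= dual_rate mu tau nu + m'%:E.
  apply: (@le_trans _ _ (\int[na]_y (psi m y + m')%:E)).
    rewrite integral_mkcond; apply: ge0_le_integral => //.
    - by move=> y _; rewrite patchE; case: ifP => // _; rewrite lee_fin; case/andP: (v0 m y).
    - by apply/(measurable_restrictT _ _).1 => //; apply: measurable_funTS; exact/measurable_EFinP.
    - by apply/measurable_EFinP; exact: measurable_funD.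
    - move=> y _; rewrite patchE /psi; have [yE|yE] := ltP (th y) eta.
        by rewrite mem_set// lee_fin lerDl.
      by rewrite memNset ?addNr// /E/F/= ltNge yE.
  rewrite (integral_na_shift m' (mpsi m) (psiM m)) leeD//.
    apply: le_trans (dual_parts (mpsi m) (psiM m) (epsi m)).
    by rewrite leeDl.
  by rewrite -[leRHS]mule1 lee_wpmul2l// lee_fin.
have lim : \int[na]_(y in E) (v m y)%:E @[m --> \oo] --> +oo.
  rewrite (_ : +oo = \int[na]_(y in E) limn (fun m => (v m y)%:E)).
    apply: cvg_monotone_convergence => //.
    - by move=> m; apply: measurable_funTS; exact/measurable_EFinP.
    - by move=> m y _; rewrite lee_fin; case/andP: (v0 m y).
    - move=> y _ m n mn; rewrite lee_fin /v le_min !ge_min lexx orbT andbT.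
      by rewrite ler_nat mn.
  have limE y : limn (fun m => (v m y)%:E) = ((th y)^-1)%:E.
    apply/cvg_lim => //; apply: cvg_near_cst.
    exists (Num.truncn (th y)^-1).+1 => // m /= tm; rewrite /v min_r//.
    by rewrite (le_trans (ltW (truncnS_gt _)))// ler_nat.
  under eq_integral do rewrite limE.
  have mEC : measurable (~` E) by exact: measurableC.
  have tauE : \int[na]_(y in E) (tau y)^-1 = \int[na]_(y in E) ((th y)^-1)%:E.
    apply: ge0_ae_eq_integral => //.
    - exact: measurable_funTS.
    - by apply: measurable_funTS; apply/measurable_EFinP; exact: measurable_inv_fun.
    - by move=> y _; rewrite lee_fin invr_ge0.
    have := tau_gt0_finite na_dom; apply: filterS => y /andP[t0 ty] _.
    rewrite -{1}(@fineK _ (tau y)) ?ge0_fin_numE// inver gt_eqF//.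
    by rewrite fine_gt0// t0.
  have tauEC : \int[na]_(y in ~` E) (tau y)^-1 <= (eta^-1)%:E.
    apply: (@le_trans _ _ (\int[na]_(y in ~` E) (eta^-1)%:E)).
      apply: ge0_le_integral => //.
      - exact: measurable_funTS.
      - move=> y /negP; rewrite -leNgt => etay.
        have thy : (0 < th y)%R by exact: lt_le_trans etay.
        have tyoo : tau y != +oo by apply/eqP => ty; move: thy; rewrite /th ty ltxx.
        rewrite -(@fineK _ (tau y)) ?ge0_fin_numE ?ltey// inver gt_eqF// lee_fin.
        by rewrite lef_pV2 ?posrE.
    rewrite integral_cst// -[leRHS]mule1 lee_wpmul2l ?lee_fin ?invr_ge0 ?(ltW eta0)//.
    by apply: le_trans na1; apply: le_measure; rewrite ?inE.
  apply/esym/eqP; rewrite -leye_eq -tauE leNgt; apply/negP => Eoo.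
  have : a < +oo.
    rewrite /a /inv_tau_mass -(setUv E) ge0_integral_setU//.
    - by rewrite lte_add_pinfty// (le_lt_trans tauEC)// ltry.
    - by rewrite setUv.
    - by apply/disj_setPS; rewrite setICr.
  by rewrite aoo ltxx.
have : +oo <= dual_rate mu tau nu + m'%:E.
  rewrite -(cvg_lim _ lim)//; apply: lime_le; first by apply/cvg_ex; eexists; exact: lim.
  exact: nearW.
by case: (dual_rate mu tau nu).
Qed.

(** All limits are taken on nonnegative integrands: the target is the integral of
    [h(rho) + rho = rho ln rho + 1], with [h] the entropy integrand, and the added [a] is cancelled
    at the end. The loss [delta] makes the exponential functional strictly less than 1. *)
Lemma dual_rate_ge_rate : ldp_rate mu mtau tau_ge0 nu <= dual_rate mu tau nu.
Proof.
rewrite /ldp_rate -/a; case: ifPn => [aoo|]; last first.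
  by rewrite -leNgt leye_eq => /eqP/dual_rate_ge_infinite ->.
rewrite -addeA -/B; have a_ge0 : 0 <= a by apply: integral_ge0 => y _; exact: r0.
have [a_eq0|a_neq0] := eqVneq a 0.
  (* Without an entropy term the constant test function [- eta] is enough, since [nu_a] has mass at
     most 1. *)
  rewrite a_eq0 mul0e add0e; apply/lee_addgt0Pr => eta eta0.
  have e1 : exp_functional mu tau (fun=> - eta)%R < 1.
    have := laplace_lt1 mtau tau_ge0 tau_neq0 tau_finite eta0.
    rewrite /exp_functional; congr (_ < _); apply: eq_integral => y _.
    by rewrite mulrN mulrC.
  have Meta (y : borel X) : (`|- eta| <= eta)%R by rewrite normrN ger0_norm// ltW.
  have := dual_parts (@measurable_cst _ _ _ _ _ (- eta)%R) Meta e1.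
  rewrite (_ : \int[na]_y _ = (- eta)%:E * na setT); last by rewrite -integral_cst.
  rewrite EFinN mulNe => leJ.
  apply: (@le_trans _ _ (- (eta%:E * na setT) + B + eta%:E)); last by rewrite leeD2r.
  rewrite addeAC leeDr// addeC sube_ge0 ?fin_numM//.
  by rewrite -[leRHS]mule1 lee_wpmul2l// lee_fin ltW.
have a0 : 0 < a by rewrite lt_neqAle eq_sym a_neq0.
have af : a = (fine a)%:E by rewrite fineK// ge0_fin_numE.
have fa0 : (0 < fine a)%R by rewrite fine_gt0// a0.
have [rho [mrho rho0 qE ->]] := rel_entropy_density ac_bar_dominated.
have naE f mf f0 := @integral_ac_part f rho a0 aoo mf f0 mrho rho0 qE.
have ment : measurable_fun [set: borel X] (fun y => entropy_fun (rho y)).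
  exact: measurable_entropy.
have mlnrho : measurable_fun [set: borel X] (fun y => ln (rho y)).
  by apply: measurableT_comp => //; exact: measurable_ln.
have irho : \int[mu]_y (rho y)%:E = 1 by rewrite -qE// probability_setT.
have key (delta : R) : (0 < delta)%R ->
    a * (\int[mu]_y (entropy_fun (rho y))%:E + 1) + B <= dual_rate mu tau nu + a * (delta + 1)%:E.
  move=> d0.
  (* Truncated at [m] and [- m], with the value [- m] where [rho] vanishes. Then [e^(tau psi)] is at
     most [e^(- delta) rho + e^(- m tau)], and the integral of the second term tends to 0. *)
  pose psi (m : nat) y := if (0 < rho y)%R then
    Num.max (- m%:R)%R (Num.min m%:R ((ln (rho y) - delta) / th y)%R) else (- m%:R)%R.
  have mpsi m : measurable_fun [set: borel X] (psi m).
    apply: measurable_fun_ifT => //; first exact: measurable_fun_ltr.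
    apply: measurable_maxr => //; apply: measurable_minr => //; apply: measurable_funM => //.
      exact: measurable_funB.
    exact: measurable_inv_fun.
  have psiM m y : (`|psi m y| <= m%:R)%R.
    rewrite /psi; case: ifP => _; last by rewrite normrN ger0_norm.
    have : (0 <= m%:R :> R)%R by [].
    set mm := (m%:R)%R; set z := ((ln _ - _) / _)%R => mm0.
    rewrite ler_norml le_max lexx/= ge_max ge_min lexx andbT.
    by rewrite ge0_cp.
  (* A nonnegative lower bound for [psi tau rho + delta rho + 1] that increases with [m]: the second
     argument of the minimum accounts for the truncation of [psi] at [m]. The negative truncation
     only raises [psi]. *)
  pose g (m : nat) y := Num.min (entropy_fun (rho y) + rho y)%R ((m%:R * th y + delta) * rho y + 1)%R.
  have mg m : measurable_fun [set: borel X] (g m).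
    apply: measurable_minr; first exact: measurable_funD.
    by apply: measurable_funD => //; apply: measurable_funM => //; apply: measurable_funD => //; exact: measurable_funM.
  have g0 m y : (0 <= g m y)%R.
    rewrite /g le_min; apply/andP; split; first by rewrite addr_ge0// entropy_fun_ge0.
    by rewrite addr_ge0// mulr_ge0// addr_ge0// ?mulr_ge0// ltW.
  have pt m y : (g m y + m%:R * th y * rho y <= (psi m y + m%:R) * th y * rho y + delta * rho y + 1)%R.
    rewrite /g /psi; have [rho_gt0|rho_le0] := ltP 0%R (rho y); last first.
      have -> : rho y = 0%R by apply/eqP; rewrite eq_le rho_le0 rho0.
      by rewrite !mulr0 !addr0 add0r ge_min /entropy_fun mul0r add0r lexx orbT.
    set r := rho y; set t := th y; set M := (m%:R : R)%R.
    have r1 : (0 < r)%R by [].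
    have t0 : (0 <= t)%R by exact: th_ge0.
    have [t_eq0|t_neq0] := eqVneq t 0%R.
      by rewrite t_eq0 !mulr0 !mul0r addr0 !add0r ge_min lexx orbT.
    have t_gt0 : (0 < t)%R by rewrite lt_neqAle eq_sym t_neq0.
    set p := Num.max _ _; have [Mz|zM] := leP M ((ln r - delta) / t)%R.
      have pM : (M <= p)%R by rewrite /p -/r -/t -/M (min_l Mz) le_max lexx orbT.
      have : (0 <= (p - M) * (t * r))%R by rewrite mulr_ge0 ?subr_ge0// mulr_ge0// ltW.
      set G := Num.min _ _; have : (G <= (M * t + delta) * r + 1)%R by rewrite /G ge_min lexx orbT.
      lra.
    have pz : ((ln r - delta) / t <= p)%R.
      by rewrite /p -/r -/t -/M (min_r (ltW zM)) le_max lexx orbT.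
    have : (0 <= (p - (ln r - delta) / t) * (t * r))%R.
      by rewrite mulr_ge0 ?subr_ge0// mulr_ge0// ltW.
    rewrite mulrBl (_ : ((ln r - delta) / t * (t * r) = (ln r - delta) * r)%R); last first.
      by field; rewrite gt_eqF.
    set G := Num.min _ _; have : (G <= entropy_fun r + r)%R by rewrite /G ge_min lexx.
    by rewrite /entropy_fun; lra.
  have mrhoE : measurable_fun [set: borel X] (fun y => (rho y)%:E : \bar R) by exact/measurable_EFinP.
  have me (c : R) : measurable_fun [set: borel X] (fun y => (expR (- (c * th y)))%:E : \bar R).
    by apply/measurable_EFinP; do 2 apply: measurableT_comp => //; exact: measurable_funM.
  have em m : exp_functional mu tau (psi m) <= (expR (- delta))%:E + \int[mu]_y (expR (- (m%:R * th y)))%:E.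
    rewrite -[X in X + _]mule1 -irho -ge0_integralZl//; last by move=> y _; rewrite lee_fin.
    rewrite -ge0_integralD//; last 2 first.
    - by move=> y _; rewrite -EFinM lee_fin mulr_ge0// expR_ge0.
    - exact: measurable_funeM.
    apply: ge0_le_integral => //.
    - by apply/measurable_EFinP; exact: measurable_exp_integrand.
    - by apply: emeasurable_funD => //; exact: measurable_funeM.
    - move=> y _; rewrite -EFinM -EFinD lee_fin /psi -/(th y).
      have [rho_gt0|rho_le0] := ltP 0%R (rho y); last first.
        by rewrite mulrN mulrC lerDr mulr_ge0// expR_ge0.
      have [th_eq0|th_neq0] := eqVneq (th y) 0%R.
        by rewrite th_eq0 mul0r mulr0 oppr0 lerDr mulr_ge0// expR_ge0.
      have th_gt0 : (0 < th y)%R by rewrite lt_neqAle eq_sym th_neq0 th_ge0.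
      set z := ((ln _ - _) / _)%R; have [Mz|zM] := leP (- m%:R)%R (Num.min m%:R z); last first.
        by rewrite mulrN mulrC lerDr mulr_ge0// expR_ge0.
      apply: (@le_trans _ _ (expR (ln (rho y) - delta))); last first.
        by rewrite expRD lnK ?posrE// mulrC lerDl expR_ge0.
      rewrite ler_expR (_ : (ln (rho y) - delta = th y * z)%R); last by rewrite /z mulrC mulfVK// gt_eqF.
      by rewrite ler_pM2l// ge_min lexx orbT.
  have e_cv : \int[mu]_y (expR (- (m%:R * th y)))%:E @[m --> \oo] --> 0.
    rewrite -(integral0 mu setT).
    have [] := @dominated_convergence _ _ _ mu setT measurableT
      (fun m y => (expR (- (m%:R * th y)))%:E) (fun=> 0) (fun=> 1%:E) => //.
    - have := @tau_gt0_finite mu (fun A _ h => h); apply: filterS => y /andP[t0 ty] _.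
      under eq_fun do rewrite -mulrN expRM_natl.
      apply/cvg_EFin; first exact: nearW.
      have thy : (0 < th y)%R by rewrite fine_gt0// t0.
      by apply: cvg_expr; rewrite ger0_norm ?expR_ge0// expR_lt1 oppr_lt0.
    - by apply: (@integrable_bounded _ _ _ _ _ 1%R) => // y; rewrite normr1.
    - apply: aeW => y m _; rewrite /= lee_fin ger0_norm ?expR_ge0// -expR0 ler_expR oppr_le0.
      by rewrite mulr_ge0.
  have ed1 : (expR (- delta) < 1)%R by rewrite expR_lt1 oppr_lt0.
  have d1 : 0 < (1 - expR (- delta))%:E :> \bar R by rewrite lte_fin subr_gt0.
  have step : \forall m \near \oo, a * \int[mu]_y (g m y)%:E + B <= dual_rate mu tau nu + a * (delta + 1)%:E.
    have := cvge_near_lt e_cv d1; apply: filterS => m em1.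
    have ep1 : exp_functional mu tau (psi m) < 1.
      apply: (le_lt_trans (em m)); rewrite addeC -lteBrDr//.
    have mM : measurable_fun [set: borel X] (fun y => psi m y + m%:R)%R by exact: measurable_funD.
    have psim0 y : (0 <= psi m y + m%:R)%R.
      by have := psiM m y; rewrite ler_norml => /andP[? ?]; lra.
    have psith y : (0 <= (psi m y + m%:R) * th y * rho y)%R by rewrite !mulr_ge0.
    have mpsith : measurable_fun [set: borel X] (fun y => ((psi m y + m%:R) * th y * rho y)%:E : \bar R).
      by apply/measurable_EFinP; apply: measurable_funM => //; exact: measurable_funM.
    have mgE : measurable_fun [set: borel X] (fun y => (g m y)%:E : \bar R) by exact/measurable_EFinP.
    have mthrho : measurable_fun [set: borel X] (fun y => (m%:R * th y * rho y)%:E : \bar R).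
      by apply/measurable_EFinP; apply: measurable_funM => //; exact: measurable_funM.
    have mdrho : measurable_fun [set: borel X] (fun y => delta%:E * (rho y)%:E + 1).
      by apply: emeasurable_funD => //; exact: measurable_funeM.
    have drho0 y : 0 <= delta%:E * (rho y)%:E by rewrite -EFinM lee_fin mulr_ge0// ltW.
    have ipt : \int[mu]_y (g m y)%:E + \int[mu]_y (m%:R * th y * rho y)%:E <=
        \int[mu]_y ((psi m y + m%:R) * th y * rho y)%:E + (delta + 1)%:E.
      have -> : (delta + 1)%:E = \int[mu]_y (delta%:E * (rho y)%:E + 1).
        rewrite ge0_integralD//; last exact: measurable_funeM.
        rewrite ge0_integralZl_EFin//; last 2 first.
        - by move=> y _; rewrite lee_fin.
        - exact: ltW.
        by rewrite irho mule1 integral_cst// mul1e [X in _ + X]probability_setT.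
      rewrite -!ge0_integralD//; last 4 first.
      - by move=> y _; rewrite lee_fin.
      - by move=> y _; rewrite adde_ge0.
      - by move=> y _; rewrite lee_fin.
      - by move=> y _; rewrite lee_fin !mulr_ge0.
      apply: ge0_le_integral => //.
      - by move=> y _; rewrite adde_ge0// lee_fin// !mulr_ge0.
      - exact: emeasurable_funD.
      - exact: emeasurable_funD.
      - by move=> y _; rewrite -EFinM -!EFinD lee_fin addrA; exact: pt.
    have := lee_wpmul2l a_ge0 ipt.
    have I1 : 0 <= \int[mu]_y (g m y)%:E by apply: integral_ge0 => y _; rewrite lee_fin.
    have I2 : 0 <= \int[mu]_y (m%:R * th y * rho y)%:E.
      by apply: integral_ge0 => y _; rewrite lee_fin !mulr_ge0.
    have I3 : 0 <= \int[mu]_y ((psi m y + m%:R) * th y * rho y)%:E.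
      by apply: integral_ge0 => y _; rewrite lee_fin.
    have I4 : 0 <= (delta + 1)%:E by rewrite lee_fin addr_ge0// ltW.
    rewrite (ge0_muleDr a I1 I2) (ge0_muleDr a I3 I4).
    rewrite -(naE _ mM psim0) -(naE (fun=> m%:R)%R)// integral_cst//.
    rewrite (integral_na_shift m%:R (mpsi m) (psiM m)) addeAC leeD2rE; last by rewrite fin_numM.
    move=> le1; apply: (@le_trans _ _ (\int[na]_y (psi m y)%:E + a * (delta + 1)%:E + B)).
      by rewrite leeD2r.
    by rewrite addeAC leeD2r//; exact: dual_parts (mpsi m) (psiM m) ep1.
  (* Where [th] vanishes, [g m] does not reach its intended limit; this null set is corrected so
     that monotone convergence holds everywhere. *)
  pose gt m y := if (0 < th y)%R then g m y else (entropy_fun (rho y) + rho y)%R.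
  have mgt m : measurable_fun [set: borel X] (gt m).
    by apply: measurable_fun_ifT => //; [exact: measurable_fun_ltr|exact: measurable_funD].
  have gt0 m y : (0 <= gt m y)%R.
    by rewrite /gt; case: ifP => // _; rewrite addr_ge0// entropy_fun_ge0.
  have gtE m : \int[mu]_y (g m y)%:E = \int[mu]_y (gt m y)%:E.
    apply: ge0_ae_eq_integral => //; [exact/measurable_EFinP|exact/measurable_EFinP| | |].
    - by move=> y _; rewrite lee_fin.
    - by move=> y _; rewrite lee_fin.
    have := @tau_gt0_finite mu (fun A _ h => h); apply: filterS => y /andP[t0 ty] _.
    by rewrite /gt fine_gt0// t0.
  have gcv : \int[mu]_y (g m y)%:E @[m --> \oo] --> \int[mu]_y (entropy_fun (rho y))%:E + 1.
    rewrite -irho -ge0_integralD//; last 3 first.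
    - by move=> y _; rewrite lee_fin entropy_fun_ge0.
    - exact/measurable_EFinP.
    - by move=> y _; rewrite lee_fin.
    rewrite (_ : (fun m => _) = (fun m => \int[mu]_y (gt m y)%:E)); last exact/funext.
    rewrite (_ : \int[mu]_y (_ + _) = \int[mu]_y limn (fun m => (gt m y)%:E)); last first.
      apply: eq_integral => y _; apply/esym/cvg_lim => //; apply: cvg_near_cst.
      rewrite /gt; have [thy|_] := ltP 0%R (th y); last by exact: nearW.
      have [rho_eq0|rho_neq0] := eqVneq (rho y) 0%R.
        apply: nearW => m; rewrite -EFinD; congr _%:E.
        by rewrite /g rho_eq0 mulr0 add0r !addr0 /entropy_fun mul0r add0r minxx.
      have rho_gt0 : (0 < rho y)%R by rewrite lt_neqAle eq_sym rho_neq0 rho0.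
      exists (Num.truncn ((entropy_fun (rho y) + rho y) / (th y * rho y))).+1 => // m /= tm.
      have le : (entropy_fun (rho y) + rho y <= (m%:R * th y + delta) * rho y + 1)%R.
        have : (entropy_fun (rho y) + rho y <= m%:R * (th y * rho y))%R.
          rewrite -ler_pdivrMr ?mulr_gt0//.
          by rewrite (le_trans (ltW (truncnS_gt _)))// ler_nat.
        have : (0 <= delta * rho y)%R by rewrite mulr_ge0// ltW.
        rewrite mulrDl mulrA; lra.
      by rewrite /g (min_l le).
    apply: cvg_monotone_convergence => //.
    - by move=> m; exact/measurable_EFinP.
    - by move=> m y _; rewrite lee_fin.
    - move=> y _ m n mn; rewrite lee_fin /gt; case: ifP => // _.
      by rewrite /g le_min !ge_min lexx/= lerD2r ler_wpM2r// ?orbT// lerD2r ler_wpM2r// ler_nat.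
  have Tcv : a * \int[mu]_y (g m y)%:E + B @[m --> \oo] -->
      a * (\int[mu]_y (entropy_fun (rho y))%:E + 1) + B.
    have afin : a \is a fin_num by rewrite ge0_fin_numE.
    apply: cvgeD; [|exact: (cvgeZl afin gcv)|exact: cvg_cst].
    apply: ge0_adde_def; rewrite inE// mule_ge0// adde_ge0//.
    by apply: integral_ge0 => y _; rewrite lee_fin entropy_fun_ge0.
  rewrite -(cvg_lim _ Tcv)//; apply: lime_le => //; apply/cvg_ex; eexists; exact: Tcv.
apply/lee_addgt0Pr => eps eps0.
have := key (eps / fine a)%R (divr_gt0 eps0 fa0).
have H0 : 0 <= \int[mu]_y (entropy_fun (rho y))%:E.
  by apply: integral_ge0 => y _; rewrite lee_fin entropy_fun_ge0.
rewrite (ge0_muleDr a H0 lee01) mule1 {2 3}af -EFinM (_ : (fine a * (eps / fine a + 1) = eps + fine a)%R); last first.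
  by field; rewrite gt_eqF.
by rewrite EFinD addeAC (addeA (dual_rate mu tau nu)) leeD2rE.
Qed.

End dual_lower_bound_rate.

(** * Change of law and the lower bound *)

Section bounded_measurable.
Context d (T : measurableType d) (R : realType).
Implicit Types f g : T -> R.
Local Notation "m `[ f ]" := ((\int[m]_(x in [set: T]) f x)%R)
  (at level 10, format "m `[ f ]").

Definition bounded_measurable f :=
  measurable_fun [set: T] f /\ exists M : R, forall y, (`|f y| <= M)%R.

Lemma bounded_measurable_cst (c : R) : bounded_measurable (fun=> c).
Proof. by split => //; exists `|c|%R. Qed.

Lemma bounded_measurableD f g : bounded_measurable f -> bounded_measurable g ->
  bounded_measurable (fun y => f y + g y)%R.
Proof.
move=> [mf [M fM]] [mg [L gL]]; split; first exact: measurable_funD.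
by exists (M + L)%R => y; rewrite (le_trans (ler_normD _ _))// lerD.
Qed.

Lemma bounded_measurableM f g : bounded_measurable f -> bounded_measurable g ->
  bounded_measurable (fun y => f y * g y)%R.
Proof.
move=> [mf [M fM]] [mg [L gL]]; split; first exact: measurable_funM.
by exists (M * L)%R => y; rewrite normrM ler_pM.
Qed.

Lemma bounded_measurableZ (c : R) f : bounded_measurable f ->
  bounded_measurable (fun y => c * f y)%R.
Proof. by apply: bounded_measurableM; exact: bounded_measurable_cst. Qed.

Lemma bounded_measurableB f g : bounded_measurable f -> bounded_measurable g ->
  bounded_measurable (fun y => f y - g y)%R.
Proof.
move=> bf /(bounded_measurableZ (-1)) bg.
by have := bounded_measurableD bf bg; under eq_fun do rewrite mulN1r.
Qed.

Lemma bounded_measurable_sum (I : Type) (s : seq I) (F : I -> T -> R) :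
  (forall i, bounded_measurable (F i)) -> bounded_measurable (fun y => \sum_(i <- s) F i y)%R.
Proof.
move=> bF; elim: s => [|i s IH].
  by under eq_fun do rewrite big_nil; exact: bounded_measurable_cst.
by under eq_fun do rewrite big_cons; exact: bounded_measurableD.
Qed.

Lemma measurable_ler_set f g : measurable_fun [set: T] f ->
  measurable_fun [set: T] g -> measurable [set y | (f y <= g y)%R].
Proof.
move=> mf mg; rewrite (_ : [set y | _] = ~` [set y | (g y < f y)%R]).
  by apply: measurableC; exact: measurable_ltr_set.
by apply/seteqP; split => y /=; rewrite leNgt => /negP.
Qed.

Variable m : {finite_measure set T -> \bar R}.

Lemma bounded_integrable f : bounded_measurable f -> m.-integrable [set: T] (EFin \o f).
Proof. by move=> [mf [M fM]]; exact: (integrable_bounded m mf fM). Qed.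

Lemma bounded_integralE f : bounded_measurable f -> \int[m]_y (f y)%:E = (m`[f])%:E.
Proof. by move=> bf; rewrite fineK//; apply: integrable_fin_num => //; exact: bounded_integrable. Qed.

Lemma bounded_integralD f g : bounded_measurable f -> bounded_measurable g ->
  m`[fun y => f y + g y]%R = (m`[f] + m`[g])%R.
Proof. by move=> /bounded_integrable bf /bounded_integrable bg; rewrite RintegralD. Qed.

Lemma bounded_integralZ (c : R) f : bounded_measurable f ->
  m`[fun y => c * f y]%R = (c * m`[f])%R.
Proof. by move=> /bounded_integrable bf; rewrite RintegralZl. Qed.

Lemma bounded_integralB f g : bounded_measurable f -> bounded_measurable g ->
  m`[fun y => f y - g y]%R = (m`[f] - m`[g])%R.
Proof. by move=> /bounded_integrable bf /bounded_integrable bg; rewrite RintegralB. Qed.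

Lemma bounded_integral_le f g : bounded_measurable f -> bounded_measurable g ->
  (forall y, f y <= g y)%R -> (m`[f] <= m`[g])%R.
Proof. by move=> /bounded_integrable bf /bounded_integrable bg fg; apply: le_Rintegral. Qed.

End bounded_measurable.

(** * Change of law on the first samples *)

Section tilting.
Context (R : realType) (X : completeMetricType R).
Variables (mu : probability (borel X) R).
Context d (Omega : measurableType d) (P : probability Omega R) (x : nat -> {RV P >-> borel X}).
Hypothesis x_iid : iid x mu.
Local Notation "m `[ f ]" := ((\int[m]_(x in [set: borel X]) f x)%R)
  (at level 10, format "m `[ f ]").

(** From [1 - z <= e^(-z)], [e^z] is at most [1 / (1 - z)]. *)
Lemma expR_le_quadratic (z : R) : (z <= 2^-1)%R -> (expR z <= 1 + z + 2 * z ^+ 2)%R.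
Proof.
move=> z2; have z1 : (0 < 1 - z)%R by lra.
have : (1 - z <= expR (- z))%R by have := expR_ge1Dx (- z)%R.
rewrite expRN -[leLHS]invrK lef_pV2 ?posrE ?expR_gt0 ?invr_gt0// => /le_trans; apply.
rewrite -div1r ler_pdivrMr// (_ : ((1 + z + 2 * z ^+ 2) * (1 - z) = 1 + z ^+ 2 * (1 - 2 * z))%R); last by ring.
by rewrite lerDl mulr_ge0 ?sqr_ge0//; lra.
Qed.

Lemma measurable_sample_sum (phi : borel X -> R) n : measurable_fun [set: borel X] phi ->
  measurable_fun [set: Omega] (fun w => \sum_(i < n) phi (x i w))%R.
Proof.
move=> mphi; apply: (@measurable_sum _ _ _ _ _ _ (fun (i : 'I_n) w => phi (x i w))) => i.
exact: measurableT_comp.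
Qed.

Variable q : borel X -> R.
Hypotheses (bq : bounded_measurable q) (q0 : forall y, (0 <= q y)%R) (q1 : mu`[q] = 1%R).

Let mq : measurable_fun [set: borel X] q. Proof. by have [] := bq. Qed.

Let D n w := (\prod_(i < n) q (x i w))%R.

Lemma tilt_measurable n : measurable_fun [set: Omega] (fun w => (D n w)%:E : \bar R).
Proof.
apply/measurable_EFinP; apply: (measurable_prod (h := fun (i : 'I_n) w => q (x i w))) => i _.
exact: measurableT_comp.
Qed.

Lemma tilt_ge0 n w : 0 <= (D n w)%:E.
Proof. by rewrite lee_fin prodr_ge0. Qed.

(** The law under which the first [n] samples are independent with density [q] with respect to
    [mu]. *)
Definition tilt n := mdensity P (tilt_measurable n) (tilt_ge0 n).

Lemma tilt_setT n : tilt n [set: Omega] = 1.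
Proof.
rewrite /tilt /mdensity/= (integral_prod_real x_iid (phi := fun=> q))//; last first.
  by move=> i; rewrite bounded_integralE// ltry.
by under eq_bigr do rewrite bounded_integralE//= q1; rewrite big_const_ord iter_mulr_1/= expr1n.
Qed.

(** Chernoff bound for a variable that is bounded and centred under [q]. The bound on [phi] is
    required only where [q] does not vanish, because [tau] and [ln q] are bounded only there. *)
Lemma tilt_chernoff (phi : borel X -> R) (L b : R) : measurable_fun [set: borel X] phi ->
  (forall y, q y != 0 -> `|phi y| <= L)%R -> mu`[fun y => q y * phi y]%R = 0%R -> (0 < b)%R ->
  exists g : R, (0 <= g < 1)%R /\
    forall n, tilt n [set w | (n%:R * b <= \sum_(i < n) phi (x i w))%R] <= (g ^+ n)%:E.
Proof.
move=> mphi phiL phi0 b0; pose B := (`|L| + b)%R.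
have B0 : (0 < B)%R by rewrite ltr_wpDl.
(* Chosen so that the quadratic bound on the mean of [e^(l (phi - b))], namely
   [1 - l b + 2 l^2 B^2], equals [1 - l b / 2]; moreover [l B <= 1/4] keeps the exponent where that
   bound is valid. *)
pose l := (b / (4 * B ^+ 2))%R.
have l0 : (0 < l)%R by rewrite divr_gt0// mulr_gt0// exprn_gt0.
have lB : (l * B <= 4^-1)%R.
  rewrite (_ : l * B = 4^-1 * (b / B))%R; last by rewrite /l; field; rewrite gt_eqF.
  by rewrite ler_piMr ?invr_ge0// ler_pdivrMr// mul1r lerDr.
pose psi y := (l * (phi y - b))%R.
pose e y := (q y * expR (psi y))%R.
have mpsi : measurable_fun [set: borel X] psi by apply: measurable_funM => //; exact: measurable_funB.
have psiB y : (q y != 0 -> psi y <= 4^-1 /\ psi y ^+ 2 <= l ^+ 2 * B ^+ 2)%R.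
  move=> /phiL; have := ler_norm L; rewrite ler_norml => LL /andP[p1 p2].
  have pB : (`|phi y - b| <= B)%R by rewrite ler_norml /B; lra.
  split.
    by apply: le_trans lB; rewrite /psi ler_pM2l// (le_trans (ler_norm _)).
  by rewrite /psi exprMn ler_pM2l ?exprn_gt0// -real_normK ?num_real// lerXn2r ?nnegrE// ltW.
have [_ [N qN]] := bq.
have be : bounded_measurable e.
  split; first by apply: measurable_funM => //; exact: measurableT_comp.
  exists (N * expR 1)%R => y; rewrite /e; have [->|qy] := eqVneq (q y) 0%R.
    by rewrite mul0r normr0 mulr_ge0 ?expR_ge0// (le_trans (normr_ge0 _) (qN point)).
  rewrite normrM ler_pM// ger0_norm ?expR_ge0// ler_expR.
  by have [+ _] := psiB y qy; lra.
have bqphi : bounded_measurable (fun y => q y * phi y)%R.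
  split; first exact: measurable_funM.
  exists (N * `|L|)%R => y; have [->|qy] := eqVneq (q y) 0%R.
    by rewrite mul0r normr0 mulr_ge0// (le_trans (normr_ge0 _) (qN point)).
  by rewrite normrM ler_pM// (le_trans (phiL y qy))// ler_norm.
pose g := (1 - l * b / 2)%R.
have lb1 : (0 < l * b <= 1)%R.
  rewrite mulr_gt0//= (le_trans (y := l * B)%R)//; last by lra.
  by rewrite ler_pM2l// lerDr.
have g01 : (0 <= g < 1)%R by rewrite /g; move: lb1 => /andP[? ?]; lra.
have eg : (mu`[e] <= g)%R.
  apply: (@le_trans _ _ (mu`[fun y => (1 - l * b + 2 * (l ^+ 2 * B ^+ 2)) * q y + l * (q y * phi y)]))%R.
    apply: bounded_integral_le => //.
      by apply: bounded_measurableD; exact: bounded_measurableZ.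
    move=> y; rewrite /e; have [->|qy] := eqVneq (q y) 0%R; first by rewrite !mul0r !mulr0 addr0.
    have [p1 p2] := psiB y qy; have p3 : (psi y <= 2^-1)%R by lra.
    have := ler_wpM2l (q0 y) (expR_le_quadratic p3).
    have := ler_wpM2l (q0 y) p2.
    have : (q y * psi y = l * (q y * phi y) - l * b * q y)%R by rewrite /psi; ring.
    lra.
  rewrite bounded_integralD; [|exact: bounded_measurableZ|exact: bounded_measurableZ].
  rewrite !bounded_integralZ// phi0 q1 mulr0 addr0 mulr1 /g.
  have : (l ^+ 2 * B ^+ 2 = l * b / 4)%R by rewrite /l; field; rewrite gt_eqF.
  lra.
exists g; split => // n; pose A := [set w | (n%:R * b <= \sum_(i < n) phi (x i w))%R].
have mA : measurable A.
  by apply: measurable_ler_set => //; exact: measurable_sample_sum.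
have mprod : measurable_fun [set: Omega] (fun w => (\prod_(i < n) e (x i w))%:E : \bar R).
  apply/measurable_EFinP; apply: (measurable_prod (h := fun (i : 'I_n) w => e (x i w))) => i _.
  by apply: measurableT_comp => //; case: be.
have e0 y : (0 <= e y)%R by rewrite mulr_ge0// expR_ge0.
apply: (@le_trans _ _ (\int[P]_(w in A) (\prod_(i < n) e (x i w))%:E)).
  apply: ge0_le_integral => //.
  - by move=> w _; exact: tilt_ge0.
  - by apply: measurable_funTS; exact: tilt_measurable.
  - exact: measurable_funTS.
  - move=> w /= Aw; rewrite lee_fin /e big_split/= ler_peMr ?prodr_ge0//.
    rewrite -expR_sum -expR0 ler_expR /psi -mulr_sumr mulr_ge0 ?(ltW l0)//.
    by rewrite sumrB sumr_const card_ord subr_ge0 -mulr_natl.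
apply: (@le_trans _ _ (\int[P]_w (\prod_(i < n) e (x i w))%:E)).
  by apply: ge0_subset_integral => // w _; rewrite lee_fin prodr_ge0.
rewrite (integral_prod_real x_iid (phi := fun=> e))//; last 2 first.
- by case: be.
- by move=> i; rewrite bounded_integralE// ltry.
rewrite bounded_integralE// big_const_ord iter_mulr_1/= lee_fin lerXn2r ?nnegrE//.
  by apply: fine_ge0; apply: integral_ge0 => y _; rewrite lee_fin.
by case/andP: g01.
Qed.

Lemma tilt_good_event (phi : nat -> borel X -> R) (L : nat -> R) (b eps : R) k :
  (forall j, measurable_fun [set: borel X] (phi j)) ->
  (forall j y, q y != 0 -> `|phi j y| <= L j)%R ->
  (forall j, mu`[fun y => q y * phi j y]%R = 0%R) -> (0 < b)%R -> (0 < eps)%R ->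
  exists n0 : nat, forall n, (n0 <= n)%N ->
    tilt n (\big[setU/set0]_(j < k) [set w | (n%:R * b <= \sum_(i < n) phi j (x i w))%R]) <= eps%:E.
Proof.
move=> mphi phiL phi0 b0; elim: k eps => [|k IH] eps eps0.
  by exists 0%N => n _; rewrite big_ord0 (_ : tilt n set0 = 0) ?lee_fin ?ltW//; exact: measure0.
have e20 : (0 < eps / 2)%R by rewrite divr_gt0.
have [n1 n1P] := IH _ e20.
have [g [/andP[g0 g1] gP]] := tilt_chernoff (mphi k) (phiL k) (phi0 k) b0.
have gcv : (g ^+ n @[n --> \oo] --> 0)%R by apply: cvg_expr; rewrite ger0_norm.
have /cvgr0Pnorm_lt/(_ _ e20)[n2 _ n2P] := gcv.
have mset n j : measurable [set w | (n%:R * b <= \sum_(i < n) phi j (x i w))%R].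
  by apply: measurable_ler_set => //; exact: measurable_sample_sum.
exists (maxn n1 n2) => n; rewrite geq_max => /andP[nn1 nn2].
rewrite big_ord_recr/=; apply: le_trans (measureU2 _ _ _) _ => //.
  by apply: bigsetU_measurable => j _.
rewrite (splitr eps) EFinD leeD//; first exact: n1P.
apply: le_trans (gP n) _; rewrite lee_fin ltW//.
by apply: le_lt_trans (n2P n nn2); rewrite ler_norm.
Qed.

End tilting.

(** * From sums over samples to time averages *)

Section renewal_deviation.
Context (R : realType) (X : completeMetricType R).
Variables (tau : X -> \bar R) (x : nat -> X) (th : nat -> R).
Hypotheses (tauE : forall i, tau (x i) = (th i)%:E) (th_gt0 : forall i, (0 < th i)%R).

(** Both terms are integrals of [f] along the renewal path, up to [t] and up to the end of the
    [n]-th interval; they differ by an integral of a function bounded by [M] over the times in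
    between. This replaces the random index [N] by a deterministic [n]. *)
Lemma empirical_deviation (f : borel X -> R) (M t : R) (N n : nat) : (0 < t)%R ->
  measurable_fun [set: borel X] f -> (forall y, `|f y| <= M)%R ->
  (\sum_(i < N) th i <= t <= \sum_(i < N.+1) th i)%R ->
  (`|t * \int[empirical tau x t]_(y in [set: borel X]) f y - \sum_(i < n) th i * f (x i)|
    <= M * `|t - \sum_(i < n) th i|)%R.
Proof.
move=> t0 mf fM StN; rewrite (Rintegral_empiricalE tauE th_gt0 t0 mf fM StN).
pose S k := (\sum_(i < k) th i)%R; pose G k := (\sum_(i < k) th i * f (x i))%R.
have SS k : S k.+1 = (S k + th k)%R by rewrite /S big_ord_recr.
have GS k : G k.+1 = (G k + th k * f (x k))%R by rewrite /G big_ord_recr.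
have fx k : (- M <= f (x k) <= M)%R by have := fM (x k); rewrite ler_norml.
have M0 : (0 <= M)%R by exact: le_trans (normr_ge0 _) (fM point).
have GL k l : (k <= l)%N -> (S k <= S l)%R /\ (`|G l - G k| <= M * (S l - S k))%R.
  elim: l => [|l IH].
    by rewrite leqn0 => /eqP ->; rewrite !subrr mulr0 normr0.
  rewrite leq_eqVlt => /orP[/eqP ->|]; first by rewrite !subrr mulr0 normr0.
  rewrite ltnS => /IH[le1 le2]; rewrite SS GS; have tl := th_gt0 l; split; first by lra.
  rewrite addrAC (le_trans (ler_normD _ _))// [leRHS](_ : _ = M * (S l - S k) + th l * M)%R; last by ring.
  by rewrite lerD// normrM gtr0_norm// ler_pM2l.
move: StN; rewrite -/(S N) -/(S N.+1) -/(S n) -/(G N) -/(G n) => /andP[St tS].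
have [nN|Nn] := leqP n N.
  have [le1 le2] := GL _ _ nN.
  rewrite [X in (_ <= M * X)%R]ger0_norm; last by lra.
  rewrite addrAC (le_trans (ler_normD _ _))//.
  rewrite [leRHS](_ : _ = M * (S N - S n) + (t - S N) * M)%R; last by ring.
  by rewrite lerD// normrM ger0_norm ?subr_ge0// ler_wpM2l ?subr_ge0.
have [le1 le2] := GL _ _ Nn.
rewrite [X in (_ <= M * X)%R]ler0_norm; last by lra.
rewrite (_ : _ - G n = - (G n - G N.+1) - (S N.+1 - t) * f (x N))%R; last by rewrite GS SS; ring.
rewrite (le_trans (ler_normB _ _))// normrN.
rewrite [leRHS](_ : _ = M * (S n - S N.+1) + (S N.+1 - t) * M)%R; last by ring.
by rewrite lerD// normrM ger0_norm ?subr_ge0// ler_wpM2l ?subr_ge0.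
Qed.

End renewal_deviation.

(** Here [S] and [G] are the sums of [tau] and [tau f] over [n] samples, [T] and [F] their means,
    [E] the time average. Replacing [t E] by [G], [G] by [n F] and [n F] by [t F / T] costs at most
    [n b (1 + M) + 2 M T]. The condition on [b] bounds the first term by [t delta / 2] since
    [n T <= t], and the lower bound on [t] does so for the second. *)
Lemma renewal_average_bound (R : realFieldType) (t n T S G F E M b delta : R) :
  (0 < T -> 0 < t -> 0 <= n -> 0 <= M -> 0 < delta -> n * T <= t -> t < n * T + T ->
  `|S - n * T| <= n * b -> `|G - n * F| <= n * b -> `|F| <= M * T ->
  `|t * E - G| <= M * `|t - S| -> b * (1 + M) <= delta * T / 2 -> 4 * M * T / delta < t ->
  `|E - F / T| < delta)%R.
Proof.
move=> T0 t0 n0 M0 d0 nT tnT dS dG FM dev bT tM'.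
rewrite -(ltr_pM2l t0) -{1}(gtr0_norm t0) -normrM.
have tS : (`|t - S| <= T + n * b)%R.
  by move: dS; rewrite !ler_norml => /andP[? ?]; apply/andP; split; lra.
have le1 : (`|t * E - G| <= M * (T + n * b))%R.
  by apply: le_trans dev _; rewrite ler_wpM2l.
have le2 : (`|n * F - t * (F / T)| <= M * T)%R.
  rewrite (_ : n * F - t * (F / T) = F * ((n * T - t) / T))%R; last by field; rewrite gt_eqF.
  rewrite normrM -[leRHS]mulr1 ler_pM//.
  rewrite normrM normfV (gtr0_norm T0) ler_pdivrMr// mul1r ler_norml.
  by apply/andP; split; lra.
have nbM : (n * (b * (1 + M)) <= t * delta / 2)%R.
  apply: (@le_trans _ _ (n * (delta * T / 2))%R); first by rewrite ler_wpM2l.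
  rewrite (_ : n * (delta * T / 2) = (n * T) * (delta / 2))%R; last by ring.
  by rewrite -[in leRHS]mulrA ler_wpM2r// divr_ge0// ltW.
have tM : (2 * (M * T) < t * delta / 2)%R.
  by move: tM'; rewrite ltr_pdivrMr//; lra.
rewrite mulrBr (_ : t * E - _ = (t * E - G) + (G - n * F) + (n * F - t * (F / T)))%R; last by ring.
rewrite (le_lt_trans (ler_normD _ _))// (le_lt_trans (y := M * (T + n * b) + n * b + M * T)%R)//.
  by rewrite lerD// (le_trans (ler_normD _ _))// lerD.
lra.
Qed.

(** * Lower bound for a truncated density *)

Section density_lower_bound.
Context (R : realType) (X : completeMetricType R).
Hypotheses (X_second_countable : @second_countable X)
  (X_locally_compact : locally_compact [set: X]).
Variables (mu : probability (borel X) R) (tau : borel X -> \bar R).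
Hypotheses (mtau : measurable_fun [set: borel X] tau)
  (tau_ge0 : forall x, 0 <= tau x)
  (tau_neq0 : mu [set x | tau x = 0] = 0)
  (tau_finite : mu [set x | tau x = +oo] = 0).
Context d (Omega : measurableType d) (P : probability Omega R) (x : nat -> {RV P >-> borel X}).
Hypothesis x_iid : iid x mu.
Local Notation "m `[ f ]" := ((\int[m]_(x in [set: borel X]) f x)%R)
  (at level 10, format "m `[ f ]").

Let th (y : borel X) : R := fine (tau y).
Let mth : measurable_fun [set: borel X] th. Proof. exact: measurable_fine_tau. Qed.
Let th_ge0 y : (0 <= th y)%R. Proof. exact: fine_ge0. Qed.

(** One constant controls [r] and [tau] from both sides, only where [r] does not vanish; this makes
    [r tau] and [r ln r] bounded, so that their integrals are real. *)
Definition truncated_density (N : R) (r : borel X -> R) :=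
  [/\ (0 < N)%R, measurable_fun [set: borel X] r, (forall y, 0 <= r y)%R &
      forall y, (r y != 0 -> (N^-1 <= r y <= N) /\ (N^-1 <= th y <= N))%R].

Lemma truncated_bounded N r : truncated_density N r -> bounded_measurable r.
Proof.
move=> [N0 mr r0 rN]; split => //; exists N => y; rewrite ger0_norm//.
by have [->|/rN[/andP[]]] := eqVneq (r y) 0%R; first exact: ltW.
Qed.

Lemma truncated_boundedM N r (h : borel X -> R) (L : R) : truncated_density N r ->
  measurable_fun [set: borel X] h -> (forall y, r y != 0 -> `|h y| <= L)%R ->
  bounded_measurable (fun y => r y * h y)%R.
Proof.
move=> [N0 mr r0 rN] mh hL; split; first exact: measurable_funM.
exists (N * `|L|)%R => y; have [->|ry] := eqVneq (r y) 0%R.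
  by rewrite mul0r normr0 mulr_ge0// ltW.
rewrite normrM ler_pM// ?(le_trans (hL y ry)) ?ler_norm//.
by rewrite ger0_norm//; have [/andP[]] := rN y ry.
Qed.

Lemma truncated_tau N r y : truncated_density N r -> (r y != 0 -> `|th y| <= N)%R.
Proof. by move=> [_ _ _ rN] /rN[_ /andP[_]]; rewrite ger0_norm. Qed.

Lemma truncated_ln N r y : truncated_density N r -> (r y != 0 -> `|ln (r y)| <= `|ln N|)%R.
Proof.
move=> [N0 _ r0 rN] ry; have [/andP[r1 r2] _] := rN y ry.
have ry0 : (0 < r y)%R by rewrite lt_neqAle eq_sym ry r0.
have := ler_norm (ln N); have : (ln (r y) <= ln N)%R by rewrite ler_ln ?posrE.
have : (- ln N <= ln (r y))%R by rewrite -lnV ?posrE// ler_ln ?posrE ?invr_gt0.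
have := ler_norm (- ln N)%R; rewrite normrN ler_norml; lra.
Qed.

Variables (q : borel X -> R) (N : R).
Hypotheses (qN : truncated_density N q) (q1 : mu`[q] = 1%R).

Let T := mu`[fun y => q y * th y]%R.
Let H := mu`[fun y => q y * ln (q y)]%R.
Let bq : bounded_measurable q := truncated_bounded qN.
Let q0 y : (0 <= q y)%R. Proof. by case: qN. Qed.
Let mq : measurable_fun [set: borel X] q. Proof. by case: qN. Qed.
Let bqth : bounded_measurable (fun y => q y * th y)%R.
Proof. by apply: (truncated_boundedM qN mth (L := N)) => y; exact: truncated_tau. Qed.
Let mlnq : measurable_fun [set: borel X] (fun y => ln (q y)).
Proof. by apply: measurableT_comp => //; exact: measurable_ln. Qed.
Let bqln : bounded_measurable (fun y => q y * ln (q y))%R.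
Proof. by apply: (truncated_boundedM qN mlnq (L := `|ln N|%R)) => y; exact: truncated_ln. Qed.

Lemma mean_time_gt0 : (0 < T)%R.
Proof.
have [N0 _ _ qth] := qN; apply: (@lt_le_trans _ _ (N^-1)%R); first by rewrite invr_gt0.
rewrite -[leLHS]mulr1 -q1 -bounded_integralZ//; apply: bounded_integral_le => //.
  exact: bounded_measurableZ.
move=> y; rewrite mulrC; have [->|qy] := eqVneq (q y) 0%R; first by rewrite !mul0r.
by rewrite ler_wpM2l//; have [_ /andP[]] := qth y qy.
Qed.

Lemma relative_entropy_ge0 : (0 <= H)%R.
Proof.
have -> : 0%R = mu`[fun y => q y - 1]%R.
  rewrite bounded_integralB//; last exact: bounded_measurable_cst.
  by rewrite q1 Rintegral_cst// [X in fine X]probability_setT mulr1 subrr.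
apply: bounded_integral_le => //.
  by apply: bounded_measurableB => //; exact: bounded_measurable_cst.
by move=> y; have := entropy_fun_ge0 (q0 y); rewrite /entropy_fun; lra.
Qed.

(** Take [n] close to [t / T], with [T] the mean of [tau] under [q]. Under the law tilted on [n]
    samples, the complement of [bad] has probability at least 1/2. There the density of the tilted
    law is at most [e^(n (H + b))], which bounds the original probability from below, and the
    renewal path is controlled deterministically, whatever the later samples are. *)
Lemma lower_bound_density (f : nat -> borel X -> R) (M delta eps : R) k :
  (forall j, measurable_fun [set: borel X] (f j)) -> (forall j y, `|f j y| <= M)%R ->
  (0 < delta)%R -> (0 < eps)%R ->
  exists T0 : R, forall t, (T0 <= t)%R -> forall U : set (M1 X),
    measurable (U : set (borel (M1 X))) ->
    (forall nu' : M1 X, (forall j, (j < k)%N ->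
       `|nu'`[f j] - mu`[fun y => q y * (th y * f j y)] / T| < delta)%R -> U nu') ->
    (expR (- (t * (H / T + eps))))%:E <= P (empirical_rv tau x t @^-1` U).
Proof.
move=> mf fM d0 e0; have T0 := mean_time_gt0; have H0 := relative_entropy_ge0.
have M0 : (0 <= M)%R by exact: le_trans (normr_ge0 _) (fM 0%N point).
have N0 : (0 < N)%R by case: qN.
(* The constant 1, placed at the index [k], adds the constraint that the [n]-th renewal time is
   close to [n T]. *)
pose f' j := if (j < k)%N then f j else fun=> 1%R.
have mf' j : measurable_fun [set: borel X] (f' j) by rewrite /f'; case: ifP.
have f'M j y : (`|f' j y| <= M + 1)%R.
  by rewrite /f'; case: ifP => _; [rewrite (le_trans (fM j y))// lerDl|rewrite normr1 lerDr].
have thf'M j y : (q y != 0 -> `|th y * f' j y| <= N * (M + 1))%R.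
  by move=> qy; rewrite normrM ler_pM//; exact: truncated_tau qN qy.
have mthf' j : measurable_fun [set: borel X] (fun y => th y * f' j y)%R by exact: measurable_funM.
have bF j : bounded_measurable (fun y => q y * (th y * f' j y))%R.
  exact: (truncated_boundedM qN (mthf' j) (thf'M j)).
pose F j := mu`[fun y => q y * (th y * f' j y)]%R.
have FM j : (j < k)%N -> (`|F j| <= M * T)%R.
  move=> jk; rewrite ler_norml -mulNr -!bounded_integralZ//; apply/andP; split.
    apply: bounded_integral_le => //; first exact: bounded_measurableZ.
    move=> y; rewrite /f' jk (_ : q y * (th y * f j y) = f j y * (q y * th y))%R; last by ring.
    rewrite ler_wpM2r ?mulr_ge0//.
    by have := fM j y; rewrite ler_norml => /andP[].
  apply: bounded_integral_le => //; first exact: bounded_measurableZ.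
  move=> y; rewrite /f' jk (_ : q y * (th y * f j y) = f j y * (q y * th y))%R; last by ring.
  rewrite ler_wpM2r ?mulr_ge0//.
  by have := fM j y; rewrite ler_norml => /andP[].
(* The first bound is the one required by [renewal_average_bound]; the second keeps the extra cost
   [b / T] below [eps / 2]. *)
pose b := Num.min (delta * T / (2 * (1 + M)))%R (eps * T / 2)%R.
have M1 : (0 < 1 + M)%R by rewrite ltr_wpDr.
have b0 : (0 < b)%R by rewrite lt_min !divr_gt0// ?mulr_gt0.
have centred (h : borel X -> R) : bounded_measurable (fun y => q y * h y)%R ->
    mu`[fun y => q y * (h y - mu`[fun y => q y * h y])]%R = 0%R.
  move=> bh; under eq_Rintegral do rewrite mulrBr [X in (_ - X)%R]mulrC.
  rewrite bounded_integralB//; last exact: bounded_measurableZ.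
  by rewrite bounded_integralZ// q1 mulr1 subrr.
have centredN (h : borel X -> R) : bounded_measurable (fun y => q y * h y)%R ->
    mu`[fun y => q y * (mu`[fun y => q y * h y] - h y)]%R = 0%R.
  move=> bh; under eq_Rintegral do rewrite mulrBr [X in (X - _)%R]mulrC.
  rewrite bounded_integralB//; last exact: bounded_measurableZ.
  by rewrite bounded_integralZ// q1 mulr1 subrr.
(* Three families of bad events, of tilted probability at most 1/6 each, leave a good event of
   probability at least 1/2. *)
have e60 : (0 < 6^-1 :> R)%R by rewrite invr_gt0.
have m1 j : measurable_fun [set: borel X] (fun y => th y * f' j y - F j)%R by exact: measurable_funB.
have m2 j : measurable_fun [set: borel X] (fun y => F j - th y * f' j y)%R by exact: measurable_funB.
have m3 (j : nat) : measurable_fun [set: borel X] (fun y => ln (q y) - H)%R by exact: measurable_funB.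
have l1 j y : (q y != 0 -> `|th y * f' j y - F j| <= N * (M + 1) + `|F j|)%R.
  by move=> qy; rewrite (le_trans (ler_normB _ _))// lerD2r thf'M.
have l2 j y : (q y != 0 -> `|F j - th y * f' j y| <= N * (M + 1) + `|F j|)%R.
  by move=> qy; rewrite distrC l1.
have l3 (j : nat) y : (q y != 0 -> `|ln (q y) - H| <= `|ln N| + `|H|)%R.
  by move=> qy; rewrite (le_trans (ler_normB _ _))// lerD2r; exact: truncated_ln qN qy.
have [n1 n1P] := tilt_good_event x_iid bq q0 q1 k.+1 m1 l1 (fun j => centred _ (bF j)) b0 e60.
have [n2 n2P] := tilt_good_event x_iid bq q0 q1 k.+1 m2 l2 (fun j => centredN _ (bF j)) b0 e60.
have [n3 n3P] := tilt_good_event x_iid bq q0 q1 1 m3 l3 (fun j => centred _ bqln) b0 e60.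
pose n0 := maxn n1 (maxn n2 n3).
(* The first threshold makes [n] large enough for the three tail bounds, the second is the one of
   [renewal_average_bound], and the third gives [t eps / 2 >= 1], which absorbs the factor 1/2
   because [1/2 >= e^(-1)]. *)
exists (Num.max (n0%:R * T) (Num.max (4 * M * T / delta + 1) (2 / eps)))%R => t.
rewrite !ge_max => /and3P[tn0 tMT teps] U mU Uf.
have t0 : (0 < t)%R by apply: lt_le_trans teps; rewrite divr_gt0.
pose n := Num.truncn (t / T).
have /andP[nle nlt] : (n%:R <= t / T < n.+1%:R)%R by apply: truncn_itv; rewrite divr_ge0// ltW.
have n0n : (n0 <= n)%N.
  by rewrite -ltnS -(ltr_nat R); apply: le_lt_trans nlt; rewrite ler_pdivlMr.
move: (n0n); rewrite /n0 !geq_max => /and3P[n1n n2n n3n].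
pose bad1 := \big[setU/set0]_(j < k.+1) [set w | (n%:R * b <= \sum_(i < n) (th (x i w) * f' j (x i w) - F j))%R].
pose bad2 := \big[setU/set0]_(j < k.+1) [set w | (n%:R * b <= \sum_(i < n) (F j - th (x i w) * f' j (x i w)))%R].
pose bad3 := \big[setU/set0]_(j < 1) [set w | (n%:R * b <= \sum_(i < n) (ln (q (x i w)) - H))%R].
pose bad := bad1 `|` (bad2 `|` bad3).
have mbad1 : measurable bad1.
  apply: bigsetU_measurable => j _; apply: measurable_ler_set => //.
  exact: (measurable_sample_sum x n (m1 j)).
have mbad2 : measurable bad2.
  apply: bigsetU_measurable => j _; apply: measurable_ler_set => //.
  exact: (measurable_sample_sum x n (m2 j)).
have mbad3 : measurable bad3.
  apply: bigsetU_measurable => j _; apply: measurable_ler_set => //.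
  exact: (measurable_sample_sum x n (m3 j)).
have mbad : measurable bad by apply: measurableU => //; exact: measurableU.
pose Q := tilt x bq q0 n.
have Qbad : Q bad <= (2^-1)%:E.
  apply: le_trans (measureU2 _ _ _) _ => //; first exact: measurableU.
  rewrite (_ : 2^-1 = 6^-1 + (6^-1 + 6^-1))%R; last by field.
  rewrite EFinD leeD//; first exact: n1P.
  apply: le_trans (measureU2 _ _ _) _ => //.
  by rewrite EFinD leeD//; [exact: n2P|exact: n3P].
have Qgood : (2^-1)%:E <= Q (~` bad).
  rewrite -(leeD2lE (x := (2^-1)%:E))//; apply: (@le_trans _ _ (Q bad + Q (~` bad))).
    rewrite -measureU//; [|exact: measurableC|by rewrite setICr].
    by rewrite setUv [leRHS](tilt_setT x_iid bq q0 q1) -EFinD lee_fin -div1r -splitr.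
  by rewrite leeD2r.
have nb1 w : (~` bad) w -> forall j, (j < k.+1)%N ->
    (\sum_(i < n) (th (x i w) * f' j (x i w) - F j) < n%:R * b)%R.
  move=> nbad j jk; rewrite ltNge; apply/negP => h; apply: nbad; left.
  rewrite /bad1 -(@bigcup_mkord _ k.+1 (fun j => [set w | (n%:R * b <= \sum_(i < n) (th (x i w) * f' j (x i w) - F j))%R])).
  by exists j.
have nb2 w : (~` bad) w -> forall j, (j < k.+1)%N ->
    (\sum_(i < n) (F j - th (x i w) * f' j (x i w)) < n%:R * b)%R.
  move=> nbad j jk; rewrite ltNge; apply/negP => h; apply: nbad; right; left.
  rewrite /bad2 -(@bigcup_mkord _ k.+1 (fun j => [set w | (n%:R * b <= \sum_(i < n) (F j - th (x i w) * f' j (x i w)))%R])).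
  by exists j.
have nb w : (~` bad) w -> forall j, (j < k.+1)%N ->
    (`|\sum_(i < n) th (x i w) * f' j (x i w) - n%:R * F j| <= n%:R * b)%R.
  move=> nbad j jk; have := nb1 w nbad j jk; have := nb2 w nbad j jk.
  rewrite !sumrB sumr_const card_ord -[(F j *+ n)%R]mulr_natl ler_norml => h2 h1.
  by apply/andP; split; [rewrite -opprB lerN2 ltW|exact: ltW].
have goodP : Q (~` bad) <= (expR (n%:R * (H + b)))%:E * P (~` bad).
  have mbadC : measurable (~` bad) by exact: measurableC.
  rewrite -[leRHS]integral_cst//; apply: ge0_le_integral => //.
  - by move=> w _; rewrite lee_fin prodr_ge0.
  - by apply: measurable_funTS; exact: (tilt_measurable x bq n).
  - move=> w nbad; rewrite lee_fin; apply: (@le_trans _ _ (\prod_(i < n) expR (ln (q (x i w))))%R).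
      apply: ler_prod => i _; rewrite q0/=; have := q0 (x i w).
      by rewrite le_eqVlt => /orP[/eqP <-|qi]; [exact: expR_ge0|rewrite lnK].
    rewrite -expR_sum ler_expR mulrDr.
    have : (\sum_(i < n) (ln (q (x i w)) - H) < n%:R * b)%R.
      rewrite ltNge; apply/negP => h; apply: nbad; right; right.
      by rewrite /bad3 big_ord1.
    by rewrite sumrB sumr_const card_ord -[(H *+ n)%R]mulr_natl ltrBlDl => /ltW.
have bT : (b * (1 + M) <= delta * T / 2)%R.
  rewrite -ler_pdivlMr//; apply: (@le_trans _ _ (delta * T / (2 * (1 + M)))%R).
    by rewrite /b ge_min lexx.
  by rewrite le_eqVlt; apply/orP; left; apply/eqP; field; rewrite gt_eqF.
have nT : (n%:R * T <= t)%R by rewrite -ler_pdivlMr.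
have tnT : (t < n%:R * T + T)%R.
  by move: nlt; rewrite ltr_pdivrMr// -[n.+1%:R]natr1 mulrDl mul1r.
have sub : ~` bad `&` good_sample tau x `<=` empirical_rv tau x t @^-1` U.
  move=> w [nbad Gw]; apply: Uf => j jk.
  have [N' SN] := good_sample_renewal tau_ge0 Gw t0.
  have SN' : (\sum_(i < N') th (x i w) <= t <= \sum_(i < N'.+1) th (x i w))%R.
    by case/andP: SN => /ltW -> ->.
  have dev := empirical_deviation (fun i => good_sample_tauE tau_ge0 i Gw)
    (fun i => good_sample_gt0 i Gw) n t0 (mf j) (fM j) SN'.
  have f'j : f' j = f j by rewrite /f' jk.
  have f'k : f' k = fun=> 1%R by rewrite /f' ltnn.
  have FkT : F k = T by rewrite /F f'k; apply: eq_Rintegral => y _; rewrite mulr1.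
  have := nb w nbad k (ltnSn k); rewrite f'k FkT.
  under eq_bigr do rewrite mulr1.
  have := nb w nbad j (ltnW jk); rewrite f'j.
  have FjE : F j = mu`[fun y => q y * (th y * f j y)]%R by rewrite /F f'j.
  rewrite -FjE; move: dev; set E := (\int[_]_(_ in _) _)%R.
  move=> dev dG dS; apply: (renewal_average_bound T0 t0 _ M0 d0 nT tnT dS dG (FM j jk) dev bT) => //.
  by apply: lt_le_trans tMT; rewrite ltrDl.
have mU' : measurable (empirical_rv tau x t @^-1` U) by exact: measurable_preimage_empirical.
have mG : measurable (good_sample tau x) by exact: measurable_good_sample.
have mbadC : measurable (~` bad) by exact: measurableC.
apply: (@le_trans _ _ (P (~` bad))); last first.
  rewrite (good_sample_ae mtau tau_ge0 tau_neq0 tau_finite x_iid mbadC).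
  by apply: le_measure; rewrite ?inE//; exact: measurableI.
have pE : P (~` bad) = (fine (P (~` bad)))%:E by rewrite fineK// fin_num_measure.
have := le_trans Qgood goodP; rewrite pE -EFinM !lee_fin; set p := fine _ => lep.
have p0 : (expR (- (n%:R * (H + b))) * 2^-1 <= p)%R.
  by rewrite expRN ler_pdivrMl ?expR_gt0.
apply: le_trans p0; apply: (@le_trans _ _ (expR (- (n%:R * (H + b))) * expR (- 1)))%R.
  rewrite -expRD ler_expR -opprD lerN2.
  have le1 : (n%:R * (H + b) <= t / T * (H + b))%R by rewrite ler_wpM2r// addr_ge0// ltW.
  have le2 : (t / T * b <= t * (eps / 2))%R.
    rewrite -mulrA ler_pM2l// mulrC ler_pdivrMr//.
    have -> : (eps / 2 * T = eps * T / 2)%R by ring.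
    by rewrite /b ge_min lexx orbT.
  have le3 : (1 <= t * (eps / 2))%R.
    by move: teps; rewrite ler_pdivrMr// => h; rewrite mulrA ler_pdivlMr// mul1r.
  rewrite (_ : t * (H / T + eps) = t / T * H + (t * (eps / 2) + t * (eps / 2)))%R; last by field; rewrite gt_eqF.
  by rewrite addrA lerD// (le_trans le1)// mulrDr lerD2l.
rewrite ler_pM2l ?expR_gt0// expRN lef_pV2 ?posrE ?expR_gt0//.
exact: expR_ge1Dx.
Qed.

End density_lower_bound.

(** * Measures reachable at a given cost *)

Section entropy_perspective.
Context (R : realType).

Lemma entropy_perspective (a r : R) : (0 < a -> 0 <= r ->
  a * entropy_fun (r / a) = r * ln r - r * ln a - r + a)%R.
Proof.
move=> a0; rewrite le_eqVlt /entropy_fun => /orP[/eqP <-|r0]; first by rewrite !mul0r; ring.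
by rewrite ln_div ?posrE//; field; rewrite gt_eqF.
Qed.

(* Convexity of the entropy function in homogeneous form, by comparison with the tangent at
   [(r1 + r2) / (a1 + a2)]. *)
Lemma entropy_perspective_add (a1 a2 r1 r2 : R) :
  (0 < a1 -> 0 < a2 -> 0 <= r1 -> 0 <= r2 ->
  (a1 + a2) * entropy_fun ((r1 + r2) / (a1 + a2)) <=
    a1 * entropy_fun (r1 / a1) + a2 * entropy_fun (r2 / a2))%R.
Proof.
move=> a10 a20 r10 r20.
have a0 : (0 < a1 + a2)%R by rewrite addr_gt0.
have [r_eq0|r_neq0] := eqVneq (r1 + r2)%R 0%R.
  have -> : r1 = 0%R by lra.
  have -> : r2 = 0%R by lra.
  by rewrite addr0 !mul0r /entropy_fun !mul0r; lra.
have r0 : (0 < r1 + r2)%R by rewrite lt_neqAle eq_sym r_neq0 addr_ge0.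
pose z := ((r1 + r2) / (a1 + a2))%R; have z0 : (0 < z)%R by rewrite divr_gt0.
have tangent (a r : R) : (0 < a -> 0 <= r ->
    r * ln z + a - a * z <= a * entropy_fun (r / a))%R.
  move=> aa rr; have /entropy_fun_ge0 : (0 <= r / (a * z))%R.
    by rewrite divr_ge0// mulr_ge0// ltW.
  move=> /(ler_wpM2l (ltW (mulr_gt0 aa z0))); rewrite mulr0.
  rewrite (entropy_perspective (mulr_gt0 aa z0) rr) (entropy_perspective aa rr) lnM ?posrE//.
  by lra.
have := tangent _ _ a10 r10; have := tangent _ _ a20 r20.
have := entropy_perspective a0 (ltW r0); rewrite -/z => ->.
have lnz : (ln z = ln (r1 + r2) - ln (a1 + a2))%R by rewrite ln_div ?posrE.
have za : ((a1 + a2) * z = r1 + r2)%R by rewrite /z mulrC divfK ?gt_eqF.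
rewrite lnz; lra.
Qed.

End entropy_perspective.

(** * Superposition of densities and of their costs *)

Section reachable.
Context (R : realType) (X : completeMetricType R).
Variables (mu : probability (borel X) R) (tau : borel X -> \bar R).
Hypotheses (mtau : measurable_fun [set: borel X] tau)
  (tau_ge0 : forall x, 0 <= tau x).
Local Notation "m `[ f ]" := ((\int[m]_(x in [set: borel X]) f x)%R)
  (at level 10, format "m `[ f ]").

Let th (y : borel X) : R := fine (tau y).
Let mth : measurable_fun [set: borel X] th. Proof. exact: measurable_fine_tau. Qed.
Let th_ge0 y : (0 <= th y)%R. Proof. exact: fine_ge0. Qed.

Lemma truncated_tau_bounded N r : truncated_density tau N r ->
  bounded_measurable (fun y => r y * th y)%R.
Proof. by move=> rN; apply: (truncated_boundedM rN mth (L := N)) => y; exact: truncated_tau. Qed.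

Lemma truncated_ln_bounded N r : truncated_density tau N r ->
  bounded_measurable (fun y => r y * ln (r y))%R.
Proof.
move=> rN; have [_ mr _ _] := rN.
have mln : measurable_fun [set: borel X] (fun y => ln (r y)).
  by apply: measurableT_comp => //; exact: measurable_ln.
exact: (truncated_boundedM rN mln (fun y => @truncated_ln R X tau N r y rN)).
Qed.

Lemma truncated_scale N r (c : R) : (0 < c)%R -> truncated_density tau N r ->
  exists N', truncated_density tau N' (fun y => c * r y)%R.
Proof.
move=> c0 [N0 mr r0 rN]; have ci0 : (0 < c^-1)%R by rewrite invr_gt0.
exists (N * (c + c^-1 + 1))%R; have s0 : (0 < c + c^-1 + 1)%R by rewrite !addr_gt0.
have N'0 : (0 < N * (c + c^-1 + 1))%R by rewrite mulr_gt0.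
split => //; [exact: measurable_funM|by move=> y; rewrite mulr_ge0// ltW|].
move=> y; rewrite mulf_eq0 negb_or => /andP[_ /rN[/andP[r1 r2] /andP[t1 t2]]].
have NN' : (N <= N * (c + c^-1 + 1))%R by rewrite ler_peMr ?(ltW N0)// lerDr ltW// addr_gt0.
split; apply/andP; split.
- apply: (@le_trans _ _ (c * N^-1)%R); last by rewrite ler_pM2l.
  rewrite invfM mulrC ler_pM2r ?invr_gt0// -[leRHS]invrK lef_pV2 ?posrE//.
  by lra.
- by rewrite mulrC; apply: ler_pM => //; [exact: ltW|lra].
- by apply: le_trans t1; rewrite lef_pV2 ?posrE.
- exact: le_trans t2 NN'.
Qed.

(** The parameter [a] stands for the number of renewals per unit of time and is left free, so that
    the costs of two densities add when their rates do. *)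
Definition entropy_cost (a : R) (r : borel X -> R) := mu`[fun y => a * entropy_fun (r y / a)]%R.

Lemma entropy_cost_bounded N r a : (0 < a)%R -> truncated_density tau N r ->
  bounded_measurable (fun y => a * entropy_fun (r y / a))%R.
Proof.
move=> a0 rN; have [_ _ r0 _] := rN; under eq_fun do rewrite entropy_perspective//.
have br := truncated_bounded rN.
apply: bounded_measurableD; last exact: bounded_measurable_cst.
apply: bounded_measurableB => //; apply: bounded_measurableB; first exact: truncated_ln_bounded rN.
by under eq_fun do rewrite mulrC; exact: bounded_measurableZ.
Qed.

(** The difference of the two sides is [a * entropy_fun (m / a)], which is nonnegative: the rate
    [a = m] is optimal and gives the entropy of the normalised density times the renewal rate. *)
Lemma entropy_cost_ge N r a (m := mu`[r]) : (0 < a)%R -> (0 < m)%R -> truncated_density tau N r ->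
  (m * mu`[fun y => (m^-1 * r y) * ln (m^-1 * r y)] <= entropy_cost a r)%R.
Proof.
move=> a0 m0 rN; have [_ _ r0 _] := rN; have br := truncated_bounded rN.
have brln := truncated_ln_bounded rN.
have mi0 : (0 < m^-1)%R by rewrite invr_gt0.
have eq1 y : (m^-1 * r y * ln (m^-1 * r y) = m^-1 * (r y * ln (r y) + (- ln m) * r y))%R.
  have := r0 y; rewrite le_eqVlt => /orP[/eqP <-|ry]; first by rewrite !(mulr0, mul0r, addr0).
  by rewrite lnM ?posrE// lnV ?posrE//; ring.
under eq_Rintegral do rewrite eq1.
rewrite bounded_integralZ; last by apply: bounded_measurableD => //; exact: bounded_measurableZ.
rewrite mulVKf ?gt_eqF// bounded_integralD//; last exact: bounded_measurableZ.
rewrite bounded_integralZ// -/m /entropy_cost.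
have eq2 y : (a * entropy_fun (r y / a) = r y * ln (r y) + (- ln a - 1) * r y + a)%R.
  by rewrite entropy_perspective//; ring.
rewrite [leRHS](_ : _ = mu`[fun y => r y * ln (r y) + (- ln a - 1) * r y + a]%R); last first.
  by apply: eq_Rintegral => y _; exact: eq2.
rewrite bounded_integralD; last exact: bounded_measurable_cst.
  rewrite bounded_integralD//; last exact: bounded_measurableZ.
  rewrite bounded_integralZ// -/m Rintegral_cst// [X in fine X]probability_setT mulr1.
  have := entropy_fun_ge0 (ltW (divr_gt0 m0 a0)) => /(ler_wpM2l (ltW a0)).
  by rewrite (entropy_perspective a0 (ltW m0)); lra.
by apply: bounded_measurableD => //; exact: bounded_measurableZ.
Qed.

Variables (f : nat -> borel X -> R) (M : R) (k : nat).
Hypotheses (mf : forall j, measurable_fun [set: borel X] (f j)) (fM : forall j y, (`|f j y| <= M)%R).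

Let M0 : (0 <= M)%R. Proof. exact: le_trans (normr_ge0 _) (fM 0%N point). Qed.

Lemma truncated_test_bounded N r j : truncated_density tau N r ->
  bounded_measurable (fun y => r y * (th y * f j y))%R.
Proof.
move=> rN; have mthf : measurable_fun [set: borel X] (fun y => th y * f j y)%R by exact: measurable_funM.
apply: (truncated_boundedM rN mthf (L := N * M)%R) => y ry.
by rewrite normrM ler_pM//; exact: truncated_tau rN ry.
Qed.

(* The measure of mass [p] giving to the test functions [f j] the integrals [v j] is, up to the
   error [e], the occupation measure [r tau mu] of the tilted density [r], at cost [C]. *)
Definition reachable (e p : R) (v : nat -> R) (C : R) := exists N r a,
  [/\ truncated_density tau N r, (0 < a)%R, (`|mu`[fun y => r y * th y]%R - p| <= e)%R,
      (forall j, (j < k)%N -> `|mu`[fun y => r y * (th y * f j y)]%R - v j| <= e)%R &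
      (entropy_cost a r <= C + e)%R].

Lemma reachable_weaken e e' p v v' C : (e <= e')%R -> reachable e p v C ->
  (forall j, (j < k)%N -> `|v j - v' j| <= e' - e)%R -> reachable e' p v' C.
Proof.
move=> ee' [N [r [a [rN a0 rp rv rC]]]] vv'; exists N, r, a; split => //.
- exact: le_trans ee'.
- move=> j jk; rewrite -(subrKA (v j)) (le_trans (ler_normD _ _))//.
  by have := rv j jk; have := vv' j jk; lra.
- by rewrite (le_trans rC)// lerD2l.
Qed.

(** The zero density costs [a], because [entropy_fun 0 = 1]; the rate must be positive and is taken
    equal to [e]. *)
Lemma reachable_zero e : (0 < e)%R -> reachable e 0 (fun=> 0%R) 0.
Proof.
move=> e0; exists 1%R, (fun=> 0%R), e.
have int0 (h : borel X -> R) : mu`[fun y => 0 * h y]%R = 0%R.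
  by under eq_Rintegral do rewrite mul0r; rewrite Rintegral_cst// mul0r.
split => //.
- by split => //; move=> y; rewrite eqxx.
- by rewrite int0 subrr normr0 ltW.
- by move=> j _; rewrite int0 subrr normr0 ltW.
- rewrite /entropy_cost; under eq_Rintegral do rewrite mul0r /entropy_fun mul0r add0r mulr1.
  by rewrite Rintegral_cst// [X in fine X]probability_setT mulr1 add0r.
Qed.

Lemma reachable_add e1 e2 p1 p2 v1 v2 C1 C2 : reachable e1 p1 v1 C1 -> reachable e2 p2 v2 C2 ->
  reachable (e1 + e2) (p1 + p2) (fun j => v1 j + v2 j)%R (C1 + C2).
Proof.
move=> [N1 [r1 [a1 [rN1 a10 rp1 rv1 rC1]]]] [N2 [r2 [a2 [rN2 a20 rp2 rv2 rC2]]]].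
have [N10 mr1 r10 r1N] := rN1; have [N20 mr2 r20 r2N] := rN2.
have rN : truncated_density tau (N1 + N2)%R (fun y => r1 y + r2 y)%R.
  have sum (A B z : R) : (0 < A -> 0 < B -> A^-1 <= z <= A -> (A + B)^-1 <= z <= A + B)%R.
    move=> A0 B0 /andP[z1 z2]; apply/andP; split; last by lra.
    by apply: le_trans z1; rewrite lef_pV2 ?posrE ?addr_gt0// lerDl ltW.
  split; [exact: addr_gt0|exact: measurable_funD|by move=> y; rewrite addr_ge0|].
  have upper r N y : truncated_density tau N r -> (r y <= N)%R.
    move=> [N0 _ _ rN]; have [->|/rN[/andP[]]//] := eqVneq (r y) 0%R; exact: ltW.
  move=> y ry; have [r1y|r1y] := eqVneq (r1 y) 0%R.
    have r2y : r2 y != 0%R by move: ry; rewrite r1y add0r.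
    have [h1 h2] := r2N y r2y; rewrite r1y add0r addrC; split; exact: sum.
  have [/andP[h1 h1'] h2] := r1N y r1y; split; last exact: sum.
  apply/andP; split; last by rewrite lerD// ?(upper _ _ _ rN1) ?(upper _ _ _ rN2).
  have /andP[h3 _] : ((N1 + N2)^-1 <= r1 y <= N1 + N2)%R by apply: sum => //; rewrite h1.
  by rewrite (le_trans h3)// lerDl.
exists (N1 + N2)%R, (fun y => r1 y + r2 y)%R, (a1 + a2)%R; split => //.
- by rewrite addr_gt0.
- under eq_Rintegral do rewrite mulrDl.
  rewrite bounded_integralD; [|exact: truncated_tau_bounded rN1|exact: truncated_tau_bounded rN2].
  rewrite (_ : _ - _ = (mu`[fun y => r1 y * th y] - p1) + (mu`[fun y => r2 y * th y] - p2))%R; last by ring.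
  by rewrite (le_trans (ler_normD _ _))// lerD.
- move=> j jk; under eq_Rintegral do rewrite mulrDl.
  rewrite bounded_integralD; [|exact: truncated_test_bounded rN1|exact: truncated_test_bounded rN2].
  rewrite (_ : _ - _ = (mu`[fun y => r1 y * (th y * f j y)] - v1 j) + (mu`[fun y => r2 y * (th y * f j y)] - v2 j))%R; last by ring.
  by rewrite (le_trans (ler_normD _ _))// lerD// ?rv1 ?rv2.
- apply: (@le_trans _ _ (entropy_cost a1 r1 + entropy_cost a2 r2)%R); last by lra.
  have b1 := entropy_cost_bounded a10 rN1; have b2 := entropy_cost_bounded a20 rN2.
  rewrite /entropy_cost -bounded_integralD//; apply: bounded_integral_le.
  + exact: entropy_cost_bounded (addr_gt0 a10 a20) rN.
  + exact: bounded_measurableD.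
  + by move=> y; exact: entropy_perspective_add.
Qed.

(** The additional [e] is the cost of the empty sum. *)
Lemma reachable_sum (I : Type) (s : seq I) (e : R) (E p : I -> R) (v : I -> nat -> R) (C : I -> R) :
  (0 < e)%R -> (forall i, reachable (E i) (p i) (v i) (C i)) ->
  reachable (\sum_(i <- s) E i + e) (\sum_(i <- s) p i)
    (fun j => \sum_(i <- s) v i j)%R (\sum_(i <- s) C i).
Proof.
move=> e0 rE; elim: s => [|i s IH].
  rewrite !big_nil add0r (_ : (fun j => _) = fun=> 0%R); first exact: reachable_zero.
  by apply/funext => j; rewrite big_nil.
rewrite !big_cons -addrA (_ : (fun j => _) = fun j => v i j + \sum_(i <- s) v i j)%R.
  exact: reachable_add.
by apply/funext => j; rewrite big_cons.
Qed.

End reachable.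

(** * The singular part and the missing mass *)

Section reachable_pieces.
Context (R : realType) (X : completeMetricType R).
Variables (mu : probability (borel X) R) (tau : borel X -> \bar R).
Hypotheses (mtau : measurable_fun [set: borel X] tau)
  (tau_ge0 : forall x, 0 <= tau x)
  (tau_neq0 : mu [set x | tau x = 0] = 0)
  (tau_finite : mu [set x | tau x = +oo] = 0).
Local Notation "m `[ f ]" := ((\int[m]_(x in [set: borel X]) f x)%R)
  (at level 10, format "m `[ f ]").

Let th (y : borel X) : R := fine (tau y).
Let mth : measurable_fun [set: borel X] th. Proof. exact: measurable_fine_tau. Qed.
Let th_ge0 y : (0 <= th y)%R. Proof. exact: fine_ge0. Qed.

Variables (f : nat -> borel X -> R) (M : R) (k : nat).
Hypotheses (mf : forall j, measurable_fun [set: borel X] (f j)) (fM : forall j y, (`|f j y| <= M)%R).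
Local Notation reachable := (reachable mu tau f k).

Let M0 : (0 <= M)%R. Proof. exact: le_trans (normr_ge0 _) (fM 0%N point). Qed.

Let level (n : nat) := [set y | (n.+1%:R^-1 <= th y <= n.+1%:R)%R].

Let measurable_level n : measurable (level n).
Proof.
rewrite (_ : level n = [set y | (n.+1%:R^-1 <= th y)%R] `&` [set y | (th y <= n.+1%:R)%R]).
  by apply: measurableI; apply: measurable_ler_set.
apply/seteqP; split => y; first by move=> /andP[].
by move=> [h1 h2]; apply/andP; split.
Qed.

Let level_exhausts (z : R) : (0 < z)%R -> exists n0 : nat, forall n, (n0 <= n)%N ->
  (n.+1%:R^-1 <= z <= n.+1%:R)%R.
Proof.
move=> z0; exists (maxn (Num.truncn z^-1%R) (Num.truncn z)) => n; rewrite geq_max => /andP[n1 n2].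
have h1 : (z^-1 <= n.+1%:R)%R.
  by rewrite (le_trans (ltW (truncnS_gt _)))// ler_nat.
rewrite (le_trans (ltW (truncnS_gt z))) ?ler_nat// andbT.
by rewrite -[leRHS]invrK lef_pV2 ?posrE ?invr_gt0 ?ltr0n.
Qed.

Let indic_bounded (A : set (borel X)) (h : borel X -> R) : measurable A ->
  bounded_measurable h -> bounded_measurable (fun y => \1_A y * h y)%R.
Proof.
move=> mA bh; apply: bounded_measurableM => //; split => //.
by exists 1%R => y; rewrite indicE; case: (_ \in _); rewrite ?normr1 ?normr0.
Qed.

(* On a set where [e^(c tau)] is not integrable, the densities proportional to [e^(c tau)],
   truncated, have entropy at most [c] per unit of time. *)
Lemma reachable_tail (O : set (borel X)) (c p eta : R) (b : nat -> R) : measurable O ->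
  (0 <= c)%R -> (0 < p)%R -> (0 <= eta)%R ->
  \int[mu]_(y in O) (expR (c * th y))%:E = +oo ->
  (forall j y, (j < k)%N -> O y -> `|f j y - b j| <= eta)%R ->
  reachable (eta * p) p (fun j => p * b j)%R (p * c).
Proof.
move=> mO c0 p0 eta0 Ooo fb.
pose A n := O `&` level n.
have mA n : measurable (A n) by exact: measurableI.
pose g n y := (\1_(A n) y * expR (c * th y))%R.
have mexp : measurable_fun [set: borel X] (fun y => expR (c * th y)).
  by apply: measurableT_comp => //; exact: measurable_funM.
have mg n : measurable_fun [set: borel X] (g n) by exact: measurable_funM.
have g0 n y : (0 <= g n y)%R by rewrite mulr_ge0 ?expR_ge0// indicE.
have mth0 : measurable [set y | (0 < th y)%R] by exact: measurable_ltr_set.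
pose A0 := O `&` [set y | (0 < th y)%R].
have mA0 : measurable A0 by exact: measurableI.
pose G y := (\1_A0 y * expR (c * th y))%R.
have mG : measurable_fun [set: borel X] G by exact: measurable_funM.
have G0 y : (0 <= G y)%R by rewrite mulr_ge0 ?expR_ge0// indicE.
have levelS m n y : (m <= n)%N -> level m y -> level n y.
  move=> mn /= /andP[t1 t2]; apply/andP; split.
    by rewrite (le_trans _ t1)// lef_pV2 ?posrE ?ltr0n// ler_nat.
  by rewrite (le_trans t2)// ler_nat.
have gcv : \int[mu]_y (g n y)%:E @[n --> \oo] --> \int[mu]_y (G y)%:E.
  rewrite (_ : \int[mu]_y (G y)%:E = \int[mu]_y limn (fun n => (g n y)%:E)); last first.
    apply: eq_integral => y _; apply/esym/cvg_lim => //; apply: cvg_near_cst.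
    have [[Oy /= ty]|nA0] := pselect (A0 y).
      have [n0 n0P] := level_exhausts ty; exists n0 => // n /= /n0P ny.
      by rewrite /g /G !indicE !mem_set.
    apply: nearW => n; rewrite /g /G !indicE !memNset// => -[Oy /= /andP[t1 _]].
    by apply: nA0; split => //=; apply: lt_le_trans t1; rewrite invr_gt0 ltr0n.
  apply: cvg_monotone_convergence => //.
  - by move=> n; exact/measurable_EFinP.
  - by move=> n y _; rewrite lee_fin.
  - move=> y _ m n mn; rewrite lee_fin /g ler_wpM2r ?expR_ge0// !indicE ler_nat.
    have [/set_mem[Oy ym]|//] := boolP (y \in A m).
    by rewrite mem_set//; split => //; exact: levelS ym.
(* The truncated integrals increase to infinity. A normalising constant [Z >= 1] is enough: the
   normalised density then satisfies [ln q = c tau - ln Z <= c tau] where it does not vanish. *)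
have [n Zn] : exists n, 1 <= \int[mu]_y (g n y)%:E.
  apply: contrapT => /forallNP nZ.
  have G1 : \int[mu]_y (G y)%:E <= 1.
    rewrite -(cvg_lim _ gcv)//; apply: lime_le; first by apply/cvg_ex; eexists; exact: gcv.
    by apply: nearW => n; have /negP := nZ n; rewrite -ltNge => /ltW.
  have : \int[mu]_(y in O) (expR (c * th y))%:E <= \int[mu]_y ((G y)%:E + 1).
    rewrite integral_mkcond; apply: ge0_le_integral => //.
    - by move=> y _; rewrite patchE; case: ifP => // _; rewrite lee_fin expR_ge0.
    - by apply/(measurable_restrictT _ _).1 => //; apply: measurable_funTS; exact/measurable_EFinP.
    - by apply: emeasurable_funD => //; exact/measurable_EFinP.
    - move=> y _; rewrite patchE; have [/set_mem Oy|Oy] := boolP (y \in O); last by rewrite adde_ge0// lee_fin.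
      rewrite -EFinD lee_fin /G indicE; have [ty|t0] := ltP 0%R (th y).
        by rewrite mem_set ?mul1r ?lerDl.
      have -> : th y = 0%R by apply/eqP; rewrite eq_le t0 th_ge0.
      by rewrite mulr0 expR0 lerDr mulr_ge0// indicE.
  rewrite Ooo ge0_integralD//; last 2 first.
  - by move=> y _; rewrite lee_fin.
  - exact/measurable_EFinP.
  rewrite integral_cst// mul1e [X in _ + X]probability_setT leNgt => /negP; apply.
  by rewrite lte_add_pinfty// ?ltry// (le_lt_trans G1)// ltry.
have n1 : (0 < n.+1%:R :> R)%R by rewrite ltr0n.
have bg : bounded_measurable (g n).
  split => //; exists (expR (c * n.+1%:R)) => y; rewrite ger0_norm// /g indicE.
  have [/set_mem[_ /= /andP[_ tn]]|_] := boolP (y \in A n); last by rewrite mul0r expR_ge0.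
  by rewrite mul1r ler_expR ler_wpM2l.
rewrite (bounded_integralE mu bg) lee_fin in Zn.
set Z := mu`[g n] in Zn; have Z0 : (0 < Z)%R by apply: lt_le_trans Zn.
have Zi0 : (0 < Z^-1)%R by rewrite invr_gt0.
have gA y : (g n y != 0)%R -> [/\ O y, level n y & g n y = expR (c * th y)].
  rewrite /g indicE; have [/set_mem[Oy ln]|_] := boolP (y \in A n); last by rewrite mul0r eqxx.
  by rewrite mul1r.
have gN : truncated_density tau (n.+1%:R * expR (c * n.+1%:R))%R (g n).
  have e1 : (1 <= expR (c * n.+1%:R))%R by rewrite -expR0 ler_expR mulr_ge0.
  have nn1 : (1 <= n.+1%:R :> R)%R by rewrite ler1n.
  have le_n : (n.+1%:R <= n.+1%:R * expR (c * n.+1%:R) :> R)%R by rewrite ler_peMr.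
  split => //; first by rewrite mulr_gt0// expR_gt0.
  move=> y /gA[Oy /andP[t1 t2] ->]; split; apply/andP; split.
  - rewrite (@le_trans _ _ 1%R)// ?invf_le1 ?mulr_gt0 ?expR_gt0//.
      by rewrite (le_trans nn1).
    by rewrite -expR0 ler_expR mulr_ge0.
  - rewrite (@le_trans _ _ (expR (c * n.+1%:R)))// ?ler_peMl ?expR_ge0//.
    by rewrite ler_expR ler_wpM2l.
  - by rewrite (le_trans _ t1)// lef_pV2 ?posrE ?mulr_gt0 ?expR_gt0.
  - exact: le_trans t2 le_n.
have [N1 qN] := truncated_scale Zi0 gN.
pose q y := (Z^-1 * g n y)%R; rewrite -/q in qN.
have bq := truncated_bounded qN.
have q1 : mu`[q] = 1%R by rewrite bounded_integralZ// -/Z mulVf// gt_eqF.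
have bqt := truncated_tau_bounded mtau tau_ge0 qN.
pose T := mu`[fun y => q y * th y]%R.
have T0 : (0 < T)%R by apply: (mean_time_gt0 mtau tau_ge0 qN q1).
have pT : (0 < p / T)%R by rewrite divr_gt0.
have [N2 rN] := truncated_scale pT qN.
exists N2, (fun y => p / T * q y)%R, (p / T)%R.
have rtE : mu`[fun y => (p / T * q y) * th y]%R = p.
  by under eq_Rintegral do rewrite -mulrA; rewrite bounded_integralZ// -/T divfK// gt_eqF.
have brt := truncated_tau_bounded mtau tau_ge0 rN.
split => //.
- by rewrite rtE subrr normr0 mulr_ge0// ltW.
- move=> j jk; have brtf := truncated_test_bounded mtau tau_ge0 mf fM j rN.
  have -> : (p * b j = mu`[fun y => b j * (p / T * q y * th y)])%R.
    by rewrite bounded_integralZ// rtE mulrC.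
  rewrite -bounded_integralB//; last exact: bounded_measurableZ.
  have le_pt y : (`|p / T * q y * (th y * f j y) - b j * (p / T * q y * th y)| <= eta * (p / T * q y * th y))%R.
    have rt0 : (0 <= p / T * q y * th y)%R by case: rN => _ _ r0 _; rewrite mulr_ge0.
    rewrite (_ : _ - _ = (f j y - b j) * (p / T * q y * th y))%R; last by ring.
    rewrite normrM [X in (_ * X <= _)%R]ger0_norm//; have [gy|gy] := eqVneq (g n y) 0%R.
      by rewrite /q gy !(mulr0, mul0r).
    by have [Oy _ _] := gA y gy; rewrite ler_wpM2r// fb.
  rewrite ler_norml -[X in (eta * X)%R]rtE -mulNr -!bounded_integralZ//; apply/andP; split.
    apply: bounded_integral_le; [exact: bounded_measurableZ| |].
      by apply: bounded_measurableB => //; exact: bounded_measurableZ.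
    by move=> y; have := le_pt y; rewrite ler_norml mulNr => /andP[].
  apply: bounded_integral_le; [|exact: bounded_measurableZ|].
    by apply: bounded_measurableB => //; exact: bounded_measurableZ.
  by move=> y; have := le_pt y; rewrite ler_norml => /andP[].
- apply: (@le_trans _ _ (p * c)%R); last by rewrite lerDl mulr_ge0// ltW.
  (* Since [q ln q <= c q tau], the cost at rate [p / T] is at most the integral of
     [(p / T) * (c q tau + 1 - q)]; the means [T] of [tau] and 1 of [q] reduce this to [p c]. *)
  rewrite (_ : p * c = mu`[fun y => (p / T) * (c * (q y * th y) + (1 - q y))])%R.
    apply: bounded_integral_le.
    + exact: entropy_cost_bounded pT rN.
    + apply: bounded_measurableZ; apply: bounded_measurableD; first exact: bounded_measurableZ.
      by apply: bounded_measurableB => //; exact: bounded_measurable_cst.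
    move=> y; rewrite ler_pM2l// mulrC mulKf ?gt_eqF// /entropy_fun.
    have [gy|gy] := eqVneq (g n y) 0%R; first by rewrite /q gy !(mulr0, mul0r) subr0.
    have [_ _ gE] := gA y gy; rewrite /q gE lnM ?posrE ?expR_gt0// expRK lnV ?posrE//.
    have lnZ : (0 <= ln Z)%R by rewrite ln_ge0.
    have := mulr_ge0 (mulr_ge0 (ltW Zi0) (expR_ge0 (c * th y))) lnZ.
    by lra.
  rewrite bounded_integralZ; last first.
    apply: bounded_measurableD; first exact: bounded_measurableZ.
    by apply: bounded_measurableB => //; exact: bounded_measurable_cst.
  rewrite bounded_integralD; [|exact: bounded_measurableZ|]; last first.
    by apply: bounded_measurableB => //; exact: bounded_measurable_cst.
  rewrite bounded_integralZ// bounded_integralB//; last exact: bounded_measurable_cst.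
  rewrite q1 Rintegral_cst// [X in fine X]probability_setT mulr1 subrr addr0 -/T.
  by field; rewrite gt_eqF.
Qed.

Hypothesis fc : forall j, continuous (f j : X -> R).

Lemma bounded_test j : bounded_measurable (f j).
Proof. by split => //; exists M. Qed.

Lemma bounded_integral_sum (m : {finite_measure set (borel X) -> \bar R}) (I : Type) (s : seq I)
    (F : I -> borel X -> R) : (forall i, bounded_measurable (F i)) ->
  (m`[fun y => \sum_(i <- s) F i y] = \sum_(i <- s) m`[F i])%R.
Proof.
move=> bF; elim: s => [|i s IH].
  by under eq_Rintegral do rewrite big_nil; rewrite Rintegral_cst// mul0r big_nil.
under eq_Rintegral do rewrite big_cons.
by rewrite bounded_integralD ?big_cons ?IH//; exact: bounded_measurable_sum.
Qed.

(* The partition is encoded by its indicators, of sum 1. *)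
Lemma oscillation_partition (eta : R) : (0 < eta)%R ->
  exists (I : finType) (B : I -> set (borel X)),
    [/\ (forall i, measurable (B i)), (forall y, \sum_i \1_(B i) y = 1 :> R)%R &
        forall i j y z, (j < k)%N -> B i y -> B i z -> (`|f j y - f j z| <= eta)%R].
Proof.
move=> eta0; elim: k => [|k' [I [B [mB B1 Bosc]]]].
  exists unit, (fun=> setT); split => // y.
  by rewrite big_const card_unit/= indicT addr0.
pose n := (Num.truncn (2 * M / eta)).+1.
pose z y := ((f k' y + M) / eta)%R.
have mz : measurable_fun [set: borel X] z by apply: measurable_funM => //; exact: measurable_funD.
have z0 y : (0 <= z y)%R.
  by rewrite divr_ge0 ?(ltW eta0)//; have := fM k' y; rewrite ler_norml => /andP[? ?]; lra.
have zn y : (Num.truncn (z y) < n)%N.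
  rewrite ltnS -ltnS -(ltr_nat R); apply: le_lt_trans (truncnS_gt (2 * M / eta)).
  have /andP[h _] := truncn_itv (z0 y); apply: le_trans h _.
  rewrite /z ler_pM2r ?invr_gt0//.
  by have := fM k' y; rewrite ler_norml => /andP[? ?]; lra.
pose C (l : 'I_n) := [set y | (l%:R <= z y)%R] `&` [set y | (z y < l.+1%:R)%R].
have CE l y : C l y <-> l = Num.truncn (z y) :> nat.
  split=> [[/= h1 h2]|lE]; first by apply/esym/truncn_def; rewrite h1.
  by have /andP[h1 h2] := truncn_itv (z0 y); split; rewrite /= lE.
exists (I * 'I_n)%type, (fun il => B il.1 `&` C il.2); split.
- move=> [i l] /=; apply: measurableI => //; apply: measurableI.
    exact: measurable_ler_set.
  exact: measurable_ltr_set.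
- move=> y; under eq_bigr do rewrite indicI/=.
  rewrite -(pair_bigA _ (fun i l => \1_(B i) y * \1_(C l) y)%R)/=.
  rewrite -[RHS](B1 y); apply: eq_bigr => i _; rewrite -mulr_sumr (bigD1 (Ordinal (zn y)))//=.
  have Cy : C (Ordinal (zn y)) y by apply/CE.
  rewrite big1 => [|l lz]; first by rewrite addr0 [\1_(C _) y]indicE (mem_set Cy) mulr1.
  rewrite indicE memNset// => /CE lE; move/eqP: lz; apply; exact: val_inj.
- move=> [i l] j y y'; rewrite ltnS leq_eqVlt => /orP[/eqP -> [_ [/= a1 a2]] [_ [/= b1 b2]]|jk [By _] [By' _]].
    have : (`|z y - z y'| <= 1)%R.
      by move: a1 a2 b1 b2; rewrite -[l.+1%:R]natr1 ler_norml => *; apply/andP; split; lra.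
    rewrite /z -mulrBl normrM normfV (gtr0_norm eta0) ler_pdivrMr// mul1r.
    by rewrite (_ : _ + M - _ = f k' y - f k' y')%R//; ring.
  exact: (Bosc i).
Qed.

(** Some [y] in the cell has [xi y] less than the mean of [xi] over it plus [eta]. The whole mass of
    the cell is moved near this [y]: in a neighborhood [O] where the test functions vary by less
    than [eta], [e^(c tau)] is not integrable for [c] above [xi y]. One error [eta] per unit of mass
    comes from [O], the other from the oscillation within the cell. *)
Lemma reachable_cell (lam : {finite_measure set (borel X) -> \bar R}) (B : set (borel X)) (eta e : R) :
  measurable B -> measurable_fun [set: borel X] (xi mu tau) ->
  (forall y, 0 <= xi mu tau y) ->
  \int[lam]_(y in B) xi mu tau y < +oo -> (0 < eta)%R -> (0 < e)%R ->
  (forall j y z, (j < k)%N -> B y -> B z -> (`|f j y - f j z| <= eta)%R) ->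
  reachable (2 * (eta * fine (lam B)) + e) (fine (lam B)) (fun j => lam`[fun y => \1_B y * f j y]%R)
    (fine (\int[lam]_(y in B) xi mu tau y)).
Proof.
move=> mB mxi xi0 xioo eta0 e0 osc.
have lamB : lam B = (fine (lam B))%:E by rewrite fineK// fin_num_measure.
have xiB0 : 0 <= \int[lam]_(y in B) xi mu tau y by exact: integral_ge0.
set S := fine (\int[lam]_(y in B) xi mu tau y).
have SE : \int[lam]_(y in B) xi mu tau y = S%:E by rewrite fineK// ge0_fin_numE.
have S0 : (0 <= S)%R by exact: fine_ge0.
set p := fine (lam B) in lamB *.
have p0 : (0 <= p)%R by exact: fine_ge0.
have b1B j : bounded_measurable (fun y => \1_B y * f j y)%R by apply: indic_bounded => //; exact: bounded_test.
have bind : bounded_measurable (\1_B : borel X -> R).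
  split => //; exists 1%R => y; rewrite indicE.
  by case: (_ \in _); rewrite ?normr1 ?normr0.
have p1B : lam`[\1_B : borel X -> R]%R = p by rewrite Rintegral_indic.
have cell y j : B y -> (j < k)%N -> (`|p * f j y - lam`[fun y => \1_B y * f j y]| <= eta * p)%R.
  move=> By jk; rewrite mulrC -[X in (f j y * X)%R]p1B -bounded_integralZ//.
  rewrite -bounded_integralB//; last exact: bounded_measurableZ.
  have pt z : (`|f j y * \1_B z - \1_B z * f j z| <= eta * \1_B z)%R.
    rewrite indicE; have [/set_mem Bz|_] := boolP (z \in B); last by rewrite !mulr0 mul0r subrr normr0.
    by rewrite !mulr1 mul1r; exact: osc.
  rewrite ler_norml -[X in (eta * X)%R]p1B -mulNr -!bounded_integralZ//; apply/andP; split.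
    apply: bounded_integral_le; [exact: bounded_measurableZ| |].
      by apply: bounded_measurableB => //; exact: bounded_measurableZ.
    by move=> z; have := pt z; rewrite ler_norml mulNr => /andP[].
  apply: bounded_integral_le; [|exact: bounded_measurableZ|].
    by apply: bounded_measurableB => //; exact: bounded_measurableZ.
  by move=> z; have := pt z; rewrite ler_norml => /andP[].
have [p_eq0|p_neq0] := eqVneq p 0%R.
  rewrite p_eq0 mulr0 mulr0 add0r.
  have [N [r [a [rN a0 rp rv rC]]]] := reachable_zero mu tau f k e0.
  exists N, r, a; split => //; last by rewrite (le_trans rC)// lerD2r.
  move=> j jk; rewrite (_ : (\int[lam]_(y in setT) (\1_B y * f j y))%R = 0%R); first exact: rv.
  rewrite /Rintegral (_ : \int[lam]_y _ = 0)//.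
  rewrite -(integral0 lam setT); apply: ae_eq_integral => //.
    by apply/measurable_EFinP; case: (b1B j).
  exists B; split => //; first exact: (etrans lamB (congr1 EFin p_eq0)).
  by move=> z /= h; apply: contrapT => Bz; apply: h => _; rewrite indicE memNset ?mul0r.
have p_gt0 : (0 < p)%R by rewrite lt_neqAle eq_sym p_neq0.
pose c := (S / p + eta)%R.
have c0 : (0 <= c)%R by rewrite addr_ge0 ?divr_ge0// ltW.
have [y [By xiy]] : exists y, B y /\ xi mu tau y < c%:E.
  apply: contrapT => /forallNP nB.
  have : \int[lam]_(y in B) c%:E <= \int[lam]_(y in B) xi mu tau y.
    apply: ge0_le_integral => //.
    - exact: measurable_funTS.
    - by move=> y By; rewrite leNgt; apply/negP => xiy; apply: (nB y).
  rewrite integral_cst// SE [X in _ * X <= _]lamB -EFinM lee_fin /c mulrDl divfK ?gt_eqF// -subr_ge0 opprD addrA subrr add0r.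
  by rewrite oppr_ge0 leNgt mulr_gt0.
pose O := \big[setI/setT]_(j < k) [set z : X | (`|f j z - f j y| < eta)%R].
have OE z : O z <-> forall j, (j < k)%N -> (`|f j z - f j y| < eta)%R.
  rewrite /O -(@bigcap_mkord _ k (fun j => [set z : X | (`|f j z - f j y| < eta)%R])).
  by split=> [Oz j jk|Oz j jk]; [exact: Oz|exact: Oz].
have oO : open O.
  apply: big_ind => [|A A' oA oA'|j _]; [exact: openT|exact: openI|].
  apply: (@open_comp _ _ (fun z : X => `|f j z - f j y|)%R [set u : R | (u < eta)%R]).
    move=> z _; apply: (@continuous_comp _ _ _ (fun z : X => f j z - f j y)%R Num.norm).
      by apply: (@continuousB _ _ _ (f j) (fun=> f j y)); [exact: fc|exact: cst_continuous].
    exact: norm_continuous.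
  exact: open_lt.
have mO : measurable (O : set (borel X)) by exact: sub_sigma_algebra.
have Ooo : \int[mu]_(z in (O : set (borel X))) (expR (c * th z))%:E = +oo.
  apply/eqP; rewrite eq_le leey/= leNgt; apply/negP => Olt.
  have : nbhs y O by apply: open_nbhs_nbhs; split => //; apply/OE => j jk; rewrite subrr normr0.
  move=> /nbhs_ballP[delta /= d0 dO].
  have mball : measurable (ball y delta : set (borel X)).
    by apply: sub_sigma_algebra; exact: metric_ball_open.
  move: xiy; rewrite ltNge => /negP; apply.
  apply: (@le_trans _ _ (ereal_sup (exp_moments mu tau (ball y delta)))); last first.
    by apply: ereal_sup_ubound; exists delta.
  apply: ereal_sup_ubound; exists c => //; split => //.
  rewrite (integral_expeR_tau mtau tau_ge0 tau_finite mball c0); apply: le_lt_trans Olt.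
  apply: ge0_subset_integral => //.
  by apply: measurable_funTS; apply/measurable_EFinP; exact: measurable_expR_tau.
have Of j z : (j < k)%N -> O z -> (`|f j z - f j y| <= eta)%R.
  by move=> jk /OE Oz; apply: ltW; exact: Oz.
have [N [r [a [rN a0 rp rv rC]]]] := reachable_tail mO c0 p_gt0 (ltW eta0) Ooo Of.
have ep : (0 <= eta * p)%R by rewrite mulr_ge0// ltW.
exists N, r, a; split => //.
- by rewrite (le_trans rp)//; lra.
- move=> j jk; rewrite -(subrKA (p * f j y)%R) (le_trans (ler_normD _ _))//.
  by have := rv j jk; have := cell y j By jk; lra.
- rewrite (le_trans rC)// /c mulrDr [(p * (S / p))%R]mulrC divfK ?gt_eqF//.
  by have := ep; rewrite [(p * eta)%R]mulrC; lra.
Qed.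

Lemma reachable_singular (lam : {finite_measure set (borel X) -> \bar R}) (e : R) :
  measurable_fun [set: borel X] (xi mu tau) -> (forall y, 0 <= xi mu tau y) ->
  \int[lam]_y xi mu tau y < +oo -> (0 < e)%R ->
  reachable e (fine (lam [set: borel X])) (fun j => lam`[f j]%R) (fine (\int[lam]_y xi mu tau y)).
Proof.
move=> mxi xi0 xioo e0; set p := fine (lam setT); have p0 : (0 <= p)%R by exact: fine_ge0.
(* The oscillation errors [2 eta p] sum to at most [e / 2]; the constants [e1], one per cell and one
   for the empty sum, make [e / 4]. *)
pose eta := (e / (4 * (p + 1)))%R.
have p1 : (0 < p + 1)%R by rewrite ltr_wpDl.
have eta0 : (0 < eta)%R by rewrite divr_gt0// mulr_gt0.
have [I [B [mB B1 Bosc]]] := oscillation_partition eta0.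
pose e1 := (e / (4 * (#|I|%:R + 1)))%R.
have I1 : (0 < #|I|%:R + 1 :> R)%R by rewrite ltr_wpDl.
have e10 : (0 < e1)%R by rewrite divr_gt0// mulr_gt0.
have xiB i : \int[lam]_(y in B i) xi mu tau y < +oo.
  by apply: le_lt_trans xioo; apply: ge0_subset_integral.
have bB i : bounded_measurable (\1_(B i) : borel X -> R).
  by split => //; exists 1%R => y; rewrite indicE; case: (_ \in _); rewrite ?normr1 ?normr0.
have psum : (\sum_i fine (lam (B i)) = p)%R.
  under eq_bigr do rewrite -(Rintegral_indic lam (mB _)).
  rewrite -bounded_integral_sum//; under eq_Rintegral do rewrite B1.
  by rewrite Rintegral_cst// mul1r.
have fsum j : (\sum_i lam`[fun y => \1_(B i) y * f j y] = lam`[f j])%R.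
  rewrite -bounded_integral_sum; last by move=> i; apply: bounded_measurableM => //; exact: bounded_test.
  by apply: eq_Rintegral => y _; rewrite -mulr_suml B1 mul1r.
have xisum : (\sum_i fine (\int[lam]_(y in B i) xi mu tau y) = fine (\int[lam]_y xi mu tau y))%R.
  rewrite -[LHS]/(fine (\sum_i fine (\int[lam]_(y in B i) xi mu tau y))%R%:E) -sumEFin; congr fine.
  transitivity (\sum_i \int[lam]_y (xi mu tau y * (\1_(B i) y)%:E)).
    apply: eq_bigr => i _; rewrite fineK ?ge0_fin_numE ?integral_ge0//.
    rewrite integral_mkcond; apply: eq_integral => y _; rewrite patchE indicE.
    by case: ifP => _; rewrite ?mule1 ?mule0.
  rewrite -ge0_integral_sum//; last 2 first.
  - by move=> i; apply: emeasurable_funM => //; exact/measurable_EFinP.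
  - by move=> i y _; rewrite mule_ge0// lee_fin.
  apply: eq_integral => y _; rewrite -ge0_sume_distrr; last by move=> i _; rewrite lee_fin.
  by rewrite sumEFin B1 mule1.
have := reachable_sum mtau tau_ge0 mf fM (index_enum I) e10
  (fun i => reachable_cell (mB i) mxi xi0 (xiB i) eta0 e10 (fun j y z => @Bosc i j y z)).
rewrite psum xisum => reach.
have le_e : (\sum_i (2 * (eta * fine (lam (B i))) + e1) + e1 <= e)%R.
  rewrite big_split/= sumr_const -mulr_sumr -mulr_sumr psum -[(e1 *+ _)%R]mulr_natl.
  have h1 : (eta * p <= e / 4)%R.
    rewrite /eta invfM mulrA -mulrA ler_piMr ?divr_ge0 ?(ltW e0)//.
    by rewrite mulrC ler_pdivrMr// mul1r lerDl.
  have h2 : ((#|I|%:R + 1) * e1 = e / 4)%R by rewrite /e1; field; rewrite gt_eqF.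
  by move: h1 h2; rewrite mulrDl mul1r; lra.
apply: (reachable_weaken le_e reach) => j jk.
by rewrite fsum subrr normr0 subr_ge0.
Qed.

(** Outside [K] the test functions vanish, so mass placed there is not seen by them; since [c]
    exceeds [xi_infty], [e^(c tau)] is not integrable on the complement of [K]. *)
Lemma reachable_infinity (K : set X) (p e : R) : compact K ->
  (forall j y, (j < k)%N -> ~ K y -> f j y = 0%R) ->
  (0 < p)%R -> (0 < e)%R -> 0 <= xi_infty mu tau -> xi_infty mu tau < +oo ->
  reachable e p (fun=> 0%R) (p * fine (xi_infty mu tau)).
Proof.
move=> cK fK p0 e0 xi0 xioo; set x0 := fine (xi_infty mu tau).
have xE : xi_infty mu tau = x0%:E by rewrite fineK// ge0_fin_numE.
have x00 : (0 <= x0)%R by exact: fine_ge0.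
pose c := (x0 + e / p)%R.
have c0 : (0 <= c)%R by rewrite addr_ge0// divr_ge0// ltW.
have mKC : measurable (~` K : set (borel X)) by apply: measurableC; exact: compact_borel_measurable.
have Koo : \int[mu]_(y in (~` K : set (borel X))) (expR (c * th y))%:E = +oo.
  apply/eqP; rewrite eq_le leey/= leNgt; apply/negP => Klt.
  have : c%:E <= xi_infty mu tau.
    apply: (@le_trans _ _ (ereal_sup (exp_moments mu tau (~` K)))); last first.
      by apply: ereal_sup_ubound; exists K.
    apply: ereal_sup_ubound; exists c => //; split => //.
    by rewrite (integral_expeR_tau mtau tau_ge0 tau_finite mKC c0).
  by rewrite xE lee_fin /c -subr_ge0 opprD addrA subrr add0r oppr_ge0 leNgt divr_gt0.
have fb j y : (j < k)%N -> (~` K) y -> (`|f j y - 0| <= 0)%R.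
  by move=> jk Ky; rewrite fK// subrr normr0.
have [N [r [a [rN a0 rp rv rC]]]] := reachable_tail mKC c0 p0 (lexx 0%R) Koo fb.
exists N, r, a; split => //.
- by rewrite (le_trans rp)// mul0r ltW.
- by move=> j jk; have := rv j jk; rewrite mulr0 mul0r => /le_trans; apply; exact: ltW.
- by rewrite (le_trans rC)// mul0r addr0 /c mulrDr [(p * (e / p))%R]mulrC divfK// gt_eqF.
Qed.

End reachable_pieces.

Lemma rel_entropy_ge0 d (T : measurableType d) (R : realType) (q mu : probability T R) :
  0 <= rel_entropy q mu.
Proof.
have [qmu|qmu] := pselect (q `<< mu); last by rewrite /rel_entropy asboolF.
have [rho [_ rho0 _ ->]] := rel_entropy_density qmu.
by apply: integral_ge0 => y _; rewrite lee_fin entropy_fun_ge0.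
Qed.

(** * The absolutely continuous part *)

Section reachable_rate.
Context (R : realType) (X : completeMetricType R).
Variables (mu : probability (borel X) R) (tau : borel X -> \bar R).
Hypotheses (mtau : measurable_fun [set: borel X] tau)
  (tau_ge0 : forall x, 0 <= tau x)
  (tau_neq0 : mu [set x | tau x = 0] = 0)
  (tau_finite : mu [set x | tau x = +oo] = 0).
Local Notation "m `[ f ]" := ((\int[m]_(x in [set: borel X]) f x)%R)
  (at level 10, format "m `[ f ]").

Let th (y : borel X) : R := fine (tau y).
Let mth : measurable_fun [set: borel X] th. Proof. exact: measurable_fine_tau. Qed.
Let th_ge0 y : (0 <= th y)%R. Proof. exact: fine_ge0. Qed.

Variables (f : nat -> borel X -> R) (M : R) (k : nat).
Hypotheses (mf : forall j, measurable_fun [set: borel X] (f j)) (fM : forall j y, (`|f j y| <= M)%R).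
Local Notation reachable := (reachable mu tau f k).

Variable nu : M1 X.
Let na := ac_part mu nu.
Let a := inv_tau_mass mu tau nu.
Let H := rel_entropy (ac_bar mu mtau tau_ge0 nu) mu.

Let M0 : (0 <= M)%R. Proof. exact: le_trans (normr_ge0 _) (fM 0%N point). Qed.

Let bf j : bounded_measurable (f j). Proof. by split => //; exists M. Qed.

Let bindic (A : set (borel X)) : measurable A -> bounded_measurable (\1_A : borel X -> R).
Proof.
move=> mA; split => //; exists 1%R => y.
by rewrite indicE; case: (_ \in _); rewrite ?normr1 ?normr0.
Qed.

Lemma restriction_error (m : {finite_measure set (borel X) -> \bar R}) (A : set (borel X))
    (h : borel X -> R) (L : R) :
  measurable A -> measurable_fun [set: borel X] h -> (forall y, `|h y| <= L)%R ->
  (`|m`[fun y => \1_A y * h y] - m`[h]| <= L * fine (m (~` A)))%R.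
Proof.
move=> mA mh hL; have mAC : measurable (~` A) by exact: measurableC.
have bh : bounded_measurable h by split => //; exists L.
have b1 : bounded_measurable (fun y => \1_A y * h y)%R by apply: bounded_measurableM => //; exact: bindic.
have bC := bindic mAC.
rewrite -bounded_integralB// -[X in (_ <= _ * X)%R](_ : m`[\1_(~` A) : borel X -> R] = _)%R; last first.
  by rewrite Rintegral_indic.
have pt y : (`|\1_A y * h y - h y| <= L * \1_(~` A) y)%R.
  rewrite !indicE in_setC; case: (_ \in _) => /=; first by rewrite mul1r subrr normr0 mulr0.
  by rewrite mul0r sub0r normrN mulr1.
rewrite ler_norml -mulNr -!bounded_integralZ//; apply/andP; split.
  apply: bounded_integral_le; [exact: bounded_measurableZ|exact: bounded_measurableB|].
  by move=> y; have := pt y; rewrite ler_norml mulNr => /andP[].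
apply: bounded_integral_le; [exact: bounded_measurableB|exact: bounded_measurableZ|].
by move=> y; have := pt y; rewrite ler_norml => /andP[].
Qed.

(** The density is [a rho] restricted to the set [A n] where [tau] and [a rho] are bounded above and
    below. With rate [a] its cost is the integral of [a h(1_A rho)], with [h] the entropy integrand;
    truncation raises [h] to [h(0) = 1] on the removed set, whose [mu]-mass is the only extra
    cost. *)
Lemma reachable_ac (e : R) : 0 < a -> a < +oo -> H < +oo -> (0 < e)%R ->
  reachable e (fine (na setT)) (fun j => na`[f j]) (fine a * fine H).
Proof.
move=> a0 aoo Hoo e0.
have af : a = (fine a)%:E by rewrite fineK// ge0_fin_numE// ltW.
set al := fine a in af *; have al0 : (0 < al)%R by rewrite fine_gt0// a0.
have [rho [mrho rho0 qE HE]] := @rel_entropy_density _ _ _ (ac_bar mu mtau tau_ge0 nu) mu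
  (ac_bar_dominated mtau tau_ge0 nu).
have naE g mg g0 : \int[na]_y (g y)%:E = a * \int[mu]_y (g y * th y * rho y)%:E :=
  integral_ac_part tau_neq0 tau_finite (f := g) a0 aoo mg g0 mrho rho0 qE.
pose D n (u : R) := (n.+1%:R^-1 <= u <= n.+1%:R)%R.
have DS m n u : (m <= n)%N -> D m u -> D n u.
  move=> mn /andP[h1 h2]; apply/andP; split.
    by rewrite (le_trans _ h1)// lef_pV2 ?posrE ?ltr0n// ler_nat.
  by rewrite (le_trans h2)// ler_nat.
have Dex u : (0 < u)%R -> exists n, D n u.
  move=> u0; exists (maxn (Num.truncn u) (Num.truncn u^-1)); apply/andP; split.
    rewrite -[leRHS]invrK lef_pV2 ?posrE ?invr_gt0 ?ltr0n//.
    by rewrite (le_trans (ltW (truncnS_gt _)))// ler_nat ltnS leq_maxr.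
  by rewrite (le_trans (ltW (truncnS_gt _)))// ler_nat ltnS leq_maxl.
have mDf n (h : borel X -> R) : measurable_fun [set: borel X] h -> measurable [set y | D n (h y)].
  move=> mh; rewrite (_ : [set y | _] = [set y | (n.+1%:R^-1 <= h y)%R] `&` [set y | (h y <= n.+1%:R)%R]).
    by apply: measurableI; exact: measurable_ler_set.
  by apply/seteqP; split => y /=; [move=> /andP[]|move=> [h1 h2]; apply/andP].
have malrho : measurable_fun [set: borel X] (fun y => al * rho y)%R by exact: measurable_funM.
pose A n := [set y | D n (th y)] `&` [set y | D n (al * rho y)%R].
have mA n : measurable (A n) by apply: measurableI; exact: mDf.
have mAC n : measurable (~` A n) by exact: measurableC.
have AS m n : (m <= n)%N -> A m `<=` A n.
  by move=> mn y [h1 h2]; split; exact: (DS m n).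
have Aex y : (0 < th y)%R -> (0 < rho y)%R -> exists n, A n y.
  move=> ty ry; have [n1 h1] := Dex _ ty; have [n2 h2] := Dex _ (mulr_gt0 al0 ry).
  exists (maxn n1 n2); split; [exact: (DS n1 _ _ (leq_maxl _ _))|exact: (DS n2 _ _ (leq_maxr _ _))].
have na_cv : na (~` A n) @[n --> \oo] --> 0.
  have mcap : measurable (\bigcap_n ~` A n) by exact: bigcap_measurable.
  rewrite [X in _ --> X](_ : 0 = na (\bigcap_n ~` A n)).
    apply: nonincreasing_cvg_mu => //; first by rewrite ltey_eq fin_num_measure.
    by move=> m n mn; apply/subsetPset; apply: subsetC; exact: AS.
  apply/esym; rewrite -[LHS]mul1e -integral_cst// integral_mkcond.
  rewrite (_ : \int[na]_y _ = \int[na]_y (\1_(\bigcap_n ~` A n) y)%:E); last first.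
    by apply: eq_integral => y _; rewrite patchE indicE; case: ifP.
  rewrite naE// integral0_eq ?mule0// => y _; congr _%:E.
  rewrite indicE; have [/set_mem nA|_] := boolP (y \in _); last by rewrite !mul0r.
  rewrite mul1r; apply/eqP; rewrite mulf_eq0 !eq_le th_ge0 rho0 !andbT -implyNb -ltNge.
  apply/implyP => ty; rewrite leNgt; apply/negP => ry.
  by have [n An] := Aex y ty ry; exact: (nA n).
(* The points where [rho] vanishes are never in [A n], but there the entropy integrand already
   equals 1; the removed set that matters is the rest, which shrinks to a null set. *)
pose B n := ~` A n `&` [set y | (0 < rho y)%R].
have mpos : measurable [set y | (0 < rho y)%R] by exact: measurable_ltr_set.
have mB n : measurable (B n) by exact: measurableI.
have mu_cv : mu (B n) @[n --> \oo] --> 0.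
  have mcap : measurable (\bigcap_n B n) by exact: bigcap_measurable.
  rewrite [X in _ --> X](_ : 0 = mu (\bigcap_n B n)).
    apply: nonincreasing_cvg_mu => //; first by rewrite ltey_eq fin_num_measure.
    by move=> m n mn; apply/subsetPset; apply: setSI; apply: subsetC; exact: AS.
  apply/esym; apply: measure_negligible => //.
  have := tau_gt0_finite mtau tau_ge0 tau_neq0 tau_finite (m := mu) (fun A _ h => h).
  apply: negligibleS => y yB; rewrite /setC/= => /andP[t0 ty].
  have ty0 : (0 < th y)%R by rewrite fine_gt0// t0.
  have [_ ry] := yB 0%N Logic.I; have [n An] := Aex y ty0 ry.
  by have [] := yB n Logic.I.
have L0 : (0 < M + 1)%R by rewrite ltr_pwDr.
have [n [nan mun]] : exists n, na (~` A n) < (e / (M + 1))%:E /\ mu (B n) < (e / al)%:E.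
  have h1 : 0 < (e / (M + 1))%:E :> \bar R by rewrite lte_fin divr_gt0.
  have h2 : 0 < (e / al)%:E :> \bar R by rewrite lte_fin divr_gt0.
  have [n _ /(_ n (leqnn n)) [? ?]] := filterI (cvge_near_lt na_cv h1) (cvge_near_lt mu_cv h2).
  by exists n.
have nan' : ((M + 1) * fine (na (~` A n)) <= e)%R.
  by rewrite -ler_pdivlMl// mulrC -lee_fin fineK ?fin_num_measure// ltW.
pose r y := (\1_(A n) y * (al * rho y))%R.
have mr : measurable_fun [set: borel X] r by exact: measurable_funM.
have n1 : (0 < n.+1%:R :> R)%R by rewrite ltr0n.
have rN : truncated_density tau n.+1%:R r.
  split => //; first by move=> y; rewrite mulr_ge0 ?mulr_ge0 ?(ltW al0)// indicE.
  move=> y; rewrite /r indicE; have [/set_mem[h1 h2]|_] := boolP (y \in A n); last by rewrite mul0r eqxx.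
  by rewrite mul1r.
have bA := bindic (mA n).
have rE0 (h : borel X -> R) : measurable_fun [set: borel X] h -> (forall y, 0 <= h y)%R ->
    mu`[fun y => r y * (th y * h y)]%R = na`[fun y => \1_(A n) y * h y]%R.
  move=> mh h0; rewrite /Rintegral; congr fine.
  rewrite naE; [|exact: measurable_funM|by move=> y; rewrite mulr_ge0// indicE].
  rewrite af -ge0_integralZl_EFin//.
  - by apply: eq_integral => y _; rewrite -EFinM /r; congr _%:E; ring.
  - by move=> y _; rewrite lee_fin !mulr_ge0// indicE.
  - by apply/measurable_EFinP; do 3 apply: measurable_funM => //.
  - exact: ltW.
(* Extends the identity from nonnegative to bounded [h] by adding a constant [L]. *)
have rE (h : borel X -> R) : bounded_measurable h ->
    mu`[fun y => r y * (th y * h y)]%R = na`[fun y => \1_(A n) y * h y]%R.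
  move=> bh; have [mh [L hL]] := bh.
  have L0' : (0 <= L)%R by exact: le_trans (normr_ge0 _) (hL point).
  have mhL : measurable_fun [set: borel X] (fun y => h y + L)%R by exact: measurable_funD.
  have hL0 y : (0 <= h y + L)%R by have := hL y; rewrite ler_norml => /andP[? ?]; lra.
  have bhL : bounded_measurable (fun y => h y + L)%R.
    by apply: bounded_measurableD => //; exact: bounded_measurable_cst.
  have bL := @bounded_measurable_cst _ (borel X) R L.
  have brt (g : borel X -> R) : bounded_measurable g -> bounded_measurable (fun y => r y * (th y * g y))%R.
    move=> bg; under eq_fun do rewrite mulrA; apply: bounded_measurableM => //.
    exact: truncated_tau_bounded rN.
  have e1 : mu`[fun y => r y * (th y * h y)]%R =
      mu`[fun y => r y * (th y * (h y + L)) - r y * (th y * L)]%R.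
    by apply: eq_Rintegral => y _; ring.
  have e2 : na`[fun y => \1_(A n) y * h y]%R =
      na`[fun y => \1_(A n) y * (h y + L) - \1_(A n) y * L]%R.
    by apply: eq_Rintegral => y _; ring.
  rewrite e1 e2 bounded_integralB; [|exact: brt|exact: brt].
  rewrite bounded_integralB; [|exact: bounded_measurableM|exact: bounded_measurableM].
  by rewrite !rE0.
exists n.+1%:R, r, al; split => //.
- have -> : mu`[fun y => r y * th y]%R = mu`[fun y => r y * (th y * 1)]%R.
    by apply: eq_Rintegral => y _; rewrite mulr1.
  rewrite rE; last exact: bounded_measurable_cst.
  have := restriction_error na (h := fun=> 1%R) (L := 1%R) (mA n).
  rewrite (_ : na`[fun=> 1]%R = fine (na setT)) => [h|]; last by rewrite Rintegral_cst// mul1r.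
  apply: le_trans (h _ _) _ => //; first by move=> y; rewrite normr1.
  by apply: le_trans nan'; rewrite ler_wpM2r ?fine_ge0// lerDr.
- move=> j _; rewrite rE//; apply: le_trans (restriction_error na (mA n) (mf j) (fM j)) _.
  by apply: le_trans nan'; rewrite ler_wpM2r ?fine_ge0// lerDl.
- have cb := entropy_cost_bounded al0 rN.
  have H0 : 0 <= H by exact: rel_entropy_ge0.
  have HF : H = (fine H)%:E by rewrite fineK// ge0_fin_numE.
  have muB : mu (B n) = (fine (mu (B n)))%:E by rewrite fineK// fin_num_measure.
  apply: (@le_trans _ _ (al * fine H + al * fine (mu (B n)))%R); last first.
    rewrite lerD2l -ler_pdivlMl// mulrC -lee_fin fineK ?fin_num_measure//; exact: ltW.
  rewrite -lee_fin -(bounded_integralE mu cb) EFinD !EFinM -HF -muB /H HE.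
  rewrite -ge0_integralZl_EFin//; last 3 first.
  - by move=> y _; rewrite lee_fin entropy_fun_ge0.
  - by apply/measurable_EFinP; exact: measurable_entropy.
  - exact: ltW.
  have <- : \int[mu]_y (\1_(B n) y)%:E = mu (B n) by rewrite integral_indic// setIT.
  rewrite -ge0_integralZl_EFin//; last 2 first.
  - by apply/measurable_EFinP.
  - exact: ltW.
  rewrite -ge0_integralD//; last 4 first.
  - by move=> y _; rewrite -EFinM lee_fin mulr_ge0 ?(ltW al0)// entropy_fun_ge0.
  - by apply: measurable_funeM; apply/measurable_EFinP; exact: measurable_entropy.
  - by move=> y _; rewrite -EFinM lee_fin mulr_ge0 ?(ltW al0)// indicE.
  - by apply: measurable_funeM; apply/measurable_EFinP.
  apply: ge0_le_integral => //.
  - move=> y _; rewrite lee_fin mulr_ge0 ?(ltW al0)// entropy_fun_ge0// divr_ge0 ?(ltW al0)//.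
    by case: rN.
  - by apply/measurable_EFinP; case: cb.
  - apply: emeasurable_funD; apply: measurable_funeM; apply/measurable_EFinP => //.
    exact: measurable_entropy.
  - move=> y _; rewrite -!EFinM -EFinD lee_fin -mulrDr ler_pM2l// /r mulrCA mulrC mulKf ?gt_eqF//.
    rewrite indicE; have [/set_mem Ay|nAy] := boolP (y \in A n).
      by rewrite mul1r lerDl indicE.
    rewrite mul0r [leLHS]/entropy_fun mul0r add0r indicE.
    have := rho0 y; rewrite le_eqVlt => /orP[/eqP <-|ry].
      by rewrite /entropy_fun mul0r add0r lerDl.
    rewrite mem_set; last by split => // Ay; move: nAy; rewrite (mem_set Ay).
    by rewrite lerDr entropy_fun_ge0.
Qed.

(** If [a = 0], then [1 / tau] vanishes [nu_a]-almost everywhere while [tau] is finite there, so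
    [nu_a = 0]. Otherwise finiteness of the product forces a finite entropy. *)
Lemma reachable_ac_part (e : R) : a < +oo -> a * H < +oo -> (0 < e)%R ->
  reachable e (fine (na setT)) (fun j => na`[f j]) (fine (a * H)).
Proof.
move=> aoo aHoo e0; have a_ge0 : 0 <= a.
  by apply: integral_ge0 => y _; exact: inv_tau_ge0.
have [a_eq0|a_neq0] := eqVneq a 0.
  have na0 : na setT = 0.
    apply: measure_negligible => //.
    have := tau_gt0_finite mtau tau_ge0 tau_neq0 tau_finite (@ac_part_dominates R X mu nu).
    have mr := measurable_inv_tau mtau.
    have : ae_eq na setT (fun y => (tau y)^-1) (cst 0).
      apply/ae_eq_integral_abs => //; rewrite -[RHS]a_eq0 /a /inv_tau_mass.
      by apply: eq_integral => y _; rewrite gee0_abs// inv_tau_ge0.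
    move=> inv0 fin; suff : {ae na, forall y : borel X, False} by apply: negligibleS => y _ /=.
    apply: filterS2 inv0 fin => y /(_ Logic.I) h /andP[t0 ty].
    by move: h; apply/eqP; rewrite inve_eq0 lt_eqF.
  rewrite na0 a_eq0 mul0e /=; rewrite (_ : (fun j => _) = fun=> 0%R); first exact: reachable_zero.
  by apply/funext => j; rewrite /Rintegral null_set_integral//; apply/measurable_EFinP.
have a0 : 0 < a by rewrite lt_neqAle eq_sym a_neq0.
have Hoo : H < +oo.
  by rewrite ltey; apply/eqP => Hoo; move: aHoo; rewrite Hoo gt0_muley// ltxx.
have H0 : 0 <= H by exact: rel_entropy_ge0.
by rewrite fineM ?ge0_fin_numE//; exact: reachable_ac.
Qed.

End reachable_rate.

(** * Local lower bound at a measure of finite rate *)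

Section vague_neighborhoods.
Context (R : realType) (X : completeMetricType R).
Local Notation "m `[ f ]" := ((\int[m]_(x in [set: borel X]) f x)%R)
  (at level 10, format "m `[ f ]").

Definition test_family (f : nat -> X -> R) (M : R) (K : set X) :=
  [/\ forall j, continuous (f j), forall j y, (`|f j y| <= M)%R, compact K &
      forall j y, ~ K y -> f j y = 0%R].

(** The sets that contain a neighborhood defined by finitely many test functions form a filter,
    which converges to [nu] by [vague_cvg]; hence it contains [U]. The supremum of topologies need
    not be unfolded. *)
Lemma vague_nbhs (nu : M1 X) (U : set (M1 X)) : open U -> U nu ->
  exists f M K (k : nat) (delta : R), [/\ test_family f M K, (0 < delta)%R &
    forall nu' : M1 X, (forall j, (j < k)%N -> `|nu'`[f j] - nu`[f j]| < delta)%R -> U nu'].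
Proof.
move=> oU Unu.
pose F : set_system (M1 X) := [set V | exists f M K (k : nat) (delta : R),
  [/\ test_family f M K, (0 < delta)%R &
    forall nu' : M1 X, (forall j, (j < k)%N -> `|nu'`[f j] - nu`[f j]| < delta)%R -> V nu']].
have FF : Filter F.
  split.
  - exists (fun=> cst 0%R), 0%R, set0, 0%N, 1%R; split => //; split => //.
    + by move=> j; exact: cst_continuous.
    + by move=> j y; rewrite normr0.
    + exact: compact0.
  - move=> V V' [f [M [K [k [d [[cf fM cK fK] d0 fV]]]]]] [f' [M' [K' [k' [d' [[cf' fM' cK' fK'] d'0 fV']]]]]].
    have M0 : (0 <= M)%R by exact: le_trans (fM 0%N point).
    have M'0 : (0 <= M')%R by exact: le_trans (fM' 0%N point).
    (* The two finite families are concatenated; bounds are added and supports united. *)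
    pose g j := if (j < k)%N then f j else f' (j - k)%N.
    exists g, (M + M')%R, (K `|` K'), (k + k')%N, (Num.min d d'); split.
    + split.
      * by move=> j; rewrite /g; case: ifP.
      * move=> j y; rewrite /g; case: ifP => _.
          by rewrite (le_trans (fM _ _))// lerDl.
        by rewrite (le_trans (fM' _ _))// lerDr.
      * exact: compactU.
      * by move=> j y /not_orP[nK nK']; rewrite /g; case: ifP => _; [exact: fK|exact: fK'].
    + by rewrite lt_min d0.
    + move=> nu' nuV; split.
        apply: fV => j jk; have := nuV j (ltn_addr _ jk).
        by rewrite /g jk lt_min => /andP[].
      apply: fV' => j jk; have := nuV (k + j)%N; rewrite ltn_add2l => /(_ jk).
      by rewrite /g ltnNge leq_addr/= addKn lt_min => /andP[].
  - move=> V V' VV' [f [M [K [k [d [tf d0 fV]]]]]].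
    by exists f, M, K, k, d; split => // nu' /fV /VV'.
have Fnu : F --> nu.
  apply: vague_cvg => h W /nbhs_ballP[d /= d0 dW].
  have [M M0 hM] := Cc_bounded h.
  exists (fun=> sval h), M, (closure [set x | sval h x != 0%R]), 1%N, d; split => //.
    split => //; [by move=> j; exact: Cc_continuous|by case: (svalP h)|].
    move=> j y nh; apply/eqP; apply: contrapT => /negP hy; apply: nh; exact: subset_closure.
  by move=> nu' /(_ 0%N erefl) lt; apply: dW; rewrite /ball/= distrC.
by apply: Fnu; exact: open_nbhs_nbhs.
Qed.

End vague_neighborhoods.

(** The approximating density has total time [s] close to 1 instead of 1. This lemma and the next
    one bound the effect of dividing by [s] on the test integrals and on the cost. *)
Lemma normalized_error (R : realFieldType) (e s F v M d : R) :
  (0 < e -> e <= 2^-1 -> e * (4 * (1 + M)) <= d -> `|s - 1| <= e -> `|F - v| <= e -> `|v| <= M ->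
   `|F / s - v| <= d / 2)%R.
Proof.
move=> e0 e2 ed se Fe vM; have s2 : (2^-1 <= s)%R by move: se; rewrite ler_norml => /andP[? ?]; lra.
have s0 : (0 < s)%R by apply: lt_le_trans s2.
have M0 : (0 <= M)%R by exact: le_trans (normr_ge0 _) vM.
rewrite (_ : F / s - v = ((F - v) - (s - 1) * v) / s)%R; last by field; rewrite gt_eqF.
rewrite normrM normfV (gtr0_norm s0) ler_pdivrMr//.
apply: (@le_trans _ _ (e + e * M)%R).
  by apply: le_trans (ler_normB _ _) _; rewrite normrM lerD// ler_pM.
have d0 : (0 <= d)%R by apply: le_trans ed; rewrite mulr_ge0 ?(ltW e0)//; lra.
have := ler_wpM2l d0 s2; lra.
Qed.

Lemma normalized_cost (R : realFieldType) (e s C I c : R) :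
  (0 < e -> e <= 2^-1 -> e * (4 * (1 + I)) <= c -> `|s - 1| <= e -> C <= I + e -> 0 <= I ->
   C / s <= I + c / 2)%R.
Proof.
move=> e0 e2 ec se CI I0; have s2 : (2^-1 <= s)%R by move: se; rewrite ler_norml => /andP[? ?]; lra.
have s0 : (0 < s)%R by apply: lt_le_trans s2.
rewrite ler_pdivrMr// (le_trans CI)//.
have c0 : (0 <= c)%R by apply: le_trans ec; rewrite mulr_ge0 ?(ltW e0)//; lra.
have := ler_wpM2l c0 s2.
have : (I * (1 - e) <= I * s)%R.
  by apply: ler_wpM2l => //; move: se; rewrite ler_norml => /andP[? ?]; lra.
lra.
Qed.

Lemma fineD3 (R : realType) (A B C : \bar R) : 0 <= A -> 0 <= B -> 0 <= C ->
  A < +oo -> B < +oo -> C < +oo -> fine (A + B + C) = (fine A + fine B + fine C)%R.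
Proof.
by move=> *; rewrite !fineD ?ge0_fin_numE ?adde_ge0 ?lte_add_pinfty.
Qed.

Section local_lower_bound.
Context (R : realType) (X : completeMetricType R).
Hypotheses (X_second_countable : @second_countable X)
  (X_locally_compact : locally_compact [set: X]).
Variables (mu : probability (borel X) R) (tau : borel X -> \bar R).
Hypotheses (mtau : measurable_fun [set: borel X] tau)
  (tau_ge0 : forall x, 0 <= tau x)
  (tau_neq0 : mu [set x | tau x = 0] = 0)
  (tau_finite : mu [set x | tau x = +oo] = 0).
Context d (Omega : measurableType d) (P : probability Omega R) (x : nat -> {RV P >-> borel X}).
Hypothesis x_iid : iid x mu.
Local Notation "m `[ f ]" := ((\int[m]_(x in [set: borel X]) f x)%R)
  (at level 10, format "m `[ f ]").

Let th (y : borel X) : R := fine (tau y).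
Let mth : measurable_fun [set: borel X] th. Proof. exact: measurable_fine_tau. Qed.
Let th_ge0 y : (0 <= th y)%R. Proof. exact: fine_ge0. Qed.
Local Notation I := (ldp_rate mu mtau tau_ge0).

Lemma mass_defect_ge0 (nu : M1 X) : 0 <= 1 - nu [set: borel X].
Proof. by rewrite sube_ge0 ?sprobability_setT// fin_num_measure. Qed.

Lemma ldp_rate_ge0 nu : 0 <= I nu.
Proof.
rewrite /ldp_rate; case: ifP => // _; apply: adde_ge0; first apply: adde_ge0.
- rewrite mule_ge0 ?rel_entropy_ge0//; apply: integral_ge0 => y _; exact: inv_tau_ge0.
- by apply: integral_ge0 => y _; exact: xi_ge0.
- by rewrite mule_ge0 ?mass_defect_ge0//; exact: xi_infty_ge0.
Qed.

(** One density for each of the three terms of the rate. Their masses [nu_a(X)], [nu_s(X)] and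
    [1 - nu(X)] add up to 1, the total time of an empirical measure. *)
Lemma reachable_ldp_rate (f : nat -> X -> R) (M : R) (K : set X) (k : nat) (nu : M1 X) (e : R) :
  test_family f M K -> I nu < +oo -> (0 < e)%R ->
  reachable mu tau f k e 1 (fun j => nu`[f j]) (fine (I nu)).
Proof.
move=> [fc fM cK fK] Ioo e0; have mf j : measurable_fun [set: borel X] (f j : borel X -> R).
  exact: continuous_borel.
have aoo : inv_tau_mass mu tau nu < +oo.
  by move: Ioo; rewrite /ldp_rate; case: ifPn => //; rewrite ltxx.
move: Ioo; rewrite /ldp_rate aoo.
set A := _ * _; set B := \int[_]_x _; set C := _ * _.
have A0 : 0 <= A.
  by rewrite mule_ge0 ?rel_entropy_ge0//; apply: integral_ge0 => y _; exact: inv_tau_ge0.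
have B0 : 0 <= B by apply: integral_ge0 => y _; exact: xi_ge0.
have C0 : 0 <= C by rewrite mule_ge0 ?mass_defect_ge0//; exact: xi_infty_ge0.
move=> ABCoo.
have Aoo : A < +oo by apply: le_lt_trans ABCoo; rewrite -addeA leeDl// adde_ge0.
have Boo : B < +oo by apply: le_lt_trans ABCoo; rewrite addeAC leeDr// adde_ge0.
have Coo : C < +oo by apply: le_lt_trans ABCoo; rewrite leeDr// adde_ge0.
rewrite (fineD3 A0 B0 C0 Aoo Boo Coo).
have e30 : (0 < e / 3)%R by rewrite divr_gt0.
have rA := reachable_ac_part tau_neq0 tau_finite k mf fM aoo Aoo e30.
have mxi := measurable_xi X_second_countable X_locally_compact mtau tau_ge0 tau_finite.
have rB := reachable_singular mtau tau_ge0 tau_finite k mf fM fc mxi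
  (xi_ge0 mtau tau_ge0 tau_finite) Boo e30.
have nufin : nu [set: borel X] \is a fin_num by exact: fin_num_measure.
set p := fine (1 - nu [set: borel X]).
have pE : 1 - nu [set: borel X] = p%:E by rewrite fineK// fin_numB nufin.
have rC : reachable mu tau f k (e / 3) p (fun=> 0%R) (fine C).
  have p0 : (0 <= p)%R by rewrite fine_ge0// mass_defect_ge0.
  have [p_eq0|p_neq0] := eqVneq p 0%R.
    by rewrite /C pE p_eq0 mul0e; exact: reachable_zero.
  have p_gt0 : (0 < p)%R by rewrite lt_neqAle eq_sym p_neq0.
  have xoo : xi_infty mu tau < +oo.
    by rewrite ltey; apply/eqP => xE; move: Coo; rewrite /C pE xE gt0_muley ?ltxx.
  rewrite /C pE fineM ?ge0_fin_numE ?xi_infty_ge0 ?ltry//.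
  by apply: (reachable_infinity mtau tau_ge0 tau_finite mf fM cK) => //;
    [move=> j y _; exact: fK|exact: xi_infty_ge0].
have := reachable_add mtau tau_ge0 mf fM (reachable_add mtau tau_ge0 mf fM rA rB) rC.
have [_ _ dec] := svalP (cid (lebesgue_decomposition_exists mu nu)).
have -> : (fine (ac_part mu nu setT) + fine (sing_part mu nu setT) + p = 1)%R.
  rewrite -fineD ?fin_num_measure// -[ac_part _ _ _ + _](dec setT)// /p fineB//=.
  by rewrite addrC subrK.
rewrite (_ : e / 3 + e / 3 + e / 3 = e)%R; last by field.
move=> r; apply: (reachable_weaken (lexx e) r) => j _ /=.
have -> : nu`[f j] = ((ac_part mu nu)`[f j] + (sing_part mu nu)`[f j])%R.
  have bj : bounded_measurable (f j : borel X -> R) by split => //; exists M.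
  apply: EFin_inj; rewrite (integral_ac_sing mu nu (mf j) (fM j)) EFinD.
  by rewrite -!bounded_integralE.
by rewrite addr0 subrr normr0 subrr.
Qed.

(** The density [r] approximating [nu] is normalised to [q = r / m]. The cost of [q] per unit of
    time, its entropy divided by its mean time [s / m], is at most [entropy_cost a r / s] by
    optimality of the rate [m], hence at most the rate of [nu] plus [eps / 2]. *)
Lemma lower_bound_nbhs (nu : M1 X) (U : set (M1 X)) (eps : R) : open U -> U nu -> I nu < +oo ->
  (0 < eps)%R -> exists T0 : R, forall t, (T0 <= t)%R ->
    (expR (- (t * (fine (I nu) + eps))))%:E <= P (empirical_rv tau x t @^-1` U).
Proof.
move=> oU Unu Ioo eps0.
have [f [M [K [k [delta [tf delta0 fU]]]]]] := vague_nbhs oU Unu.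
have [fc fM cK fK] := tf.
have mf j : measurable_fun [set: borel X] (f j : borel X -> R) by exact: continuous_borel.
have M0 : (0 <= M)%R by exact: le_trans (fM 0%N point).
have I0 : (0 <= fine (I nu))%R by exact/fine_ge0/ldp_rate_ge0.
(* With this [e] one has [s >= 1/2], and normalisation changes the test integrals by at most
   [delta / 2] and the cost by at most [eps / 2]; the other halves go to [lower_bound_density]. *)
pose e := Num.min (2^-1)%R (Num.min (delta / (4 * (1 + M))) (eps / (4 * (1 + fine (I nu)))))%R.
have M40 : (0 < 4 * (1 + M))%R by rewrite mulr_gt0// ltr_pwDl.
have I40 : (0 < 4 * (1 + fine (I nu)))%R by rewrite mulr_gt0// ltr_pwDl.
have e0 : (0 < e)%R by rewrite !lt_min invr_gt0 ltr0n/= !divr_gt0.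
have e2 : (e <= 2^-1)%R by rewrite ge_min lexx.
have ed : (e * (4 * (1 + M)) <= delta)%R by rewrite -ler_pdivlMr// !ge_min lexx orbT.
have ee : (e * (4 * (1 + fine (I nu))) <= eps)%R by rewrite -ler_pdivlMr// !ge_min lexx !orbT.
have [N [r [a [rN a0 rs rv rC]]]] := reachable_ldp_rate k tf Ioo e0.
set s := (\int[mu]_y _)%R in rs; have [N0 mr r0 _] := rN.
have s0 : (0 < s)%R by move: rs; rewrite ler_norml => /andP[? ?]; lra.
pose m := mu`[r]; have br := truncated_bounded rN.
have m0 : (0 < m)%R.
  rewrite -(pmulr_rgt0 _ N0); apply: lt_le_trans s0 _.
  rewrite /m -bounded_integralZ//; apply: bounded_integral_le; first exact: truncated_tau_bounded rN.
    exact: bounded_measurableZ.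
  move=> y; rewrite mulrC; have [->|ry] := eqVneq (r y) 0%R; first by rewrite !mulr0.
  by rewrite ler_wpM2r// (le_trans (ler_norm _))//; exact: truncated_tau rN ry.
have mi0 : (0 < m^-1)%R by rewrite invr_gt0.
have [N' qN] := truncated_scale mi0 rN.
pose q y := (m^-1 * r y)%R; rewrite -/q in qN.
have q1 : mu`[q] = 1%R by rewrite bounded_integralZ// -/m mulVf// gt_eqF.
have qth : mu`[fun y => q y * th y]%R = (s / m)%R.
  rewrite mulrC -bounded_integralZ; last exact: truncated_tau_bounded rN.
  by apply: eq_Rintegral => y _; rewrite /q mulrA.
have qf j : mu`[fun y => q y * (th y * f j y)]%R = (mu`[fun y => r y * (th y * f j y)] / m)%R.
  rewrite mulrC -bounded_integralZ; last exact: (truncated_test_bounded mtau tau_ge0 mf fM j rN).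
  by apply: eq_Rintegral => y _; rewrite /q mulrA.
have [T0 T0P] := lower_bound_density X_second_countable X_locally_compact mtau tau_ge0 tau_neq0
  tau_finite x_iid qN q1 k mf fM (divr_gt0 delta0 (ltr0n R 2)) (divr_gt0 eps0 (ltr0n R 2)).
exists (Num.max T0 1%R) => t; rewrite ge_max => /andP[/T0P tP t1].
have t0 : (0 < t)%R by exact: lt_le_trans t1.
apply: le_trans (tP U _ _).
- rewrite lee_fin ler_expR lerN2 ler_pM2l// -lerBrDr.
  rewrite (_ : _ - _ = fine (I nu) + eps / 2)%R; last by field.
  apply: le_trans (normalized_cost e0 e2 ee rs rC I0).
  rewrite qth invf_div mulrA ler_pM2r ?invr_gt0// mulrC.
  exact: entropy_cost_ge a0 m0 rN.
- exact: measurable_open_M1.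
- move=> nu' nuP; apply: fU => j jk.
  rewrite -(subrKA (mu`[fun y => q y * (th y * f j y)] / mu`[fun y => q y * th y])%R).
  apply: le_lt_trans (ler_normD _ _) _; rewrite (splitr delta) ltr_leD//; first exact: nuP.
  rewrite qth qf invf_div mulrA divfK ?gt_eqF//.
  apply: normalized_error e0 e2 ed rs (rv j jk) _.
  exact: normr_Rintegral_le.
Qed.

End local_lower_bound.

(** * The large deviation principle *)

Section limits_at_infinity.
Context (R : realType).

Lemma limf_esup_pinfty_le (f : R -> \bar R) (T : R) (L : \bar R) :
  (forall t, (T < t)%R -> f t <= L) -> limf_esup f +oo%R <= L.
Proof.
move=> fL; apply: (@le_trans _ _ (ereal_sup (f @` [set t | (T < t)%R]))).
  apply: ereal_inf_lbound; exists [set t | (T < t)%R] => //.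
  by exists T; split; [exact: num_real|].
by apply: ge_ereal_sup => _ [t /= Tt <-]; exact: fL.
Qed.

Lemma limf_einf_pinfty_ge (f : R -> \bar R) (T : R) (L : \bar R) :
  (forall t, (T < t)%R -> L <= f t) -> L <= limf_einf f +oo%R.
Proof.
move=> Lf; rewrite /limf_einf leeNr; apply: (limf_esup_pinfty_le (T := T)) => t Tt.
by rewrite leeN2; exact: Lf.
Qed.

Lemma lee_real_lbound (y z : \bar R) : (forall M : R, M%:E < y -> M%:E <= z) -> y <= z.
Proof.
move=> h; rewrite leNgt; apply/negP => zy.
suff [M /andP[zM My]] : exists M : R, z < M%:E < y by have := h M My; rewrite leNgt zM.
move: y z zy {h} => [y| |] [z| |] //= zy.
- by exists ((y + z) / 2)%R; rewrite !lte_fin in zy *; apply/andP; split; lra.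
- by exists (y - 1)%R; rewrite ltNyr lte_fin; lra.
- by exists (z + 1)%R; rewrite ltry andbT lte_fin; lra.
- by exists 0%R; rewrite ltNyr ltry.
Qed.

End limits_at_infinity.

Section large_deviation_bounds.
Context (R : realType) (X : completeMetricType R).
Hypotheses (X_second_countable : @second_countable X)
  (X_locally_compact : locally_compact [set: X]).
Variables (mu : probability (borel X) R) (tau : borel X -> \bar R).
Hypotheses (mtau : measurable_fun [set: borel X] tau)
  (tau_ge0 : forall x, 0 <= tau x)
  (tau_neq0 : mu [set x | tau x = 0] = 0)
  (tau_finite : mu [set x | tau x = +oo] = 0)
  (xi_infinite : mu [set x | xi mu tau x < +oo] = 0).
Context d (Omega : measurableType d) (P : probability Omega R) (x : nat -> {RV P >-> borel X}).
Hypothesis x_iid : iid x mu.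
Local Notation "m `[ f ]" := ((\int[m]_(x in [set: borel X]) f x)%R)
  (at level 10, format "m `[ f ]").
Local Notation I := (ldp_rate mu mtau tau_ge0).
Local Notation Q t A := (P (empirical_rv tau x t @^-1` A)).

Let lower nu U eps := @lower_bound_nbhs R X X_second_countable X_locally_compact mu tau mtau
  tau_ge0 tau_neq0 tau_finite d Omega P x x_iid nu U eps.

Let upper C M := @upper_bound_closed R X X_second_countable X_locally_compact mu tau mtau
  tau_ge0 tau_neq0 tau_finite d Omega P x x_iid C M.

Let rate_le nu : I nu <= dual_rate mu tau nu := dual_rate_ge_rate X_second_countable
  X_locally_compact mtau tau_ge0 tau_neq0 tau_finite xi_infinite nu.

Let affine_continuous (cg : R * Cc X) : continuous (fun nu : M1 X => cg.1 + nu`[sval cg.2])%R.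
Proof.
move=> nu; apply: (@continuousD _ _ _ (fun=> cg.1) (fun nu : M1 X => nu`[sval cg.2])).
  exact: cst_continuous.
exact: vague_continuous.
Qed.

(* Incompatible exponential bounds on the probability of a small neighborhood otherwise. *)
Lemma dual_rateE nu : dual_rate mu tau nu = I nu.
Proof.
apply/eqP; rewrite eq_le rate_le andbT; apply: ge_ereal_sup => _ [cg cg1 <-].
set v := (cg.1 + _)%R; rewrite leNgt; apply/negP => Iv.
have I0 : 0 <= I nu by exact: ldp_rate_ge0.
have Ioo : I nu < +oo by rewrite (lt_trans Iv)// ltry.
have IE : I nu = (fine (I nu))%:E by rewrite fineK// ge0_fin_numE.
set i := fine (I nu) in IE; rewrite IE lte_fin in Iv.
(* The upper bound is used at [v - 2 e] and the lower bound at [i + e]; the gap between these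
   exponents is again [e]. *)
pose e := ((v - i) / 4)%R; have e0 : (0 < e)%R by rewrite divr_gt0// subr_gt0.
pose h (nu' : M1 X) := (cg.1 + nu'`[sval cg.2])%R.
pose C := [set nu' | (v - e <= h nu')%R]; pose U := [set nu' | (v - e < h nu')%R].
have cC : closed C.
  apply: (@preimage_closed _ _ h [set y : R | (v - e <= y)%R]); last exact: closed_ge.
  by move=> nu' _; exact: affine_continuous.
have oU : open U.
  apply: (@open_comp _ _ h [set y : R | (v - e < y)%R]); last exact: open_gt.
  by move=> nu' _; exact: affine_continuous.
have Unu : U nu by rewrite /U/= /h -/v ltrBlDr ltrDl.
have [K K0 KP] : exists2 K : R, (0 < K)%R & forall t, (0 < t)%R -> Q t C <= (K * expR (- (t * (v - 2 * e))))%:E.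
  apply: upper => // nu' Cnu'; apply: (@lt_le_trans _ _ (h nu')%:E).
    by rewrite lte_fin; apply: lt_le_trans Cnu'; rewrite ltrD2l ltrN2 ltr_pMl// ltr1n.
  by apply: ereal_sup_ubound; exists cg.
have [T0 T0P] := lower oU Unu Ioo e0.
(* Late enough for the lower bound, and such that [t e >= K]; then [K < 1 + t e <= e^(t e)]
   contradicts the two bounds. *)
pose t := (Num.max T0 1 + K / e)%R.
have tT0 : (T0 <= t)%R by rewrite /t -[leLHS]addr0; apply: lerD; [rewrite le_max lexx|rewrite divr_ge0// ltW].
have tK : (K / e <= t)%R by rewrite lerDr le_max ler01 orbT.
have t0 : (0 < t)%R by apply: lt_le_trans tK; rewrite divr_gt0.
have : (expR (- (t * (i + e))) <= K * expR (- (t * (v - 2 * e))))%R.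
  rewrite -lee_fin; apply: le_trans (T0P t tT0) _; apply: le_trans (KP t t0).
  apply: le_measure; rewrite ?inE.
  - by apply: measurable_preimage_empirical => //; exact: measurable_open_M1.
  - by apply: measurable_preimage_empirical => //; exact: measurable_closed_M1.
  - by move=> w /ltW.
rewrite -ler_pdivrMr ?expR_gt0// -expRN -expRD opprK leNgt => /negP; apply.
apply: lt_le_trans (expR_ge1Dx _).
have -> : (- (t * (i + e)) + t * (v - 2 * e) = t * e)%R by rewrite /e; field.
by rewrite ltr_pwDl// -ler_pdivrMr.
Qed.

(** Compactness of sublevel sets is read on the dual form: each is an intersection of closed
    half-spaces in the compact space [M1]. *)
Lemma rate_good : good_rate I.
Proof.
split.
- by move=> nu; exact: ldp_rate_ge0.
- move=> M _; apply: (subclosed_compact _ (M1_compact X_second_countable X_locally_compact)) => //.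
  rewrite (_ : [set y | _] = \bigcap_(cg in [set cg : R * Cc X |
      exp_functional mu tau (fun y => cg.1 + sval cg.2 y)%R < 1])
      [set nu : M1 X | (cg.1 + nu`[sval cg.2] <= M)%R]).
    apply: closed_bigI => cg _.
    apply: (@preimage_closed _ _ (fun nu : M1 X => cg.1 + nu`[sval cg.2])%R [set y : R | (y <= M)%R]).
      by move=> nu' _; exact: affine_continuous.
    exact: closed_le.
  apply/seteqP; split => nu /=; rewrite -dual_rateE.
    move=> IM cg cg1 /=; rewrite -lee_fin; apply: le_trans IM.
    by apply: ereal_sup_ubound; exists cg.
  by move=> h; apply: ge_ereal_sup => _ [cg cg1 <-]; rewrite lee_fin; exact: (h cg).
(* If the rate were infinite everywhere, the upper bound on the whole space with [M = 1] would give
   [1 <= K e^(-t)] for all [t > 0], which fails at [t = K]. *)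
- apply: contrapT => /forallNP Ioo.
  have [nu _|K K0 KP] := @upper setT 1%R closedT.
    rewrite dual_rateE (_ : I nu = +oo) ?ltry//.
    by apply/eqP; have /negP := Ioo nu; rewrite negbK.
  have := KP K K0; rewrite preimage_setT probability_setT mulr1 lee_fin leNgt => /negP; apply.
  rewrite expRN ltr_pdivrMr ?expR_gt0// mul1r.
  by apply: lt_le_trans (expR_ge1Dx _); rewrite ltrDr.
Qed.

Lemma upper_bound_limf_esup (C : set (M1 X)) : closed C ->
  limf_esup (fun t : R => (t^-1)%:E * lne (Q t C)) +oo%R <= - ereal_inf (I @` C).
Proof.
move=> cC; rewrite leeNr; apply: lee_real_lbound => M MI; rewrite leeNr.
have [K K0 KP] : exists2 K : R, (0 < K)%R & forall t, (0 < t)%R -> Q t C <= (K * expR (- (t * M)))%:E.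
  apply: upper => // nu Cnu; rewrite dual_rateE; apply: lt_le_trans MI _.
  by apply: ereal_inf_lbound; exists nu.
apply/lee_addgt0Pr => e e0.
apply: (limf_esup_pinfty_le (T := Num.max 1%R (ln K / e)%R)) => t.
rewrite gt_max => /andP[t1 tK]; have t0 : (0 < t)%R by exact: lt_trans t1.
have ti0 : 0 <= (t^-1)%:E :> \bar R by rewrite lee_fin invr_ge0 ltW.
apply: (@le_trans _ _ ((t^-1)%:E * lne (K * expR (- (t * M)))%:E)).
  apply: lee_wpmul2l => //; rewrite lee_lne ?KP// in_itv/= leey andbT ?measure_ge0//.
  by rewrite lee_fin mulr_ge0 ?expR_ge0// ltW.
rewrite lne_EFin ?mulr_gt0 ?expR_gt0// lnM ?posrE ?expR_gt0// expRK -EFinM -EFinN -EFinD lee_fin.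
rewrite mulrDr mulrN mulKf ?gt_eqF// addrC lerD2l.
by rewrite mulrC ler_pdivrMr// mulrC -ler_pdivrMr// ltW.
Qed.

Lemma lower_bound_limf_einf (U : set (M1 X)) : open U ->
  - ereal_inf (I @` U) <= limf_einf (fun t : R => (t^-1)%:E * lne (Q t U)) +oo%R.
Proof.
move=> oU; rewrite leeNl; apply: le_ereal_inf_tmp => _ [nu Unu <-]; rewrite leeNl.
have I0 : 0 <= I nu by exact: ldp_rate_ge0.
have [Ioo|] := ltP (I nu) +oo; last by rewrite leye_eq => /eqP ->; exact: leNye.
have IE : I nu = (fine (I nu))%:E by rewrite fineK// ge0_fin_numE.
apply/lee_addgt0Pr => e e0; rewrite -leeBlDr//.
have [T0 T0P] := lower oU Unu Ioo e0.
apply: (limf_einf_pinfty_ge (T := Num.max T0 1%R)) => t; rewrite gt_max => /andP[tT0 t1].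
have t0 : (0 < t)%R by exact: lt_trans t1.
have ti0 : 0 <= (t^-1)%:E :> \bar R by rewrite lee_fin invr_ge0 ltW.
apply: (@le_trans _ _ ((t^-1)%:E * lne (expR (- (t * (fine (I nu) + e))))%:E)).
  rewrite lne_EFin ?expR_gt0// expRK -EFinM mulrN mulKf ?gt_eqF// IE -EFinN -EFinB lee_fin /=.
  by rewrite opprD.
by apply: lee_wpmul2l => //; rewrite lee_lne ?T0P ?(ltW tT0)// in_itv/= leey andbT ?measure_ge0.
Qed.

End large_deviation_bounds.

Theorem theorem1p6 (R : realType) (X : completeMetricType R)
  (X_second_countable : @second_countable X)
  (X_locally_compact : locally_compact [set: X])
  (mu : probability (borel X) R)
  (tau : borel X -> \bar R)
  (mtau : measurable_fun [set: borel X] tau)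
  (tau_ge0 : forall x, 0 <= tau x)
  (tau_neq0 : mu [set x | tau x = 0] = 0)
  (tau_finite : mu [set x | tau x = +oo] = 0)
  (xi_infinite : mu [set x | xi mu tau x < +oo] = 0)
  (d : measure_display) (Omega : measurableType d) (P : probability Omega R)
  (x : nat -> {RV P >-> borel X}) (x_iid : iid x mu) :
  good_ldp
    (fun t : R => pushforward P
       (fun w => empirical tau (fun i => x i w) t : borel (M1 X)))
    (ldp_rate mu mtau tau_ge0).
Proof.
split.
- move=> t t0.
  have mE := measurable_empirical_rv X_second_countable X_locally_compact mtau x t0.
  pose E : {mfun Omega >-> borel (M1 X)} := mfun_Sub (mem_set mE).
  by exists (distribution P E).
- exact: (rate_good X_second_countable X_locally_compact mtau tau_ge0 tau_neq0 tau_finite xi_infinite x_iid).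
- exact: (upper_bound_limf_esup X_second_countable X_locally_compact mtau tau_ge0 tau_neq0 tau_finite xi_infinite x_iid).
- exact: (lower_bound_limf_einf X_second_countable X_locally_compact mtau tau_ge0 tau_neq0 tau_finite x_iid).
Qed.
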